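(* For the $\beta$-sine processes on $\mathbb R$ with $\beta=1,2,4$, $$\lim_{N\to\infty}\mathrm{Var}(\mathcal W_N)=0 .$$
   Context: For a random locally finite configuration $\{a_i\}\subset\mathbb R$ and $N\ge1$, $$\mathcal W_N=-\frac1N\sum_{i\ne j,\ a_i,a_j\in[0,N]}\log\left|2\sin\frac{\pi(a_i-a_j)}{N}\right|+\log N .$$ The $k$-point correlation function $\rho_k$ is characterized by $\mathbb E\sum_{i_1,\dots,i_k\text{ pairwise distinct}}F(a_{i_1},\dots,a_{i_k})=\int F\rho_k$. The $\beta$-sine processes ($\beta=1,2,4$) are the stationary simple point processes on $\mathbb R$ with density $1$ defined as follows. For $\beta=2$ the process is determinantal: $\rho_n(x_1,\dots,x_n)=\det(K^{(2)}(x_i,x_j))_{i,j=1}^n$ with $K^{(2)}(x,y)=\frac{\sin\pi(x-y)}{\pi(x-y)}$. For $\beta=1,4$ the correlation functions are quaternion determinants, $\rho_n(x_1,\dots,x_n)=\mathrm{qdet}(K^{(\beta)}(x_i,x_j))_{i,j=1}^n$, i.e. $\rho_n=\sum_{\sigma\in\mathbf S_n}\mathrm{sgn}(\sigma)\prod_{\text{cycles }(i_1\to i_2\to\dots\to i_l\to i_1)\text{ of }\sigma}\frac12\mathrm{Tr}\big(K^{(\beta)}(x_{i_1},x_{i_2})K^{(\beta)}(x_{i_2},x_{i_3})\cdots K^{(\beta)}(x_{i_l},x_{i_1})\big)$, with the $2\times2$ matrix kernels $$K^{(1)}(x,y)=\begin{pmatrix}\frac{\sin\pi(x-y)}{\pi(x-y)}&\frac{\partial}{\partial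 x}\frac{\sin\pi(x-y)}{\pi(x-y)}\\ \frac1\pi\int_0^{\pi(x-y)}\frac{\sin t}t\,dt-\frac12\mathrm{sgn}(x-y)&\frac{\sin\pi(x-y)}{\pi(x-y)}\end{pmatrix},$$ $$K^{(4)}(x,y)=\begin{pmatrix}\frac{\sin2\pi(x-y)}{2\pi(x-y)}&\frac{\partial}{\partial x}\frac{\sin2\pi(x-y)}{2\pi(x-y)}\\ \frac1{2\pi}\int_0^{2\pi(x-y)}\frac{\sin t}t\,dt&\frac{\sin2\pi(x-y)}{2\pi(x-y)}\end{pmatrix}$$ (indeterminacies at $x=y$ resolved by continuity). *)

(* Defs.v *)
From HB Require Import structures.
From mathcomp Require Export all_boot all_order all_algebra all_fingroup.
From mathcomp Require Export all_classical all_reals all_analysis measurable_realfun.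
Export Order.TTheory GRing.Theory Num.Theory.
Export numFieldNormedType.Exports.

Set Implicit Arguments.
Unset Strict Implicit.
Unset Printing Implicit Defensive.

Local Open Scope classical_set_scope.
Local Open Scope ring_scope.

(* Point configurations are simple, hence subsets of the line. *)
Definition locally_finite (R : realType) (A : set R) : Prop :=
  forall a b : R, finite_set (A `&` `[a, b]).

Definition random_configuration d (T : measurableType d) (R : realType)
    (X : T -> set R) : Prop :=
  (forall w, locally_finite (X w)) /\
  (forall B : set R, measurable B ->
     measurable_fun [set: T] (fun w => counting (X w `&` B) : \bar R)).

(* Invariance under translations of the finite-dimensional distributions of
   the counting variables. *)
Definition stationary d (T : measurableType d) (R : realType)
    (P : probability T R) (X : T -> set R) : Prop :=
  forall (t : R) (m : nat) (B : 'I_m -> set R)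
    (k : 'I_m -> nat), (forall i, measurable (B i)) ->
    P [set w | forall i,
        counting ([set x + t | x in X w] `&` B i) = (k i)%:R%:E :> \bar R] =
    P [set w | forall i, counting (X w `&` B i) = (k i)%:R%:E :> \bar R].

Definition has_density d (T : measurableType d) (R : realType)
    (P : probability T R) (X : T -> set R) (m : R) : Prop :=
  forall B : set R, measurable B ->
    (\int[P]_w counting (X w `&` B) = m%:E * lebesgue_measure B)%E.

(* The Lebesgue integral over R^n, as an iterated integral: it is only applied
   to F * rho with F nonnegative, where Tonelli's theorem applies. *)
Fixpoint integral_Rn (R : realType) (n : nat) :
    (n.-tuple R -> \bar R) -> \bar R :=
  match n with
  | 0 => fun F => F [tuple]
  | n'.+1 => fun F =>
      (\int[@lebesgue_measure R]_x
         integral_Rn (fun t : n'.-tuple R => F [tuple of x :: t]))%E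
  end.

Definition correlation_function d (T : measurableType d) (R : realType)
    (P : probability T R) (X : T -> set R) (k : nat)
    (rho : k.-tuple R -> R) : Prop :=
  forall F : k.-tuple R -> \bar R,
    measurable_fun [set: k.-tuple R] F ->
    (forall t, (0 <= F t)%E) ->
    (\int[P]_w (\esum_(t in [set t : k.-tuple R |
                    uniq t /\ forall i, X w (tnth t i)]) F t) =
     integral_Rn (fun t : k.-tuple R => F t * (rho t)%:E))%E.

Definition sinc (R : realType) (x : R) : R := if x == 0 then 1 else sin x / x.

(* The oriented integral of sin t / t from 0 to x. *)
Definition sine_integral (R : realType) (x : R) : R :=
  if 0 <= x then \int[@lebesgue_measure R]_(t in `[0, x]) sinc t
  else - \int[@lebesgue_measure R]_(t in `[x, 0]) sinc t.

Definition mx22 (R : realType) (a b c d : R) : 'M[R]_2 :=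
  \matrix_(i, j) if i == 0 then (if j == 0 then a else b)
                 else (if j == 0 then c else d).

Definition kernel2 (R : realType) (x y : R) : R := sinc (pi * (x - y)).

Definition kernel1 (R : realType) (x y : R) : 'M[R]_2 :=
  mx22 (sinc (pi * (x - y)))
       (derive1 (fun u : R => sinc (pi * (u - y))) x)
       (pi^-1 * sine_integral (pi * (x - y)) - 2^-1 * Num.sg (x - y))
       (sinc (pi * (x - y))).

Definition kernel4 (R : realType) (x y : R) : 'M[R]_2 :=
  mx22 (sinc (2 * pi * (x - y)))
       (derive1 (fun u : R => sinc (2 * pi * (u - y))) x)
       ((2 * pi)^-1 * sine_integral (2 * pi * (x - y)))
       (sinc (2 * pi * (x - y))).

(* The factor of a cycle c does not depend on the starting point i picked in
   it, the trace being cyclic; the default value 1 is never used. *)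
Definition qdet (R : realType) (n : nat) (K : 'I_n -> 'I_n -> 'M[R]_2) : R :=
  \sum_(s : 'S_n) (-1) ^+ s *
    \prod_(c in porbits s)
      (if [pick i in c] is Some i then
         2^-1 * \tr (\prod_(k < #|c|) K (iter k s i) (iter k.+1 s i))
       else 1).

Definition sine_correlation (R : realType) (beta n : nat) (x : n.-tuple R) : R :=
  match beta with
  | 1 => qdet (fun i j => kernel1 (tnth x i) (tnth x j))
  | 2 => \det (\matrix_(i < n, j < n) kernel2 (tnth x i) (tnth x j))
  | 4 => qdet (fun i j => kernel4 (tnth x i) (tnth x j))
  | _ => 0
  end.

Definition sine_process d (T : measurableType d) (R : realType)
    (P : probability T R) (beta : nat) (X : T -> set R) : Prop :=
  [/\ random_configuration X,
      stationary P X,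
      has_density P X 1 &
      forall k, correlation_function P X (@sine_correlation R beta k)].

(* The sum over ordered pairs is finite when A is locally finite.  When A
   contains both 0 and N the logarithm of 0 is read as 0; for a process having
   a 2-point correlation function this is an event of probability 0. *)
Definition renormalized_energy (R : realType) (N : R) (A : set R) : R :=
  - (N^-1 * \sum_(p \in [set p : R * R | [/\ A p.1, A p.2,
                           0 <= p.1 <= N, 0 <= p.2 <= N & p.1 != p.2]])
              ln `|2 * sin (pi * (p.1 - p.2) / N)|)
  + ln N.

(* Main.v *)
Require Import Defs.
From mathcomp Require Import ring lra.

(** The obstacle is size. Up to logarithms the terms of the second moment are of order N ^ 2, which
    is just what the factor 1 / N in W_N cannot absorb, so they have to cancel: this is the work of
    the zero mean of h and of the total mass one of T. The rest is counting, each decaying link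
    between two of the variables costing a factor of order ln N / N.

    The bound for Var (L h) depends on q only through ln (1 / (1 - q)), so 1 - q may be any power of
    N. It has to be small because the Cauchy-Schwarz inequality counts all pairs: the expectation of
    (L (g - h)) ^ 2 is bounded by a multiple of N ^ 4 sqrt (1 - q), and the exponent 10 turns this
    into N ^ -3 after division by N ^ 2.

    Expectations are computed for bounded functions only, which keeps Fubini's theorem and the
    integrations by parts free of convergence questions. The unbounded power of the sine is reached
    from bounded approximations by Fatou's lemma. *)

(* Write [L f] for the sum of [f (a_i - a_j)] over the ordered pairs of distinct points of the
   process in [0, N], so that W_N = ln N - L g / N with g u = ln |2 sin (pi u / N)|. The
   singular [g] is replaced by h u = (1/2) ln (1 - 2 q cos (2 pi u / N) + q ^ 2) with
   1 - q = N ^ -10, which is smooth, periodic and has mean zero.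

   Expanding the correlation functions of orders 2, 3, 4 into cycles of the kernel, Var (L h)
   becomes a sum of averages over [0, N]^4 of products of values of [h] and of cycles. Those in
   which some variable occurs only in one factor [h] vanish, and the product of expectations
   cancels the square of the two-point term. Let [T] be the truncated two-point function and
   [G] the convolution with [h]. The remaining terms with cycles of length 2 combine, up to an
   error of order N, into 2 Tr (G (1 - T) G (1 - T)), which is small because [T] has total mass
   one, so that [G (1 - T)] is expressed through the derivative of [h]. In the cycles of length
   3 and 4 the decay of the kernel leaves a single integral over [0, N], up to logarithms. The
   exception is beta = 4, where one entry of the kernel does not decay: there one integration
   by parts gains the missing factor N. Hence Var (L h) = O (N ln^5 N).

   The error L (g - h) is handled by the Cauchy-Schwarz inequality over pairs of points, from
   a bound of (g - h) ^ 2 by a small multiple of |sin (pi u / N)| ^ (-1/2). *)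

Set Implicit Arguments.
Unset Strict Implicit.
Unset Printing Implicit Defensive.
Local Open Scope classical_set_scope.
Local Open Scope ring_scope.

(** * Derivatives and integrals *)

Section derivatives.
Context {R : realType}.
Implicit Types (f g : R -> R) (x a b c l : R).

(** The derivative is an argument rather than a function of [f], so that [dv_auto] synthesises it
    along the structure of [f] and leaves only an identity between values. *)
Definition dv f x l := is_derive x (1 : R) f l.

Lemma dv_eq f x l l' : dv f x l -> l = l' -> dv f x l'.
Proof. by move=> + <-. Qed.

Lemma dv_cst c x : dv (fun=> c) x 0.
Proof. exact: is_derive_cst. Qed.

Lemma dv_id x : dv (fun y => y) x 1.
Proof. exact: is_derive_id. Qed.

Lemma dvD f g x a b : dv f x a -> dv g x b -> dv (fun y => f y + g y) x (a + b).
Proof. by move=> df dg; exact: (@is_deriveD _ _ _ f g x 1 a b). Qed.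

Lemma dvN f x a : dv f x a -> dv (fun y => - f y) x (- a).
Proof. by move=> df; exact: (@is_deriveN _ _ _ f x 1 a). Qed.

Lemma dvM f g x a b : dv f x a -> dv g x b ->
  dv (fun y => f y * g y) x (a * g x + f x * b).
Proof.
move=> df dg; apply: dv_eq; first by apply: (@is_deriveM _ _ f g x 1 a b).
by rewrite addrC [a * _]mulrC.
Qed.

Lemma dv_comp f g x a b : dv f (g x) a -> dv g x b ->
  dv (fun y => f (g y)) x (a * b).
Proof.
by move=> df dg; exact: (@is_derive1_comp _ f g x a b).
Qed.

Lemma dvV f x a : f x != 0 -> dv f x a -> dv (fun y => (f y)^-1) x (- a / f x ^+ 2).
Proof.
move=> f0 df; apply: dv_eq; first exact: (@is_deriveV _ f x a 1).
by rewrite /GRing.scale /= mulrC mulrN -mulNr.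
Qed.

Lemma dv_sin f x a : dv f x a -> dv (fun y => sin (f y)) x (cos (f x) * a).
Proof. by move=> df; apply: dv_comp df; exact: is_derive_sin. Qed.

Lemma dv_cos f x a : dv f x a -> dv (fun y => cos (f y)) x (- sin (f x) * a).
Proof. by move=> df; apply: dv_comp df; exact: is_derive_cos. Qed.

Lemma dv_ln f x a : 0 < f x -> dv f x a -> dv (fun y => ln (f y)) x ((f x)^-1 * a).
Proof. by move=> f0 df; apply: dv_comp df; exact: is_derive1_ln. Qed.

Lemma dv_sqrt f x a : 0 < f x -> dv f x a ->
  dv (fun y => Num.sqrt (f y)) x ((2 * Num.sqrt (f x))^-1 * a).
Proof. by move=> f0 df; apply: dv_comp df; exact: is_derive1_sqrt. Qed.

Lemma dv_cts f x a : dv f x a -> {for x, continuous f}.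
Proof.
by move=> df; apply: differentiable_continuous; apply/derivable1_diffP; case: df.
Qed.

Lemma dv_near f g x a : (\forall y \near x, f y = g y) -> dv f x a -> dv g x a.
Proof. by move=> fg df; exact: (@near_eq_is_derive R R^o R^o f g x 1 a fg df). Qed.

Lemma dv_derive1 f x a : dv f x a -> derive1 f x = a.
Proof. by move=> df; rewrite derive1E; case: df. Qed.

Lemma dv_ge0_le f f' a b : a <= b ->
  (forall x, a <= x <= b -> dv f x (f' x)) ->
  (forall x, a < x < b -> 0 <= f' x) -> f a <= f b.
Proof.
move=> ab df f0.
have cf : {within `[a, b], continuous f}.
  apply: continuous_in_subspaceT => x /set_mem /=; rewrite in_itv /= => xab.
  exact: dv_cts (df _ xab).
move: ab; rewrite le_eqVlt => /predU1P[->//|ab].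
have dfo x : x \in `]a, b[ -> is_derive x 1 f (f' x).
  by rewrite in_itv /= => /andP[ax xb]; apply: df; rewrite (ltW ax) (ltW xb).
have [c + E] := MVT ab dfo cf.
rewrite in_itv /= => cab; rewrite -subr_ge0 E mulr_ge0 ?f0// subr_ge0 ltW//.
Qed.

Lemma dv_eq_cst f g f' x a : (forall x, dv f x (f' x)) -> (forall x, dv g x (f' x)) ->
  f a = g a -> f x = g x.
Proof.
move=> df dg E.
have dfg (y : R) : is_derive y (1 : R) (fun y => f y - g y) 0.
  by apply: dv_eq (subrr (f' y)); apply: dvD => //; apply: dvN.
have := is_derive_0_is_cst x a dfg; rewrite E subrr => /eqP.
by rewrite subr_eq0 => /eqP.
Qed.

Lemma dv_ftc f F a b : a <= b ->
  (forall x, dv F x (f x)) -> continuous f ->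
  \int[lebesgue_measure]_(x in `[a, b]) f x = F b - F a.
Proof.
move=> + dF cf; rewrite le_eqVlt => /predU1P[->|ab].
  by rewrite set_itv1 Rintegral_set1 subrr.
rewrite /Rintegral (@continuous_FTC2 _ f F)//.
- exact: continuous_subspaceT.
- split => [x _||]; first by case: (dF x).
  + by apply: cvg_at_right_filter; exact: dv_cts (dF a).
  + by apply: cvg_at_left_filter; exact: dv_cts (dF b).
- by move=> x _; exact: dv_derive1.
Qed.

Lemma continuous_itv_integrable f a b : continuous f ->
  lebesgue_measure.-integrable `[a, b] (EFin \o f).
Proof.
move=> cf; apply: continuous_compact_integrable; first exact: segment_compact.
exact: continuous_subspaceT.
Qed.

(** Written exactly like [sine_integral], which is thereby an instance of it. It later gives the
    antiderivatives of [logpot] and of the absolute value of its derivative. *)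
Definition primitive f x := if 0 <= x then \int[lebesgue_measure]_(t in `[0, x]) f t
  else - \int[lebesgue_measure]_(t in `[x, 0]) f t.

Lemma primitive0 f : primitive f 0 = 0.
Proof. by rewrite /primitive lexx set_itv1 Rintegral_set1. Qed.

Lemma primitiveE f a x : continuous f -> a <= 0 -> a <= x ->
  primitive f x = \int[lebesgue_measure]_(t in `[a, x]) f t -
                  \int[lebesgue_measure]_(t in `[a, 0]) f t.
Proof.
move=> cf a0 ax; rewrite /primitive; case: ifPn => [x0|].
  rewrite Rintegral_itvB ?bnd_simp//; last exact: continuous_itv_integrable.
  rewrite Rintegral_itv_obnd_cbnd//; apply: integrableS (continuous_itv_integrable 0 x cf) => //.
  exact: subset_itv_oc_cc.
rewrite -ltNge => x0; rewrite -opprB; congr (- _).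
rewrite Rintegral_itvB ?bnd_simp// ?(ltW x0)//; last exact: continuous_itv_integrable.
rewrite Rintegral_itv_obnd_cbnd//; apply: integrableS (continuous_itv_integrable x 0 cf) => //.
exact: subset_itv_oc_cc.
Qed.

Lemma dv_primitive f x : continuous f -> dv (primitive f) x (f x).
Proof.
(* The base point lies strictly below both 0 and [x], so that [x] is interior and one formula holds
   near [x] whatever its sign. *)
move=> cf; pose a := - (`|x| + 1).
have a0 : a < 0 by rewrite /a oppr_lt0 ltr_wpDl.
have ax : a < x by rewrite /a ltrNl ltr_pwDr// -normrN ler_norm.
pose G y := \int[lebesgue_measure]_(t in `[a, y]) f t.
have [dG GE] : derivable G x 1 /\ derive1 G x = f x.
  apply: (@continuous_FTC1_closed _ _ _ _ (x + 1)) => //; first lra.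
    exact: continuous_itv_integrable.
  exact: cf.
apply: (@dv_near (fun y => G y - G 0)).
  near=> y; rewrite (@primitiveE _ a)// ltW//.
  near: y; exact: lt_nbhsr.
rewrite -GE -[X in dv _ _ X]subr0 derive1E; apply: dvD; first exact: derivableP.
by rewrite oppr0; have := @dv_cst (- G 0) x.
Unshelve. all: by end_near. Qed.

End derivatives.

Ltac dv_step := first
  [ eassumption | apply: dv_cst | apply: dv_id
  | apply: dvD | apply: dvN | apply: dvM | apply: dv_sin | apply: dv_cos ].
Ltac dv_auto := apply: dv_eq; [repeat dv_step | rewrite /idfun /=].

(** * The sine integral *)

Section sinc.
Context {R : realType}.
Implicit Types (f g : R -> R) (x a b c l : R).

(** For functions defined by cases at a point: the removable singularity of [sinc], and later
    products with [Num.sg], are differentiated from a quadratic bound alone. *)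
Lemma dv_quadratic f x c : (forall y, `|f y - f x| <= c * (y - x) ^+ 2) -> dv f x 0.
Proof.
move=> fq; have c0 : 0 <= c.
  by have := le_trans (normr_ge0 _) (fq (x + 1)); rewrite addrAC subrr add0r expr1n mulr1.
have : (h^-1 *: (f (h *: (1 : R) + x) - f x)) @[h --> 0^'] --> (0 : R).
  apply/cvgr0Pnorm_le => e e0; near=> h.
  have h0 : h != 0 by near: h; exact: nbhs_dnbhs_neq.
  rewrite /GRing.scale /= mulr1 normrM normfV ler_pdivrMl ?normr_gt0//.
  apply: (le_trans (fq _)); rewrite addrK -real_normK ?num_real// expr2 mulrA.
  rewrite mulrC ler_wpM2l// (@le_trans _ _ ((c + 1) * `|h|))// ?ler_wpM2r//; first lra.
  rewrite mulrC -ler_pdivlMr; last lra.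
  near: h; apply: dnbhs0_le; apply: divr_gt0 => //; lra.
move=> lim0; apply: DeriveDef; first by apply/cvg_ex; exists 0.
exact: cvg_lim.
Unshelve. all: by end_near. Qed.

(** Taylor bounds with crude constants; each of the next ones follows by integrating the preceding
    one through [dv_ge0_le]. *)
Lemma sin_le_id x : 0 <= x -> sin x <= x.
Proof.
move=> x0; rewrite -subr_ge0.
suff : 0 - sin 0 <= x - sin x by rewrite sin0 subrr.
apply: (@dv_ge0_le _ (fun y => y - sin y) (fun y => 1 - cos y)) => [//|y _|y _].
  by dv_auto; rewrite mulr1.
by rewrite subr_ge0 cos_le1.
Qed.

Lemma cos_ge_quadratic x : 0 <= x -> 1 - x ^+ 2 <= cos x.
Proof.
move=> x0; rewrite -subr_ge0.
suff : cos 0 - (1 - 0 * 0) <= cos x - (1 - x * x) by rewrite cos0 -expr2; lra.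
apply: (@dv_ge0_le _ (fun y => cos y - (1 - y * y)) (fun y => y + y - sin y)) => // y.
  by move=> _; dv_auto; ring.
by move=> /andP[/ltW y0 _]; have := sin_le_id y0; lra.
Qed.

Lemma sin_ge_cubic x : 0 <= x -> x - x ^+ 3 <= sin x.
Proof.
move=> x0; rewrite -subr_ge0.
suff : sin 0 - (0 - 0 * 0 * 0) <= sin x - (x - x * x * x).
  by rewrite sin0 !exprS expr0; lra.
apply: (@dv_ge0_le _ (fun y => sin y - (y - y * y * y)) (fun y => cos y - 1 + 3 * y ^+ 2)) => // y.
  by move=> _; dv_auto; ring.
by move=> /andP[/ltW y0 _]; have := cos_ge_quadratic y0; have := sqr_ge0 y; lra.
Qed.

(** The derivative of sin x - x cos x is x sin x, at most x ^ 2 in size. The bound is what makes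
    [dsinc] continuous at 0. *)
Lemma sin_sub_xcos x : 0 <= x -> `|sin x - x * cos x| <= x ^+ 3.
Proof.
move=> x0; rewrite ler_norml.
have d (y : R) : dv (fun y => sin y - y * cos y) y (y * sin y) by dv_auto; ring.
have d3 (y : R) : dv (fun y : R => y * y * y) y (3 * y ^+ 2) by dv_auto; ring.
have b (y : R) : 0 < y < x -> `|y * sin y| <= y ^+ 2.
  move=> /andP[/ltW y0 _]; rewrite normrM (ger0_norm y0) expr2 ler_wpM2l//.
  rewrite ler_norml sin_le_id// andbT; case: (leP y 1) => y1.
    by have := sin_ge_cubic y0; have := @ler_piMl _ (y ^+ 3) 1; have : y ^+ 3 <= y;
    [rewrite exprS ler_piMr ?exprn_ile1// | lra].
  by have := sin_geN1 y; lra.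
have E (y : R) : y ^+ 3 = y * y * y by rewrite !exprS expr0; ring.
apply/andP; split.
  rewrite -subr_ge0 opprK E.
  suff : (sin 0 - 0 * cos 0) + 0 * 0 * 0 <= (sin x - x * cos x) + x * x * x :> R.
    by rewrite sin0 !mul0r subrr addr0.
  apply: (@dv_ge0_le _ (fun y => (sin y - y * cos y) + y * y * y)
    (fun y => y * sin y + 3 * y ^+ 2)) => // y.
    by move=> _; apply: dvD.
  by move=> /b; rewrite ler_norml => /andP[]; have := sqr_ge0 y; lra.
rewrite -subr_ge0 E.
suff : 0 * 0 * 0 - (sin 0 - 0 * cos 0) <= x * x * x - (sin x - x * cos x) :> R.
  by rewrite sin0 !mul0r !subrr.
apply: (@dv_ge0_le _ (fun y => y * y * y - (sin y - y * cos y))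
  (fun y => 3 * y ^+ 2 - y * sin y)) => // y.
  by move=> _; apply: dvD => //; apply: dvN.
by move=> /b; rewrite ler_norml => /andP[]; have := sqr_ge0 y; lra.
Qed.

Lemma mul_sinc x : x * sinc x = sin x.
Proof.
by rewrite /sinc; case: eqVneq => [->|x0]; rewrite ?sin0 ?mul0r// mulrC divfK.
Qed.

Lemma sincN x : sinc (- x) = sinc x.
Proof. by rewrite /sinc oppr_eq0 sinN invrN mulrNN. Qed.

Lemma sinc0 : sinc 0 = 1 :> R.
Proof. by rewrite /sinc eqxx. Qed.

Lemma norm_wlog (P : R -> Prop) : (forall x, P x -> P (- x)) ->
  (forall x, 0 <= x -> P x) -> forall x, P x.
Proof.
move=> PN P0 x; have [x0|x0] := leP 0 x; first exact: P0.
by rewrite -[x]opprK; apply/PN/P0; rewrite oppr_ge0 ltW.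
Qed.

Lemma norm_sin_le x : `|sin x| <= `|x|.
Proof.
move: x; apply: norm_wlog => [x|x x0]; first by rewrite sinN !normrN.
rewrite (ger0_norm x0) ler_norml sin_le_id// andbT.
have d (y : R) : dv (fun y => y + sin y) y (1 + cos y) by dv_auto; ring.
have := @dv_ge0_le _ (fun y => y + sin y) _ 0 x x0 (fun z _ => d z).
rewrite sin0 addr0 => h; rewrite -subr_ge0 opprK addrC; apply: h => y _.
by have := cos_geN1 y; lra.
Qed.

Lemma sinc_sub1 x : `|sinc x - 1| <= x ^+ 2.
Proof.
move: x; apply: norm_wlog => [x|x]; first by rewrite sincN sqrrN.
rewrite le_eqVlt => /predU1P[<-|x0]; first by rewrite sinc0 subrr normr0 expr0n.
rewrite /sinc gt_eqF// ler_norml; have := sin_le_id (ltW x0); have := sin_ge_cubic (ltW x0).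
move=> h1 h2; rewrite lerBrDr ler_pdivlMr// lerBlDr ler_pdivrMr//.
have : 0 <= x ^+ 2 * x by rewrite mulr_ge0 ?sqr_ge0// ltW.
by move: h1; rewrite exprSr; lra.
Qed.

Lemma norm_sinc_le1 x : `|sinc x| <= 1.
Proof.
rewrite /sinc; case: eqVneq => [_|x0]; first by rewrite normr1.
by rewrite normrM normfV ler_pdivrMr ?normr_gt0// mul1r norm_sin_le.
Qed.

Lemma norm_mul_sinc x : `|x| * `|sinc x| <= 1.
Proof. by rewrite -normrM mul_sinc ler_norml sin_geN1 sin_le1. Qed.

Definition dsinc x := if x == 0 then 0 else (x * cos x - sin x) / x ^+ 2.

Lemma dv_sinc x : dv (@sinc R) x (dsinc x).
Proof.
rewrite /dsinc; case: eqVneq => [->|x0].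
  by apply: (@dv_quadratic _ _ 1) => y; rewrite sinc0 subr0 mul1r sinc_sub1.
apply: (@dv_near _ (fun y => sin y * y^-1)).
  near=> y; rewrite /sinc ifN//; near: y; exact: open_neq.
apply: dv_eq; first by apply: dvM; [dv_step; exact: dv_id | apply: dvV; [done | exact: dv_id]].
by rewrite /idfun /=; field.
Unshelve. all: by end_near. Qed.

Lemma dsincN x : dsinc (- x) = - dsinc x.
Proof. by rewrite /dsinc oppr_eq0; case: eqP; rewrite ?oppr0// cosN sinN sqrrN => _; ring. Qed.

Lemma norm_dsinc_le x : `|dsinc x| <= `|x|.
Proof.
move: x; apply: norm_wlog => [x|x x0]; first by rewrite dsincN !normrN.
rewrite /dsinc; case: eqVneq => [->|xn0]; first by rewrite normr0.
rewrite normrM normfV ler_pdivrMr ?normr_gt0 ?expf_neq0// normrX -exprS.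
by rewrite distrC (ger0_norm x0) sin_sub_xcos.
Qed.

Lemma norm_mul_dsinc_le x : `|x| * `|dsinc x| <= 2.
Proof.
rewrite -normrM; have [->|x0] := eqVneq x 0; first by rewrite mul0r normr0.
have -> : x * dsinc x = cos x - sinc x by rewrite /dsinc /sinc ifN// ifN//; field.
rewrite (le_trans (ler_normB _ _))//.
have := norm_sinc_le1 x; have : `|cos x| <= 1 by rewrite ler_norml cos_geN1 cos_le1.
lra.
Qed.

Lemma norm_dsinc_le2 x : `|dsinc x| <= 2.
Proof.
have [h|h] := leP `|x| 2; first exact: le_trans (norm_dsinc_le x) h.
have := norm_mul_dsinc_le x; have := normr_ge0 (dsinc x) => d0 d1.
by rewrite -(@ler_pM2l _ `|x|) ?(lt_trans _ h)//; lra.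
Qed.

Lemma continuous_sinc : continuous (@sinc R).
Proof. by move=> x; exact: dv_cts (dv_sinc x). Qed.

Lemma continuous_dsinc : continuous dsinc.
Proof.
move=> x; have [->|x0] := eqVneq x 0.
  rewrite /continuous_at {2}/dsinc eqxx; apply/cvgr0Pnorm_le => e e0; near=> h.
  apply: le_trans (norm_dsinc_le h) _; near: h; exact: (@nbhs0_le _ R^o).
pose F (y : R) := (y * cos y - sin y) * (y * y)^-1.
have : {for x, continuous F}.
  apply: (@dv_cts _ _ _ _); apply: dvM; first by repeat dv_step.
  by apply: dvV; [rewrite mulf_neq0 | repeat dv_step].
move=> cF; have E y : y != 0 -> F y = dsinc y by move=> y0; rewrite /dsinc ifN// /F expr2.
rewrite /continuous_at -E//; apply: cvg_trans cF; apply: near_eq_cvg; near=> y.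
rewrite E//; near: y; exact: open_neq.
Unshelve. all: by end_near. Qed.

Notation Si := (@sine_integral R).

Lemma dv_Si x : dv Si x (sinc x).
Proof. exact: dv_primitive continuous_sinc. Qed.

Lemma Si0 : Si 0 = 0.
Proof. exact: primitive0. Qed.

Lemma dv_scale f x c l : dv f (c * x) l -> dv (fun y => f (c * y)) x (c * l).
Proof.
move=> df; apply: dv_eq; first by apply: dv_comp df _; repeat dv_step.
by rewrite /idfun /=; ring.
Qed.

Lemma SiN x : Si (- x) = - Si x.
Proof.
apply: (@dv_eq_cst _ (fun x => Si (- x)) (fun x => - Si x) (fun x => - sinc x) x 0).
- move=> y; apply: dv_eq; first by apply: dv_comp (dv_Si _) _; repeat dv_step.
  by rewrite sincN mulrN1.
- by move=> y; apply: dvN; exact: dv_Si.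
- by rewrite oppr0 Si0 oppr0.
Qed.

(* An antiderivative of [sinc ^+ 2], by parts from [sin (2 * x) / x]. *)
Definition Sisq x := Si (2 * x) - sin x * sinc x.

Lemma dv_Sisq x : dv Sisq x (sinc x ^+ 2).
Proof.
apply: dv_eq.
  apply: dvD; first by apply: dv_scale; exact: dv_Si.
  by apply: dvN; apply: dvM; [repeat dv_step | exact: dv_sinc].
rewrite /sinc /dsinc mulf_eq0 (_ : (2 : R) == 0 = false) ?pnatr_eq0//=.
rewrite /idfun /=; case: eqVneq => [->|x0]; first by rewrite cos0 sin0; ring.
have -> : sin (2 * x) = 2 * (sin x * cos x).
  by rewrite (_ : 2 * x = x + x) ?sinD; ring.
by field.
Qed.

Lemma Sisq0 : Sisq 0 = 0.
Proof. by rewrite /Sisq mulr0 Si0 sin0 mul0r subrr. Qed.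

Lemma SisqN x : Sisq (- x) = - Sisq x.
Proof. by rewrite /Sisq mulrN SiN sinN sincN; ring. Qed.

(** The Dirichlet and Fejer kernels as sums, free of division. They serve to compute the limit pi /
    2 of the sine integral: the integral of the Fejer kernel is known exactly, and the kernel is
    close to a rescaled sinc ^ 2. *)
Definition dirichlet n t : R := 1 + 2 * \sum_(k < n) cos (2 * k.+1%:R * t).
Definition fejer n t : R := \sum_(j < n) dirichlet j t.

Lemma sin_dirichlet n t : sin t * dirichlet n t = sin ((2 * n)%:R * t + t).
Proof.
elim: n => [|n IH]; first by rewrite /dirichlet big_ord0 mulr0 addr0 mulr1 muln0 mul0r add0r.
rewrite /dirichlet big_ord_recr /= (_ : _ * _ = sin t * dirichlet n t +
  2 * sin t * cos (2 * n.+1%:R * t)); last by rewrite /dirichlet; ring.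
rewrite IH; set y := 2 * n.+1%:R * t.
have -> : (2 * n)%:R * t + t = y - t by rewrite /y natrM -(natr1 n); ring.
have -> : (2 * n.+1)%:R * t = y by rewrite /y natrM.
by rewrite sinB sinD; ring.
Qed.

Lemma sin_fejer n t : sin t ^+ 2 * fejer n t = sin (n%:R * t) ^+ 2.
Proof.
elim: n => [|n IH]; first by rewrite /fejer big_ord0 mul0r sin0 mulr0 expr0n.
rewrite /fejer big_ord_recr /= -/(fejer n t) mulrDr IH.
rewrite expr2 -mulrA sin_dirichlet.
have -> : (2 * n)%:R * t + t = n%:R * t + (n%:R * t + t) by rewrite natrM; ring.
rewrite -(natr1 n) mulrDl mul1r; set y := n%:R * t.
rewrite [sin (y + (y + t))]sinD cosD [sin (y + t)]sinD.
have := cos2Dsin2 y; have := cos2Dsin2 t.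
set a := sin y; set b := cos y; set s := sin t; set c := cos t => h1 h2.
have Hc : c * c = 1 - s ^+ 2 by rewrite -h1; ring.
have Hb : b * b = 1 - a ^+ 2 by rewrite -h2; ring.
have -> : a ^+ 2 + s * (a * (b * c - a * s) + b * (a * c + b * s)) =
  a ^+ 2 * (1 - s ^+ 2) + 2 * a * b * c * s + (b * b) * s ^+ 2 by ring.
have -> : (a * c + b * s) ^+ 2 = a ^+ 2 * (c * c) + 2 * a * b * c * s + (b * b) * s ^+ 2 by ring.
by rewrite Hc.
Qed.

Definition dirichlet_prim n t : R := t + \sum_(k < n) sin (2 * k.+1%:R * t) / k.+1%:R.
Definition fejer_prim n t : R := \sum_(j < n) dirichlet_prim j t.

Lemma dv_sum n (f f' : nat -> R -> R) x :
  (forall i, dv (f i) x (f' i x)) ->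
  dv (fun y => \sum_(i < n) f i y) x (\sum_(i < n) f' i x).
Proof.
move=> df; elim: n => [|n IH].
  rewrite big_ord0 (_ : (fun _ => _) = fun=> 0); first exact: dv_cst.
  by apply/funext => y; rewrite big_ord0.
rewrite big_ord_recr /=.
rewrite (_ : (fun _ => _) = (fun y => \sum_(i < n) f i y + f n y)); first exact: dvD.
by apply/funext => y; rewrite big_ord_recr.
Qed.

Lemma dv_dirichlet_prim n t : dv (dirichlet_prim n) t (dirichlet n t).
Proof.
apply: dv_eq.
  apply: dvD; first exact: dv_id.
  apply: (@dv_sum n (fun k t => sin (2 * k.+1%:R * t) / k.+1%:R)
    (fun k t => 2 * cos (2 * k.+1%:R * t))) => k.
  apply: dv_eq; first by repeat dv_step.
  by rewrite mulr0 addr0 mul0r add0r; field; rewrite addrC natr1 pnatr_eq0.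
by rewrite /dirichlet -mulr_sumr.
Qed.

Lemma dv_fejer_prim n t : dv (fejer_prim n) t (fejer n t).
Proof. by apply: dv_sum => k; exact: dv_dirichlet_prim. Qed.

Lemma sin_npi n : sin (n%:R * pi) = 0 :> R.
Proof.
elim: n => [|n IH]; first by rewrite mul0r sin0.
by rewrite -natr1 mulrDl mul1r sinDpi IH oppr0.
Qed.

(** At pi / 2 all the sines in the antiderivative vanish, so that only its linear part
    contributes. *)
Lemma fejer_prim_pihalf n : fejer_prim n (pi / 2) = n%:R * (pi / 2).
Proof.
rewrite /fejer_prim; have E j : dirichlet_prim j (pi / 2) = pi / 2 :> R.
  rewrite /dirichlet_prim big1 ?addr0// => k _.
  by rewrite (_ : 2 * _ * _ = k.+1%:R * pi) ?sin_npi ?mul0r//; field.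
rewrite (eq_bigr (fun=> pi / 2)); last by move=> j _; exact: E.
by rewrite sumr_const card_ord mulr_natl.
Qed.

Lemma fejer_prim0 n : fejer_prim n 0 = 0.
Proof.
rewrite /fejer_prim big1// => j _; rewrite /dirichlet_prim add0r big1// => k _.
by rewrite mulr0 sin0 mul0r.
Qed.

Lemma xcos_le_sin t : 0 <= t <= pi -> t * cos t <= sin t :> R.
Proof.
move=> /andP[t0 tpi]; rewrite -subr_ge0.
suff : sin 0 - 0 * cos 0 <= sin t - t * cos t by rewrite sin0 mul0r subrr.
apply: (@dv_ge0_le _ (fun y => sin y - y * cos y) (fun y => y * sin y)) => // y.
  by move=> _; dv_auto; ring.
move=> /andP[y0 yt]; rewrite mulr_ge0// ?(ltW y0)// ltW// sin_gt0_pi// y0.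
exact: lt_le_trans yt tpi.
Qed.

(* The Fejer kernel [sin (n t) ^ 2 / sin t ^ 2] differs from [sin (n t) ^ 2 / t ^ 2] by at
   most [1] on [0, pi / 2], since [1 / sin t ^ 2 - 1 / t ^ 2 <= 1] is [t <= tan t]. *)
Lemma fejer_sinc n t : 0 < t < pi / 2 ->
  (n%:R * sinc (n%:R * t)) ^+ 2 <= fejer n t <= (n%:R * sinc (n%:R * t)) ^+ 2 + 1.
Proof.
move=> /andP[t0 tpi]; have pi0 := @pi_gt0 R.
have s0 : 0 < sin t by rewrite sin_gt0_pi// t0; lra.
have c0 : 0 <= cos t by rewrite cos_ge0_pihalf//; apply/andP; split; lra.
have st := sin_le_id (ltW t0).
have ts : t * cos t <= sin t by apply: xcos_le_sin; rewrite ltW//=; lra.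
set q := n%:R * sinc (n%:R * t).
have E1 : t ^+ 2 * q ^+ 2 = sin (n%:R * t) ^+ 2.
  by rewrite -exprMn /q mulrA [t * _]mulrC mul_sinc.
have E2 := sin_fejer n t.
have t20 : 0 < t ^+ 2 by rewrite exprn_gt0.
have s20 : 0 < sin t ^+ 2 by rewrite exprn_gt0.
have st2 : sin t ^+ 2 <= t ^+ 2 by rewrite ler_sqr ?nnegrE// ltW.
have ts2 : t ^+ 2 - sin t ^+ 2 <= t ^+ 2 * sin t ^+ 2.
  have : (t * cos t) ^+ 2 <= sin t ^+ 2 by rewrite ler_sqr ?nnegrE ?mulr_ge0// ltW.
  rewrite exprMn (_ : cos t ^+ 2 = 1 - sin t ^+ 2); first by rewrite mulrBr mulr1; lra.
  by rewrite -(cos2Dsin2 t); ring.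
have sn1 : sin (n%:R * t) ^+ 2 <= 1.
  by have := cos2Dsin2 (n%:R * t); have := sqr_ge0 (cos (n%:R * t)); lra.
have q0 := sqr_ge0 q; apply/andP; split.
  by rewrite -(ler_pM2l s20) E2 -E1 ler_wpM2r.
rewrite -(ler_pM2l s20) E2 -(ler_pM2l t20) -E1.
rewrite -subr_ge0 (_ : _ - _ = t ^+ 2 * sin t ^+ 2 - (t ^+ 2 - sin t ^+ 2) * (t ^+ 2 * q ^+ 2));
  last by ring.
rewrite subr_ge0 E1; apply: le_trans ts2.
by rewrite ler_piMr// subr_ge0.
Qed.

(** Integrating [fejer_sinc] over [0, pi / 2] compares n pi / 2 with n times the value of [Sisq], up
    to pi / 2; dividing by n gives the limit with a rate. *)
Lemma Sisq_npihalf n : (0 < n)%N ->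
  `|Sisq (n%:R * (pi / 2)) - pi / 2| <= pi / 2 / n%:R :> R.
Proof.
move=> n0; have n0R : 0 < n%:R :> R by rewrite ltr0n.
have pi0 := @pi_gt0 R; have pih0 : 0 <= pi / 2 :> R by lra.
pose Z t : R := n%:R * Sisq (n%:R * t).
have dZ t : dv Z t ((n%:R * sinc (n%:R * t)) ^+ 2).
  apply: dv_eq.
    by apply: dvM; [exact: dv_cst | apply: dv_scale; exact: dv_Sisq].
  by ring.
have Z0 : Z 0 = 0 by rewrite /Z mulr0 Sisq0 mulr0.
have H1 : n%:R * (pi / 2) - Z (pi / 2) >= 0.
  rewrite -fejer_prim_pihalf.
  rewrite (_ : 0 = fejer_prim n 0 - Z 0); last by rewrite fejer_prim0 Z0 subrr.
  apply: (@dv_ge0_le _ (fun t => fejer_prim n t - Z t)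
    (fun t => fejer n t - (n%:R * sinc (n%:R * t)) ^+ 2)) => // t.
    by move=> _; apply: dvD; [exact: dv_fejer_prim|exact: dvN].
  by move=> /(fejer_sinc n)/andP[h _]; rewrite subr_ge0.
have H2 : 0 <= Z (pi / 2) + pi / 2 - n%:R * (pi / 2).
  rewrite -fejer_prim_pihalf.
  rewrite (_ : 0 = Z 0 + 0 - fejer_prim n 0); last by rewrite fejer_prim0 Z0 addr0 subrr.
  apply: (@dv_ge0_le _ (fun t => Z t + t - fejer_prim n t)
    (fun t => (n%:R * sinc (n%:R * t)) ^+ 2 + 1 - fejer n t)) => // t.
    by move=> _; apply: dvD; [apply: dvD => //; exact: dv_id | apply: dvN; exact: dv_fejer_prim].
  by move=> /(fejer_sinc n)/andP[_ h]; rewrite subr_ge0.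
rewrite ler_pdivlMr// -[X in _ * X](ger0_norm (ltW n0R)) -normrM mulrBl.
by rewrite ler_norml; move: H1 H2; rewrite /Z; lra.
Qed.

(** The derivative of Si t + (cos t + c) / t is - (cos t + c) / t ^ 2, of constant sign for c = 1
    and for c = -1. The two monotone functions enclose the oscillation of the sine integral. *)
Lemma Si_bounds x y : 0 < x -> x <= y ->
  Si x + (cos x - 1) / x <= Si y + (cos y - 1) / y /\
  Si y + (cos y + 1) / y <= Si x + (cos x + 1) / x.
Proof.
move=> x0 xy.
have d (c z : R) : x <= z <= y ->
    dv (fun t => Si t + (cos t + c) / t) z (- (cos z + c) / z ^+ 2).
  move=> /andP[xz _]; have z0 : z != 0 by rewrite gt_eqF// (lt_le_trans x0).
  apply: dv_eq.
    apply: dvD; first exact: dv_Si.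
    by apply: dvM; [repeat dv_step | apply: dvV; [done | exact: dv_id]].
  by rewrite /sinc ifN// /idfun /=; field.
split.
  apply: (@dv_ge0_le _ (fun t => Si t + (cos t - 1) / t) _ _ _ xy (d (-1))) => z /andP[xz _].
  rewrite divr_ge0 ?sqr_ge0// oppr_ge0; have := cos_le1 z; lra.
rewrite -lerN2; apply: (@dv_ge0_le _ (fun t => - (Si t + (cos t + 1) / t)) _ _ _ xy).
  by move=> z xz; apply: dvN; exact: d.
move=> z _ /=; rewrite mulNr opprK divr_ge0 ?sqr_ge0//; have := cos_geN1 z; lra.
Qed.

(** The limit is known along the multiples of pi from [Sisq_npihalf]; [Si_bounds] carries it back to
    [x] from an arbitrarily distant multiple. *)
Lemma Si_limit x : 0 < x -> `|Si x - pi / 2| <= 2 / x.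
Proof.
move=> x0; have pi0 := @pi_gt0 R.
apply/ler_addgt0Pr => e e0.
(* The sum of two errors at n pi: that of [Sisq_npihalf], and the product of sine and [sinc] by
   which [Sisq] differs from the sine integral. *)
pose b n : R := (pi / 2 + 2 / pi) / n%:R.
have b0 : 0 <= pi / 2 + 2 / pi :> R by rewrite addr_ge0// divr_ge0// ltW.
have [n [n0 xn be]] : exists n, [/\ (0 < n)%N, x <= n%:R * pi & b n <= e].
  exists (maxn 1 (maxn (Num.truncn (x / pi)).+1 (Num.truncn ((pi / 2 + 2 / pi) / e)).+1)).
  rewrite leq_maxl /b; set n := maxn 1 _.
  have n0 : 0 < n%:R :> R by rewrite ltr0n leq_maxl.
  split => //.
    rewrite -ler_pdivrMr// (le_trans (ltW (truncnS_gt _)))// ler_nat.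
    by rewrite !leq_max leqnn orbT.
  have := truncnS_gt ((pi / 2 + 2 / pi) / e); rewrite ltr_pdivrMr// => h.
  rewrite ler_pdivrMr// [e * _]mulrC (le_trans (ltW h))// ler_wpM2r ?(ltW e0)// ler_nat.
  by rewrite !leq_max leqnn !orbT.
have n0R : 0 < n%:R :> R by rewrite ltr0n.
have S : `|Si (n%:R * pi) - pi / 2| <= e.
  apply: le_trans be; have := Sisq_npihalf n0.
  rewrite /Sisq (_ : 2 * (n%:R * (pi / 2)) = n%:R * pi); last by field.
  set y := n%:R * (pi / 2) => h.
  have y0 : 0 < y by rewrite mulr_gt0// divr_gt0.
  have hs : `|sin y * sinc y| <= 2 / pi / n%:R.
    rewrite /sinc gt_eqF// mulrA normrM normfV (gtr0_norm y0) ler_pdivrMr//.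
    have -> : 2 / pi / n%:R * y = 1.
      rewrite /y; move: (lt0r_neq0 n0R) (lt0r_neq0 pi0); move: pi n%:R => p k k0 p0.
      by field; rewrite p0 k0.
    by rewrite -expr2 ger0_norm ?sqr_ge0// -(cos2Dsin2 y) lerDr sqr_ge0.
  have -> : b n = pi / 2 / n%:R + 2 / pi / n%:R by rewrite /b mulrDl.
  apply: le_trans (lerD h hs).
  rewrite (_ : Si _ - _ = (Si (n%:R * pi) - sin y * sinc y - pi / 2) + sin y * sinc y).
    exact: ler_normD.
  by move: (Si _) (pi / 2) => u v; ring.
have [] := Si_bounds x0 xn.
set y := n%:R * pi in S xn *; have y0 : 0 < y by exact: lt_le_trans xn.
have c1 := cos_le1 y; have c2 := cos_geN1 y; have c3 := cos_le1 x; have c4 := cos_geN1 x.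
have h1 : (cos y - 1) / y <= 0 by rewrite mulr_le0_ge0 ?invr_ge0 ?(ltW y0)//; lra.
have h2 : 0 <= (cos y + 1) / y by rewrite divr_ge0// ?(ltW y0)//; lra.
have h3 : - (2 / x) <= (cos x - 1) / x by rewrite -mulNr ler_wpM2r ?invr_ge0 ?(ltW x0)//; lra.
have h4 : (cos x + 1) / x <= 2 / x by rewrite ler_wpM2r ?invr_ge0 ?(ltW x0)//; lra.
move: S; rewrite !ler_norml => /andP[? ?] ? ?; apply/andP; split; lra.
Qed.

End sinc.

(** * The entries of the sine kernels *)

Section kernels.
Context {R : realType}.
Implicit Types (S D I Q f g : R -> R) (x y u a b c l : R).
Notation Si := (@sine_integral R).

(** Comparable with 1 / (1 + |u|), but smooth and with an elementary antiderivative, the inverse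
    hyperbolic sine of [dv_ln_decay]. *)
Definition decay u : R := (Num.sqrt (1 + u ^+ 2))^-1.

(* [Q] is the odd antiderivative of the truncated two-point function [S ^+ 2 - D * I], whose
   total mass is one. For beta = 4 the entry [I] is only bounded, but it is an antiderivative
   of [S]. *)
Record sine_kernel S D I Q (k : R) : Prop := SineKernel {
  sk_k : 1 <= k;
  sk_dS : forall u, dv S u (D u);
  sk_cD : continuous D;
  sk_mI : measurable_fun setT I;
  sk_S : forall u, `|S u| <= k * decay u;
  sk_D : forall u, `|D u| <= k * decay u;
  sk_I : forall u, `|I u| <= k;
  sk_SN : forall u, S (- u) = S u;
  sk_DN : forall u, D (- u) = - D u;
  sk_IN : forall u, I (- u) = - I u;
  sk_dQ : forall u, dv Q u (S u ^+ 2 - D u * I u);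
  sk_cT : continuous (fun u => S u ^+ 2 - D u * I u);
  sk_QN : forall u, Q (- u) = - Q u;
  sk_Q : forall u, `|Q u - Num.sg u / 2| <= k * decay u;
  sk_alt : (forall u, `|I u| <= k * decay u) \/ (forall u, dv I u (S u)) }.

Lemma decay_gt0 u : 0 < decay u.
Proof. by rewrite invr_gt0 sqrtr_gt0 ltr_pwDl// sqr_ge0. Qed.

Lemma decay_ge0 u : 0 <= decay u.
Proof. exact: ltW (decay_gt0 u). Qed.

Lemma decayN u : decay (- u) = decay u.
Proof. by rewrite /decay sqrrN. Qed.

Lemma decay_le1 u : decay u <= 1.
Proof.
rewrite invf_le1 ?sqrtr_gt0 ?ltr_pwDl ?sqr_ge0// -{1}(sqrtr1 R) ler_wsqrtr//.
by rewrite lerDl sqr_ge0.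
Qed.

Lemma norm_mul_decay u : `|u| * decay u <= 1.
Proof.
rewrite ler_pdivrMr ?sqrtr_gt0 ?ltr_pwDl ?sqr_ge0// mul1r -sqrtr_sqr ler_wsqrtr//.
by rewrite lerDr.
Qed.

(** Since sqrt (1 + u ^ 2) <= 1 + |u|, a bound near 0 and a bound at infinity add up. *)
Lemma le_decay a b u f : `|f u| <= a -> `|u| * `|f u| <= b -> `|f u| <= (a + b) * decay u.
Proof.
move=> fa fb; rewrite ler_pdivlMr ?sqrtr_gt0 ?ltr_pwDl ?sqr_ge0//.
have : Num.sqrt (1 + u ^+ 2) <= 1 + `|u|.
  rewrite -[leRHS]ger0_norm ?addr_ge0// -sqrtr_sqr ler_wsqrtr//.
  by rewrite sqrrD expr1n real_normK ?num_real// mul1r lerD2r lerDl mulrn_wge0.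
move=> /(ler_wpM2l (normr_ge0 (f u))) /le_trans; apply.
by rewrite mulrDr mulr1 [_ * `|u|]mulrC lerD.
Qed.

Lemma continuous_decay : continuous decay.
Proof.
move=> u; have h : 0 < 1 + u * u by rewrite -expr2 ltr_pwDl// sqr_ge0.
have -> : decay = (fun v => (Num.sqrt (1 + v * v))^-1).
  by apply/funext => v; rewrite /decay expr2.
apply: (@dv_cts _ _ _ _); apply: dvV; first by rewrite gt_eqF// sqrtr_gt0.
by apply: (@dv_sqrt _ (fun y => 1 + y * y)); [exact: h | repeat dv_step].
Qed.

Lemma dv_ln_decay u : dv (fun v => ln (v + Num.sqrt (1 + v ^+ 2))) u (decay u).
Proof.
have h : 0 < 1 + u * u by rewrite -expr2 ltr_pwDl// sqr_ge0.
have s0 : 0 < Num.sqrt (1 + u * u) by rewrite sqrtr_gt0.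
have us : 0 < u + Num.sqrt (1 + u * u).
  have : `|u| < Num.sqrt (1 + u * u).
    by rewrite -sqrtr_sqr ltr_sqrt// -expr2 ltrDr.
  by rewrite ltr_norml => /andP[]; lra.
have -> : (fun v : R => ln (v + Num.sqrt (1 + v ^+ 2))) = (fun v => ln (v + Num.sqrt (1 + v * v))).
  by apply/funext => v; rewrite expr2.
apply: dv_eq.
  apply: dv_ln; first exact: us.
  by apply: dvD; [exact: dv_id | apply: (@dv_sqrt _ (fun y => 1 + y * y)); [exact: h | repeat dv_step]].
rewrite /idfun /= /decay expr2; field.
by rewrite !gt_eqF.
Qed.

Lemma continuous_shift f c : continuous f -> continuous (fun u => f (u + c)).
Proof.
move=> cf u; apply: (@continuous_comp _ _ _ (fun u => u + c) f); last exact: cf.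
by apply: (@dv_cts _ _ _ (1 + 0)); repeat dv_step.
Qed.

(** The antiderivative is odd and grows like a logarithm, so each end of the interval contributes at
    most ln (1 + 2 N). *)
Lemma decay_integral N y : 0 <= y <= N ->
  \int[lebesgue_measure]_(t in `[0, N]) decay (t - y) <= 2 * ln (1 + 2 * N).
Proof.
move=> /andP[y0 yN]; pose L v : R := ln (v + Num.sqrt (1 + v ^+ 2)).
have L0 (v : R) : 0 <= v -> 0 < v + Num.sqrt (1 + v ^+ 2).
  by move=> v0; rewrite ltr_wpDl// sqrtr_gt0 ltr_pwDl// sqr_ge0.
rewrite (@dv_ftc _ _ (fun t => L (t - y))).
- rewrite sub0r.
  have -> : L (- y) = - L y.
    rewrite /L -lnV ?posrE ?L0//; congr ln; rewrite sqrrN.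
    have := @sqr_sqrtr _ (1 + y ^+ 2); rewrite addr_ge0 ?sqr_ge0// => /(_ isT).
    have := L0 _ y0; set s := Num.sqrt _ => p q.
    have p0 : y + s != 0 by rewrite gt_eqF.
    apply: (@mulIf _ (y + s)) => //; rewrite mulVf//.
    have -> : (- y + s) * (y + s) = s ^+ 2 - y ^+ 2 by ring.
    by rewrite q addrK.
  have LN (v : R) : 0 <= v <= N -> L v <= ln (1 + 2 * N).
    move=> /andP[v0 vN]; rewrite ler_ln ?posrE ?L0//; last by lra.
    have : Num.sqrt (1 + v ^+ 2) <= 1 + v.
      rewrite -[leRHS]ger0_norm ?addr_ge0// -sqrtr_sqr ler_wsqrtr//.
      by rewrite sqrrD expr1n mul1r lerD2r lerDl mulrn_wge0.
    lra.
  have := LN y; have := LN (N - y); rewrite y0 yN => h1 h2.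
  have := h1 _; have := h2 isT; rewrite subr_ge0 yN gerBl y0 => + /(_ isT); lra.
- lra.
- move=> t; apply: dv_eq; first by apply: dv_comp (dv_ln_decay _) _; repeat dv_step.
  by rewrite addr0 mulr1.
- exact: continuous_shift continuous_decay.
Qed.

Lemma norm_Si_le x : `|Si x| <= 4.
Proof.
move: x; apply: norm_wlog => [x|x x0]; first by rewrite SiN normrN.
have pi0 := @pi_gt0 R; have := @pi_ge2 R => pi2.
have [pih1 pih2] := (@pihalf_ge1 R, @pihalf_lt2 R).
have [x1|x1] := leP x 1; last first.
  have := Si_limit (lt_trans ltr01 x1); have : 2 / x <= 2.
    by rewrite ler_pdivrMr ?(lt_trans ltr01 x1)// ler_peMr// ltW.
  by rewrite !ler_norml => ? /andP[? ?]; apply/andP; split; lra.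
apply: (@le_trans _ _ x); last by rewrite (le_trans x1)// ler1n.
have dI y : dv (fun y => y + Si y) y (1 + sinc y) by apply: dvD; [exact: dv_id|exact: dv_Si].
have dJ y : dv (fun y => y - Si y) y (1 - sinc y).
  by apply: dvD; [exact: dv_id | apply: dvN; exact: dv_Si].
have h1 := @dv_ge0_le _ (fun y => y + Si y) _ 0 x x0 (fun y _ => dI y).
have h2 := @dv_ge0_le _ (fun y => y - Si y) _ 0 x x0 (fun y _ => dJ y).
move: h1 h2; rewrite Si0 addr0 subr0 => h1 h2; rewrite ler_norml.
have b y : -1 <= sinc y <= 1 by have := norm_sinc_le1 y; rewrite ler_norml.
have p : forall y, 0 < y < x -> 0 <= 1 + sinc y by move=> y _; have := b y; lra.
have q : forall y, 0 < y < x -> 0 <= 1 - sinc y by move=> y _; have := b y; lra.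
have := h1 p; have := h2 q; lra.
Qed.

Lemma norm_Sisq_le x : `|Sisq x| <= 5.
Proof.
rewrite /Sisq (le_trans (ler_normB _ _))// normrM.
have h1 := norm_Si_le (2 * x); have h2 := norm_sinc_le1 x.
have h3 : `|sin x| <= 1 by rewrite ler_norml sin_geN1 sin_le1.
have : `|sin x| * `|sinc x| <= 1 * 1 by rewrite ler_pM.
lra.
Qed.

Lemma Sisq_limit x : 0 < x -> `|Sisq x - pi / 2| <= 2 / x.
Proof.
move=> x0; rewrite /Sisq.
have h1 := Si_limit (mulr_gt0 (@ltr0n R 2) x0).
have h2 : `|sin x * sinc x| <= 1 / x.
  rewrite ler_pdivlMr// normrM -[X in _ * X](gtr0_norm x0) -mulrA.
  rewrite -[leRHS]mulr1 ler_pM//; first by rewrite ler_norml sin_geN1 sin_le1.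
  by rewrite mulrC norm_mul_sinc.
rewrite (_ : _ - _ = (Si (2 * x) - pi / 2) - sin x * sinc x); last by move: (pi / 2) => p; ring.
rewrite (le_trans (ler_normB _ _))// (_ : 2 / x = 2 / (2 * x) + 1 / x) ?lerD//.
by field; rewrite gt_eqF.
Qed.


Lemma continuous_mul_sg f : continuous f -> f 0 = 0 -> continuous (fun u => f u * Num.sg u).
Proof.
move=> cf f0 u; have [->|u0] := eqVneq u 0.
  rewrite /continuous_at sgr0 mulr0; apply/cvgr0Pnorm_le => e e0; near=> v.
  rewrite (@le_trans _ _ `|f v|)//.
    by rewrite normrM ler_piMr// normr_sg lern1; case: (v != 0).
  near: v; apply: (@cvgr0_norm_le _ _ _ _ _ f) => //; rewrite -[X in _ --> X]f0; exact: cf.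
have : (fun v => f v * Num.sg u) v @[v --> u] --> f u * Num.sg u.
  by apply: cvgM; [exact: cf | exact: cvg_cst].
apply: cvg_trans; apply: near_eq_cvg.
have [u1|u1] : u < 0 \/ 0 < u by apply/orP; rewrite -neq_lt.
  near=> v; congr (_ * _); rewrite !ltr0_sg//; near: v; exact: (lt_nbhsl u1).
near=> v; congr (_ * _); rewrite !gtr0_sg//; near: v; exact: (lt_nbhsr u1).
Unshelve. all: by end_near. Qed.

(** The jump of [Num.sg] at 0 does no harm because [f] vanishes there to second order. This is
    needed for beta = 1, whose kernel contains a sign. *)
Lemma dv_mul_sg f x l c : (forall y, `|f y| <= c * y ^+ 2) -> dv f x l ->
  dv (fun u => f u * Num.sg u) x (l * Num.sg x).
Proof.
move=> fc df; have [->|x0] := eqVneq x 0.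
  rewrite sgr0 mulr0; apply: (@dv_quadratic _ _ _ c) => y.
  rewrite sgr0 mulr0 !subr0 normrM (le_trans _ (fc y))//.
  by rewrite ler_piMr// normr_sg lern1; case: (y != 0).
apply: (@dv_near _ (fun u => f u * Num.sg x)).
  have [u1|u1] : x < 0 \/ 0 < x by apply/orP; rewrite -neq_lt.
    near=> v; congr (_ * _); rewrite !ltr0_sg//; near: v; exact: (lt_nbhsl u1).
  near=> v; congr (_ * _); rewrite !gtr0_sg//; near: v; exact: (lt_nbhsr u1).
by apply: dv_eq; [apply: dvM; [exact: df | exact: dv_cst] | rewrite mulr0 addr0].
Unshelve. all: by end_near. Qed.

Lemma pi_bounds : 2 <= (pi : R) < 4.
Proof.
by have := @pihalf_lt2 R; rewrite pi_ge2 /= ltr_pdivrMr// -natrM.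
Qed.

Lemma mul_pi_gt0 u : 0 < u -> 0 < pi * u.
Proof. by move=> u0; rewrite mulr_gt0// pi_gt0. Qed.

(** The index 1 serves beta = 1 and 2, the index 4 serves beta = 4. [I0] is the smooth part of [I1];
    [Z1] and [Z4] are antiderivatives of S1 ^ 2 and 2 S4 ^ 2 with limit 1 / 2 at plus infinity. *)
Let S1 u : R := sinc (pi * u).
Let D1 u : R := pi * dsinc (pi * u).
Let I0 u : R := pi^-1 * Si (pi * u).
Let I1 u : R := pi^-1 * Si (pi * u) - 2^-1 * Num.sg u.
Let Z1 u : R := pi^-1 * Sisq (pi * u).
Let S4 u : R := sinc (2 * pi * u).
Let D4 u : R := 2 * pi * dsinc (2 * pi * u).
Let I4 u : R := (2 * pi)^-1 * Si (2 * pi * u).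
Let Z4 u : R := pi^-1 * Sisq (2 * pi * u).

Lemma dv_S1 u : dv S1 u (D1 u).
Proof. by apply: dv_scale; exact: dv_sinc. Qed.

Lemma dv_S4 u : dv S4 u (D4 u).
Proof. by apply: dv_scale; exact: dv_sinc. Qed.

Lemma dv_cscale f c b u l : dv f (b * u) l -> dv (fun v => c * f (b * v)) u (c * b * l).
Proof.
move=> df; apply: dv_eq; first by apply: dvM; [exact: dv_cst | apply: dv_scale; exact: df].
by rewrite mul0r add0r mulrA.
Qed.

Lemma dv_I0 u : dv I0 u (S1 u).
Proof.
apply: dv_eq; first by apply: dv_cscale; exact: dv_Si.
by rewrite mulVf ?mul1r// gt_eqF ?pi_gt0.
Qed.

Lemma dv_I4 u : dv I4 u (S4 u).
Proof.
apply: dv_eq; first by apply: dv_cscale; exact: dv_Si.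
by rewrite mulVf ?mul1r// gt_eqF// mulr_gt0 ?pi_gt0.
Qed.

Lemma dv_Z1 u : dv Z1 u (S1 u ^+ 2).
Proof.
apply: dv_eq; first by apply: dv_cscale; exact: dv_Sisq.
by rewrite mulVf ?mul1r// gt_eqF ?pi_gt0.
Qed.

Lemma dv_Z4 u : dv Z4 u (2 * S4 u ^+ 2).
Proof.
apply: dv_eq; first by apply: dv_cscale; exact: dv_Sisq.
by rewrite (_ : pi^-1 * (2 * pi) = 2)// mulrCA mulVf ?mulr1// gt_eqF ?pi_gt0.
Qed.

Lemma continuous_scale f c : continuous f -> continuous (fun u => f (c * u)).
Proof.
move=> cf u; apply: (@continuous_comp _ _ _ (fun u => c * u) f); last exact: cf.
by apply: (@dv_cts _ _ _ c); apply: dv_eq; [repeat dv_step | rewrite /idfun /=; ring].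
Qed.

Lemma continuous_D1 : continuous D1.
Proof.
move=> u; apply: cvgM; first exact: cvg_cst.
by apply: continuous_scale; exact: continuous_dsinc.
Qed.

Lemma continuous_D4 : continuous D4.
Proof.
move=> u; apply: cvgM; first exact: cvg_cst.
by apply: continuous_scale; exact: continuous_dsinc.
Qed.

Lemma le_invpi x c : `|x| <= 2 * c -> `|pi^-1 * x| <= c.
Proof.
move=> xc; have /andP[p2 _] := pi_bounds; have p0 := @pi_gt0 R.
rewrite normrM gtr0_norm ?invr_gt0// ler_pdivrMl// (le_trans xc)// ler_wpM2r//.
by have := le_trans (normr_ge0 _) xc; lra.
Qed.

Lemma sinc_scale_bounds c u : 1 <= c -> `|sinc (c * u)| <= 1 /\ `|u| * `|sinc (c * u)| <= 1.
Proof.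
move=> c1; split; first exact: norm_sinc_le1.
apply: le_trans (norm_mul_sinc (c * u)); rewrite ler_wpM2r// normrM ger0_norm; last by lra.
by rewrite ler_peMl.
Qed.

Lemma dsinc_scale_bounds c u : 1 <= c ->
  `|c * dsinc (c * u)| <= 2 * c /\ `|u| * `|c * dsinc (c * u)| <= 2.
Proof.
move=> c1; have c0 : 0 < c by lra.
split; first by rewrite normrM gtr0_norm// mulrC ler_wpM2r ?norm_dsinc_le2// ltW.
apply: le_trans (norm_mul_dsinc_le (c * u)).
by rewrite !normrM mulrCA mulrA.
Qed.

Lemma odd_bound f b c u : (forall v, f (- v) = - f v) -> (forall v, 0 < v -> `|f v - c| <= b / v) ->
  0 <= b -> `|u| * `|f u - c * Num.sg u| <= b.
Proof.
move=> fN fb b0; move: u; apply: norm_wlog => [u|u].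
  by rewrite fN sgrN mulrN -opprD !normrN.
rewrite le_eqVlt => /predU1P[<-|u0]; first by rewrite normr0 mul0r.
by rewrite gtr0_sg// mulr1 gtr0_norm// mulrC -ler_pdivlMr// fb.
Qed.

Lemma I1_bounds u : `|I1 u| <= 3 /\ `|u| * `|I1 u| <= 1.
Proof.
have /andP[p2 _] := pi_bounds; have p0 := @pi_gt0 R; split.
  rewrite /I1 (le_trans (ler_normB _ _))//.
  have h1 : `|pi^-1 * Si (pi * u)| <= 2.
    by apply: le_invpi; rewrite -natrM; exact: norm_Si_le.
  have h2 : `|2^-1 * Num.sg u| <= 1.
    rewrite normrM -[leRHS]mulr1 ler_pM// ?normr_sg ?lern1; last by case: (u != 0).
    by rewrite ger0_norm ?invf_le1 ?ler1n ?ltr0n.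
  lra.
apply: (@odd_bound (fun u => pi^-1 * Si (pi * u)) 1 2^-1 u) => // [v|v v0].
  by rewrite mulrN SiN mulrN.
rewrite (_ : _ - _ = pi^-1 * (Si (pi * v) - pi / 2)); last first.
  by move: (Si _); move: pi p0 => p p0 s; field; rewrite gt_eqF.
apply: le_invpi; apply: le_trans (Si_limit (mul_pi_gt0 v0)) _.
by rewrite mulrA mulr1 ler_pM2l// lef_pV2 ?posrE ?mul_pi_gt0// ler_peMl ?ltW//; lra.
Qed.

Lemma Z_bounds c u : 1 <= c ->
  `|pi^-1 * Sisq (c * u) - 2^-1 * Num.sg u| <= 4 /\
  `|u| * `|pi^-1 * Sisq (c * u) - 2^-1 * Num.sg u| <= 1.
Proof.
move=> c1; have /andP[p2 _] := pi_bounds; have p0 := @pi_gt0 R; split.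
  rewrite (le_trans (ler_normB _ _))//.
  have h1 : `|pi^-1 * Sisq (c * u)| <= 3.
    by apply: le_invpi; rewrite (le_trans (norm_Sisq_le _))//; lra.
  have h2 : `|2^-1 * Num.sg u| <= 1.
    rewrite normrM -[leRHS]mulr1 ler_pM// ?normr_sg ?lern1; last by case: (u != 0).
    by rewrite ger0_norm ?invf_le1 ?ler1n ?ltr0n.
  lra.
apply: (@odd_bound (fun u => pi^-1 * Sisq (c * u)) 1 2^-1 u) => // [v|v v0].
  by rewrite mulrN SisqN mulrN.
rewrite (_ : _ - _ = pi^-1 * (Sisq (c * v) - pi / 2)); last first.
  by move: (Sisq _); move: pi p0 => p p0 s; field; rewrite gt_eqF.
apply: le_invpi; apply: le_trans (Sisq_limit _) _; first by rewrite mulr_gt0//; lra.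
rewrite mulrA mulr1 ler_pM2l// lef_pV2 ?posrE ?ler_peMl// ?ltW//.
by rewrite mulr_gt0//; lra.
Qed.

Lemma measurable_sg : measurable_fun setT (Num.sg : R -> R).
Proof.
have -> : Num.sg = (fun u : R => \1_`]0, +oo[ u - \1_`]-oo, 0[ u).
  apply/funext => u; rewrite !indicE !mem_setE !in_itv /= andbT.
  by case: sgrP => h; rewrite ?subr0 ?sub0r.
exact: measurable_funB.
Qed.

Lemma mul_bound3 a b c u : `|a| <= c -> `|b| <= 1 -> `|u| * `|b| <= 1 ->
  `|a * b| <= c /\ `|u| * `|a * b| <= c.
Proof.
move=> h1 h2 h3; rewrite normrM mulrCA -[X in _ <= X /\ _]mulr1 -[X in _ /\ _ <= X]mulr1.
by split; apply: ler_pM; rewrite ?mulr_ge0.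
Qed.

Lemma add_bound (a b c1 c2 d1 d2 u : R) : `|a| <= c1 /\ `|u| * `|a| <= d1 ->
  `|b| <= c2 /\ `|u| * `|b| <= d2 -> `|a - b| <= c1 + c2 /\ `|u| * `|a - b| <= d1 + d2.
Proof.
move=> [h1 h2] [h3 h4]; have := ler_normB a b => h; split; first by lra.
by rewrite (le_trans (ler_wpM2l (normr_ge0 u) h))// mulrDr lerD.
Qed.

Lemma decay_of_bounds (f : R) u c b : `|f| <= c /\ `|u| * `|f| <= b -> c + b <= 20 ->
  `|f| <= 20 * decay u.
Proof.
move=> [h1 h2] cb; apply: le_trans (@le_decay c b u (fun=> f) h1 h2) _.
by rewrite ler_wpM2r// decay_ge0.
Qed.

Lemma S_kernel_decay c u : 1 <= c -> `|sinc (c * u)| <= 20 * decay u.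
Proof. by move=> /sinc_scale_bounds h; apply: decay_of_bounds (h u) _; lra. Qed.

Lemma D_kernel_decay c u : 1 <= c -> c <= 8 -> `|c * dsinc (c * u)| <= 20 * decay u.
Proof. by move=> /dsinc_scale_bounds h c8; apply: decay_of_bounds (h u) _; lra. Qed.

Lemma pi_ge1 : 1 <= pi :> R.
Proof. by have := pi_bounds; lra. Qed.

Lemma pi2_bounds : 1 <= 2 * pi :> R /\ 2 * pi <= 8 :> R.
Proof. by have := pi_bounds; lra. Qed.

(** With I = 0 the matrices are triangular with equal diagonal entries, so the half trace around a
    cycle is the product of the [S]: in this way beta = 2 fits the quaternion scheme. *)
Lemma sine_kernel2 : sine_kernel S1 D1 (fun=> 0) Z1 20.
Proof.
have E : (fun u => S1 u ^+ 2 - D1 u * 0) = fun u => S1 u ^+ 2.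
  by apply/funext => u; rewrite mulr0 subr0.
have [p1 p8] := (pi_ge1, pi_bounds).
split => //=; rewrite ?E.
- by rewrite ler1n.
- exact: dv_S1.
- exact: continuous_D1.
- by move=> u; exact: S_kernel_decay.
- by move=> u; apply: D_kernel_decay => //; lra.
- by move=> u; rewrite normr0.
- by move=> u; rewrite /S1 mulrN sincN.
- by move=> u; rewrite /D1 mulrN dsincN mulrN.
- by move=> u; rewrite oppr0.
- by move=> u; rewrite mulr0 subr0; exact: dv_Z1.
- move=> u; apply: (@cvg_comp _ _ _ S1 (fun x => x ^+ 2)); last exact: exprn_continuous.
  exact: dv_cts (dv_S1 u).
- by move=> u; rewrite /Z1 mulrN SisqN mulrN.
- move=> u; rewrite [Num.sg u / 2]mulrC; apply: decay_of_bounds (Z_bounds u p1) _.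
  lra.
- by left => u; rewrite normr0 mulr_ge0 ?decay_ge0.
Qed.

(** [Q] is found by parts: since I' = S, the derivative of S I is D I + S ^ 2, and subtracting it
    from that of [Z4] leaves S ^ 2 - D I. *)
Lemma sine_kernel4 : sine_kernel S4 D4 I4 (fun u => Z4 u - S4 u * I4 u) 20.
Proof.
have [p1 p8] := pi2_bounds; have p0 := @pi_gt0 R.
have I4b u : `|I4 u| <= 1.
  rewrite normrM normfV ler_pdivrMl ?normr_gt0 ?gt_eqF ?mulr_gt0// mulr1.
  by rewrite (le_trans (norm_Si_le _))// gtr0_norm ?mulr_gt0//; have := pi_bounds; lra.
have cS u : {for u, continuous S4} by exact: dv_cts (dv_S4 u).
have cI u : {for u, continuous I4} by exact: dv_cts (dv_I4 u).
split => //=.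
- by rewrite ler1n.
- exact: dv_S4.
- exact: continuous_D4.
- by apply: continuous_measurable_fun => u; exact: cI.
- by move=> u; exact: S_kernel_decay.
- by move=> u; exact: D_kernel_decay.
- by move=> u; rewrite (le_trans (I4b u))// ler1n.
- by move=> u; rewrite /S4 mulrN sincN.
- by move=> u; rewrite /D4 mulrN dsincN mulrN.
- by move=> u; rewrite /I4 mulrN SiN mulrN.
- move=> u; apply: dv_eq.
    apply: dvD; first exact: dv_Z4.
    by apply: dvN; apply: dvM; [exact: dv_S4 | exact: dv_I4].
  by move: (S4 u) (D4 u) (I4 u) => s d i; ring.
- move=> u; apply: cvgB; last by apply: cvgM; [exact: continuous_D4 | exact: cI].
  by apply: (@cvg_comp _ _ _ S4 (fun x => x ^+ 2)); [exact: cS | exact: exprn_continuous].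
- by move=> u; rewrite /Z4 /S4 /I4 !mulrN SisqN sincN SiN !mulrN; ring.
- move=> u; have h := mul_bound3 (I4b u) (sinc_scale_bounds u p1).1 (sinc_scale_bounds u p1).2.
  rewrite (_ : _ - _ = Z4 u - 2^-1 * Num.sg u - I4 u * S4 u); last first.
    by move: (S4 u) (I4 u) (Z4 u) => s i z; ring.
  by apply: decay_of_bounds (add_bound (Z_bounds u p1) h) _; lra.
- by right; exact: dv_I4.
Qed.

(** As for beta = 4, with one more term for the sign in [I1]: its contribution D sg / 2 integrates
    to (S1 - 1) sg / 2, where the constant -1 makes the factor of the sign vanish to second order at
    0. *)
Lemma sine_kernel1 : sine_kernel S1 D1 I1
  (fun u => 2 * Z1 u - S1 u * I0 u + 2^-1 * (S1 u - 1) * Num.sg u) 20.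
Proof.
have p0 := @pi_gt0 R; have p1 := pi_ge1; have /andP[p2 p4] := pi_bounds.
have cS u : {for u, continuous S1} by exact: dv_cts (dv_S1 u).
have cI u : {for u, continuous I0} by exact: dv_cts (dv_I0 u).
have D10 : D1 0 = 0 by rewrite /D1 /dsinc mulr0 eqxx mulr0.
have mI : measurable_fun setT I1.
  apply: measurable_funB; first by apply: continuous_measurable_fun => u; exact: cI.
  apply: measurable_funM => //.
  exact: measurable_sg.
split => //=.
- by rewrite ler1n.
- exact: dv_S1.
- exact: continuous_D1.
- by move=> u; exact: S_kernel_decay.
- by move=> u; apply: D_kernel_decay => //; lra.
- by move=> u; have [h _] := I1_bounds u; lra.
- by move=> u; rewrite /S1 mulrN sincN.
- by move=> u; rewrite /D1 mulrN dsincN mulrN.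
- by move=> u; rewrite /I1 sgrN !mulrN SiN; ring.
- move=> u; apply: dv_eq.
    apply: dvD.
      apply: dvD; first by apply: dvM; [exact: dv_cst | exact: dv_Z1].
      by apply: dvN; apply: dvM; [exact: dv_S1 | exact: dv_I0].
    apply: (@dv_mul_sg _ _ _ (2^-1 * pi ^+ 2)).
      move=> y; rewrite normrM ger0_norm ?invr_ge0// -mulrA ler_wpM2l ?invr_ge0//.
      by rewrite -exprMn; exact: sinc_sub1.
    apply: dvM; first exact: dv_cst.
    by apply: dvD; [exact: dv_S1 | apply: dvN; exact: dv_cst].
  rewrite /I1 -/(I0 u) /=; move: (S1 u) (D1 u) (I0 u) (Num.sg u) => s e i g; ring.
- rewrite (_ : (fun _ => _) = fun u => S1 u ^+ 2 - D1 u * I0 u + 2^-1 * (D1 u * Num.sg u)).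
    move=> u; apply: cvgD.
      apply: cvgB; last by apply: cvgM; [exact: continuous_D1 | exact: cI].
      by apply: (@cvg_comp _ _ _ S1 (fun x => x ^+ 2)); [exact: cS | exact: exprn_continuous].
    apply: cvgM; first exact: cvg_cst.
    exact: (continuous_mul_sg continuous_D1 D10).
  apply/funext => u; rewrite /I1 -/(I0 u).
  by move: (S1 u) (D1 u) (I0 u) (Num.sg u) => s e i g; ring.
- by move=> u; rewrite /Z1 /S1 /I0 sgrN !mulrN SisqN sincN SiN !mulrN; ring.
- move=> u.
  have h := mul_bound3 (I1_bounds u).1 (sinc_scale_bounds u p1).1 (sinc_scale_bounds u p1).2.
  have z := Z_bounds u p1.
  (* The difference is twice Z1 - sg / 2 minus I1 S1, and each part decays. *)
  rewrite (_ : _ - _ = (Z1 u - 2^-1 * Num.sg u) - (- (Z1 u - 2^-1 * Num.sg u)) - I1 u * S1 u).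
    apply: decay_of_bounds (add_bound (add_bound z _) h) _; last first.
      by instantiate (1 := 1); instantiate (1 := 4); lra.
    by rewrite normrN.
  by rewrite /I1 -/(I0 u); move: (S1 u) (Z1 u) (I0 u) (Num.sg u) => s e i g; field.
- left => u; apply: decay_of_bounds (I1_bounds u) _; lra.
Qed.

Definition entries S D I x y : 'M[R]_2 := mx22 (S (x - y)) (D (x - y)) (I (x - y)) (S (x - y)).

Lemma dv_shift f y x l : dv f (x - y) l -> dv (fun u => f (u - y)) x l.
Proof.
move=> df; apply: dv_eq; first by apply: (@dv_comp _ f (fun u => u - y)) df _; repeat dv_step.
by rewrite addr0 mulr1.
Qed.

Lemma kernel1E x y : kernel1 x y = entries S1 D1 I1 x y.
Proof.
rewrite /kernel1 /entries; congr mx22.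
exact: (dv_derive1 (dv_shift (dv_S1 (x - y)))).
Qed.

Lemma kernel4E x y : kernel4 x y = entries S4 D4 I4 x y.
Proof.
rewrite /kernel4 /entries; congr mx22.
exact: (dv_derive1 (dv_shift (dv_S4 (x - y)))).
Qed.

End kernels.

(** * Expansion of determinants by cycles *)

Section orbits.
Implicit Types (f : nat -> nat) (n : nat).

(** Cycles of a permutation read off from a function on [nat], so that their lengths and least
    elements are found by computation once the values are concrete. *)
Definition orbit_len n f i := (find (fun k => iter k.+1 f i == i) (iota 0 n)).+1.
Definition orbit_min n f i := all (fun k => i <= iter k f i)%N (iota 0 n).

Context {n : nat} (s : 'S_n) (f : nat -> nat).
Hypothesis fs : forall i : 'I_n, f i = s i.

Lemma iter_perm_val k (i : 'I_n) : iter k f i = iter k s i.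
Proof. by elim: k => //= k ->. Qed.

Lemma card_porbit_le (i : 'I_n) : (#|porbit s i| <= n)%N.
Proof. by rewrite -[leqRHS]card_ord max_card. Qed.

Lemma card_porbit_gt0 (i : 'I_n) : (0 < #|porbit s i|)%N.
Proof. by rewrite lt0n card_porbit_neq0. Qed.

Lemma orbit_lenE (i : 'I_n) : orbit_len n f i = #|porbit s i|.
Proof.
rewrite /orbit_len; have c0 := card_porbit_gt0 i; have cn := card_porbit_le i.
set c := #|_| in c0 cn *; rewrite -(prednK c0); congr _.+1.
have c1n : (c.-1 < n)%N by rewrite prednK.
have -> : iota 0 n = iota 0 c.-1 ++ c.-1 :: iota c (n - c).
  have E : c.-1 :: iota c (n - c) = iota (0 + c.-1) (n - c).+1 by rewrite add0n /= prednK.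
  by rewrite E -iotaD -addSnnS prednK// subnKC.
rewrite find_cat ifN; last first.
  apply/hasPn => k; rewrite mem_iota add0n => kc /=.
  rewrite -iterS iter_perm_val; apply/eqP => /val_inj E.
  have := uniq_traject_porbit s i; rewrite -/c => u; have := @nth_uniq _ i _ 0%N k.+1 _ _ u.
  have kc1 : (k.+1 < c)%N by rewrite -ltn_predRL.
  by rewrite size_traject !nth_traject// c0 kc1 => /(_ isT isT); rewrite E /= eqxx.
rewrite size_iota [find _ _]/= -iterS prednK// iter_perm_val iter_porbit eqxx.
by rewrite addn0.
Qed.

Lemma orbit_minP (i : 'I_n) :
  reflect (forall j, j \in porbit s i -> i <= j)%N (orbit_min n f i).
Proof.
apply: (iffP allP) => [h j|h k _]; last first.
  by rewrite iter_perm_val h// -permX mem_porbit.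
rewrite porbit_traject => /trajectP[k kc ->].
rewrite -iter_perm_val h// mem_iota /= add0n.
exact: leq_trans kc (card_porbit_le i).
Qed.

(** Each orbit is represented by its least element, which turns a product over sets into a
    computable product over indices. *)
Lemma big_porbits (R : comPzRingType) (G : {set 'I_n} -> R) :
  \prod_(c in porbits s) G c =
  \prod_(i <- iota 0 n | orbit_min n f i)
    (if insub i is Some x then G (porbit s x) else 1).
Proof.
rewrite -[n in iota 0 n]subn0 -/(index_iota 0 n) big_mkord.
under [RHS]eq_bigr do rewrite valK.
rewrite -(big_imset (h := porbit s) G (A := [pred i : 'I_n | orbit_min n f i])) /=; last first.
  move=> i j; rewrite !inE => /orbit_minP hi /orbit_minP hj /eqP.
  rewrite eq_porbit_mem => ij; apply/val_inj/eqP; rewrite eqn_leq.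
  by rewrite hj// hi// porbit_sym.
apply: eq_bigl => c; apply/imsetP/imsetP => [[i _ ->]|[i _ ->]]; last by exists i.
have [j jp jm] := @arg_minnP _ i (mem (porbit s i)) val (porbit_id s i).
have E : porbit s i = porbit s j by apply/eqP; rewrite eq_porbit_mem porbit_sym.
exists j => //; rewrite inE; apply/orbit_minP => k; rewrite -E; exact: jm.
Qed.

End orbits.

(** * Determinants and quaternion determinants of order at most four *)

Section qdet_small.
Context {R : realType}.
Implicit Types (k : nat -> nat -> 'M[R]_2) (f : nat -> nat) (n : nat).

Definition half_trace (A : 'M[R]_2) := 2^-1 * \tr A.

Lemma prod_rotate (A : nat -> 'M[R]_2) c m : (forall i, A (i + c)%N = A i) ->
  \tr (\prod_(i < c) A (i + m)%N) = \tr (\prod_(i < c) A i).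
Proof.
move=> Ac; elim: m => [|m <-].
  by under eq_bigr do rewrite addn0.
case: c Ac => [|c] Ac; first by rewrite !big_ord0.
rewrite big_ord_recr [in RHS]big_ord_recl /= add0n mxtrace_mulC.
have -> : A (c + m.+1)%N = A m by rewrite -[RHS]Ac addnS addnC addnS.
congr (\tr (_ *m _)); apply: eq_bigr => i _.
by rewrite /bump add1n addnS addSn.
Qed.

Definition cycle_trace n (K : 'I_n -> 'I_n -> 'M[R]_2) (s : 'S_n) (i : 'I_n) : R :=
  half_trace (\prod_(k < #|porbit s i|) K (iter k s i) (iter k.+1 s i)).

(** The element chosen by [pick] in [qdet] is unspecified; another choice rotates the product, which
    the trace does not see. *)
Lemma cycle_trace_porbit n (K : 'I_n -> 'I_n -> 'M[R]_2) (s : 'S_n) i j :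
  j \in porbit s i -> cycle_trace K s j = cycle_trace K s i.
Proof.
move=> ji; have E : porbit s j = porbit s i by apply/eqP; rewrite eq_porbit_mem.
move: ji; rewrite porbit_traject => /trajectP[m _ jE].
rewrite /cycle_trace E /half_trace; congr (_ * _).
pose A q := K (iter q s i) (iter q.+1 s i).
rewrite -(@prod_rotate A #|porbit s i| m); last first.
  by move=> q; rewrite /A -addSn !iterD iter_porbit.
by congr (\tr _); apply: eq_bigr => q _; rewrite /A jE -addSn !iterD.
Qed.

(** A [foldr] over [iota] instead of a big operator, so that simplification reduces it to an
    explicit product. *)
Definition qterm n k f : R := foldr (fun i p => if orbit_min n f i then
    half_trace (foldr (fun j A => k (iter j f i) (iter j.+1 f i) * A) 1
      (iota 0 (orbit_len n f i))) * p
  else p) 1 (iota 0 n).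

Lemma qterm_prod n k f : qterm n k f = \prod_(i <- iota 0 n | orbit_min n f i)
  half_trace (\prod_(j <- iota 0 (orbit_len n f i)) k (iter j f i) (iter j.+1 f i)).
Proof.
have E (g : nat -> 'M[R]_2) l : foldr (fun j A => g j * A) 1 l = \prod_(j <- l) g j.
  by elim: l => [|j l IH]; rewrite ?big_nil ?big_cons//= IH.
have E' (g : nat -> R) l : foldr (fun i p => if orbit_min n f i then g i * p else p) 1 l =
    \prod_(i <- l | orbit_min n f i) g i.
  by elim: l => [|j l IH]; rewrite ?big_nil ?big_cons//= IH.
by rewrite -E'; congr foldr; apply/funext => i; apply/funext => p; rewrite E.
Qed.

Lemma qtermE n (K : 'I_n -> 'I_n -> 'M[R]_2) k (s : 'S_n) f :
  (forall i j : 'I_n, K i j = k i j) -> (forall i : 'I_n, f i = s i) ->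
  \prod_(c in porbits s)
      (if [pick i in c] is Some i then
         2^-1 * \tr (\prod_(k < #|c|) K (iter k s i) (iter k.+1 s i))
       else 1) = qterm n k f.
Proof.
move=> Kk fs; rewrite (big_porbits fs) qterm_prod.
rewrite -[n in iota 0 n]subn0 -/(index_iota 0 n) !big_mkord.
apply: eq_bigr => i _; rewrite valK.
case: pickP => [j ji|/(_ i)]; last by rewrite porbit_id.
have E : porbit s j = porbit s i by apply/eqP; rewrite eq_porbit_mem.
rewrite -E -[LHS]/(cycle_trace K s j) (cycle_trace_porbit K ji) /cycle_trace (orbit_lenE fs).
congr half_trace; set c := #|_|; rewrite -[c in iota 0 c]subn0 -/(index_iota 0 c) big_mkord.
by apply: eq_bigr => q _; rewrite Kk -!(iter_perm_val fs).
Qed.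

(** A permutation of n + 1 points amounts to the image of the first one and the permutation that the
    others induce once both are removed, as in the expansion of a determinant along a row. *)
Lemma sum_perm_lift n (F : 'S_n.+1 -> R) :
  \sum_s F s = \sum_(j < n.+1) \sum_(s : 'S_n) F (lift_perm ord0 j s).
Proof.
rewrite (partition_big (fun s : 'S_n.+1 => s ord0) predT) //=.
apply: eq_bigr => j0 _; set i0 := ord0.
rewrite (reindex (lift_perm i0 j0)); last first.
  pose ulsf i (s : 'S_n.+1) (k : 'I_n) := odflt k (unlift (s i) (s (lift i k))).
  have ulsfK i (s : 'S_n.+1) (k : 'I_n): lift (s i) (ulsf i s k) = s (lift i k).
    rewrite /ulsf; have:= neq_lift i k.
    by rewrite -(can_eq (permK s)) => /unlift_some[] ? ? ->.
  have inj_ulsf: injective (ulsf i0 _).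
    move=> s; apply: can_inj (ulsf (s i0) s^-1%g) _ => k'.
    by rewrite {1}/ulsf ulsfK !permK liftK.
  exists (fun s => perm (inj_ulsf s)) => [s _ | s].
    by apply/permP=> k'; rewrite permE /ulsf lift_perm_lift lift_perm_id liftK.
  move/(s _ =P _) => si0; apply/permP=> k.
  case: (unliftP i0 k) => [k'|] ->; rewrite ?lift_perm_id //.
  by rewrite lift_perm_lift -si0 permE ulsfK.
by apply: eq_bigl => s; rewrite lift_perm_id eqxx.
Qed.

Definition nlift (a : nat) f i := if i is j.+1 then bump a (f j) else a.

Lemma nliftE n (a : 'I_n.+1) (s : 'S_n) f : (forall i : 'I_n, f i = s i) ->
  forall i : 'I_n.+1, nlift a f i = lift_perm ord0 a s i.
Proof.
move=> fs i; case: (unliftP ord0 i) => [j|] ->; last by rewrite lift_perm_id.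
by rewrite lift_perm_lift /= fs.
Qed.

(* [G f b] is the term of the permutation [f] with sign [b]. *)
Fixpoint sum_codes n (G : (nat -> nat) -> bool -> R) : R :=
  if n is n'.+1 then
    foldr (fun a x => sum_codes n' (fun f b => G (nlift a f) (odd a (+) b)) + x) 0
      (iota 0 n'.+1)
  else G id false.

Lemma sum_codesE n (F : 'S_n -> R) (G : (nat -> nat) -> bool -> R) :
  (forall (s : 'S_n) f, (forall i : 'I_n, f i = s i) -> F s = G f (odd_perm s)) ->
  \sum_s F s = sum_codes n G.
Proof.
elim: n F G => [|n IH] F G FG.
  rewrite (big_pred1 1%g) => [|s]; last by rewrite permS0; apply/esym/eqP; rewrite permS0.
  by rewrite (FG _ id) ?odd_perm1//; case.
have -> : sum_codes n.+1 G =
    \sum_(a < n.+1) sum_codes n (fun f b => G (nlift a f) (odd a (+) b)).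
  rewrite -(big_mkord predT (fun a => sum_codes n (fun f b => G (nlift a f) (odd a (+) b)))).
  rewrite /index_iota subn0 -[LHS]/(foldr (fun a x =>
    sum_codes n (fun f b => G (nlift a f) (odd a (+) b)) + x) 0 (iota 0 n.+1)).
  by elim: (iota 0 n.+1) => [|a l IHl]; rewrite ?big_nil ?big_cons//= IHl.
rewrite sum_perm_lift; apply: eq_bigr => a _; apply: IH => s f fs.
rewrite (FG _ (nlift a f)); first by rewrite odd_lift_perm.
exact: nliftE.
Qed.

Lemma qdet_codes n (K : 'I_n -> 'I_n -> 'M[R]_2) k :
  (forall i j : 'I_n, K i j = k i j) ->
  qdet K = sum_codes n (fun f b => (-1) ^+ b * qterm n k f).
Proof. by move=> Kk; apply: sum_codesE => s f fs; rewrite (qtermE Kk fs). Qed.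

Lemma det_codes n (M : 'M[R]_n) (m : nat -> nat -> R) :
  (forall i j : 'I_n, M i j = m i j) ->
  \det M = sum_codes n (fun f b => (-1) ^+ b * foldr (fun i p => m i (f i) * p) 1 (iota 0 n)).
Proof.
move=> Mm; apply: sum_codesE => s f fs; congr (_ * _).
have -> : foldr (fun i p => m i (f i) * p) 1 (iota 0 n) = \prod_(i <- iota 0 n) m i (f i).
  by elim: (iota 0 n) => [|j l IH]; rewrite ?big_nil ?big_cons//= IH.
rewrite -[n in iota 0 n]subn0 -/(index_iota 0 _) big_mkord.
by apply: eq_bigr => i _; rewrite Mm fs.
Qed.



(** Sums over permutations sorted by cycle type: [t], [c] and [q] stand for the weights of cycles of
    length 2, 3 and 4, and a fixed point has weight 1. Each cycle of even length brings a minus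
    sign. *)
Definition expand2 (t : nat -> nat -> R) : R := 1 - t 0%N 1%N.

Definition expand3 (t : nat -> nat -> R) (c : nat -> nat -> nat -> R) : R :=
  1 - t 0%N 1%N - t 0%N 2%N - t 1%N 2%N + c 0%N 1%N 2%N + c 0%N 2%N 1%N.

Definition expand4 (t : nat -> nat -> R) (c : nat -> nat -> nat -> R)
    (q : nat -> nat -> nat -> nat -> R) : R :=
  1 - t 0%N 1%N - t 0%N 2%N - t 0%N 3%N - t 1%N 2%N - t 1%N 3%N - t 2%N 3%N
   + c 0%N 1%N 2%N + c 0%N 2%N 1%N + c 0%N 1%N 3%N + c 0%N 3%N 1%N
   + c 0%N 2%N 3%N + c 0%N 3%N 2%N + c 1%N 2%N 3%N + c 1%N 3%N 2%N
   + t 0%N 1%N * t 2%N 3%N + t 0%N 2%N * t 1%N 3%N + t 0%N 3%N * t 1%N 2%N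
   - q 0%N 1%N 2%N 3%N - q 0%N 1%N 3%N 2%N - q 0%N 2%N 1%N 3%N - q 0%N 2%N 3%N 1%N
   - q 0%N 3%N 1%N 2%N - q 0%N 3%N 2%N 1%N.

Let kt k i j := half_trace (k i j * k j i).
Let kc k i j l := half_trace (k i j * (k j l * k l i)).
Let kq k i j l m := half_trace (k i j * (k j l * (k l m * k m i))).

Lemma qdet2E (K : 'I_2 -> 'I_2 -> 'M[R]_2) k : (forall i j : 'I_2, K i j = k i j) ->
  (forall i, half_trace (k i i) = 1) -> qdet K = expand2 (kt k).
Proof.
move=> Kk k1; rewrite (qdet_codes Kk) /=.
rewrite /qterm /bump /= /orbit_len /= !mulr1 !k1 /expand2 /kt; ring.
Qed.

Lemma qdet3E (K : 'I_3 -> 'I_3 -> 'M[R]_2) k : (forall i j : 'I_3, K i j = k i j) ->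
  (forall i, half_trace (k i i) = 1) -> qdet K = expand3 (kt k) (kc k).
Proof.
move=> Kk k1; rewrite (qdet_codes Kk) /=.
rewrite /qterm /bump /= /orbit_len /= !mulr1 !k1 /expand3 /kt /kc.
repeat match goal with |- context [half_trace ?A] => move: (half_trace A) => ? end.
ring.
Qed.

Lemma qdet4E (K : 'I_4 -> 'I_4 -> 'M[R]_2) k : (forall i j : 'I_4, K i j = k i j) ->
  (forall i, half_trace (k i i) = 1) -> qdet K = expand4 (kt k) (kc k) (kq k).
Proof.
move=> Kk k1; rewrite (qdet_codes Kk) /=.
rewrite /qterm /bump /= /orbit_len /= !mulr1 !k1 /expand4 /kt /kc /kq.
repeat match goal with |- context [half_trace ?A] => move: (half_trace A) => ? end.
ring.
Qed.

Let mt (m : nat -> nat -> R) i j := m i j * m j i.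
Let mc (m : nat -> nat -> R) i j l := m i j * (m j l * m l i).
Let mq (m : nat -> nat -> R) i j l r := m i j * (m j l * (m l r * m r i)).

Lemma det2E (M : 'M[R]_2) (m : nat -> nat -> R) : (forall i j : 'I_2, M i j = m i j) ->
  (forall i, m i i = 1) -> \det M = expand2 (mt m).
Proof.
move=> Mm m1; rewrite (det_codes Mm) /= /bump /= ?(addn0, add0n, addn1, add1n) !m1 /expand2 /mt; ring.
Qed.

Lemma det3E (M : 'M[R]_3) (m : nat -> nat -> R) : (forall i j : 'I_3, M i j = m i j) ->
  (forall i, m i i = 1) -> \det M = expand3 (mt m) (mc m).
Proof.
move=> Mm m1; rewrite (det_codes Mm) /= /bump /= ?(addn0, add0n, addn1, add1n) !m1 /expand3 /mt /mc.
generalize (m 0%N 1%N) (m 0%N 2%N) (m 1%N 0%N) (m 1%N 2%N) (m 2%N 0%N) (m 2%N 1%N).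
move=> *; ring.
Qed.

Lemma det4E (M : 'M[R]_4) (m : nat -> nat -> R) : (forall i j : 'I_4, M i j = m i j) ->
  (forall i, m i i = 1) -> \det M = expand4 (mt m) (mc m) (mq m).
Proof.
move=> Mm m1; rewrite (det_codes Mm) /= /bump /= ?(addn0, add0n, addn1, add1n) !m1 /expand4 /mt /mc /mq.
generalize (m 0%N 1%N) (m 0%N 2%N) (m 0%N 3%N) (m 1%N 0%N) (m 1%N 2%N) (m 1%N 3%N)
  (m 2%N 0%N) (m 2%N 1%N) (m 2%N 3%N) (m 3%N 0%N) (m 3%N 1%N) (m 3%N 2%N).
move=> *; ring.
Qed.

End qdet_small.

(** * Correlation functions of the sine processes as sums over cycles *)

Section correlations.
Context {R : realType}.
Implicit Types (S D I Q : R -> R) (x y z t : R).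

Lemma mul_mx22 (a b c d a' b' c' d' : R) : mx22 a b c d * mx22 a' b' c' d' =
  mx22 (a * a' + b * c') (a * b' + b * d') (c * a' + d * c') (c * b' + d * d').
Proof.
apply/matrixP => i j; rewrite !mxE !big_ord_recl big_ord0 addr0 !mxE.
by case: i => [[|[|]]]//= ?; case: j => [[|[|]]].
Qed.

Lemma half_trace_mx22 (a b c d : R) : half_trace (mx22 a b c d) = 2^-1 * (a + d).
Proof.
by rewrite /half_trace /mxtrace !big_ord_recl big_ord0 addr0 !mxE.
Qed.

Definition cyc2 S D I x y := half_trace (entries S D I x y * entries S D I y x).
Definition cyc3 S D I x y z :=
  half_trace (entries S D I x y * (entries S D I y z * entries S D I z x)).
Definition cyc4 S D I x y z t :=
  half_trace (entries S D I x y * (entries S D I y z * (entries S D I z t * entries S D I t x))).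

Definition corr2 S D I x y := 1 - cyc2 S D I x y.
Definition corr3 S D I x y z :=
  1 - cyc2 S D I x y - cyc2 S D I x z - cyc2 S D I y z + cyc3 S D I x y z + cyc3 S D I x z y.
Definition corr4 S D I x y z t :=
  1 - cyc2 S D I x y - cyc2 S D I x z - cyc2 S D I x t
  - cyc2 S D I y z - cyc2 S D I y t - cyc2 S D I z t
  + cyc3 S D I x y z + cyc3 S D I x z y + cyc3 S D I x y t + cyc3 S D I x t y
  + cyc3 S D I x z t + cyc3 S D I x t z + cyc3 S D I y z t + cyc3 S D I y t z
  + cyc2 S D I x y * cyc2 S D I z t + cyc2 S D I x z * cyc2 S D I y t
  + cyc2 S D I x t * cyc2 S D I y z
  - cyc4 S D I x y z t - cyc4 S D I x y t z - cyc4 S D I x z y t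
  - cyc4 S D I x z t y - cyc4 S D I x t y z - cyc4 S D I x t z y.

Lemma half_trace_entries S D I x : S 0 = 1 -> half_trace (entries S D I x x) = 1.
Proof. by move=> S0; rewrite half_trace_mx22 subrr S0; field. Qed.

(** From here on the three values of beta are treated together, through the properties collected in
    [sine_kernel] and the cycle expansions of orders 2, 3 and 4. *)
Lemma sine_correlation_kernel (beta : nat) : beta \in [:: 1; 2; 4]%N ->
  exists S D I Q (k : R), [/\ sine_kernel S D I Q k,
    forall x y, @sine_correlation R beta 2 [tuple x; y] = corr2 S D I x y,
    forall x y z, @sine_correlation R beta 3 [tuple x; y; z] = corr3 S D I x y z &
    forall x y z t, @sine_correlation R beta 4 [tuple x; y; z; t] = corr4 S D I x y z t].
Proof.
have nthE n (x : n.-tuple R) (i : 'I_n) : tnth x i = nth 0 x i by rewrite (tnth_nth 0).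
rewrite !inE => /or3P[] /eqP ->.
- do 4 eexists; exists 20; split; first exact: sine_kernel1.
  + move=> x y; pose k i j := kernel1 (nth 0 [:: x; y] i) (nth 0 [:: x; y] j).
    rewrite /sine_correlation (@qdet2E _ _ k) => [|i j|i].
    * by rewrite /expand2 /k /= !kernel1E.
    * by rewrite !nthE.
    * by rewrite /k kernel1E half_trace_entries// mulr0 sinc0.
  + move=> x y z; pose k i j := kernel1 (nth 0 [:: x; y; z] i) (nth 0 [:: x; y; z] j).
    rewrite /sine_correlation (@qdet3E _ _ k) => [|i j|i].
    * by rewrite /expand3 /k /= !kernel1E.
    * by rewrite !nthE.
    * by rewrite /k kernel1E half_trace_entries// mulr0 sinc0.
  + move=> x y z t; pose k i j := kernel1 (nth 0 [:: x; y; z; t] i) (nth 0 [:: x; y; z; t] j).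
    rewrite /sine_correlation (@qdet4E _ _ k) => [|i j|i].
    * by rewrite /expand4 /k /= !kernel1E.
    * by rewrite !nthE.
    * by rewrite /k kernel1E half_trace_entries// mulr0 sinc0.
- do 4 eexists; exists 20; split; first exact: sine_kernel2.
  + move=> x y; pose k i j := kernel2 (nth 0 [:: x; y] i) (nth 0 [:: x; y] j).
    rewrite /sine_correlation (@det2E _ _ k) => [|i j|i].
    * rewrite /expand2 /k /= /corr2 /cyc2 /entries !mul_mx22 !half_trace_mx22 /kernel2.
      by field.
    * by rewrite mxE !nthE.
    * by rewrite /k /kernel2 subrr mulr0 sinc0.
  + move=> x y z; pose k i j := kernel2 (nth 0 [:: x; y; z] i) (nth 0 [:: x; y; z] j).
    rewrite /sine_correlation (@det3E _ _ k) => [|i j|i].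
    * rewrite /expand3 /k /= /corr3 /cyc2 /cyc3 /entries !mul_mx22 !half_trace_mx22 /kernel2.
      by field.
    * by rewrite mxE !nthE.
    * by rewrite /k /kernel2 subrr mulr0 sinc0.
  + move=> x y z t; pose k i j := kernel2 (nth 0 [:: x; y; z; t] i) (nth 0 [:: x; y; z; t] j).
    rewrite /sine_correlation (@det4E _ _ k) => [|i j|i].
    * rewrite /expand4 /k /= /corr4 /cyc2 /cyc3 /cyc4 /entries !mul_mx22 !half_trace_mx22 /kernel2.
      by field.
    * by rewrite mxE !nthE.
    * by rewrite /k /kernel2 subrr mulr0 sinc0.
- do 4 eexists; exists 20; split; first exact: sine_kernel4.
  + move=> x y; pose k i j := kernel4 (nth 0 [:: x; y] i) (nth 0 [:: x; y] j).
    rewrite /sine_correlation (@qdet2E _ _ k) => [|i j|i].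
    * by rewrite /expand2 /k /= !kernel4E.
    * by rewrite !nthE.
    * by rewrite /k kernel4E half_trace_entries// mulr0 sinc0.
  + move=> x y z; pose k i j := kernel4 (nth 0 [:: x; y; z] i) (nth 0 [:: x; y; z] j).
    rewrite /sine_correlation (@qdet3E _ _ k) => [|i j|i].
    * by rewrite /expand3 /k /= !kernel4E.
    * by rewrite !nthE.
    * by rewrite /k kernel4E half_trace_entries// mulr0 sinc0.
  + move=> x y z t; pose k i j := kernel4 (nth 0 [:: x; y; z; t] i) (nth 0 [:: x; y; z; t] j).
    rewrite /sine_correlation (@qdet4E _ _ k) => [|i j|i].
    * by rewrite /expand4 /k /= !kernel4E.
    * by rewrite !nthE.
    * by rewrite /k kernel4E half_trace_entries// mulr0 sinc0.
Qed.

End correlations.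

(** * Averages over a box *)

Section bounded_measurable.
Context d (T : measurableType d) {R : realType}.
Implicit Types (f g : T -> R).

(** A class stable under sums, products, measurable substitutions and averages, on which every
    integral over the box exists. *)
Definition bm f := measurable_fun setT f /\ exists C, forall x, `|f x| <= C.

Lemma bm_cst c : bm (fun=> c).
Proof. by split => //; exists `|c|. Qed.

Lemma bmD f g : bm f -> bm g -> bm (fun x => f x + g x).
Proof.
move=> [mf [a fa]] [mg [b gb]]; split; first exact: measurable_funD.
by exists (a + b) => x; rewrite (le_trans (ler_normD _ _))// lerD.
Qed.

Lemma bmN f : bm f -> bm (fun x => - f x).
Proof.
move=> [mf [a fa]]; split; last by exists a => x; rewrite normrN.
exact: measurableT_comp.
Qed.

Lemma bmM f g : bm f -> bm g -> bm (fun x => f x * g x).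
Proof.
move=> [mf [a fa]] [mg [b gb]]; split; first exact: measurable_funM.
by exists (a * b) => x; rewrite normrM ler_pM.
Qed.

Lemma bm_norm f : bm f -> bm (fun x => `|f x|).
Proof.
move=> [mf [a fa]]; split; last by exists a => x; rewrite normr_id.
exact: measurableT_comp.
Qed.

Lemma bmX f n : bm f -> bm (fun x => f x ^+ n).
Proof.
move=> bf; elim: n => [|n IH]; first exact: bm_cst.
by have := bmM bf IH; congr bm; apply/funext => x; rewrite exprS.
Qed.

Lemma bmB f g : bm f -> bm g -> bm (fun x => f x - g x).
Proof. by move=> bf bg; apply: bmD => //; exact: bmN. Qed.

End bounded_measurable.

Lemma bm_comp d d' (T : measurableType d) (T' : measurableType d') (R : realType)
    (f : T -> R) (g : T' -> T) :
  bm f -> measurable_fun setT g -> bm (fun x => f (g x)).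
Proof.
move=> [mf [a fa]] mg; split; last by exists a.
exact: measurableT_comp.
Qed.

Section mean.
Context {R : realType} (N : R).
Hypothesis N0 : 0 < N.
Notation mu := (@lebesgue_measure R).
Implicit Types (f g : R -> R).

(** Normalised, so that averaging over a variable that does not occur changes nothing; the powers of
    [N] are written separately. *)
Definition mean f : R := N^-1 * \int[mu]_(t in `[0, N]) f t.

Lemma mu_itv : mu `[0, N] = N%:E.
Proof. by rewrite lebesgue_measure_itv /= lte_fin N0 sube0. Qed.

Lemma bm_integrable f : bm f -> mu.-integrable `[0, N] (EFin \o f).
Proof.
move=> [mf [a fa]]; apply: measurable_bounded_integrable => //.
- by rewrite [X in (X < _)%E]mu_itv ltry.
- exact: measurable_funS mf.
- exists a; split; first exact: num_real.
  by move=> b ab x _; rewrite /= (le_trans (fa x))// ltW.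
Qed.

Lemma mean_cst c : mean (fun=> c) = c.
Proof.
rewrite /mean Rintegral_cst// (_ : fine _ = N); last exact: (congr1 fine mu_itv).
by rewrite mulrC mulfK// gt_eqF.
Qed.

Lemma meanD f g : bm f -> bm g -> mean (fun t => f t + g t) = mean f + mean g.
Proof. by move=> bf bg; rewrite /mean RintegralD ?mulrDr//; exact: bm_integrable. Qed.

Lemma meanZ c f : bm f -> mean (fun t => c * f t) = c * mean f.
Proof.
move=> bf; rewrite /mean RintegralZl; [exact: mulrCA | by [] | exact: bm_integrable].
Qed.

Lemma le_mean f g : bm f -> bm g -> (forall t, 0 <= t <= N -> f t <= g t) ->
  mean f <= mean g.
Proof.
move=> bf bg fg; rewrite /mean ler_wpM2l ?invr_ge0 ?(ltW N0)//.
apply: le_Rintegral; [by [] | exact: bm_integrable | exact: bm_integrable |].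
by move=> t /=; rewrite in_itv /=; exact: fg.
Qed.

Lemma eq_mean f g : (forall t, 0 <= t <= N -> f t = g t) -> mean f = mean g.
Proof.
move=> fg; rewrite /mean; congr (_ * _); apply: eq_Rintegral => t.
by rewrite inE /= in_itv /=; exact: fg.
Qed.

Lemma norm_mean_le f C : bm f -> (forall x, `|f x| <= C) -> `|mean f| <= C.
Proof.
move=> bf fC; have h t : - C <= f t <= C by rewrite -ler_norml.
rewrite ler_norml -{1}[- C]mean_cst -{2}[C]mean_cst.
by apply/andP; split; apply: le_mean; try exact: bm_cst; try exact: bf;
  move=> t _; have /andP[] := h t.
Qed.

Lemma norm_mean f : bm f -> `|mean f| <= mean (fun t => `|f t|).
Proof.
move=> bf; rewrite /mean normrM gtr0_norm ?invr_gt0// ler_wpM2l ?invr_ge0 ?(ltW N0)//.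
exact: le_normr_Rintegral (bm_integrable bf).
Qed.

Lemma EFin_mean f : bm f -> (forall t, 0 <= f t) ->
  ((N * mean f)%:E = \int[mu]_t (f t * \1_`[0, N] t)%:E)%E.
Proof.
move=> bf f0; rewrite /mean mulVKf ?gt_eqF// /Rintegral fineK; last first.
  by apply: integrable_fin_num => //; exact: bm_integrable.
rewrite integral_mkcond; apply: eq_integral => t _; rewrite patchE indicE.
by case: ifP => _; rewrite ?mulr1 ?mulr0.
Qed.

Lemma bm_mean d (T : measurableType d) (f : T * R -> R) : bm f ->
  bm (fun x => mean (fun t => f (x, t))).
Proof.
move=> bf; have [mf [C fC]] := bf.
have bfx x : bm (fun t => f (x, t)) by apply: bm_comp bf _; exact: measurable_pair1.
split; last by exists C => x; exact: norm_mean_le.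
(* Tonelli's theorem concerns nonnegative functions, hence the shift by the bound [C]; a constant is
   its own mean. *)
pose g x := mean (fun t => f (x, t) + C).
have gE x : mean (fun t => f (x, t)) = g x - C.
  by rewrite /g meanD ?mean_cst ?addrK//; exact: bm_cst.
rewrite (_ : (fun _ => _) = (fun x => g x - C)); last by apply/funext.
apply: measurable_funB => //.
rewrite (_ : g = (fun x => N^-1 * (N * g x))); last first.
  by apply/funext => x; rewrite mulKf ?gt_eqF.
apply: measurable_funM => //; apply/measurable_EFinP.
have f0 z : 0 <= f z + C.
  by have := fC z; rewrite ler_norml => /andP[h _]; rewrite -[C]opprK subr_ge0.
rewrite (_ : _ \o _ = (fun x => \int[mu]_t ((f (x, t) + C) * \1_`[0, N] t)%:E)%E); last first.
  by apply/funext => x; rewrite /comp EFin_mean//; apply: bmD => //; exact: bm_cst.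
pose F z := ((f z + C) * \1_`[0, N] z.2)%:E.
apply: (@measurable_fun_fubini_tonelli_F _ _ T _ R mu F).
  apply/measurable_EFinP; apply: measurable_funM; first exact: measurable_funD.
  by apply: measurableT_comp measurable_snd; exact: measurable_indic.
by move=> z; rewrite lee_fin mulr_ge0.
Qed.

Lemma mean_swap (f : R * R -> R) : bm f ->
  mean (fun s => mean (fun t => f (s, t))) = mean (fun t => mean (fun s => f (s, t))).
Proof.
move=> bf; have [mf [C fC]] := bf.
have b1 s : bm (fun t => f (s, t)) by apply: bm_comp bf _; exact: measurable_pair1.
have b2 t : bm (fun s => f (s, t)) by apply: bm_comp bf _; exact: measurable_pair2.
pose g z := f z + C.
have bg : bm g by apply: bmD => //; exact: bm_cst.
have g0 z : 0 <= g z.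
  by have := fC z; rewrite ler_norml => /andP[h _]; rewrite /g -[C]opprK subr_ge0.
have c1 s : bm (fun t => g (s, t)) by apply: bmD => //; exact: bm_cst.
have c2 t : bm (fun s => g (s, t)) by apply: bmD => //; exact: bm_cst.
have m1 : bm (fun s => mean (fun t => g (s, t))) by exact: bm_mean.
have m2 : bm (fun t => mean (fun s => g (s, t))).
  apply: (bm_mean (f := fun z => g (z.2, z.1))); apply: bm_comp bg _.
  exact: measurable_swap.
have E1 s : mean (fun t => f (s, t)) = mean (fun t => g (s, t)) + - C.
  by rewrite meanD ?mean_cst ?addrK//; exact: bm_cst.
have E2 t : mean (fun s => f (s, t)) = mean (fun s => g (s, t)) + - C.
  by rewrite meanD ?mean_cst ?addrK//; exact: bm_cst.
rewrite (eq_mean (fun t _ => E1 t)) (eq_mean (fun t _ => E2 t)).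
have bC : bm (fun _ : R => - C) by split => //; exists `|C| => x; rewrite normrN.
transitivity (mean (fun s => mean (fun t => g (s, t))) + mean (fun=> - C)).
  exact: meanD.
transitivity (mean (fun t => mean (fun s => g (s, t))) + mean (fun=> - C)); last first.
  exact/esym/meanD.
congr (_ + _).
apply: (mulfI (lt0r_neq0 N0)); apply: (mulfI (lt0r_neq0 N0)).
have p1 t : 0 <= mean (fun s => g (t, s)).
  by rewrite -(mean_cst 0); apply: le_mean => //; exact: bm_cst.
have p2 t : 0 <= mean (fun s => g (s, t)).
  by rewrite -(mean_cst 0); apply: le_mean => //; exact: bm_cst.
rewrite -(meanZ N m1) -(meanZ N m2); apply: EFin_inj.
have bN : bm (fun _ : R => N) by split => //; exists `|N|.
have q1 : bm (fun s => N * mean (fun t => g (s, t))) by exact: bmM.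
have q2 : bm (fun t => N * mean (fun s => g (s, t))) by exact: bmM.
rewrite (EFin_mean q1); last by move=> t; rewrite mulr_ge0 ?(ltW N0).
rewrite (EFin_mean q2); last by move=> t; rewrite mulr_ge0 ?(ltW N0).
pose G (z : R * R) := (g z * \1_`[0, N] z.1 * \1_`[0, N] z.2)%:E.
have mG : measurable_fun setT G.
  apply/measurable_EFinP; apply: measurable_funM; last first.
    by apply: measurableT_comp measurable_snd; exact: measurable_indic.
  apply: measurable_funM; first by case: bg.
  by apply: measurableT_comp measurable_fst; exact: measurable_indic.
have G0 z : (0 <= G z)%E by rewrite lee_fin !mulr_ge0.
transitivity (\int[mu]_s \int[mu]_t G (s, t))%E.
  apply: eq_integral => s _.
  have b : bm (fun t => \1_`[0, N] s * g (s, t)).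
    by apply: bmM (c1 s); split => //; exists `|\1_`[0, N] s|.
  rewrite mulrAC -mulrA -(meanZ _ (c1 s)) (EFin_mean b); last by move=> t; rewrite mulr_ge0.
  by apply: eq_integral => t _; rewrite /G /= [\1__ s * _]mulrC.
transitivity (\int[mu]_t \int[mu]_s G (s, t))%E.
  exact: (@fubini_tonelli _ _ _ _ _ mu mu G mG G0).
apply: eq_integral => t _.
have b : bm (fun s => \1_`[0, N] t * g (s, t)).
  by apply: bmM (c2 t); split => //; exists `|\1_`[0, N] t|.
rewrite mulrAC -mulrA -(meanZ _ (c2 t)) (EFin_mean b); last by move=> s; rewrite mulr_ge0.
by apply: eq_integral => s _; rewrite /G /= [\1__ t * _]mulrC mulrAC.
Qed.

End mean.

(** * Averages over several coordinates *)

Section averages.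
Context {R : realType} (N : R) (n : nat).
Hypothesis N0 : 0 < N.
Notation V := (n.-tuple R).
Implicit Types (f g F : V -> R) (x : V) (i j : 'I_n).

Definition upd x i t : V := [tuple (if j == i then t else tnth x j) | j < n].

Lemma tnth_upd x i t j : tnth (upd x i t) j = if j == i then t else tnth x j.
Proof. by rewrite tnth_mktuple. Qed.

Lemma updC x i j s t : i != j -> upd (upd x i s) j t = upd (upd x j t) i s.
Proof.
move=> ij; apply: eq_from_tnth => k; rewrite !tnth_upd.
by case: (eqVneq k j) => [->|//]; rewrite eq_sym (negbTE ij).
Qed.

Lemma upd_upd x i s t : upd (upd x i s) i t = upd x i t.
Proof. by apply: eq_from_tnth => k; rewrite !tnth_upd; case: eqP. Qed.

Lemma upd_id x i : upd x i (tnth x i) = x.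
Proof. by apply: eq_from_tnth => k; rewrite !tnth_upd; case: eqP => // ->. Qed.

Definition cube x := forall i, 0 <= tnth x i <= N.

Lemma cube_upd x i t : cube x -> 0 <= t <= N -> cube (upd x i t).
Proof. by move=> cx tN j; rewrite tnth_upd; case: eqP. Qed.

Definition indep i f := forall x t, f (upd x i t) = f x.

Definition avg i f x : R := mean N (fun t => f (upd x i t)).

Lemma measurable_upd i : measurable_fun setT (fun z : V * R => upd z.1 i z.2).
Proof.
apply/measurable_fun_tnthP => j.
have [ji|ji] := eqVneq j i.
  rewrite (_ : _ \o _ = snd); first exact: measurable_snd.
  by apply/funext => z; rewrite /= tnth_upd ji eqxx.
rewrite (_ : _ \o _ = (fun x => tnth x j) \o fst); last first.
  by apply/funext => z; rewrite /= tnth_upd (negbTE ji).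
by apply: measurableT_comp measurable_fst; exact: measurable_tnth.
Qed.

Lemma bm_upd i f : bm f -> bm (fun z : V * R => f (upd z.1 i z.2)).
Proof. by move=> bf; apply: bm_comp bf _; exact: measurable_upd. Qed.

Lemma bm_slice i f x : bm f -> bm (fun t => f (upd x i t)).
Proof.
by move=> /(bm_upd i) h; apply: (bm_comp h (g := fun t => (x, t))); exact: measurable_pair1.
Qed.

Lemma bm_avg i f : bm f -> bm (avg i f).
Proof. by move=> bf; exact: (bm_mean N0 (bm_upd i bf)). Qed.

Lemma avg_indep i f : indep i (avg i f).
Proof.
move=> x t; rewrite /avg; congr (mean N _); apply/funext => s.
by rewrite upd_upd.
Qed.

Lemma avgC i j f : bm f -> avg i (avg j f) = avg j (avg i f).
Proof.
have [->//|ij] := eqVneq i j.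
move=> bf; apply/funext => x; rewrite /avg.
have b : bm (fun z : R * R => f (upd (upd x i z.1) j z.2)).
  have h := bm_upd j bf; apply: (bm_comp h (g := fun z : R * R => (upd x i z.1, z.2))).
  apply/measurable_fun_pairP; split => /=; last exact: measurable_snd.
  have := @measurable_upd i => /(measurableT_comp (f := _)) h'.
  apply: (measurableT_comp (f := fun z : V * R => upd z.1 i z.2) (g := fun z : R * R => (x, z.1))).
    exact: measurable_upd.
  apply/measurable_fun_pairP; split => /=; [exact: measurable_cst | exact: measurable_fst].
transitivity (mean N (fun t => mean N (fun s => f (upd (upd x i s) j t)))).
  exact: (mean_swap N0 b).
congr (mean N _); apply/funext => t; congr (mean N _); apply/funext => s.
by rewrite updC.
Qed.

Lemma avg_id i f x : indep i f -> avg i f x = f x.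
Proof.
move=> fi; rewrite /avg (_ : (fun _ => _) = fun=> f x) ?mean_cst//.
by apply/funext => t.
Qed.

Lemma avgD i f g x : bm f -> bm g -> avg i (fun x => f x + g x) x = avg i f x + avg i g x.
Proof. by move=> bf bg; rewrite /avg meanD//; exact: bm_slice. Qed.

Lemma avg_pull i f g x : bm f -> indep i g -> avg i (fun x => f x * g x) x = avg i f x * g x.
Proof.
move=> bf gi; rewrite /avg [RHS]mulrC -(meanZ N0 (g x) (bm_slice i x bf)).
by congr (mean N _); apply/funext => t; rewrite gi mulrC.
Qed.

Lemma le_avg i f g x : bm f -> bm g -> cube x ->
  (forall y, cube y -> f y <= g y) -> avg i f x <= avg i g x.
Proof.
move=> bf bg cx fg; apply: le_mean; [by [] | exact: bm_slice | exact: bm_slice|].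
by move=> t tN; apply: fg; exact: cube_upd.
Qed.

Lemma eq_avg i f g x : cube x -> (forall y, cube y -> f y = g y) -> avg i f x = avg i g x.
Proof. by move=> cx fg; apply: eq_mean => t tN; apply: fg; exact: cube_upd. Qed.

Definition base : V := [tuple 0 | _ < n].

Lemma cube_base : cube base.
Proof. by move=> i; rewrite tnth_mktuple lexx ltW. Qed.

Definition avgs (s : seq 'I_n) f : V -> R := foldr avg f s.

Lemma bm_avgs s f : bm f -> bm (avgs s f).
Proof. by move=> bf; elim: s => //= i s IH; exact: bm_avg. Qed.

Lemma avgs_avg s i f : bm f -> avgs s (avg i f) = avg i (avgs s f).
Proof. by move=> bf; elim: s => //= j s ->; rewrite avgC//; exact: bm_avgs. Qed.

(** Averaging in one coordinate is a projection that commutes with the others, so one more average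
    over a coordinate already treated is absorbed. *)
Lemma avgs_absorb s i f : bm f -> i \in s -> avgs s (avg i f) = avgs s f.
Proof.
move=> bf; elim: s => //= j s IH; rewrite inE => /predU1P[<-|/IH->//].
rewrite avgs_avg//; apply/funext => x.
by rewrite (avg_id _ (@avg_indep _ _)).
Qed.

(** The average over the whole box: every coordinate is averaged out, so the choice of [base] is
    immaterial. *)
Definition tot f : R := avgs (enum 'I_n) f base.

Lemma tot_avg i f : bm f -> tot (avg i f) = tot f.
Proof. by move=> bf; rewrite /tot avgs_absorb// mem_enum. Qed.

Lemma avgs_cube s f g x : cube x -> (forall y, cube y -> f y = g y) ->
  avgs s f x = avgs s g x.
Proof.
move=> cx fg; elim: s x cx => [|i s IH] x cx /=; first exact: fg.
by apply: eq_avg => // y cy; exact: IH.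
Qed.

Lemma eq_tot f g : (forall x, cube x -> f x = g x) -> tot f = tot g.
Proof. by move=> fg; apply: avgs_cube => //; exact: cube_base. Qed.

Lemma totD f g : bm f -> bm g -> tot (fun x => f x + g x) = tot f + tot g.
Proof.
move=> bf bg; rewrite /tot; elim: (enum _) (base) => //= i s IH x.
rewrite -avgD; [|exact: bm_avgs..].
by congr avg; apply/funext => y; exact: IH.
Qed.

Lemma tot_cst c : tot (fun=> c) = c.
Proof.
rewrite /tot; elim: (enum _) (base) => //= i s IH x.
rewrite -[RHS](@mean_cst _ _ N0 c).
by congr (mean N _); apply/funext => y; exact: IH.
Qed.

Lemma totZ c f : bm f -> tot (fun x => c * f x) = c * tot f.
Proof.
move=> bf; rewrite /tot; elim: (enum _) (base) => //= i s IH x.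
rewrite /avg -(meanZ N0); last by apply: bm_slice; exact: bm_avgs.
by congr (mean N _); apply/funext => y; exact: IH.
Qed.

Lemma totN f : bm f -> tot (fun x => - f x) = - tot f.
Proof.
move=> bf; rewrite -mulN1r -totZ//.
by congr tot; apply/funext => x; rewrite mulN1r.
Qed.

Lemma totB f g : bm f -> bm g -> tot (fun x => f x - g x) = tot f - tot g.
Proof. by move=> bf bg; rewrite totD ?totN//; exact: bmN. Qed.

Lemma le_tot f g : bm f -> bm g -> (forall x, cube x -> f x <= g x) -> tot f <= tot g.
Proof.
move=> bf bg fg; rewrite /tot; elim: (enum _) (base) cube_base => [|i s IH] x cx /=.
  exact: fg.
by apply: le_avg => //; exact: bm_avgs.
Qed.

Lemma tot_ge0 f : bm f -> (forall x, cube x -> 0 <= f x) -> 0 <= tot f.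
Proof. by move=> bf f0; rewrite -(tot_cst 0); apply: le_tot => //; exact: bm_cst. Qed.

Lemma norm_tot f g : bm f -> bm g -> (forall x, cube x -> `|f x| <= g x) -> `|tot f| <= tot g.
Proof.
move=> bf bg fg; rewrite ler_norml -totN//; apply/andP; split; apply: le_tot => //.
- exact: bmN.
- by move=> x /fg; rewrite ler_norml => /andP[].
- by move=> x /fg; rewrite ler_norml => /andP[].
Qed.

(** A variable that occurs only in [f] is integrated out first. In the graph whose edges are the
    factors this removes a leaf; iterated, it evaluates paths. *)
Lemma tot_leaf i f F c : bm f -> bm F -> (forall x, cube x -> 0 <= F x) -> indep i F ->
  (forall x, cube x -> avg i f x <= c) -> tot (fun x => f x * F x) <= c * tot F.
Proof.
move=> bf bF F0 iF fc; rewrite -(tot_avg i); last exact: bmM.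
rewrite -totZ//; apply: le_tot; [by apply: bm_avg; exact: bmM | by apply: bmM => //; exact: bm_cst|].
by move=> x cx; rewrite avg_pull// ler_wpM2r ?F0// fc.
Qed.

Lemma tot_mean0 i f F : bm f -> bm F -> indep i F ->
  (forall x, cube x -> avg i f x = 0) -> tot (fun x => f x * F x) = 0.
Proof.
move=> bf bF iF f0; rewrite -(tot_avg i); last exact: bmM.
by rewrite -(tot_cst 0); apply: eq_tot => x cx; rewrite avg_pull// f0// mul0r.
Qed.

Definition swap i j x : V := upd (upd x i (tnth x j)) j (tnth x i).

Lemma tnth_swap i j x k : tnth (swap i j x) k =
  if k == j then tnth x i else if k == i then tnth x j else tnth x k.
Proof. by rewrite !tnth_upd. Qed.

(** Once both coordinates are averaged, the exchange is a mere change of the order of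
    integration. *)
Lemma tot_swap i j f : bm f -> bm (fun x => f (swap i j x)) ->
  tot (fun x => f (swap i j x)) = tot f.
Proof.
have [<-|ij] := eqVneq i j.
  by move=> _ _; apply: eq_tot => x _; rewrite /swap upd_id upd_id.
move=> bf bfs; rewrite -(tot_avg i bf) -(tot_avg j (bm_avg i bf)).
rewrite -(tot_avg i bfs) -(tot_avg j (bm_avg i bfs)); apply: eq_tot => x cx.
rewrite [in RHS](avgC j i bf); congr (mean N _); apply/funext => s; congr (mean N _).
apply/funext => t; congr f; apply: eq_from_tnth => k.
have ji : (j == i) = false by rewrite eq_sym (negbTE ij).
by rewrite tnth_swap !tnth_upd !eqxx ji; case: (k == j); case: (k == i).
Qed.

Lemma bm_swap i j f : bm f -> bm (fun x => f (swap i j x)).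
Proof.
move=> bf; apply: bm_comp bf _; apply/measurable_fun_tnthP => k.
rewrite (_ : _ \o _ = fun x => tnth x (if k == j then i else if k == i then j else k)).
  exact: measurable_tnth.
by apply/funext => x; rewrite /= tnth_swap; case: eqP => // _; case: eqP.
Qed.

Lemma bm_diff (phi : R -> R) i j : bm phi -> bm (fun x => phi (tnth x i - tnth x j)).
Proof.
move=> bphi; apply: (bm_comp bphi (g := fun x => tnth x i - tnth x j)).
by apply: measurable_funB; exact: measurable_tnth.
Qed.

Lemma bm_coord (phi : R -> R) i : bm phi -> bm (fun x => phi (tnth x i)).
Proof. by move=> bphi; apply: bm_comp bphi _; exact: measurable_tnth. Qed.

End averages.

(** * Kernel cycles integrated against a pair potential *)

(* [L] is a common bound for all the quantities that grow like the logarithm of [N]. *)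
Record pair_potential (R : realType) (N : R) (h dh : R -> R) (L : R) : Prop := PairPotential {
  pp_N : 0 < N;
  pp_L : 1 <= L;
  pp_dh : forall u, dv h u (dh u);
  pp_cdh : continuous dh;
  pp_bdh : bm dh;
  pp_hN : forall u, h (- u) = h u;
  pp_per : forall u, h (u + N) = h u;
  pp_h : forall u, `|h u| <= L;
  pp_int_dh : forall y, 0 <= y <= N -> N * mean N (fun t => `|dh (t - y)|) <= L;
  pp_int_decay : forall y, 0 <= y <= N -> N * mean N (fun t => decay (t - y)) <= L;
  pp_mean0 : forall y, 0 <= y <= N -> mean N (fun t => h (t - y)) = 0 }.

Section estimates.
Context {R : realType} (S D I Q : R -> R) (k N : R) (h dh : R -> R) (L : R).
Hypothesis K : sine_kernel S D I Q k.
Hypothesis H : pair_potential N h dh L.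
Notation V := (4.-tuple R).
Implicit Types (x : V) (a b c d p q r s : 'I_4) (u v t y z : R).

Let N0 : 0 < N := pp_N H.
Let k0 : 0 <= k. Proof. exact: le_trans ler01 (sk_k K). Qed.
Let L0 : 0 <= L. Proof. exact: le_trans ler01 (pp_L H). Qed.

Lemma pp_ch : continuous h.
Proof. by move=> u; exact: dv_cts (pp_dh H u). Qed.

Lemma sk_cS : continuous S.
Proof. by move=> u; exact: dv_cts (sk_dS K u). Qed.

Lemma bm_h : bm h.
Proof. by split; [exact: continuous_measurable_fun pp_ch | exists L; exact: pp_h H]. Qed.

Lemma bm_decay : bm (@decay R).
Proof.
split; first exact: continuous_measurable_fun continuous_decay.
by exists 1 => u; rewrite ger0_norm ?decay_ge0 ?decay_le1.
Qed.

Lemma le_decay_k u : k * decay u <= k.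
Proof. by rewrite ler_piMr ?decay_le1. Qed.

Lemma bm_S : bm S.
Proof.
split; first exact: continuous_measurable_fun sk_cS.
by exists k => u; rewrite (le_trans (sk_S K u))// le_decay_k.
Qed.

Lemma bm_D : bm D.
Proof.
split; first exact: continuous_measurable_fun (sk_cD K).
by exists k => u; rewrite (le_trans (sk_D K u))// le_decay_k.
Qed.

Lemma bm_I : bm I.
Proof. by split; [exact: sk_mI K | exists k; exact: sk_I K]. Qed.

Definition pr (f : R -> R) a b x : R := f (tnth x a - tnth x b).

Lemma bm_pr f a b : bm f -> bm (pr f a b).
Proof. exact: bm_diff. Qed.

Lemma indep_pr f a b i : i != a -> i != b -> indep i (pr f a b).
Proof. by move=> ia ib x t; rewrite /pr !tnth_upd ![_ == i]eq_sym (negbTE ia) (negbTE ib). Qed.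

Lemma indepM i (f g : V -> R) : indep i f -> indep i g -> indep i (fun x => f x * g x).
Proof. by move=> fi gi x t; rewrite fi gi. Qed.

Lemma indepD i (f g : V -> R) : indep i f -> indep i g -> indep i (fun x => f x + g x).
Proof. by move=> fi gi x t; rewrite fi gi. Qed.

Lemma indepN i (f : V -> R) : indep i f -> indep i (fun x => - f x).
Proof. by move=> fi x t; rewrite fi. Qed.

Lemma indep_norm i (f : V -> R) : indep i f -> indep i (fun x => `|f x|).
Proof. by move=> fi x t; rewrite fi. Qed.

Lemma indep_cst i (c : R) : indep i (fun _ : V => c).
Proof. by []. Qed.

Definition dc a b := pr (@decay R) a b.

Lemma bm_dc a b : bm (dc a b). Proof. exact: bm_pr bm_decay. Qed.

Lemma dc_ge0 a b x : 0 <= dc a b x. Proof. exact: decay_ge0. Qed.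

Lemma dcC a b x : dc a b x = dc b a x.
Proof. by rewrite /dc /pr -opprB decayN. Qed.

Lemma avg_pr a b f x : a != b -> cube N x ->
  avg N a (pr f a b) x = mean N (fun t => f (t - tnth x b)).
Proof.
move=> ab cx; rewrite /avg; congr (mean N _); apply/funext => t.
by rewrite /pr !tnth_upd eqxx eq_sym (negbTE ab).
Qed.

Lemma avg_dc a b x : a != b -> cube N x -> avg N a (dc a b) x <= L / N.
Proof.
move=> ab cx; rewrite avg_pr// ler_pdivlMr// mulrC.
exact: pp_int_decay H _ (cx b).
Qed.

(** One decaying link costs a factor L / N; [tot_dc2] and [tot_dc3] peel a path of links from one
    end. *)
Lemma leaf_dc a b (F : V -> R) : a != b -> bm F -> (forall x, cube N x -> 0 <= F x) ->
  indep a F -> tot N (fun x => dc a b x * F x) <= L / N * tot N F.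
Proof.
move=> ab bF F0 iF; apply: (tot_leaf N0 (bm_dc a b) bF F0 iF) => x cx.
exact: avg_dc.
Qed.

Lemma tot_dc a b : a != b -> tot N (dc a b) <= L / N.
Proof.
move=> ab; have := @leaf_dc a b (fun=> 1) ab (bm_cst _ _) (fun _ _ => ler01) (@indep_cst a 1).
rewrite tot_cst// mulr1; congr (_ <= _); congr (tot N _).
by apply/funext => x; rewrite mulr1.
Qed.

Lemma LN_ge0 : 0 <= L / N. Proof. by rewrite divr_ge0// ltW. Qed.

Lemma tot_dc2 a b c : a != b -> a != c -> b != c ->
  tot N (fun x => dc a b x * dc b c x) <= (L / N) ^+ 2.
Proof.
move=> ab ac bc; apply: le_trans (leaf_dc ab (bm_dc b c) (fun x _ => dc_ge0 b c x) _) _.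
  exact: indep_pr.
by rewrite expr2 ler_wpM2l ?LN_ge0// tot_dc.
Qed.

Lemma tot_dc3 a b c d : uniq [:: a; b; c; d] ->
  tot N (fun x => dc a b x * (dc b c x * dc c d x)) <= (L / N) ^+ 3.
Proof.
rewrite /= !inE !negb_or => /andP[/and3P[ab ac ad] /andP[/andP[bc bd] /andP[cd _]]].
have bF : bm (fun x => dc b c x * dc c d x) by apply: bmM; exact: bm_dc.
apply: le_trans (leaf_dc ab bF _ _) _.
- by move=> x _; rewrite mulr_ge0 ?dc_ge0.
- by apply: indepM; exact: indep_pr.
- by rewrite exprS ler_wpM2l ?LN_ge0// tot_dc2.
Qed.

(* The terms [D_pq I_qr D_rs I_sp], in which only two of the four factors decay, are
   integrated by parts once, which replaces a factor [D = S'] by [S] and gains [1 / N]. *)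
Lemma by_parts (phi dphi m : R -> R) (B y : R) :
  (forall t, dv phi t (dphi t)) -> continuous dphi -> bm phi -> bm dphi -> bm m ->
  (forall t, 0 <= t <= N -> `|phi t| <= B) -> (forall t, 0 <= t <= N -> `|dphi t| <= m t) ->
  `|N * mean N (fun t => phi t * D (t - y))| <=
  B * (k * (decay (N - y) + decay y)) + N * mean N (fun t => m t * (k * decay (t - y))).
Proof.
move=> dphiE cdphi bphi bdphi bm_m phiB dphim.
have bsh (f : R -> R) : bm f -> bm (fun t => f (t - y)).
  move=> bf; apply: (bm_comp bf (g := fun t => t - y)).
  by apply: measurable_funB => //; exact: measurable_cst.
have b1 : bm (fun t => phi t * D (t - y)) by apply: bmM => //; apply: bsh; exact: bm_D.
have b2 : bm (fun t => dphi t * S (t - y)) by apply: bmM => //; apply: bsh; exact: bm_S.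
have b3 : bm (fun t => m t * (k * decay (t - y))).
  by apply: bmM => //; apply: bmM; [exact: bm_cst | apply: bsh; exact: bm_decay].
have -> : N * mean N (fun t => phi t * D (t - y)) =
    phi N * S (N - y) - phi 0 * S (- y) - N * mean N (fun t => dphi t * S (t - y)).
  have E : N * mean N (fun t => dphi t * S (t - y) + phi t * D (t - y)) =
      phi N * S (N - y) - phi 0 * S (- y).
    rewrite /mean mulVKf ?lt0r_neq0//.
    have -> : S (- y) = S (0 - y) by rewrite sub0r.
    apply: (@dv_ftc _ _ (fun t => phi t * S (t - y))); first exact: ltW.
      by move=> t; apply: dvM => //; apply: dv_shift; exact: sk_dS K _.
    move=> t; apply: cvgD.
      by apply: cvgM; [exact: cdphi | exact: (continuous_shift sk_cS)].
    by apply: cvgM; [exact: (dv_cts (dphiE t)) | exact: (continuous_shift (sk_cD K))].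
  by rewrite -E (meanD N0 b2 b1) mulrDr [X in _ = X - _]addrC addrK.
have B0 : 0 <= B by rewrite (le_trans (normr_ge0 _) (phiB 0 _))// lexx ltW.
rewrite (le_trans (ler_normB _ _))// lerD//.
  rewrite (le_trans (ler_normB _ _))// !normrM [k * _]mulrDr mulrDr lerD// ler_pM//.
  - by rewrite phiB// lexx ltW.
  - exact: sk_S K _.
  - by rewrite phiB// lexx ltW.
  - by rewrite (sk_SN K) (sk_S K).
rewrite normrM gtr0_norm// ler_wpM2l ?(ltW N0)//.
apply: le_trans (norm_mean N0 b2) _; apply: (le_mean N0) => //; first exact: bm_norm.
by move=> t tN; rewrite normrM ler_pM ?dphim// (sk_S K).
Qed.

Lemma norm_prM (f g : R) (A B : R) : `|f| <= A -> `|g| <= B -> `|f * g| <= A * B.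
Proof. by move=> fA gB; rewrite normrM ler_pM. Qed.

Definition adh a b x := `|pr dh a b x|.

Lemma dhN u : dh (- u) = - dh u.
Proof.
have h1 := dv_derive1 (pp_dh H (- u)); have : dv (fun v => h (- v)) u (- dh (- u)).
  apply: dv_eq; first by apply: (@dv_comp _ h (fun v => - v)); [exact: pp_dh H _|repeat dv_step].
  by rewrite mulrN1.
have -> : (fun v => h (- v)) = h by apply/funext => v; exact: pp_hN H v.
by move=> /dv_derive1; rewrite (dv_derive1 (pp_dh H u)) => ->; rewrite opprK.
Qed.

Lemma adhC a b x : adh a b x = adh b a x.
Proof. by rewrite /adh /pr -opprB dhN normrN. Qed.

Lemma bm_adh a b : bm (adh a b).
Proof. by apply: bm_norm; apply: bm_pr; exact: pp_bdh H. Qed.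

Lemma adh_ge0 a b x : 0 <= adh a b x. Proof. exact: normr_ge0. Qed.

Lemma indep_adh a b i : i != a -> i != b -> indep i (adh a b).
Proof. by move=> ia ib; apply: indep_norm; exact: indep_pr. Qed.

Lemma tot_adh a b : a != b -> tot N (adh a b) <= L / N.
Proof.
move=> ab; have b1 := bm_adh a b.
rewrite -(tot_avg N0 a b1) -(tot_cst 4 N0 (L / N)); apply: le_tot => //.
- exact: bm_avg.
- exact: bm_cst.
- move=> x cx; rewrite (@avg_pr a b (fun u => `|dh u|))// ler_pdivlMr// mulrC.
  exact: pp_int_dh H _ (cx b).
Qed.

Lemma hC a b x : pr h a b x = pr h b a x.
Proof. by rewrite /pr -opprB (pp_hN H). Qed.

Lemma Nk_bound (c : R) n (T : R) : 0 <= c -> T <= (L / N) ^+ n -> N ^+ n * (c * T) <= c * L ^+ n.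
Proof.
move=> c0 TL; rewrite mulrCA ler_wpM2l//.
rewrite -(@ler_pM2l _ ((N ^+ n)^-1)) ?invr_gt0 ?exprn_gt0// mulKf ?expf_neq0 ?lt0r_neq0//.
by rewrite (le_trans TL)// expr_div_n mulrC.
Qed.

Lemma neq4 a b c d : uniq [:: a; b; c; d] ->
  [/\ a != b, a != c, a != d, b != c & b != d] /\ c != d.
Proof.
by rewrite /= !inE !negb_or => /andP[/and3P[-> -> ->] /andP[/andP[-> ->] /andP[-> _]]].
Qed.

Lemma bm_edges a : bm (fun x : V => decay (N - tnth x a) + decay (tnth x a)).
Proof.
apply: bmD; last exact: bm_coord bm_decay.
apply: (bm_comp bm_decay (g := fun x : V => N - tnth x a)).
by apply: measurable_funB; [exact: measurable_cst | exact: measurable_tnth].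
Qed.

(** The boundary terms of an integration by parts localise a variable near an end of [0, N], which
    gains as much as a link. *)
Lemma leaf_edges a (F : V -> R) : bm F -> (forall x, cube N x -> 0 <= F x) -> indep a F ->
  tot N (fun x => (decay (N - tnth x a) + decay (tnth x a)) * F x) <= 2 * (L / N) * tot N F.
Proof.
move=> bF F0 iF; apply: (tot_leaf N0 (bm_edges a) bF F0 iF) => x cx.
have b1 y : bm (fun t => decay (t - y)).
  apply: (bm_comp bm_decay (g := fun t => t - y)).
  by apply: measurable_funB => //; exact: measurable_cst.
rewrite /avg (_ : (fun t => _) = (fun t => decay (t - N) + decay (t - 0))).
  rewrite (meanD N0 (b1 N) (b1 0)) mulrDl mul1r.
  by apply: lerD; rewrite ler_pdivlMr// mulrC (pp_int_decay H)// lexx ltW.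
by apply/funext => t; rewrite !tnth_upd eqxx subr0 -opprB decayN.
Qed.

Section smooth_I.
Hypothesis dI : forall u, dv I u (S u).

Lemma sk_cI : continuous I.
Proof. by move=> u; exact: dv_cts (dI u). Qed.

Lemma dv_flip (f : R -> R) y t l : dv f (y - t) l -> dv (fun v => f (y - v)) t (- l).
Proof.
move=> df; apply: dv_eq.
  by apply: (@dv_comp _ f (fun v => y - v)); [exact: df | repeat dv_step].
by rewrite sub0r mulrN1.
Qed.

Lemma continuous_flip (f : R -> R) y : continuous f -> continuous (fun v => f (y - v)).
Proof.
move=> cf t; apply: (@continuous_comp _ _ _ (fun v => y - v) f); last exact: cf.
by apply: (@dv_cts _ _ _ (0 - 1)); repeat dv_step.
Qed.

Lemma bm_flip (f : R -> R) y : bm f -> bm (fun v => f (y - v)).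
Proof.
move=> bf; apply: (bm_comp bf (g := fun t => y - t)).
by apply: measurable_funB => //; exact: measurable_cst.
Qed.

Lemma bm_shift (f : R -> R) y : bm f -> bm (fun v => f (v - y)).
Proof.
move=> bf; apply: (bm_comp bf (g := fun t => t - y)).
by apply: measurable_funB => //; exact: measurable_cst.
Qed.

(** The factor [D] on the edge rs is integrated by parts in [x_r]. The derivative falls on [h], and
    h' has integral at most [L], or on [I], and then yields an [S] that decays. Either way three
    links join the four points; the boundary terms have two localising factors and one power of [N]
    less. *)
Lemma didi_separated p q r s e (G : V -> R) : uniq [:: p; q; r; s] -> e \in [:: p; q] ->
  bm G -> indep r G -> (forall x, `|G x| <= L * k) ->
  `|N ^+ 4 * tot N (fun x => (pr h e r x * pr I q r x * pr D r s x) * (pr D p q x * G x))| <=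
  4 * k ^+ 4 * L ^+ 5 * N.
Proof.
move=> /neq4[[pq prr ps qr qs] rs] epq bG iG GL.
have er : e != r by move: epq; rewrite !inE => /orP[] /eqP ->.
have bh := bm_h; have bI := bm_I; have bD := bm_D; have bS := bm_S; have bd := bm_decay.
have bP : bm (fun x => pr h e r x * pr I q r x * pr D r s x).
  by do 2 (apply: bmM; last exact: bm_pr); exact: bm_pr.
have bDG : bm (fun x => pr D p q x * G x) by apply: bmM => //; exact: bm_pr.
have iDG : indep r (fun x => pr D p q x * G x).
  by apply: indepM => //; apply: indep_pr; rewrite eq_sym.
(* [M2] bounds the integrand left by the integration by parts, and [M1] adds the boundary terms. *)
pose M2 x := (adh e r x * k + L * (k * dc q r x)) * (k * dc r s x).
have bM2 : bm M2.
  apply: bmM; last by apply: bmM; [exact: bm_cst | exact: bm_dc].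
  apply: bmD; first by apply: bmM; [exact: bm_adh | exact: bm_cst].
  by apply: bmM; [exact: bm_cst | apply: bmM; [exact: bm_cst | exact: bm_dc]].
pose M1 x := L * k * (k * (decay (N - tnth x s) + decay (tnth x s))) + N * avg N r M2 x.
have key x : cube N x ->
    `|N * avg N r (fun x => pr h e r x * pr I q r x * pr D r s x) x| <= M1 x.
  move=> cx; rewrite /M1 /avg.
  pose phi t := h (tnth x e - t) * I (tnth x q - t).
  pose dphi t := - dh (tnth x e - t) * I (tnth x q - t) + h (tnth x e - t) * - S (tnth x q - t).
  pose m t := `|dh (tnth x e - t)| * k + L * (k * decay (tnth x q - t)).
  have bp := @by_parts phi dphi m (L * k) (tnth x s).
  have ers := (eqxx, eq_sym s r, negbTE rs, negbTE qr, negbTE er).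
  have -> : (fun t => pr h e r (upd x r t) * pr I q r (upd x r t) * pr D r s (upd x r t)) =
      (fun t => phi t * D (t - tnth x s)).
    by apply/funext => t; rewrite /phi /pr !tnth_upd !ers.
  have -> : (fun t => M2 (upd x r t)) = (fun t => m t * (k * decay (t - tnth x s))).
    by apply/funext => t; rewrite /M2 /m /adh /dc /pr !tnth_upd !ers.
  apply: bp.
  - by move=> t; apply: dvM; apply: dv_flip; [exact: pp_dh H _ | exact: dI].
  - move=> t; apply: cvgD.
      apply: cvgM; last exact: (continuous_flip sk_cI).
      by apply: cvgN; exact: (continuous_flip (pp_cdh H)).
    by apply: cvgM; [exact: (continuous_flip pp_ch) | apply: cvgN; exact: (continuous_flip sk_cS)].
  - by apply: bmM; exact: bm_flip.
  - apply: bmD; first by apply: bmM; [apply: bmN; apply: bm_flip; exact: pp_bdh H | exact: bm_flip].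
    by apply: bmM; [exact: bm_flip | apply: bmN; exact: bm_flip].
  - apply: bmD; first by apply: bmM; [apply: bm_norm; apply: bm_flip; exact: pp_bdh H | exact: bm_cst].
    apply: bmM; first exact: bm_cst.
    by apply: bmM; [exact: bm_cst | exact: bm_flip].
  - by move=> t _; apply: norm_prM; [exact: pp_h H _ | exact: sk_I K _].
  - move=> t _; rewrite (le_trans (ler_normD _ _))// lerD//.
      by apply: norm_prM; [rewrite normrN | exact: sk_I K _].
    by apply: norm_prM; [exact: pp_h H _ | rewrite normrN; exact: sk_S K _].
have bM1 : bm M1.
  apply: bmD; last by apply: bmM; [exact: bm_cst | exact: bm_avg].
  apply: bmM; first exact: bm_cst.
  by apply: bmM; [exact: bm_cst | exact: bm_edges].
have bdG : bm (fun x => L * k * (k * dc p q x)).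
  by apply: bmM; [exact: bm_cst | apply: bmM; [exact: bm_cst | exact: bm_dc]].
have step : `|N * tot N (fun x => (pr h e r x * pr I q r x * pr D r s x) * (pr D p q x * G x))| <=
    tot N (fun x => M1 x * (L * k * (k * dc p q x))).
  have b4 := bmM bP bDG.
  rewrite -(tot_avg N0 r b4) -(totZ N0 N (bm_avg N0 r b4)).
  apply: (norm_tot N0); [by apply: bmM; [exact: bm_cst | exact: bm_avg] | exact: bmM |].
  move=> x cx; rewrite (avg_pull N0 x bP iDG) mulrA; apply: norm_prM; first exact: key.
  rewrite mulrC [L * k * _]mulrC mulrC; apply: norm_prM; first exact: sk_D K _.
  exact: GL.
pose E1 := tot N (fun x => (decay (N - tnth x s) + decay (tnth x s)) * dc p q x).
pose E2 := tot N (fun x => adh e r x * dc r s x * dc p q x).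
pose E3 := tot N (fun x => dc q r x * dc r s x * dc p q x).
have bE1 : bm (fun x => (decay (N - tnth x s) + decay (tnth x s)) * dc p q x).
  by apply: bmM; [exact: bm_edges | exact: bm_dc].
have bE2 : bm (fun x => adh e r x * dc r s x * dc p q x).
  by apply: bmM; [apply: bmM; [exact: bm_adh | exact: bm_dc] | exact: bm_dc].
have bE3 : bm (fun x => dc q r x * dc r s x * dc p q x).
  by apply: bmM; [apply: bmM; exact: bm_dc | exact: bm_dc].
have tE : tot N (fun x => M1 x * (L * k * (k * dc p q x))) =
    L ^+ 2 * k ^+ 4 * E1 + N * (L * k ^+ 4 * E2 + L ^+ 2 * k ^+ 4 * E3).
  have ip : indep r (fun x => L * k * (k * dc p q x)).
    by apply: indepM => //; apply: indepM => //; apply: indep_pr; rewrite eq_sym.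
  have b5 : bm (fun x => N * M2 x) by apply: bmM => //; exact: bm_cst.
  have -> : tot N (fun x => M1 x * (L * k * (k * dc p q x))) =
      tot N (fun x => L ^+ 2 * k ^+ 4 * ((decay (N - tnth x s) + decay (tnth x s)) * dc p q x) +
        avg N r (fun x => N * M2 x * (L * k * (k * dc p q x))) x).
    apply: eq_tot => // x cx; rewrite (avg_pull N0 x b5 ip).
    have -> : avg N r (fun x => N * M2 x) x = N * avg N r M2 x.
      by rewrite /avg (meanZ N0 N (bm_slice r x bM2)).
    by rewrite /M1; ring.
  have b6 : bm (fun x => N * M2 x * (L * k * (k * dc p q x))) by exact: bmM.
  have b7 : bm (fun x => L ^+ 2 * k ^+ 4 *
      ((decay (N - tnth x s) + decay (tnth x s)) * dc p q x)).
    by apply: bmM => //; exact: bm_cst.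
  rewrite (totD N0 b7 (bm_avg N0 r b6)) (tot_avg N0 r b6) (totZ N0 _ bE1); congr (_ + _).
  have bZ (c : R) (f : V -> R) : bm f -> bm (fun x => c * f x).
    by move=> bf; apply: bmM => //; exact: bm_cst.
  rewrite -(totZ N0 _ bE2) -(totZ N0 _ bE3) -(totD N0 (bZ _ _ bE2) (bZ _ _ bE3)).
  rewrite -(totZ N0 N); last by apply: bmD; exact: bZ.
  by congr (tot N _); apply/funext => x; rewrite /M2; ring.
have hE1 : E1 <= 2 * (L / N) ^+ 2.
  apply: le_trans (leaf_edges (bm_dc p q) (fun x _ => dc_ge0 p q x) _) _.
    by apply: indep_pr; rewrite eq_sym.
  rewrite (_ : 2 * (L / N) ^+ 2 = 2 * (L / N) * (L / N)); last by ring.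
  apply: ler_wpM2l; last exact: tot_dc.
  by rewrite mulr_ge0 ?LN_ge0.
have hE2 : E2 <= (L / N) ^+ 3.
  have -> : E2 = tot N (fun x => dc s r x * (adh e r x * dc p q x)).
    by congr (tot N _); apply/funext => x; rewrite (dcC r s); ring.
  have b8 : bm (fun x => adh e r x * dc p q x) by apply: bmM; [exact: bm_adh | exact: bm_dc].
  apply: le_trans (leaf_dc _ b8 _ _) _.
  - by rewrite eq_sym.
  - by move=> x _; rewrite mulr_ge0 ?adh_ge0 ?dc_ge0.
  - apply: indepM; last by apply: indep_pr; rewrite eq_sym.
    apply: indep_adh; rewrite eq_sym//.
    by move: epq; rewrite !inE => /orP[] /eqP ->.
  rewrite exprS ler_wpM2l ?LN_ge0// expr2.
  move: epq; rewrite !inE => /orP[] /eqP E; rewrite E.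
    have -> : (fun x => adh p r x * dc p q x) = (fun x => dc q p x * adh p r x).
      by apply/funext => x; rewrite (dcC p q) mulrC.
    apply: le_trans (leaf_dc _ (bm_adh p r) (fun x _ => adh_ge0 _ _ x) _) _.
    + by rewrite eq_sym.
    + by apply: indep_adh; rewrite // eq_sym.
    + by rewrite ler_wpM2l ?LN_ge0// tot_adh.
  have -> : (fun x => adh q r x * dc p q x) = (fun x => dc p q x * adh q r x).
    by apply/funext => x; rewrite mulrC.
  apply: le_trans (leaf_dc _ (bm_adh q r) (fun x _ => adh_ge0 _ _ x) _) _ => //.
  + exact: indep_adh.
  + by rewrite ler_wpM2l ?LN_ge0// tot_adh.
have hE3 : E3 <= (L / N) ^+ 3.
  have -> : E3 = tot N (fun x => dc p q x * (dc q r x * dc r s x)).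
    by congr (tot N _); apply/funext => x; ring.
  by apply: tot_dc3; rewrite /= !inE !negb_or pq prr ps qr qs rs.
rewrite (_ : N ^+ 4 * _ = N ^+ 3 * (N * tot N
  (fun x => (pr h e r x * pr I q r x * pr D r s x) * (pr D p q x * G x)))); last by ring.
rewrite normrM ger0_norm ?exprn_ge0 ?(ltW N0)//.
apply: le_trans (ler_wpM2l _ step) _; first by rewrite exprn_ge0 ?(ltW N0).
rewrite tE; have L1 := pp_L H.
(* [E1] is halved because its bound carries a factor 2, whereas [Nk_bound] expects a bare power of L
   / N. *)
have c1 : N ^+ 2 * (L ^+ 2 * k ^+ 4 * 2 * (E1 / 2)) <= L ^+ 2 * k ^+ 4 * 2 * L ^+ 2.
  by apply: Nk_bound; [rewrite !mulr_ge0 ?exprn_ge0 | rewrite ler_pdivrMr// mulrC].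
have c2 : N ^+ 3 * (L * k ^+ 4 * E2) <= L * k ^+ 4 * L ^+ 3.
  by apply: Nk_bound => //; rewrite !mulr_ge0 ?exprn_ge0.
have c3 : N ^+ 3 * (L ^+ 2 * k ^+ 4 * E3) <= L ^+ 2 * k ^+ 4 * L ^+ 3.
  by apply: Nk_bound => //; rewrite !mulr_ge0 ?exprn_ge0.
have k4 : 0 <= k ^+ 4 by rewrite exprn_ge0.
have p4 : k ^+ 4 * L ^+ 4 <= k ^+ 4 * L ^+ 5.
  by rewrite ler_wpM2l// [leRHS]exprS ler_peMl// exprn_ge0.
have -> : N ^+ 3 * (L ^+ 2 * k ^+ 4 * E1 + N * (L * k ^+ 4 * E2 + L ^+ 2 * k ^+ 4 * E3)) =
    (N ^+ 2 * (L ^+ 2 * k ^+ 4 * 2 * (E1 / 2)) +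
     N ^+ 3 * (L * k ^+ 4 * E2) + N ^+ 3 * (L ^+ 2 * k ^+ 4 * E3)) * N.
  by field.
rewrite ler_wpM2r ?(ltW N0)//.
apply: le_trans (lerD (lerD c1 c2) c3) _.
rewrite (_ : _ + _ = 3 * (k ^+ 4 * L ^+ 4) + k ^+ 4 * L ^+ 5); last by ring.
by rewrite -[leRHS]mulrA; lra.
Qed.


(** [I] need not decay, but a difference of two translates is the integral of [S] between the
    shifts, and each translate of [S] has integral at most k L over [0, N]. *)
Lemma mean_diff_I (a b : R) : 0 <= a <= N -> 0 <= b <= N ->
  N * mean N (fun t => `|I (t - a) - I (t - b)|) <= k * L * `|a - b|.
Proof.
wlog ab : a b / a <= b.
  move=> W aN bN; have [ab|/ltW ba] := leP a b; first exact: W.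
  rewrite distrC (_ : (fun _ => _) = (fun t => `|I (t - b) - I (t - a)|)); first exact: W.
  by apply/funext => t; rewrite distrC.
move=> /andP[a0 aN] /andP[b0 bN].
have bd := bm_decay; have bI := bm_I.
(* The integral over [a, b] is written as a mean over [0, N] with an indicator, so that [mean_swap]
   applies. *)
pose w (z : R * R) : R := \1_`[a, b] z.2 * (k * decay (z.1 - z.2)).
have bi : bm (\1_`[a, b] : R -> R).
  split; first exact: measurable_indic.
  by exists 1 => u; rewrite indicE; case: (_ \in _); rewrite ?normr1 ?normr0.
have bw : bm w.
  apply: bmM; first by apply: (bm_comp bi); exact: measurable_snd.
  apply: bmM; first exact: bm_cst.
  apply: (bm_comp bd (g := fun z : R * R => z.1 - z.2)).
  by apply: measurable_funB; [exact: measurable_fst | exact: measurable_snd].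
have bw1 t : bm (fun v => w (t, v)) by apply: bm_comp bw _; exact: measurable_pair1.
have bw2 v : bm (fun t => w (t, v)) by apply: bm_comp bw _; exact: measurable_pair2.
have h1 t : `|I (t - a) - I (t - b)| <= N * mean N (fun v => w (t, v)).
  have cS := sk_cS.
  have -> : N * mean N (fun v => w (t, v)) =
      \int[lebesgue_measure]_(v in `[a, b]) (k * decay (t - v)).
    rewrite /mean mulVKf ?lt0r_neq0// [LHS]Rintegral_mkcond [RHS]Rintegral_mkcond.
    apply: eq_Rintegral => v _; rewrite !patchE /w /= indicE !mem_setE !in_itv /=.
    case: ifPn => [_|]; first by case: ifP; rewrite ?mul1r ?mul0r.
    case: ifP => // /andP[av vb]; rewrite (le_trans a0 av) (le_trans vb bN)//.
  have -> : I (t - a) - I (t - b) = \int[lebesgue_measure]_(v in `[a, b]) S (t - v).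
    rewrite (@dv_ftc _ _ (fun v => - I (t - v))) ?opprK 1?addrC//.
      by move=> v; rewrite -[S _]opprK; apply: dvN; apply: dv_flip; exact: dI.
    exact: continuous_flip.
  have iS : lebesgue_measure.-integrable `[a, b] (EFin \o (fun v => S (t - v))).
    by apply: continuous_itv_integrable; exact: continuous_flip.
  apply: le_trans (le_normr_Rintegral _ iS) _ => //.
  apply: le_Rintegral => //.
  - by apply: (@continuous_itv_integrable _ (fun v => `|S (t - v)|)) => v;
      apply: cvg_norm; exact: continuous_flip.
  - apply: (@continuous_itv_integrable _ (fun v => k * decay (t - v))) => v.
    by apply: cvgM; [exact: cvg_cst | exact: (continuous_flip continuous_decay)].
  - by move=> v _; exact: sk_S K _.
have bm1 : bm (fun t => mean N (fun v => w (t, v))) by exact: (bm_mean N0 bw).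
have bl : bm (fun t => `|I (t - a) - I (t - b)|).
  by apply: bm_norm; apply: bmB; exact: bm_shift.
have h2 : mean N (fun t => `|I (t - a) - I (t - b)|) <=
    N * mean N (fun v => mean N (fun t => w (t, v))).
  rewrite -(mean_swap N0 bw) -(meanZ N0 N bm1).
  by apply: (le_mean N0) => //; apply: bmM => //; exact: bm_cst.
have h3 v : 0 <= v <= N -> mean N (fun t => w (t, v)) <= k * L / N * \1_`[a, b] v.
  move=> vN; rewrite /w /= (meanZ N0 (\1_`[a, b] v)); last first.
    by apply: bmM; [exact: bm_cst | exact: bm_shift].
  rewrite (meanZ N0 k (bm_shift v bd)) mulrC ler_wpM2r// -mulrA ler_wpM2l//.
  by rewrite ler_pdivlMr// mulrC; exact: pp_int_decay H _ vN.
have bm2 : bm (fun v => mean N (fun t => w (t, v))).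
  apply: (bm_mean N0 (f := fun z : R * R => w (z.2, z.1))); apply: (bm_comp bw).
  exact: measurable_swap.
have h4 : mean N (fun v => mean N (fun t => w (t, v))) <= k * L / N * mean N \1_`[a, b].
  rewrite -(meanZ N0 _ bi); apply: (le_mean N0) => //.
  by apply: bmM => //; exact: bm_cst.
have h5 : N * mean N \1_`[a, b] = b - a.
  rewrite /mean mulVKf ?lt0r_neq0//.
  have -> : \int[lebesgue_measure]_(t in `[0, N]) \1_`[a, b] t =
      \int[lebesgue_measure]_(t in `[a, b]) (1 : R).
    rewrite [LHS]Rintegral_mkcond [RHS]Rintegral_mkcond.
    apply: eq_Rintegral => v _; rewrite !patchE indicE !mem_setE !in_itv /=.
    case: ifPn => [_|]; first by case: ifP.
    by case: ifP => // /andP[av vb]; rewrite (le_trans a0 av) (le_trans vb bN).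
  rewrite (@dv_ftc _ _ (fun v => v))//; [exact: dv_id | exact: cst_continuous].
rewrite distrC (ger0_norm (_ : 0 <= b - a)) ?subr_ge0//.
apply: le_trans (ler_wpM2l (ltW N0) h2) _.
have NN : 0 <= N * N by rewrite mulr_ge0 ?(ltW N0).
rewrite mulrA; apply: le_trans (ler_wpM2l NN h4) _.
by rewrite -h5 le_eqVlt; apply/orP; left; apply/eqP; field; rewrite lt0r_neq0.
Qed.

End smooth_I.

End estimates.

(** * Products D I D I with the potential on the edges that carry D *)

Section cycles.
Context {R : realType} (S D I Q : R -> R) (k N : R) (h dh : R -> R) (L : R).
Hypothesis K : sine_kernel S D I Q k.
Hypothesis H : pair_potential N h dh L.
Notation V := (4.-tuple R).
Implicit Types (x : V) (a b c d p q r s : 'I_4) (u v t y z : R).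

Let N0 : 0 < N := pp_N H.
Let k0 : 0 <= k. Proof. exact: le_trans ler01 (sk_k K). Qed.
Let L0 : 0 <= L. Proof. exact: le_trans ler01 (pp_L H). Qed.
Let bh : bm h := bm_h H.
Let bS : bm S := bm_S K.
Let bD : bm D := bm_D K.
Let bI : bm I := bm_I K.
Let bd : bm (@decay R) := @bm_decay R.

Lemma bmZ (c : R) (f : V -> R) : bm f -> bm (fun x => c * f x).
Proof. by move=> bf; apply: bmM => //; exact: bm_cst. Qed.

(** The part of a four-cycle in which only the two factors [D] are sure to decay. *)
Definition didi p q r s x := pr D p q x * (pr I q r x * (pr D r s x * pr I s p x)).

Lemma bm_didi p q r s : bm (didi p q r s).
Proof. by do 3 (apply: bmM; first exact: bm_pr); exact: bm_pr. Qed.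

(* Exchanging [x_p] and [x_q] shows that only the antisymmetric part of [I_qr I_sp] contributes;
   it vanishes at [x_p = x_q], which compensates for the singularity of [h']. *)
Lemma didi_paired p q r s : (forall u, dv I u (S u)) -> uniq [:: p; q; r; s] ->
  `|N ^+ 4 * tot N (fun x => pr h p q x * pr h r s x * didi p q r s x)| <=
  4 * k ^+ 4 * L ^+ 5 * N.
Proof.
move=> dI u4; have [[pq prr ps qr qs] rs] := neq4 u4.
have cI := sk_cI dI.
(* Under the exchange of [x_p] and [x_q] the factor [h] on pq is even and [D] on pq is odd, so twice
   the total is the total with [J] in place of the product of the two [I]. *)
pose J x := pr I q r x * pr I s p x - pr I p r x * pr I s q x.
pose P x := pr h p q x * J x * pr D p q x.
pose G x := pr h r s x * pr D r s x.
have bJ : bm J by apply: bmB; apply: bmM; exact: bm_pr.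
have bP : bm P by apply: bmM; [apply: bmM => //; exact: bm_pr | exact: bm_pr].
have bG : bm G by apply: bmM; exact: bm_pr.
have bPG := bmM bP bG.
have iG : indep p G by apply: indepM; exact: indep_pr.
have bW : bm (fun x => pr h p q x * pr h r s x * didi p q r s x).
  by apply: bmM; [apply: bmM; exact: bm_pr | exact: bm_didi].
have tW : 2 * tot N (fun x => pr h p q x * pr h r s x * didi p q r s x) =
    tot N (fun x => P x * G x).
  have bWs := bm_swap p q bW.
  rewrite mulrDl mul1r -{2}(tot_swap N0 bW bWs) -(totD N0 bW bWs).
  congr (tot N _); apply/funext => x; rewrite /P /G /J /didi /pr !tnth_swap.
  rewrite !eqxx (negbTE pq) ![r == _]eq_sym ![s == _]eq_sym.
  rewrite (negbTE prr) (negbTE qr) (negbTE ps) (negbTE qs).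
  rewrite -[tnth x q - tnth x p]opprB (pp_hN H) (sk_DN K); ring.
(* [J] is a combination, with bounded coefficients, of these differences, which vanish for x_p =
   x_q. *)
pose dIs x := `|pr I s p x - pr I s q x|.
pose dIr x := `|pr I p r x - pr I q r x|.
have bdIs : bm dIs by apply: bm_norm; apply: bmB; exact: bm_pr.
have bdIr : bm dIr by apply: bm_norm; apply: bmB; exact: bm_pr.
pose M2 x := (adh dh p q x * (k * (dIs x + dIr x)) + L * (k * k * (dc s p x + dc p r x))) *
  (k * dc p q x).
have bM2 : bm M2.
  apply: bmM; last by apply: bmZ; exact: bm_dc.
  apply: bmD; first by apply: bmM; [exact: bm_adh H _ _ | apply: bmZ; exact: bmD].
  by do 2 apply: bmZ; apply: bmD; exact: bm_dc.
pose M1 x := 2 * L * k ^+ 2 * (k * (decay (N - tnth x q) + decay (tnth x q))) + N * avg N p M2 x.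
have bM1 : bm M1.
  apply: bmD; last by apply: bmZ; exact: bm_avg.
  by do 2 apply: bmZ; exact: bm_edges.
have key x : cube N x -> `|N * avg N p P x| <= M1 x.
  move=> cx; rewrite /M1 /avg.
  have ers := (eqxx, eq_sym q p, eq_sym r p, eq_sym s p, negbTE pq, negbTE prr, negbTE ps).
  pose Jt t := pr I q r x * I (tnth x s - t) - I (t - tnth x r) * pr I s q x.
  pose dJt t := pr I q r x * - S (tnth x s - t) - S (t - tnth x r) * pr I s q x.
  pose phi t := h (t - tnth x q) * Jt t.
  pose dphi t := dh (t - tnth x q) * Jt t + h (t - tnth x q) * dJt t.
  pose m t := `|dh (t - tnth x q)| * (k * (`|I (tnth x s - t) - pr I s q x| +
    `|I (t - tnth x r) - pr I q r x|)) +
    L * (k * k * (decay (tnth x s - t) + decay (t - tnth x r))).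
  have -> : (fun t => P (upd x p t)) = (fun t => phi t * D (t - tnth x q)).
    by apply/funext => t; rewrite /P /J /phi /Jt /pr !tnth_upd !ers.
  have -> : (fun t => M2 (upd x p t)) = (fun t => m t * (k * decay (t - tnth x q))).
    by apply/funext => t; rewrite /M2 /m /dIs /dIr /adh /dc /pr !tnth_upd !ers.
  have c1 (c : R) : bm (fun _ : R => c) by exact: bm_cst.
  have bJt : bm Jt.
    by apply: bmB; [apply: bmM => //; exact: bm_flip | apply: bmM => //; exact: bm_shift].
  have cJt : continuous Jt.
    move=> t; apply: cvgB; first by apply: cvgM; [exact: cvg_cst | exact: continuous_flip].
    by apply: cvgM; [exact: continuous_shift | exact: cvg_cst].
  have bdJt : bm dJt.
    apply: bmB; last by apply: bmM => //; exact: bm_shift.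
    by apply: bmM => //; apply: bmN; exact: bm_flip.
  have cS := sk_cS K.
  apply: (by_parts K H).
  - move=> t; apply: dvM; first by apply: dv_shift; exact: pp_dh H _.
    apply: dv_eq.
      apply: dvD.
        by apply: dvM; [exact: dv_cst | apply: dv_flip; exact: dI].
      by apply: dvN; apply: dvM; [apply: dv_shift; exact: dI | exact: dv_cst].
    by rewrite mul0r add0r mulr0 addr0.
  - move=> t; apply: cvgD; apply: cvgM.
    + exact: (continuous_shift (pp_cdh H)).
    + exact: cJt.
    + exact: (continuous_shift (pp_ch H)).
    + apply: cvgB; first by apply: cvgM; [exact: cvg_cst | apply: cvgN; exact: continuous_flip].
      by apply: cvgM; [exact: continuous_shift | exact: cvg_cst].
  - by apply: bmM => //; exact: bm_shift.
  - apply: bmD; first by apply: bmM => //; apply: bm_shift; exact: pp_bdh H.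
    by apply: bmM => //; exact: bm_shift.
  - apply: bmD.
      apply: bmM; first by apply: bm_norm; apply: bm_shift; exact: pp_bdh H.
      apply: bmM => //; apply: bmD; apply: bm_norm; apply: bmB => //.
        exact: bm_flip.
      exact: bm_shift.
    by do 2 apply: bmM => //; apply: bmD; [exact: bm_flip | exact: bm_shift].
  - move=> t _; rewrite -mulrA mulrCA; apply: norm_prM; first exact: pp_h H _.
    rewrite (le_trans (ler_normB _ _))// mulrDl mul1r expr2.
    by apply: lerD; apply: norm_prM; exact: sk_I K _.
  - move=> t _; rewrite (le_trans (ler_normD _ _))//; apply: lerD.
      apply: norm_prM => //.
      have -> : Jt t = pr I q r x * (I (tnth x s - t) - pr I s q x) -
          (I (t - tnth x r) - pr I q r x) * pr I s q x by rewrite /Jt; ring.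
      rewrite (le_trans (ler_normB _ _))// [leRHS]mulrDr; apply: lerD.
        by rewrite normrM ler_wpM2r// (sk_I K).
      by rewrite normrM mulrC ler_wpM2r// (sk_I K).
    apply: norm_prM; first exact: pp_h H _.
    rewrite (le_trans (ler_normB _ _))// [leRHS]mulrDr; apply: lerD; rewrite -[leRHS]mulrA.
      by apply: norm_prM; [exact: sk_I K _ | rewrite normrN; exact: sk_S K _].
    by rewrite [S _ * _]mulrC; apply: norm_prM; [exact: sk_I K _ | exact: sk_S K _].
have step : `|N * tot N (fun x => P x * G x)| <= tot N (fun x => M1 x * (L * (k * dc r s x))).
  rewrite -(tot_avg N0 p bPG) -(totZ N0 N (bm_avg N0 p bPG)).
  apply: (norm_tot N0); first by apply: bmZ; exact: bm_avg.
    by apply: bmM => //; do 2 apply: bmZ; exact: bm_dc.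
  move=> x cx; rewrite (avg_pull N0 x bP iG) mulrA; apply: norm_prM; first exact: key.
  by apply: norm_prM; [exact: pp_h H _ | exact: sk_D K _].
pose E1 := tot N (fun x => (decay (N - tnth x q) + decay (tnth x q)) * dc r s x).
pose E2 := tot N (fun x => adh dh p q x * dIs x * dc p q x * dc r s x).
pose E3 := tot N (fun x => adh dh p q x * dIr x * dc p q x * dc r s x).
pose E4 := tot N (fun x => dc s p x * dc p q x * dc r s x).
pose E5 := tot N (fun x => dc p r x * dc p q x * dc r s x).
have ba := bm_adh H p q.
have bE1 : bm (fun x => (decay (N - tnth x q) + decay (tnth x q)) * dc r s x).
  by apply: bmM; [exact: bm_edges | exact: bm_dc].
have bE2 : bm (fun x => adh dh p q x * dIs x * dc p q x * dc r s x).
  by do 2 (apply: bmM; last exact: bm_dc); exact: bmM.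
have bE3 : bm (fun x => adh dh p q x * dIr x * dc p q x * dc r s x).
  by do 2 (apply: bmM; last exact: bm_dc); exact: bmM.
have bE4 : bm (fun x => dc s p x * dc p q x * dc r s x).
  by do 2 (apply: bmM; last exact: bm_dc); exact: bm_dc.
have bE5 : bm (fun x => dc p r x * dc p q x * dc r s x).
  by do 2 (apply: bmM; last exact: bm_dc); exact: bm_dc.
have tE : tot N (fun x => M1 x * (L * (k * dc r s x))) =
    2 * L ^+ 2 * k ^+ 4 * E1 +
    N * (L * k ^+ 3 * E2 + L * k ^+ 3 * E3 + L ^+ 2 * k ^+ 4 * E4 + L ^+ 2 * k ^+ 4 * E5).
  have ip : indep p (fun x => L * (k * dc r s x)).
    by apply: indepM => //; apply: indepM => //; exact: indep_pr.
  have b5 := bmZ N bM2.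
  have -> : tot N (fun x => M1 x * (L * (k * dc r s x))) =
      tot N (fun x => 2 * L ^+ 2 * k ^+ 4 * ((decay (N - tnth x q) + decay (tnth x q)) * dc r s x) +
        avg N p (fun x => N * M2 x * (L * (k * dc r s x))) x).
    apply: eq_tot => // x cx; rewrite (avg_pull N0 x b5 ip).
    have -> : avg N p (fun x => N * M2 x) x = N * avg N p M2 x.
      by rewrite /avg (meanZ N0 N (bm_slice p x bM2)).
    by rewrite /M1; ring.
  have b6 : bm (fun x => N * M2 x * (L * (k * dc r s x))).
    by apply: bmM => //; do 2 apply: bmZ; exact: bm_dc.
  rewrite (totD N0 (bmZ _ bE1) (bm_avg N0 p b6)) (tot_avg N0 p b6) (totZ N0 _ bE1).
  congr (_ + _).
  rewrite -(totZ N0 _ bE2) -(totZ N0 _ bE3) -(totZ N0 _ bE4) -(totZ N0 _ bE5).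
  have c1 := bmD (bmZ (L * k ^+ 3) bE2) (bmZ (L * k ^+ 3) bE3).
  have c2 := bmD c1 (bmZ (L ^+ 2 * k ^+ 4) bE4).
  have c3 := bmD c2 (bmZ (L ^+ 2 * k ^+ 4) bE5).
  rewrite -(totD N0 (bmZ _ bE2) (bmZ _ bE3)) -(totD N0 c1 (bmZ _ bE4)).
  rewrite -(totD N0 c2 (bmZ _ bE5)) -(totZ N0 N c3).
  by congr (tot N _); apply/funext => x; rewrite /M2; ring.
have hE1 : E1 <= 2 * (L / N) ^+ 2.
  apply: le_trans (leaf_edges H (bm_dc r s) (fun x _ => dc_ge0 r s x) _) _.
    by apply: indep_pr.
  rewrite (_ : 2 * (L / N) ^+ 2 = 2 * (L / N) * (L / N)); last by ring.
  by apply: ler_wpM2l; [rewrite mulr_ge0 ?(LN_ge0 H) | exact: tot_dc H _ _ rs].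
have LN0 := LN_ge0 H.
(* The average over [x_i] bounds the difference of [I] by k L |x_p - x_q| / N, and the decay along
   pq absorbs |x_p - x_q|. What remains is |h'| on pq, which is integrable up to [L]. *)
have inner (i : 'I_4) : i \in [:: r; s] ->
    tot N (fun x => `|pr I i p x - pr I i q x| * dc p q x * adh dh p q x) <= k * (L / N) ^+ 2.
  move=> irs; have [ip iq] : i != p /\ i != q.
    by move: irs; rewrite !inE => /orP[] /eqP ->; rewrite ![_ == p]eq_sym ![_ == q]eq_sym.
  have bf : bm (fun x => `|pr I i p x - pr I i q x| * dc p q x).
    by apply: bmM; [apply: bm_norm; apply: bmB; exact: bm_pr | exact: bm_dc].
  apply: (le_trans (tot_leaf N0 bf (bm_adh H p q) (fun x _ => adh_ge0 _ _ _ x)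
    (indep_adh dh ip iq) (c := k * (L / N)) _)).
    move=> x cx.
    have bn : bm (fun x => `|pr I i p x - pr I i q x|).
      by apply: bm_norm; apply: bmB; exact: bm_pr.
    have idc : indep i (dc p q) := @indep_pr R (@decay R) p q i ip iq.
    rewrite (avg_pull N0 x bn idc).
    have -> : avg N i (fun x => `|pr I i p x - pr I i q x|) x =
        mean N (fun t => `|I (t - tnth x p) - I (t - tnth x q)|).
      rewrite /avg; congr (mean N _); apply/funext => t.
      by rewrite /pr !tnth_upd eqxx ![_ == i]eq_sym (negbTE ip) (negbTE iq).
    have md := mean_diff_I K H dI (cx p) (cx q).
    have := norm_mul_decay (tnth x p - tnth x q); rewrite -[decay _]/(dc p q x) => nd.
    have d0 := dc_ge0 p q x.
    rewrite -(ler_pM2l N0) [leLHS]mulrA (_ : N * (k * (L / N)) = k * L); last by field; rewrite lt0r_neq0.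
    apply: le_trans (ler_wpM2r d0 md) _.
    rewrite -[leLHS]mulrA -[leRHS]mulr1; apply: ler_wpM2l => //; exact: mulr_ge0.
  rewrite (_ : k * (L / N) ^+ 2 = k * (L / N) * (L / N)); last by ring.
  apply: ler_wpM2l; first by rewrite mulr_ge0.
  exact: tot_adh H _ _ pq.
have hE2 : E2 <= k * (L / N) ^+ 3.
  have -> : E2 = tot N (fun x => dc r s x * (dIs x * dc p q x * adh dh p q x)).
    by congr (tot N _); apply/funext => x; ring.
  have b8 : bm (fun x => dIs x * dc p q x * adh dh p q x).
    by apply: bmM => //; apply: bmM => //; exact: bm_dc.
  apply: le_trans (leaf_dc H rs b8 _ _) _.
  - move=> x _; apply: mulr_ge0; last exact: adh_ge0.
    by apply: mulr_ge0; [exact: normr_ge0 | exact: dc_ge0].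
  - have rp : r != p by rewrite eq_sym.
    have rq : r != q by rewrite eq_sym.
    apply: indepM; last exact: indep_adh.
    apply: indepM; last exact: indep_pr.
    by apply: indep_norm; apply: indepD; [|apply: indepN]; apply: indep_pr.
  - rewrite exprS mulrCA ler_wpM2l//; apply: inner; by rewrite !inE eqxx orbT.
have hE3 : E3 <= k * (L / N) ^+ 3.
  have -> : E3 = tot N (fun x => dc s r x * (`|pr I r p x - pr I r q x| * dc p q x * adh dh p q x)).
    congr (tot N _); apply/funext => x; rewrite (dcC s r) /dIr.
    have -> : `|pr I p r x - pr I q r x| = `|pr I r p x - pr I r q x|.
      rewrite /pr -[tnth x p - tnth x r]opprB -[tnth x q - tnth x r]opprB !(sk_IN K).
      by rewrite -opprD normrN.
    by ring.
  have b8 : bm (fun x => `|pr I r p x - pr I r q x| * dc p q x * adh dh p q x).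
    apply: bmM => //; apply: bmM; last exact: bm_dc.
    by apply: bm_norm; apply: bmB; exact: bm_pr.
  have sr : s != r by rewrite eq_sym.
  have sp : s != p by rewrite eq_sym.
  have sq : s != q by rewrite eq_sym.
  apply: le_trans (leaf_dc H sr b8 _ _) _.
  - move=> x _; apply: mulr_ge0; last exact: adh_ge0.
    by apply: mulr_ge0; [exact: normr_ge0 | exact: dc_ge0].
  - apply: indepM; last exact: indep_adh.
    apply: indepM; last exact: indep_pr.
    by apply: indep_norm; apply: indepD; [|apply: indepN]; apply: indep_pr.
  - by rewrite exprS mulrCA ler_wpM2l//; apply: inner; rewrite !inE eqxx.
have hE4 : E4 <= (L / N) ^+ 3.
  have -> : E4 = tot N (fun x => dc q p x * (dc p s x * dc s r x)).
    by congr (tot N _); apply/funext => x; rewrite (dcC q p) (dcC p s) (dcC s r); ring.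
  apply: (tot_dc3 H); rewrite /= !inE !negb_or ![q == p]eq_sym ![s == r]eq_sym.
  by rewrite pq qs qr ps prr rs.
have hE5 : E5 <= (L / N) ^+ 3.
  have -> : E5 = tot N (fun x => dc q p x * (dc p r x * dc r s x)).
    by congr (tot N _); apply/funext => x; rewrite (dcC q p); ring.
  apply: (tot_dc3 H); rewrite /= !inE !negb_or ![q == p]eq_sym.
  by rewrite pq qs qr ps prr rs.
have N3 : 0 <= N ^+ 3 by rewrite exprn_ge0 ?(ltW N0).
have stepN : `|N ^+ 4 * (2 * tot N (fun x => pr h p q x * pr h r s x * didi p q r s x))| <=
    8 * k ^+ 4 * L ^+ 5 * N.
  rewrite tW (_ : N ^+ 4 * _ = N ^+ 3 * (N * tot N (fun x => P x * G x))); last by ring.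
  rewrite normrM (ger0_norm N3).
  apply: le_trans (ler_wpM2l N3 step) _.
  rewrite tE; have L1 := pp_L H.
  have c1 : N ^+ 2 * (4 * (L ^+ 2 * k ^+ 4) * (E1 / 2)) <= 4 * (L ^+ 2 * k ^+ 4) * L ^+ 2.
    by apply: (Nk_bound H); [rewrite !mulr_ge0 ?exprn_ge0 | rewrite ler_pdivrMr// mulrC].
  have dk (E : R) : E <= k * (L / N) ^+ 3 -> N ^+ 3 * (L * k ^+ 3 * E) <= L * k ^+ 4 * L ^+ 3.
    move=> hE; apply: le_trans (_ : N ^+ 3 * (L * k ^+ 4 * (L / N) ^+ 3) <= _).
      rewrite ler_wpM2l// (_ : L * k ^+ 4 * _ = L * k ^+ 3 * (k * (L / N) ^+ 3)); last by ring.
      by rewrite ler_wpM2l// mulr_ge0 ?exprn_ge0.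
    by apply: (Nk_bound H) => //; rewrite !mulr_ge0 ?exprn_ge0.
  have c2 := dk _ hE2; have c3 := dk _ hE3.
  have c4 : N ^+ 3 * (L ^+ 2 * k ^+ 4 * E4) <= L ^+ 2 * k ^+ 4 * L ^+ 3.
    by apply: (Nk_bound H) => //; rewrite !mulr_ge0 ?exprn_ge0.
  have c5 : N ^+ 3 * (L ^+ 2 * k ^+ 4 * E5) <= L ^+ 2 * k ^+ 4 * L ^+ 3.
    by apply: (Nk_bound H) => //; rewrite !mulr_ge0 ?exprn_ge0.
  have k4 : 0 <= k ^+ 4 by rewrite exprn_ge0.
  have p4 : k ^+ 4 * L ^+ 4 <= k ^+ 4 * L ^+ 5.
    by rewrite ler_wpM2l// [leRHS]exprS ler_peMl// exprn_ge0.
  clearbody E1 E2 E3 E4 E5.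
  have -> : N ^+ 3 * (2 * L ^+ 2 * k ^+ 4 * E1 +
      N * (L * k ^+ 3 * E2 + L * k ^+ 3 * E3 + L ^+ 2 * k ^+ 4 * E4 + L ^+ 2 * k ^+ 4 * E5)) =
      (N ^+ 2 * (4 * (L ^+ 2 * k ^+ 4) * (E1 / 2)) + N ^+ 3 * (L * k ^+ 3 * E2) +
       N ^+ 3 * (L * k ^+ 3 * E3) + N ^+ 3 * (L ^+ 2 * k ^+ 4 * E4) +
       N ^+ 3 * (L ^+ 2 * k ^+ 4 * E5)) * N.
    by field.
  rewrite ler_wpM2r ?(ltW N0)//.
  apply: le_trans (lerD (lerD (lerD (lerD c1 c2) c3) c4) c5) _.
  rewrite (_ : _ + _ = 6 * (k ^+ 4 * L ^+ 4) + 2 * (k ^+ 4 * L ^+ 5)); last by ring.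
  by rewrite -[leRHS]mulrA; lra.
move: stepN; set W := tot N _.
rewrite (_ : N ^+ 4 * (2 * W) = 2 * (N ^+ 4 * W)); last by ring.
rewrite normrM (ger0_norm (ler0n _ 2)) -!mulrA.
by lra.
Qed.

End cycles.

(** * Entries and size of the short cycles *)

Section real_cycles.
Context {R : realType}.
Implicit Types (k : R).

Lemma norm_prM4 k (u v w z e f g : R) : 0 <= k -> `|u| <= k * e -> `|v| <= k * f -> `|w| <= k * g ->
  `|z| <= k -> `|u * (v * (w * z))| <= k ^+ 4 * (e * (f * g)).
Proof.
move=> k0 h1 h2 h3 h4; rewrite (_ : k ^+ 4 * _ = (k * e) * ((k * f) * ((k * g) * k))).
  by do 3 (apply: norm_prM => //).
by ring.
Qed.

Lemma norm_prM3 k (u v z e f : R) : `|u| <= k * e -> `|v| <= k * f -> `|z| <= k ->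
  `|u * (v * z)| <= k ^+ 3 * (e * f).
Proof.
move=> h1 h2 h3; rewrite (_ : k ^+ 3 * _ = (k * e) * ((k * f) * k)); last by ring.
by do 2 (apply: norm_prM => //).
Qed.

(** The half trace of a four-cycle without its two alternating products D I D I: each term contains
    at most one factor [I]. *)
Definition mix4 (s1 s2 s3 s4 d1 d2 d3 d4 i1 i2 i3 i4 : R) : R :=
  s1 * (s2 * (s3 * s4)) + 2^-1 * (
  d1 * (s3 * (s4 * i2)) + d1 * (s2 * (s4 * i3)) + d1 * (s2 * (s3 * i4)) +
  d2 * (s3 * (s4 * i1)) + d2 * (s1 * (s4 * i3)) + d2 * (s1 * (s3 * i4)) +
  d3 * (s2 * (s4 * i1)) + d3 * (s1 * (s4 * i2)) + d3 * (s1 * (s2 * i4)) +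
  d4 * (s2 * (s3 * i1)) + d4 * (s1 * (s3 * i2)) + d4 * (s1 * (s2 * i3))).

(** In each term three distinct edges carry a decaying factor, and three edges of a four-cycle form
    a path through all its points. A path receives three terms of weight 1 / 2 and possibly the
    product of the four [S], hence less than 3. *)
Lemma norm_mix4 k (s1 s2 s3 s4 d1 d2 d3 d4 i1 i2 i3 i4 e1 e2 e3 e4 : R) : 0 <= k ->
  `|s1| <= k * e1 -> `|s2| <= k * e2 -> `|s3| <= k * e3 -> `|s4| <= k * e4 ->
  `|d1| <= k * e1 -> `|d2| <= k * e2 -> `|d3| <= k * e3 -> `|d4| <= k * e4 ->
  `|i1| <= k -> `|i2| <= k -> `|i3| <= k -> `|i4| <= k -> `|s4| <= k ->
  0 <= e1 -> 0 <= e2 -> 0 <= e3 -> 0 <= e4 ->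
  `|mix4 s1 s2 s3 s4 d1 d2 d3 d4 i1 i2 i3 i4| <= 3 * k ^+ 4 *
   (e1 * (e2 * e3) + e2 * (e3 * e4) + e3 * (e4 * e1) + e4 * (e1 * e2)).
Proof.
move=> k0 S1 S2 S3 S4 D1 D2 D3 D4 I1 I2 I3 I4 S4' p1 p2 p3 p4.
have T0 := norm_prM4 k0 S1 S2 S3 S4'.
have T1 := norm_prM4 k0 D1 S3 S4 I2; have T2 := norm_prM4 k0 D1 S2 S4 I3.
have T3 := norm_prM4 k0 D1 S2 S3 I4; have T4 := norm_prM4 k0 D2 S3 S4 I1.
have T5 := norm_prM4 k0 D2 S1 S4 I3; have T6 := norm_prM4 k0 D2 S1 S3 I4.
have T7 := norm_prM4 k0 D3 S2 S4 I1; have T8 := norm_prM4 k0 D3 S1 S4 I2.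
have T9 := norm_prM4 k0 D3 S1 S2 I4; have T10 := norm_prM4 k0 D4 S2 S3 I1.
have T11 := norm_prM4 k0 D4 S1 S3 I2; have T12 := norm_prM4 k0 D4 S1 S2 I3.
have k4 : 0 <= k ^+ 4 by rewrite exprn_ge0.
rewrite /mix4.
have q1 : 0 <= k ^+ 4 * (e1 * (e2 * e3)) by rewrite !mulr_ge0.
have q2 : 0 <= k ^+ 4 * (e2 * (e3 * e4)) by rewrite !mulr_ge0.
have q3 : 0 <= k ^+ 4 * (e3 * (e4 * e1)) by rewrite !mulr_ge0.
have q4 : 0 <= k ^+ 4 * (e4 * (e1 * e2)) by rewrite !mulr_ge0.
have E1 : e1 * (e3 * e4) = e3 * (e4 * e1) by ring.
have E2 : e1 * (e2 * e4) = e4 * (e1 * e2) by ring.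
have E3 : e2 * (e1 * e4) = e4 * (e1 * e2) by ring.
have E4 : e2 * (e1 * e3) = e1 * (e2 * e3) by ring.
have E5 : e3 * (e2 * e4) = e2 * (e3 * e4) by ring.
have E6 : e3 * (e1 * e4) = e3 * (e4 * e1) by ring.
have E7 : e3 * (e1 * e2) = e1 * (e2 * e3) by ring.
have E8 : e4 * (e2 * e3) = e2 * (e3 * e4) by ring.
have E9 : e4 * (e1 * e3) = e3 * (e4 * e1) by ring.
rewrite ?E1 ?E2 ?E3 ?E4 ?E5 ?E6 ?E7 ?E8 ?E9 in T0 T1 T2 T3 T4 T5 T6 T7 T8 T9 T10 T11 T12.
have -> : 3 * k ^+ 4 * (e1 * (e2 * e3) + e2 * (e3 * e4) + e3 * (e4 * e1) + e4 * (e1 * e2)) =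
  3 * (k ^+ 4 * (e1 * (e2 * e3))) + 3 * (k ^+ 4 * (e2 * (e3 * e4))) +
  3 * (k ^+ 4 * (e3 * (e4 * e1))) + 3 * (k ^+ 4 * (e4 * (e1 * e2))) by ring.
move: q1 q2 q3 q4 T0 T1 T2 T3 T4 T5 T6 T7 T8 T9 T10 T11 T12.
move: (k ^+ 4 * (e1 * (e2 * e3))) (k ^+ 4 * (e2 * (e3 * e4))) (k ^+ 4 * (e3 * (e4 * e1)))
  (k ^+ 4 * (e4 * (e1 * e2))) => a b c d.
move: (s1 * (s2 * (s3 * s4))) (d1 * (s3 * (s4 * i2))) (d1 * (s2 * (s4 * i3)))
  (d1 * (s2 * (s3 * i4))) (d2 * (s3 * (s4 * i1))) (d2 * (s1 * (s4 * i3)))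
  (d2 * (s1 * (s3 * i4))) (d3 * (s2 * (s4 * i1))) (d3 * (s1 * (s4 * i2)))
  (d3 * (s1 * (s2 * i4))) (d4 * (s2 * (s3 * i1))) (d4 * (s1 * (s3 * i2)))
  (d4 * (s1 * (s2 * i3))) => t0 t1 t2 t3 t4 t5 t6 t7 t8 t9 t10 t11 t12.
rewrite !ler_norml => ? ? ? ? /andP[? ?] /andP[? ?] /andP[? ?] /andP[? ?] /andP[? ?] /andP[? ?]
  /andP[? ?] /andP[? ?] /andP[? ?] /andP[? ?] /andP[? ?] /andP[? ?] /andP[? ?].
by apply/andP; split; lra.
Qed.

Lemma norm_mix3 k (s1 s2 s3 d1 d2 d3 i1 i2 i3 e1 e2 e3 : R) : 0 <= k ->
  `|s1| <= k * e1 -> `|s2| <= k * e2 -> `|s3| <= k * e3 ->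
  `|d1| <= k * e1 -> `|d2| <= k * e2 -> `|d3| <= k * e3 ->
  `|i1| <= k -> `|i2| <= k -> `|i3| <= k -> `|s3| <= k ->
  0 <= e1 -> 0 <= e2 -> 0 <= e3 ->
  `|s1 * (s2 * s3) + 2^-1 * (d1 * (s3 * i2) + d1 * (s2 * i3) + d2 * (s3 * i1) +
    d2 * (s1 * i3) + d3 * (s2 * i1) + d3 * (s1 * i2))| <=
  2 * k ^+ 3 * (e1 * e2 + e2 * e3 + e3 * e1).
Proof.
move=> k0 S1 S2 S3 D1 D2 D3 I1 I2 I3 S3' p1 p2 p3.
have T0 := norm_prM3 S1 S2 S3'.
have T1 := norm_prM3 D1 S3 I2; have T2 := norm_prM3 D1 S2 I3.
have T3 := norm_prM3 D2 S3 I1; have T4 := norm_prM3 D2 S1 I3.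
have T5 := norm_prM3 D3 S2 I1; have T6 := norm_prM3 D3 S1 I2.
have k3 : 0 <= k ^+ 3 by rewrite exprn_ge0.
have q1 : 0 <= k ^+ 3 * (e1 * e2) by rewrite !mulr_ge0.
have q2 : 0 <= k ^+ 3 * (e2 * e3) by rewrite !mulr_ge0.
have q3 : 0 <= k ^+ 3 * (e3 * e1) by rewrite !mulr_ge0.
rewrite [e1 * e3]mulrC in T1; rewrite [e2 * e1]mulrC in T4; rewrite [e3 * e2]mulrC in T5.
have -> : 2 * k ^+ 3 * (e1 * e2 + e2 * e3 + e3 * e1) =
  2 * (k ^+ 3 * (e1 * e2)) + 2 * (k ^+ 3 * (e2 * e3)) + 2 * (k ^+ 3 * (e3 * e1)) by ring.
move: q1 q2 q3 T0 T1 T2 T3 T4 T5 T6.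
move: (k ^+ 3 * (e1 * e2)) (k ^+ 3 * (e2 * e3)) (k ^+ 3 * (e3 * e1)) => a b c.
move: (s1 * (s2 * s3)) (d1 * (s3 * i2)) (d1 * (s2 * i3)) (d2 * (s3 * i1))
  (d2 * (s1 * i3)) (d3 * (s2 * i1)) (d3 * (s1 * i2)) => t0 t1 t2 t3 t4 t5 t6.
rewrite !ler_norml => ? ? ? /andP[? ?] /andP[? ?] /andP[? ?] /andP[? ?] /andP[? ?] /andP[? ?]
  /andP[? ?].
by apply/andP; split; lra.
Qed.

Variables (S D I : R -> R).

Lemma cyc2E x y : cyc2 S D I x y = 2^-1 * (2 * S (x - y) * S (y - x) +
  D (x - y) * I (y - x) + I (x - y) * D (y - x)).
Proof. by rewrite /cyc2 /entries !mul_mx22 half_trace_mx22; congr (_ * _); ring. Qed.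

Lemma cyc3E x y z : cyc3 S D I x y z =
  let: (s1, s2, s3) := (S (x - y), S (y - z), S (z - x)) in
  let: (d1, d2, d3) := (D (x - y), D (y - z), D (z - x)) in
  let: (i1, i2, i3) := (I (x - y), I (y - z), I (z - x)) in
  s1 * (s2 * s3) + 2^-1 * (d1 * (s3 * i2) + d1 * (s2 * i3) + d2 * (s3 * i1) +
    d2 * (s1 * i3) + d3 * (s2 * i1) + d3 * (s1 * i2)).
Proof. by rewrite /cyc3 /entries !mul_mx22 half_trace_mx22; field. Qed.

Lemma cyc4E x y z t : cyc4 S D I x y z t =
  let: (s1, s2, s3, s4) := (S (x - y), S (y - z), S (z - t), S (t - x)) in
  let: (d1, d2, d3, d4) := (D (x - y), D (y - z), D (z - t), D (t - x)) in
  let: (i1, i2, i3, i4) := (I (x - y), I (y - z), I (z - t), I (t - x)) in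
  mix4 s1 s2 s3 s4 d1 d2 d3 d4 i1 i2 i3 i4 +
  2^-1 * (d1 * (i2 * (d3 * i4)) + d2 * (i3 * (d4 * i1))).
Proof. by rewrite /cyc4 /entries !mul_mx22 half_trace_mx22 /mix4; field. Qed.

End real_cycles.

(** * Contribution of the cycles of length three and four *)

Section cycle_bounds.
Context {R : realType} (S D I Q : R -> R) (k N : R) (h dh : R -> R) (L : R).
Hypothesis K : sine_kernel S D I Q k.
Hypothesis H : pair_potential N h dh L.
Notation V := (4.-tuple R).
Implicit Types (x : V) (a b c d p q r s : 'I_4) (u v t y z : R).

Let N0 : 0 < N := pp_N H.
Let k0 : 0 <= k. Proof. exact: le_trans ler01 (sk_k K). Qed.
Let L0 : 0 <= L. Proof. exact: le_trans ler01 (pp_L H). Qed.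
Let bh : bm h := bm_h H.
Let bS : bm S := bm_S K.
Let bD : bm D := bm_D K.
Let bI : bm I := bm_I K.
Let LN0 := LN_ge0 H.

Lemma bm_didiK p q r s : bm (didi D I p q r s).
Proof. exact: bm_didi K p q r s. Qed.

Lemma pr_S a b x : `|pr S a b x| <= k * dc a b x. Proof. exact: sk_S K _. Qed.
Lemma pr_D a b x : `|pr D a b x| <= k * dc a b x. Proof. exact: sk_D K _. Qed.
Lemma pr_I a b x : `|pr I a b x| <= k. Proof. exact: sk_I K _. Qed.
Lemma pr_h a b x : `|pr h a b x| <= L. Proof. exact: pp_h H _. Qed.

Lemma bm_path a b c d : bm (fun x => dc a b x * (dc b c x * dc c d x)).
Proof. by do 2 (apply: bmM; first exact: bm_dc); exact: bm_dc. Qed.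

(** Three links through four points leave one free variable: N ^ 4 (L / N) ^ 3 = L ^ 3 N. *)
Lemma tot_path_bound (f : V -> R) a b c d (C : R) : uniq [:: a; b; c; d] -> bm f -> 0 <= C ->
  (forall x, `|f x| <= C * (dc a b x * (dc b c x * dc c d x))) ->
  `|N ^+ 4 * tot N f| <= C * L ^+ 3 * N.
Proof.
move=> u4 bf C0 fC; rewrite normrM ger0_norm ?exprn_ge0 ?(ltW N0)//.
have bp := bm_path a b c d.
have h1 : `|tot N f| <= C * tot N (fun x => dc a b x * (dc b c x * dc c d x)).
  rewrite -(totZ N0 C bp); apply: (norm_tot N0) => //.
  by apply: bmM => //; exact: bm_cst.
have h2 := Nk_bound H C0 (tot_dc3 H u4).
have N4 : 0 <= N ^+ 4 by rewrite exprn_ge0 ?(ltW N0).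
apply: le_trans (ler_wpM2l N4 h1) _.
rewrite [N ^+ 4]exprSr mulrAC ler_wpM2r ?(ltW N0)//.
Qed.

Let B := 4 * k ^+ 4 * L ^+ 5 * N.

Lemma didi_decay (f : V -> R) p q r s : (forall u, `|I u| <= k * decay u) ->
  uniq [:: p; q; r; s] -> bm f -> (forall x, `|f x| <= L ^+ 2) ->
  `|N ^+ 4 * tot N (fun x => f x * didi D I p q r s x)| <= B.
Proof.
move=> Idec u4 bf fL.
apply: le_trans (tot_path_bound (C := L ^+ 2 * k ^+ 4) u4 _ _ _) _.
- by apply: bmM => //; exact: bm_didiK.
- by rewrite mulr_ge0 ?exprn_ge0.
- move=> x; rewrite -mulrA; apply: norm_prM => //.
  apply: norm_prM4 => //; [exact: pr_D | exact: Idec | exact: pr_D | exact: pr_I].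
- rewrite /B ler_wpM2r ?(ltW N0)//.
  have -> : L ^+ 2 * k ^+ 4 * L ^+ 3 = 1 * (k ^+ 4 * L ^+ 5) by ring.
  by rewrite -[leRHS]mulrA ler_wpM2r ?ler1n// mulr_ge0 ?exprn_ge0.
Qed.

Lemma hh_bound a b c d x : `|pr h a b x * pr h c d x| <= L ^+ 2.
Proof. by rewrite expr2; apply: norm_prM; exact: pr_h. Qed.

Lemma bm_hh a b c d : bm (fun x => pr h a b x * pr h c d x).
Proof. by apply: bmM; exact: bm_pr. Qed.

(** The lemmas [didi_A], [didi_B] and [didi_C] are the three positions of the two factors [h]
    relative to the cycle: on the edges with [D], on those with [I], and on the diagonals. Only in
    the first does the integration by parts meet [D] and h' on the same edge, which is why it needs
    the antisymmetry used in [didi_paired]. *)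
Lemma didi_A p q r s : uniq [:: p; q; r; s] ->
  `|N ^+ 4 * tot N (fun x => pr h p q x * pr h r s x * didi D I p q r s x)| <= B.
Proof.
move=> u4; case: (sk_alt K) => [Idec|dI]; last exact: (didi_paired K H dI u4).
by apply: didi_decay => //; [exact: bm_hh | exact: hh_bound].
Qed.

Lemma didi_B p q r s : uniq [:: p; q; r; s] ->
  `|N ^+ 4 * tot N (fun x => pr h q r x * pr h s p x * didi D I p q r s x)| <= B.
Proof.
move=> u4; case: (sk_alt K) => [Idec|dI].
  by apply: didi_decay => //; [exact: bm_hh | exact: hh_bound].
have [[pq prr ps qr qs] rs] := neq4 u4.
have := @didi_separated _ _ _ _ _ _ _ _ _ _ K H dI p q r s q
  (fun x => pr h s p x * pr I s p x) u4.
rewrite !inE eqxx orbT => /(_ isT).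
have -> : (fun x => pr h q r x * pr I q r x * pr D r s x * (pr D p q x *
    (pr h s p x * pr I s p x))) =
    (fun x => pr h q r x * pr h s p x * didi D I p q r s x).
  by apply/funext => x; rewrite /didi; ring.
apply.
- by apply: bmM; exact: bm_pr.
- by apply: indepM; apply: indep_pr; rewrite // eq_sym.
- by move=> x; apply: norm_prM; [exact: pr_h | exact: pr_I].
Qed.

Lemma didi_C p q r s : uniq [:: p; q; r; s] ->
  `|N ^+ 4 * tot N (fun x => pr h p r x * pr h q s x * didi D I p q r s x)| <= B.
Proof.
move=> u4; case: (sk_alt K) => [Idec|dI].
  by apply: didi_decay => //; [exact: bm_hh | exact: hh_bound].
have [[pq prr ps qr qs] rs] := neq4 u4.
have := @didi_separated _ _ _ _ _ _ _ _ _ _ K H dI p q r s p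
  (fun x => pr h q s x * pr I s p x) u4.
rewrite !inE eqxx => /(_ isT).
have -> : (fun x => pr h p r x * pr I q r x * pr D r s x * (pr D p q x *
    (pr h q s x * pr I s p x))) =
    (fun x => pr h p r x * pr h q s x * didi D I p q r s x).
  by apply/funext => x; rewrite /didi; ring.
apply.
- by apply: bmM; exact: bm_pr.
- by apply: indepM; apply: indep_pr; rewrite // eq_sym.
- by move=> x; apply: norm_prM; [exact: pr_h | exact: pr_I].
Qed.

Definition tc4 a b c d x := cyc4 S D I (tnth x a) (tnth x b) (tnth x c) (tnth x d).
Definition tc3 a b c x := cyc3 S D I (tnth x a) (tnth x b) (tnth x c).

Definition tmix a b c d x := mix4 (pr S a b x) (pr S b c x) (pr S c d x) (pr S d a x)
  (pr D a b x) (pr D b c x) (pr D c d x) (pr D d a x)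
  (pr I a b x) (pr I b c x) (pr I c d x) (pr I d a x).

Lemma tc4E a b c d x :
  tc4 a b c d x = tmix a b c d x + 2^-1 * (didi D I a b c d x + didi D I b c d a x).
Proof. by rewrite /tc4 cyc4E. Qed.

Lemma bm_tmix a b c d : bm (tmix a b c d).
Proof.
have bp f a' b' : bm f -> bm (fun x => pr f a' b' x) by exact: bm_pr.
by apply: bmD; [repeat (apply: bmM; first exact: bp); exact: bp |
  apply: bmM; [exact: bm_cst | do ! apply: bmD; repeat (apply: bmM; first exact: bp); exact: bp]].
Qed.

Lemma uniq4_rot a b c d : uniq [:: a; b; c; d] -> uniq [:: b; c; d; a].
Proof. by rewrite -(rot_uniq 1). Qed.

Lemma rest4_bound (f : V -> R) a b c d : uniq [:: a; b; c; d] -> bm f ->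
  (forall x, `|f x| <= L ^+ 2) ->
  `|N ^+ 4 * tot N (fun x => f x * tmix a b c d x)| <= 12 * k ^+ 4 * L ^+ 5 * N.
Proof.
move=> u1 bf fL; have u2 := uniq4_rot u1; have u3 := uniq4_rot u2; have u4 := uniq4_rot u3.
have bp := bm_path; have C0 : 0 <= 3 * k ^+ 4 * L ^+ 2 by rewrite !mulr_ge0 ?exprn_ge0.
pose G x := (dc a b x * (dc b c x * dc c d x) + dc b c x * (dc c d x * dc d a x)) +
  (dc c d x * (dc d a x * dc a b x) + dc d a x * (dc a b x * dc b c x)).
have bG : bm G by apply: bmD; apply: bmD; exact: bp.
have fG x : `|f x * tmix a b c d x| <= 3 * k ^+ 4 * L ^+ 2 * G x.
  have -> : 3 * k ^+ 4 * L ^+ 2 * G x = L ^+ 2 * (3 * k ^+ 4 *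
    (dc a b x * (dc b c x * dc c d x) + dc b c x * (dc c d x * dc d a x) +
     dc c d x * (dc d a x * dc a b x) + dc d a x * (dc a b x * dc b c x))) by rewrite /G; ring.
  apply: norm_prM => //; apply: norm_mix4 => //; try exact: pr_S; try exact: pr_D;
    try exact: pr_I; try exact: dc_ge0.
  exact: le_trans (pr_S _ _ x) (le_decay_k K _).
have tG : tot N G <= 4 * (L / N) ^+ 3.
  rewrite (totD N0); [|by apply: bmD; exact: bp..].
  rewrite (totD N0 (bp _ _ _ _) (bp _ _ _ _)) (totD N0 (bp _ _ _ _) (bp _ _ _ _)).
  have := tot_dc3 H u1; have := tot_dc3 H u2; have := tot_dc3 H u3; have := tot_dc3 H u4.
  lra.
rewrite normrM ger0_norm ?exprn_ge0 ?(ltW N0)//.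
have h1 : `|tot N (fun x => f x * tmix a b c d x)| <= 3 * k ^+ 4 * L ^+ 2 * 4 * (tot N G / 4).
  rewrite -[leRHS]mulrA [4 * _]mulrC divfK ?pnatr_eq0// -(totZ N0 _ bG).
  apply: (norm_tot N0) => //; first by apply: bmM => //; exact: bm_tmix.
  by apply: bmM => //; exact: bm_cst.
have h2 := @Nk_bound _ _ _ _ _ H (3 * k ^+ 4 * L ^+ 2 * 4) 3 (tot N G / 4).
have N4 : 0 <= N ^+ 4 by rewrite exprn_ge0 ?(ltW N0).
apply: le_trans (ler_wpM2l N4 h1) _.
rewrite [N ^+ 4]exprSr mulrAC ler_wpM2r ?(ltW N0)//.
apply: le_trans (h2 _ _) _; first by rewrite mulr_ge0.
  by rewrite ler_pdivrMr// mulrC.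
by rewrite le_eqVlt; apply/orP; left; apply/eqP; ring.
Qed.

(** The constant is 12 from [tmix] plus half of 4 + 4 from the two alternating products. *)
Lemma cyc4_bound (f : V -> R) a b c d : uniq [:: a; b; c; d] -> bm f ->
  (forall x, `|f x| <= L ^+ 2) ->
  `|N ^+ 4 * tot N (fun x => f x * didi D I a b c d x)| <= B ->
  `|N ^+ 4 * tot N (fun x => f x * didi D I b c d a x)| <= B ->
  `|N ^+ 4 * tot N (fun x => f x * tc4 a b c d x)| <= 16 * k ^+ 4 * L ^+ 5 * N.
Proof.
move=> u4 bf fL h1 h2; have h3 := rest4_bound u4 bf fL.
have b1 : bm (fun x => f x * tmix a b c d x) by apply: bmM => //; exact: bm_tmix.
have b2 : bm (fun x => f x * didi D I a b c d x) by apply: bmM => //; exact: bm_didiK.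
have b3 : bm (fun x => f x * didi D I b c d a x) by apply: bmM => //; exact: bm_didiK.
have -> : tot N (fun x => f x * tc4 a b c d x) = tot N (fun x => f x * tmix a b c d x) +
    2^-1 * (tot N (fun x => f x * didi D I a b c d x) + tot N (fun x => f x * didi D I b c d a x)).
  rewrite -(totD N0 b2 b3) -(totZ N0 _ (bmD b2 b3)).
  rewrite -(totD N0 b1); last by apply: bmM; [exact: bm_cst | exact: bmD].
  by congr (tot N _); apply/funext => x; rewrite tc4E; ring.
move: h1 h2 h3; rewrite /B.
set t1 := tot N _; set t2 := tot N _; set t3 := tot N _ => h1 h2 h3.
have -> : N ^+ 4 * (t3 + 2^-1 * (t1 + t2)) = N ^+ 4 * t3 + 2^-1 * (N ^+ 4 * t1) + 2^-1 * (N ^+ 4 * t2).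
  by ring.
have E (e : R) : e * k ^+ 4 * L ^+ 5 * N = e * (k ^+ 4 * L ^+ 5 * N) by rewrite !mulrA.
move: h1 h2 h3; rewrite !E; set z := k ^+ 4 * L ^+ 5 * N.
rewrite !ler_norml => /andP[? ?] /andP[? ?] /andP[? ?]; apply/andP; split; lra.
Qed.

Lemma cyc4_adj a b c d : uniq [:: a; b; c; d] ->
  `|N ^+ 4 * tot N (fun x => pr h a b x * pr h c d x * tc4 a b c d x)| <= 16 * k ^+ 4 * L ^+ 5 * N.
Proof.
move=> u4; apply: cyc4_bound => //; [exact: bm_hh | exact: hh_bound | exact: didi_A |].
have := didi_B (uniq4_rot u4); congr (`|_ * tot N _| <= _).
by apply/funext => x; rewrite [pr h c d x * _]mulrC.
Qed.

Lemma cyc4_adj2 a b c d : uniq [:: a; b; c; d] ->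
  `|N ^+ 4 * tot N (fun x => pr h b c x * pr h d a x * tc4 a b c d x)| <= 16 * k ^+ 4 * L ^+ 5 * N.
Proof.
move=> u4; apply: cyc4_bound => //; [exact: bm_hh | exact: hh_bound | exact: didi_B |].
exact: didi_A (uniq4_rot u4).
Qed.

Lemma cyc4_opp a b c d : uniq [:: a; b; c; d] ->
  `|N ^+ 4 * tot N (fun x => pr h a c x * pr h b d x * tc4 a b c d x)| <= 16 * k ^+ 4 * L ^+ 5 * N.
Proof.
move=> u4; apply: cyc4_bound => //; [exact: bm_hh | exact: hh_bound | exact: didi_C |].
have := didi_C (uniq4_rot u4); congr (`|_ * tot N _| <= _).
by apply/funext => x; rewrite (hC H c a) [pr h b d x * _]mulrC.
Qed.

Lemma bm_tc3 a b c : bm (tc3 a b c).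
Proof.
have bp f a' b' : bm f -> bm (fun x => pr f a' b' x) by exact: bm_pr.
rewrite (_ : tc3 a b c = fun x => pr S a b x * (pr S b c x * pr S c a x) + 2^-1 *
  (pr D a b x * (pr S c a x * pr I b c x) + pr D a b x * (pr S b c x * pr I c a x) +
   pr D b c x * (pr S c a x * pr I a b x) + pr D b c x * (pr S a b x * pr I c a x) +
   pr D c a x * (pr S b c x * pr I a b x) + pr D c a x * (pr S a b x * pr I b c x))).
  by apply: bmD; [repeat (apply: bmM; first exact: bp); exact: bp |
    apply: bmM; [exact: bm_cst | do ! apply: bmD; repeat (apply: bmM; first exact: bp); exact: bp]].
by apply/funext => x; rewrite /tc3 cyc3E.
Qed.

Lemma cyc3_bound (f : V -> R) a b c : a != b -> a != c -> b != c -> bm f ->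
  (forall x, `|f x| <= L ^+ 2) ->
  `|N ^+ 3 * tot N (fun x => f x * tc3 a b c x)| <= 6 * k ^+ 3 * L ^+ 4 * N.
Proof.
move=> ab ac bc bf fL.
have ba : b != a by rewrite eq_sym.
have ca : c != a by rewrite eq_sym.
have cb : c != b by rewrite eq_sym.
have bp a' b' c' : bm (fun x => dc a' b' x * dc b' c' x) by apply: bmM; exact: bm_dc.
pose G x := dc a b x * dc b c x + dc b c x * dc c a x + dc c a x * dc a b x.
have bG : bm G by do 2 (apply: bmD; last exact: bp); exact: bp.
have fG x : `|f x * tc3 a b c x| <= 2 * k ^+ 3 * L ^+ 2 * G x.
  have -> : 2 * k ^+ 3 * L ^+ 2 * G x = L ^+ 2 * (2 * k ^+ 3 * G x) by ring.
  rewrite /tc3 cyc3E; apply: norm_prM => //; apply: norm_mix3 => //; try exact: pr_S; try exact: pr_D;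
    try exact: pr_I; try exact: dc_ge0.
  exact: le_trans (pr_S _ _ x) (le_decay_k K _).
have tG : tot N G <= 3 * (L / N) ^+ 2.
  rewrite (totD N0 (bmD (bp _ _ _) (bp _ _ _)) (bp _ _ _)) (totD N0 (bp _ _ _) (bp _ _ _)).
  have := tot_dc2 H ab ac bc; have := tot_dc2 H bc ba ca; have := tot_dc2 H ca cb ab.
  lra.
rewrite normrM ger0_norm ?exprn_ge0 ?(ltW N0)//.
have h1 : `|tot N (fun x => f x * tc3 a b c x)| <= 2 * k ^+ 3 * L ^+ 2 * 3 * (tot N G / 3).
  rewrite -[leRHS]mulrA [3 * _]mulrC divfK ?pnatr_eq0// -(totZ N0 _ bG).
  apply: (norm_tot N0) => //; first by apply: bmM => //; exact: bm_tc3.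
  by apply: bmM => //; exact: bm_cst.
have h2 := @Nk_bound _ _ _ _ _ H (2 * k ^+ 3 * L ^+ 2 * 3) 2 (tot N G / 3).
have N4 : 0 <= N ^+ 3 by rewrite exprn_ge0 ?(ltW N0).
apply: le_trans (ler_wpM2l N4 h1) _.
rewrite [N ^+ 3]exprSr mulrAC ler_wpM2r ?(ltW N0)//.
apply: le_trans (h2 _ _) _; first by rewrite !mulr_ge0 ?exprn_ge0.
  by rewrite ler_pdivrMr// mulrC.
by rewrite le_eqVlt; apply/orP; left; apply/eqP; ring.
Qed.

End cycle_bounds.

(** * The truncated two-point function as an approximate identity *)

Section approximate_identity.
Context {R : realType} (S D I Q : R -> R) (k N : R) (h dh : R -> R) (L : R).
Hypothesis K : sine_kernel S D I Q k.
Hypothesis H : pair_potential N h dh L.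
Notation V := (4.-tuple R).
Implicit Types (x : V) (a b c d p q r s : 'I_4) (u v t y z : R).

Let N0 : 0 < N := pp_N H.
Let k0 : 0 <= k. Proof. exact: le_trans ler01 (sk_k K). Qed.
Let L0 : 0 <= L. Proof. exact: le_trans ler01 (pp_L H). Qed.
Let bh : bm h := bm_h H.
Let bdh : bm dh := pp_bdh H.
Let bd : bm (@decay R) := @bm_decay R.
Let LN0 := LN_ge0 H.

Definition trunc2 u := S u ^+ 2 - D u * I u.

Lemma cyc2_trunc2 y z : cyc2 S D I y z = trunc2 (y - z).
Proof.
rewrite cyc2E -[z - y]opprB (sk_SN K) (sk_DN K) (sk_IN K) /trunc2.
by field.
Qed.

Lemma bm_trunc2 : bm trunc2.
Proof.
by apply: bmB; [apply: bmX; exact: bm_S K | apply: bmM; [exact: bm_D K | exact: bm_I K]].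
Qed.

Lemma trunc2N u : trunc2 (- u) = trunc2 u.
Proof. by rewrite /trunc2 (sk_SN K) (sk_DN K) (sk_IN K) mulrNN. Qed.

Lemma bm_half_sg : bm (fun u : R => Num.sg u / 2).
Proof.
split; first by apply: measurable_funM; [exact: measurable_sg | exact: measurable_cst].
exists 1 => u; rewrite normrM normr_sg (_ : `|2^-1| = 2^-1 :> R); last by rewrite ger0_norm.
by case: (u != 0); rewrite ?mul1r ?mul0r// invf_le1 ?ler1n.
Qed.

Lemma bm_Q : bm Q.
Proof.
split; first by apply: continuous_measurable_fun => u; exact: dv_cts (sk_dQ K u).
have [_ [C sC]] := bm_half_sg.
exists (k + C) => u; rewrite -[Q u](subrK (Num.sg u / 2)) (le_trans (ler_normD _ _))// lerD//.
exact: le_trans (sk_Q K u) (le_decay_k K u).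
Qed.

Lemma by_parts_Q (x y : R) : 0 <= y <= N ->
  N * mean N (fun z => h (x - z) * trunc2 (z - y)) =
  h (x - N) * Q (N - y) - h x * Q (- y) + N * mean N (fun z => dh (x - z) * Q (z - y)).
Proof.
move=> yN; have bQ := bm_Q.
have b1 : bm (fun z => h (x - z) * trunc2 (z - y)).
  by apply: bmM; [exact: bm_flip | apply: bm_shift; exact: bm_trunc2].
have b2 : bm (fun z => - dh (x - z) * Q (z - y)).
  by apply: bmM; [apply: bmN; exact: bm_flip | exact: bm_shift].
have b3 : bm (fun z => dh (x - z) * Q (z - y)).
  by apply: bmM; [exact: bm_flip | exact: bm_shift].
have E : N * mean N (fun z => - dh (x - z) * Q (z - y) + h (x - z) * trunc2 (z - y)) =
    h (x - N) * Q (N - y) - h x * Q (- y).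
  rewrite /mean mulVKf ?lt0r_neq0//.
  have -> : h x * Q (- y) = h (x - 0) * Q (0 - y) by rewrite subr0 sub0r.
  apply: (@dv_ftc _ _ (fun z => h (x - z) * Q (z - y))); first exact: ltW.
    move=> t; apply: dvM; first by apply: dv_flip; exact: pp_dh H _.
    by apply: dv_shift; exact: sk_dQ K _.
  move=> t; apply: cvgD; apply: cvgM.
  - by apply: cvgN; exact: (continuous_flip (pp_cdh H)).
  - by apply: (@continuous_shift _ Q) => u; exact: dv_cts (sk_dQ K u).
  - exact: (continuous_flip (pp_ch H)).
  - exact: (continuous_shift (sk_cT K)).
rewrite -E (meanD N0 b2 b1).
have -> : mean N (fun z => - dh (x - z) * Q (z - y)) = - mean N (fun z => dh (x - z) * Q (z - y)).
  have := meanZ N0 (-1) b3; rewrite mulN1r => <-.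
  by congr (mean N _); apply/funext => z; rewrite mulNr mulN1r.
ring.
Qed.

Lemma int_dh (x a b : R) : a <= b ->
  \int[lebesgue_measure]_(z in `[a, b]) dh (x - z) = h (x - a) - h (x - b).
Proof.
move=> ab; rewrite (@dv_ftc _ _ (fun z => - h (x - z)) _ _ ab) ?opprK 1?addrC//.
  by move=> t; rewrite -[dh _]opprK; apply: dvN; apply: dv_flip; exact: pp_dh H _.
exact: continuous_flip (pp_cdh H).
Qed.

(** Half the sign is to the Dirac mass what [Q] is to [trunc2]. Integrated against h', it reproduces
    [h] exactly, up to boundary values that combine by periodicity. *)
Lemma int_dh_sg (x y : R) : 0 <= y <= N ->
  N * mean N (fun z => dh (x - z) * (Num.sg (z - y) / 2)) = h (x - y) - h x.
Proof.
move=> /andP[y0 yN]; rewrite /mean mulVKf ?lt0r_neq0//.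
pose f z := dh (x - z) * (Num.sg (z - y) / 2).
have bf : bm f by apply: bmM; [exact: bm_flip | exact: bm_shift y bm_half_sg].
have ib (a b : R) : lebesgue_measure.-integrable `[a, b] (EFin \o f).
  have [mf [C fC]] := bf; apply: measurable_bounded_integrable => //.
  - by rewrite /= lebesgue_measure_itv /=; case: ifP => _; rewrite ?ltry// -EFinD ltry.
  - exact: measurable_funS mf.
  - exists C; split; first exact: num_real.
    by move=> c bc z _; rewrite /= (le_trans (fC z))// ltW.
have ic (c a b : R) : lebesgue_measure.-integrable `[a, b] (EFin \o (fun z => c * dh (x - z))).
  apply: (@continuous_itv_integrable _ (fun z => c * dh (x - z))) => z.
  by apply: cvgM; [exact: cvg_cst | exact: (continuous_flip (pp_cdh H))].
have idh (a b : R) : lebesgue_measure.-integrable `[a, b] (EFin \o (fun z => dh (x - z))).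
  by apply: continuous_itv_integrable; exact: continuous_flip (pp_cdh H).
have E1 : \int[lebesgue_measure]_(z in `[0, y]) f z = - (h x - h (x - y)) / 2.
  rewrite -Rintegral_itv_bndo_bndc; last first.
    by apply: integrableS (ib 0 y) => //; exact: subset_itv_co_cc.
  have -> : \int[lebesgue_measure]_(z in `[0, y[) f z =
      \int[lebesgue_measure]_(z in `[0, y[) (- 2^-1 * dh (x - z)).
    apply: eq_Rintegral => z; rewrite inE /= in_itv /= => /andP[_ zy].
    by rewrite /f ltr0_sg ?subr_lt0//; ring.
  rewrite Rintegral_itv_bndo_bndc; last first.
    by apply: integrableS (ic (- 2^-1) 0 y) => //; exact: subset_itv_co_cc.
  rewrite RintegralZl ?int_dh ?subr0//; ring.
have E2 : \int[lebesgue_measure]_(z in `]y, N]) f z = (h (x - y) - h (x - N)) / 2.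
  have -> : \int[lebesgue_measure]_(z in `]y, N]) f z =
      \int[lebesgue_measure]_(z in `]y, N]) (2^-1 * dh (x - z)).
    apply: eq_Rintegral => z; rewrite inE /= in_itv /= => /andP[zy _].
    by rewrite /f gtr0_sg ?subr_gt0//; ring.
  rewrite Rintegral_itv_obnd_cbnd; last first.
    by apply: integrableS (ic 2^-1 y N) => //; exact: subset_itv_oc_cc.
  rewrite RintegralZl ?int_dh//; ring.
have := @Rintegral_itvB _ f (BLeft 0) (BRight N) y (ib 0 N).
rewrite !bnd_simp y0 yN => /(_ isT isT); rewrite E1 E2 => E.
rewrite -[LHS](subrK (- (h x - h (x - y)) / 2)) E.
have -> : h (x - N) = h x by rewrite -[in RHS](subrK N x) (pp_per H).
by field.
Qed.

(** The kernel of G (1 - T), in the notation of the overview. *)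
Definition approx_err (x y : R) := h (x - y) - N * mean N (fun z => h (x - z) * trunc2 (z - y)).

(** Subtracting the identities for [Q] and for half the sign leaves h' against Q - sg / 2, which
    decays; the other terms are localised at the ends of the interval. *)
Lemma approx_errP (x y : R) : 0 <= y <= N -> `|approx_err x y| <=
  L * (k * (decay (N - y) + decay y)) + N * mean N (fun z => `|dh (x - z)| * (k * decay (z - y))).
Proof.
move=> yN; have /andP[y0 yN'] := yN; have bQ := bm_Q; have bs := bm_half_sg.
(* At v = 0 the sign is 0 and not 1, so this case rests on Q 0 = 0 and k >= 1. *)
have Qk v : 0 <= v -> `|Q v - 2^-1| <= k * decay v.
  rewrite le_eqVlt => /predU1P[<-|v0]; last by have := sk_Q K v; rewrite gtr0_sg// div1r.
  have -> : Q 0 = 0.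
    by have := sk_QN K 0; rewrite oppr0 => /eqP; rewrite -subr_eq0 opprK -mulr2n mulrn_eq0 => /eqP.
  rewrite sub0r normrN ger0_norm// /decay expr0n addr0 sqrtr1 invr1 mulr1.
  by apply: le_trans (sk_k K); rewrite invf_le1 ?ler1n.
pose g z := dh (x - z) * (Q (z - y) - Num.sg (z - y) / 2).
have bg : bm g.
  by apply: bmM; [exact: bm_flip | apply: bmB; [exact: bm_shift y bQ | exact: bm_shift y bs]].
have bsg : bm (fun z => dh (x - z) * (Num.sg (z - y) / 2)).
  by apply: bmM; [exact: bm_flip | exact: bm_shift y bs].
have E : approx_err x y = - h x * ((Q (N - y) - 2^-1) + (Q y - 2^-1)) - N * mean N g.
  rewrite /approx_err by_parts_Q//.
  have -> : mean N (fun z => dh (x - z) * Q (z - y)) = mean N g +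
      mean N (fun z => dh (x - z) * (Num.sg (z - y) / 2)).
    rewrite -(meanD N0 bg bsg); congr (mean N _); apply/funext => z; rewrite /g; ring.
  rewrite mulrDr int_dh_sg//.
  have -> : h (x - N) = h x by rewrite -[in RHS](subrK N x) (pp_per H).
  by rewrite (sk_QN K); field.
rewrite E (le_trans (ler_normB _ _))//; apply: lerD.
  apply: norm_prM; first by rewrite normrN; exact: pp_h H _.
  rewrite mulrDr (le_trans (ler_normD _ _))//; apply: lerD; apply: Qk => //.
  by rewrite subr_ge0.
rewrite normrM gtr0_norm// ler_wpM2l ?(ltW N0)//.
apply: le_trans (norm_mean N0 bg) _; apply: (le_mean N0); first exact: bm_norm.
  apply: bmM; first by apply: bm_norm; exact: bm_flip.
  by apply: bmM; [exact: bm_cst | exact: bm_shift].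
by move=> z _; rewrite normrM ler_wpM2l//; exact: sk_Q K _.
Qed.

(** [approx_err] between the points [a] and [b] as a function on the box, with the spare coordinate
    [c] as integration variable. *)
Definition terr a b c x := pr h a b x - N * avg N c (fun x => pr h a c x * pr trunc2 c b x) x.
Definition bterr a b c x := L * (k * (decay (N - tnth x b) + decay (tnth x b))) +
  N * avg N c (fun x => adh dh a c x * (k * dc c b x)) x.

Let bhT a c b : bm (fun x => pr h a c x * pr trunc2 c b x).
Proof. by apply: bmM; apply: bm_pr => //; exact: bm_trunc2. Qed.

Let baT a c b : bm (fun x => adh dh a c x * (k * dc c b x)).
Proof. by apply: bmM; [exact: bm_adh H _ _ | apply: bmZ; exact: bm_dc]. Qed.

Lemma bm_terr a b c : bm (terr a b c).
Proof. by apply: bmB; [exact: bm_pr | apply: bmZ; exact: bm_avg]. Qed.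

Lemma bm_bterr a b c : bm (bterr a b c).
Proof. by apply: bmD; [do 2 apply: bmZ; exact: bm_edges | apply: bmZ; exact: bm_avg]. Qed.

Lemma terr_le a b c x : a != c -> b != c -> cube N x -> `|terr a b c x| <= bterr a b c x.
Proof.
move=> ac bc cx; have := @approx_errP (tnth x a) (tnth x b) (cx b).
rewrite /approx_err /terr /bterr /avg; congr (`|_ - N * mean N _| <= _ + N * mean N _);
  apply/funext => z; rewrite /adh /dc /pr !tnth_upd eqxx (negbTE ac) (negbTE bc)//.
Qed.

Lemma bterr_le a b c x : a != c -> b != c -> cube N x -> bterr a b c x <= 3 * (k * L).
Proof.
move=> ac bc cx; rewrite /bterr.
have h1 := decay_le1 (N - tnth x b); have h2 := decay_le1 (tnth x b).
have e1 : L * (k * (decay (N - tnth x b) + decay (tnth x b))) <= L * (k * 2).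
  by rewrite !ler_wpM2l//; lra.
have ca : c != a by rewrite eq_sym.
have e2 : N * avg N c (fun x => adh dh a c x * (k * dc c b x)) x <= k * L.
  have : avg N c (fun x => adh dh a c x * (k * dc c b x)) x <= avg N c (fun x => k * adh dh c a x) x.
    apply: (le_avg N0) => //; first by apply: bmZ; exact: bm_adh H _ _.
    move=> z cz; rewrite (adhC H a c) mulrC ler_wpM2r ?adh_ge0//.
    exact: (le_decay_k K).
  rewrite -(ler_pM2l N0) => /le_trans; apply.
  rewrite /avg (meanZ N0 k (bm_slice c x (bm_adh H c a))) mulrCA ler_wpM2l//.
  have := pp_int_dh H (cx a); congr (N * mean N _ <= _); apply/funext => t.
  by rewrite /adh /pr !tnth_upd eqxx ![_ == c]eq_sym (negbTE ca).
lra.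
Qed.

(** In a product of two errors, one is bounded pointwise by [bterr_le] and the other on average as
    here, which gains a factor L / N. *)
Lemma tot_bterr a b c : a != c -> b != c -> a != b -> tot N (bterr a b c) <= 3 * (k * L) * (L / N).
Proof.
move=> ac bc ab.
have ca : c != a by rewrite eq_sym.
have cb : c != b by rewrite eq_sym.
have b1 := bm_edges (R := R) N b; have b2 := bm_avg N0 c (baT a c b).
rewrite /bterr (totD N0); [|by do 2 apply: bmZ | exact: bmZ].
rewrite (totZ N0); last exact: bmZ.
rewrite (totZ N0 k b1) (totZ N0 N b2) (tot_avg N0 c (baT a c b)).
have h1 : tot N (fun x => decay (N - tnth x b) + decay (tnth x b)) <= 2 * (L / N).
  have := leaf_edges H (a := b) (bm_cst _ 1) (fun _ _ => ler01) (@indep_cst R b 1).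
  rewrite tot_cst// mulr1; congr (tot N _ <= _).
  by apply/funext => x; rewrite mulr1.
have h2 : N * tot N (fun x => adh dh a c x * (k * dc c b x)) <= k * L * (L / N).
  have -> : (fun x => adh dh a c x * (k * dc c b x)) = (fun x => k * (dc b c x * adh dh a c x)).
    by apply/funext => x; rewrite (dcC b c); ring.
  have bb : bm (fun x => dc b c x * adh dh a c x) by apply: bmM; [exact: bm_dc | exact: bm_adh H _ _].
  rewrite (totZ N0 k bb).
  have ba : b != a by rewrite eq_sym.
  have := leaf_dc H bc (bm_adh H a c) (fun x _ => adh_ge0 _ _ _ x) (indep_adh dh ba bc).
  have := tot_adh H ac => h3 h4.
  have h5 : tot N (fun x => dc b c x * adh dh a c x) <= L / N * (L / N).
    by apply: le_trans h4 _; rewrite ler_wpM2l.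
  rewrite mulrCA -mulrA ler_wpM2l//.
  rewrite -(@ler_pM2l _ N) // in h5; apply: le_trans h5 _.
  by rewrite le_eqVlt; apply/orP; left; apply/eqP; field; rewrite lt0r_neq0.
have h3 : L * (k * tot N (fun x => decay (N - tnth x b) + decay (tnth x b))) <= 2 * (k * L) * (L / N).
  rewrite (_ : 2 * (k * L) * (L / N) = L * (k * (2 * (L / N)))); last by ring.
  by rewrite !ler_wpM2l.
lra.
Qed.

Lemma indep_avg i j (f : V -> R) : indep i f -> indep i (avg N j f).
Proof.
move=> fi; have [->|ij] := eqVneq i j; first exact: avg_indep.
move=> x t; rewrite /avg; congr (mean N _); apply/funext => s.
by rewrite updC// fi.
Qed.

Lemma tot_avg_l i (f g : V -> R) : bm f -> bm g -> indep i g ->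
  tot N (fun x => avg N i f x * g x) = tot N (fun x => f x * g x).
Proof.
move=> bf bg gi; rewrite -[RHS](tot_avg N0 i); last exact: bmM.
by apply: eq_tot => // x cx; rewrite avg_pull.
Qed.

(* [2 * Tr (G (1 - T) G (1 - T))] is what remains of the terms of order [N ^ 2]. *)
Lemma eterm a b c d : uniq [:: a; b; c; d] ->
  `|N ^+ 2 * tot N (fun x => pr h a b x * pr h b a x)
    - N ^+ 3 * tot N (fun x => pr h a b x * (pr h b d x * pr trunc2 d a x))
    - N ^+ 3 * tot N (fun x => pr h a c x * pr trunc2 c b x * pr h b a x)
    + N ^+ 4 * tot N (fun x => pr h a c x * pr trunc2 c b x * (pr h b d x * pr trunc2 d a x))|
  <= 9 * k ^+ 2 * L ^+ 3 * N.
Proof.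
move=> /neq4[[ab ac ad bc bd'] cd].
have ba : b != a by rewrite eq_sym.
have ca : c != a by rewrite eq_sym.
have cb : c != b by rewrite eq_sym.
have da : d != a by rewrite eq_sym.
have db : d != b by rewrite eq_sym.
have dc' : d != c by rewrite eq_sym.
pose A x := pr h a c x * pr trunc2 c b x.
pose A' x := pr h b d x * pr trunc2 d a x.
have bA : bm A := bhT a c b; have bA' : bm A' := bhT b d a.
have bvA := bm_avg N0 c bA; have bvA' := bm_avg N0 d bA'.
have b1 : bm (pr h a b) by exact: bm_pr.
have b2 : bm (pr h b a) by exact: bm_pr.
have idA : indep d A by apply: indepM; exact: indep_pr.
have icA' : indep c A' by apply: indepM; exact: indep_pr.
(* Expanding the product of two errors gives the four terms. As [c] and [d] each occur in one error
   only, averaging them inside it or with the rest is the same. *)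
have E : N ^+ 2 * tot N (fun x => terr a b c x * terr b a d x) =
   N ^+ 2 * tot N (fun x => pr h a b x * pr h b a x)
    - N ^+ 3 * tot N (fun x => pr h a b x * A' x)
    - N ^+ 3 * tot N (fun x => A x * pr h b a x)
    + N ^+ 4 * tot N (fun x => A x * A' x).
  have t1 : tot N (fun x => pr h a b x * avg N d A' x) = tot N (fun x => pr h a b x * A' x).
    have -> : (fun x => pr h a b x * avg N d A' x) = (fun x => avg N d A' x * pr h a b x).
      by apply/funext => x; rewrite mulrC.
    rewrite tot_avg_l//; last exact: indep_pr.
    by congr (tot N _); apply/funext => x; rewrite mulrC.
  have t2 : tot N (fun x => avg N c A x * pr h b a x) = tot N (fun x => A x * pr h b a x).
    by rewrite tot_avg_l//; exact: indep_pr.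
  have t3 : tot N (fun x => avg N c A x * avg N d A' x) = tot N (fun x => A x * A' x).
    rewrite tot_avg_l//; last exact: indep_avg.
    have -> : (fun x => A x * avg N d A' x) = (fun x => avg N d A' x * A x).
      by apply/funext => x; rewrite mulrC.
    rewrite tot_avg_l//.
    by congr (tot N _); apply/funext => x; rewrite mulrC.
  have c1 := bmM b1 b2; have c2 := bmM b1 bvA'; have c3 := bmM bvA b2; have c4 := bmM bvA bvA'.
  have -> : tot N (fun x => terr a b c x * terr b a d x) =
      tot N (fun x => pr h a b x * pr h b a x) - N * tot N (fun x => pr h a b x * avg N d A' x)
      - N * tot N (fun x => avg N c A x * pr h b a x)
      + N ^+ 2 * tot N (fun x => avg N c A x * avg N d A' x).
    rewrite -(totZ N0 _ c2) -(totZ N0 _ c3) -(totZ N0 _ c4).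
    rewrite -(totB N0 c1 (bmZ N c2)) -(totB N0 (bmB c1 (bmZ N c2)) (bmZ N c3)).
    rewrite -(totD N0 (bmB (bmB c1 (bmZ N c2)) (bmZ N c3)) (bmZ _ c4)).
    by congr (tot N _); apply/funext => x; rewrite /terr -/A -/A'; ring.
  rewrite t1 t2 t3; ring.
rewrite -E normrM ger0_norm ?exprn_ge0 ?(ltW N0)//.
have kL : 0 <= 3 * (k * L) by rewrite !mulr_ge0.
have step : `|tot N (fun x => terr a b c x * terr b a d x)| <= 3 * (k * L) * tot N (bterr a b c).
  rewrite -(totZ N0 _ (bm_bterr a b c)); apply: (norm_tot N0).
  - by apply: bmM; exact: bm_terr.
  - by apply: bmZ; exact: bm_bterr.
  - move=> x cx; rewrite mulrC; apply: norm_prM; last exact: terr_le.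
    exact: le_trans (terr_le bd' ad cx) (bterr_le bd' ad cx).
have N2 : 0 <= N ^+ 2 by rewrite exprn_ge0 ?(ltW N0).
apply: le_trans (ler_wpM2l N2 (le_trans step (ler_wpM2l kL (tot_bterr ac bc ab)))) _.
rewrite le_eqVlt; apply/orP; left; apply/eqP.
by field; rewrite lt0r_neq0.
Qed.

End approximate_identity.

(** * The variance of a smooth pair statistic *)

Definition i0 : 'I_4 := @Ordinal 4 0 isT.
Definition i1 : 'I_4 := @Ordinal 4 1 isT.
Definition i2 : 'I_4 := @Ordinal 4 2 isT.
Definition i3 : 'I_4 := @Ordinal 4 3 isT.

Section variance.
Context {R : realType} (S D I Q : R -> R) (k N : R) (h dh : R -> R) (L : R).
Hypothesis K : sine_kernel S D I Q k.
Hypothesis H : pair_potential N h dh L.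
Notation V := (4.-tuple R).
Implicit Types (x : V) (a b c d p q r s : 'I_4).

Let N0 : 0 < N := pp_N H.
Let k0 : 0 <= k. Proof. exact: le_trans ler01 (sk_k K). Qed.
Let L0 : 0 <= L. Proof. exact: le_trans ler01 (pp_L H). Qed.
Let bh : bm h := bm_h H.
Notation TT := (trunc2 S D I).
Let bT : bm TT := bm_trunc2 K.

Fixpoint all_bm (s : seq (R * (V -> R))) : Prop :=
  if s is p :: s' then bm p.2 /\ all_bm s' else True.
(** Reified linear combinations, so that linearity of [tot] is applied once to all 24 terms of a
    four-point function. *)
Definition lin (s : seq (R * (V -> R))) x : R := foldr (fun (p : R * (V -> R)) y => p.1 * p.2 x + y) 0 s.

Lemma tot_lin (s : seq (R * (V -> R))) : all_bm s -> bm (lin s) /\ tot N (lin s) = foldr (fun (p : R * (V -> R)) y => p.1 * tot N p.2 + y) 0 s.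
Proof.
elim: s => [_|[c f] s IH /= [bf /IH[bs E]]].
  by split; [exact: bm_cst | rewrite /lin /= tot_cst].
split; first by apply: bmD => //; exact: bmZ.
by rewrite -E -(totZ N0 _ bf) -(totD N0 (bmZ _ bf) bs).
Qed.

Lemma tot_isolated i j (F : V -> R) : i != j -> bm F -> indep i F ->
  tot N (fun x => pr h i j x * F x) = 0.
Proof.
move=> ij bF iF; apply: (tot_mean0 N0 (i := i)) => //; first exact: bm_pr.
by move=> x cx; rewrite avg_pr// (pp_mean0 H).
Qed.

Lemma enum_I4 : enum 'I_4 = [:: i0; i1; i2; i3].
Proof. by apply: (inj_map val_inj); rewrite val_enum_ord. Qed.

(** Averages over disjoint sets of coordinates factorise, which is behind the cancellation of the
    squared two-point term. *)
Lemma tot_prod (f g : V -> R) : bm f -> bm g -> indep i2 f -> indep i3 f -> indep i0 g -> indep i1 g ->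
  tot N (fun x => f x * g x) = tot N f * tot N g.
Proof.
move=> bf bg f2 f3 g0 g1.
have b3 := bm_avg N0 i3 bg; have b2 := bm_avg N0 i2 b3.
pose G := avg N i2 (avg N i3 g).
have G0 : indep i0 G by do 2 apply: indep_avg.
have G1 : indep i1 G by do 2 apply: indep_avg.
have e3 : avg N i3 (fun x => f x * g x) = fun x => avg N i3 g x * f x.
  apply/funext => x; rewrite -(avg_pull N0 x bg f3); congr (avg N _ _ _).
  by apply/funext => y; rewrite mulrC.
have e2 : avg N i2 (avg N i3 (fun x => f x * g x)) = fun x => f x * G x.
  by rewrite e3; apply/funext => x; rewrite (avg_pull N0 x b3 f2) mulrC.
have e1 : avg N i1 (fun x => f x * G x) = fun x => avg N i1 f x * G x.
  by apply/funext => x; rewrite (avg_pull N0 x bf G1).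
have bf1 := bm_avg N0 i1 bf.
rewrite /tot enum_I4 /= e2 e1 (avg_pull N0 _ bf1 G0); congr (_ * _).
  have <- : f = avg N i3 f by apply/funext => x; rewrite avg_id.
  by have <- : f = avg N i2 f by apply/funext => x; rewrite avg_id.
have -> : avg N i1 (avg N i2 (avg N i3 g)) = G by apply/funext => x; rewrite avg_id.
by rewrite avg_id.
Qed.

Lemma prTC a b x : pr TT a b x = pr TT b a x.
Proof. by rewrite /pr -opprB (trunc2N K). Qed.

Definition tri a b c x := pr h a b x * (pr h a c x * pr TT b c x).

Lemma bm_tri a b c : bm (tri a b c).
Proof. by do 2 (apply: bmM; first exact: bm_pr); exact: bm_pr. Qed.

Lemma triC a b c x : tri a b c x = tri a c b x.
Proof. by rewrite /tri prTC mulrCA. Qed.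

Lemma tot_tri_swap i j a b c : tot N (tri (tperm i j a) (tperm i j b) (tperm i j c)) = tot N (tri a b c).
Proof.
have E : tri (tperm i j a) (tperm i j b) (tperm i j c) = fun x => tri a b c (swap i j x).
  apply/funext => x; rewrite /tri /pr.
  have sw l : tnth x (tperm i j l) = tnth (swap i j x) l.
    rewrite tnth_swap; case: tpermP => [->|->|/eqP li /eqP lj].
    - by rewrite eqxx; case: eqP => // ->.
    - by rewrite eqxx.
    - by rewrite (negbTE li) (negbTE lj).
  by rewrite !sw.
by rewrite E (tot_swap N0 (bm_tri a b c)) // -E; exact: bm_tri.
Qed.

Lemma tot_hh_swap i j a b : tot N (fun x => pr h (tperm i j a) (tperm i j b) x ^+ 2) =
  tot N (fun x => pr h a b x ^+ 2).
Proof.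
have b1 a' b' : bm (fun x => pr h a' b' x ^+ 2) by apply: bmX; exact: bm_pr.
have E : (fun x => pr h (tperm i j a) (tperm i j b) x ^+ 2) = fun x => pr h a b (swap i j x) ^+ 2.
  apply/funext => x; rewrite /pr.
  have sw l : tnth x (tperm i j l) = tnth (swap i j x) l.
    rewrite tnth_swap; case: tpermP => [->|->|/eqP li /eqP lj].
    - by rewrite eqxx; case: eqP => // ->.
    - by rewrite eqxx.
    - by rewrite (negbTE li) (negbTE lj).
  by rewrite !sw.
by rewrite E (tot_swap N0 (b1 a b)) // -E; exact: b1.
Qed.

Lemma tot_tri a b c : (a, b, c) \in [:: (i2, i1, i3); (i1, i0, i2); (i3, i1, i2); (i1, i0, i3)] ->
  tot N (tri a b c) = tot N (tri i0 i1 i2).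
Proof.
have tE (i j l : 'I_4) : tperm i j l = if l == i then j else if l == j then i else l.
  by case: tpermP => [->|->|/eqP/negbTE-> /eqP/negbTE->//]; rewrite eqxx//; case: eqP.
have triE a' b' c' : tot N (tri a' b' c') = tot N (tri a' c' b').
  by congr (tot N _); apply/funext => x; rewrite triC.
rewrite !inE => /or4P[] /eqP[-> -> ->].
- by rewrite -(tot_tri_swap i0 i2) -(tot_tri_swap i2 i3) !tE.
- by rewrite -(tot_tri_swap i0 i1) !tE.
- by rewrite -(tot_tri_swap i0 i3) !tE.
- by rewrite -(tot_tri_swap i0 i1) -(tot_tri_swap i2 i3) !tE.
Qed.

Lemma tot_h2 a : a \in [:: i2; i3] ->
  tot N (fun x => pr h i1 a x ^+ 2) = tot N (fun x => pr h i0 i1 x ^+ 2).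
Proof.
have tE (i j l : 'I_4) : tperm i j l = if l == i then j else if l == j then i else l.
  by case: tpermP => [->|->|/eqP/negbTE-> /eqP/negbTE->//]; rewrite eqxx//; case: eqP.
rewrite !inE => aI; rewrite -(tot_hh_swap i0 a) !tE.
have -> : (if i1 == i0 then a else if i1 == a then i0 else i1) = i1.
  by case/orP: aI => /eqP ->.
have -> : (if a == i0 then a else if a == a then i0 else a) = i0.
  by rewrite eqxx; case: eqP.
by congr (tot N _); apply/funext => x; rewrite (hC H).
Qed.

Notation Tc3 := (tc3 S D I).
Notation Tc4 := (tc4 S D I).

Definition rho2 x := corr2 S D I (tnth x i0) (tnth x i1).
Definition rho3 x := corr3 S D I (tnth x i0) (tnth x i1) (tnth x i2).
Definition rho4 x := corr4 S D I (tnth x i0) (tnth x i1) (tnth x i2) (tnth x i3).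

Let h01 := pr h i0 i1.
Let h02 := pr h i0 i2.
Let h23 := pr h i2 i3.
Let b01 : bm h01. Proof. exact: bm_pr. Qed.
Let b02 : bm h02. Proof. exact: bm_pr. Qed.
Let b23 : bm h23. Proof. exact: bm_pr. Qed.
Let bTp a b : bm (pr TT a b). Proof. exact: bm_pr. Qed.
Let bt3 a b c : bm (Tc3 a b c). Proof. exact: bm_tc3 K a b c. Qed.
Let bhh : bm (fun x => h01 x * h23 x). Proof. exact: bmM. Qed.
Let bhh' : bm (fun x => h01 x * h02 x). Proof. exact: bmM. Qed.

Lemma bm_tc4 a b c d : bm (Tc4 a b c d).
Proof.
rewrite (_ : Tc4 a b c d = fun x => tmix S D I a b c d x +
  2^-1 * (didi D I a b c d x + didi D I b c d a x)); last by apply/funext => x; rewrite tc4E.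
apply: bmD; first exact: bm_tmix K a b c d.
by apply: bmZ; apply: bmD; exact: bm_didi K _ _ _ _.
Qed.

Lemma indep_tc3 i a b c : i != a -> i != b -> i != c -> indep i (Tc3 a b c).
Proof.
move=> ia ib ic x t.
by rewrite /tc3 !tnth_upd ![_ == i]eq_sym (negbTE ia) (negbTE ib) (negbTE ic).
Qed.

Lemma tot_iso0 (F : V -> R) : bm F -> indep i0 F -> tot N (fun x => h01 x * h23 x * F x) = 0.
Proof.
move=> bF iF; have := @tot_isolated i0 i1 (fun x => h23 x * F x) isT (bmM b23 bF).
rewrite /h01 => <-; last by apply: indepM => //; exact: indep_pr.
by congr (tot N _); apply/funext => x; rewrite mulrA.
Qed.

Lemma tot_iso1 (F : V -> R) : bm F -> indep i1 F -> tot N (fun x => h01 x * h23 x * F x) = 0.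
Proof.
move=> bF iF; have := @tot_isolated i1 i0 (fun x => h23 x * F x) isT (bmM b23 bF).
move=> <-; last by apply: indepM => //; exact: indep_pr.
by congr (tot N _); apply/funext => x; rewrite mulrA /h01 (hC H).
Qed.

Lemma tot_iso2 (F : V -> R) : bm F -> indep i2 F -> tot N (fun x => h01 x * h23 x * F x) = 0.
Proof.
move=> bF iF; have := @tot_isolated i2 i3 (fun x => h01 x * F x) isT (bmM b01 bF).
move=> <-; last by apply: indepM => //; exact: indep_pr.
by congr (tot N _); apply/funext => x; rewrite mulrA [_ * h01 x]mulrC.
Qed.

Lemma tot_iso3 (F : V -> R) : bm F -> indep i3 F -> tot N (fun x => h01 x * h23 x * F x) = 0.
Proof.
move=> bF iF; have := @tot_isolated i3 i2 (fun x => h01 x * F x) isT (bmM b01 bF).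
move=> <-; last by apply: indepM => //; exact: indep_pr.
by congr (tot N _); apply/funext => x; rewrite mulrA [_ * h01 x]mulrC /h23 (hC H).
Qed.

Definition rem4 := tot N (fun x => h01 x * h23 x * Tc4 i0 i1 i2 i3 x)
 + tot N (fun x => h01 x * h23 x * Tc4 i0 i1 i3 i2 x)
 + tot N (fun x => h01 x * h23 x * Tc4 i0 i2 i1 i3 x)
 + tot N (fun x => h01 x * h23 x * Tc4 i0 i2 i3 i1 x)
 + tot N (fun x => h01 x * h23 x * Tc4 i0 i3 i1 i2 x)
 + tot N (fun x => h01 x * h23 x * Tc4 i0 i3 i2 i1 x).

(** Each variable lies in exactly one of the two factors [h], so a term survives only if its cycles
    of length at least 2 cover all four indices. Among the products of two transpositions, the one
    aligned with the two factors [h] splits into a square. *)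
Lemma tot_rho4 : tot N (fun x => h01 x * h23 x * rho4 x) =
  tot N (fun x => h01 x * pr TT i0 i1 x) ^+ 2
  + tot N (fun x => h01 x * h23 x * (pr TT i0 i2 x * pr TT i1 i3 x))
  + tot N (fun x => h01 x * h23 x * (pr TT i0 i3 x * pr TT i1 i2 x)) - rem4.
Proof.
pose g (F : V -> R) x := h01 x * h23 x * F x.
pose s : seq (R * (V -> R)) := [:: (1, g (fun=> 1));
  (-1, g (pr TT i0 i1)); (-1, g (pr TT i0 i2)); (-1, g (pr TT i0 i3));
  (-1, g (pr TT i1 i2)); (-1, g (pr TT i1 i3)); (-1, g (pr TT i2 i3));
  (1, g (Tc3 i0 i1 i2)); (1, g (Tc3 i0 i2 i1)); (1, g (Tc3 i0 i1 i3)); (1, g (Tc3 i0 i3 i1));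
  (1, g (Tc3 i0 i2 i3)); (1, g (Tc3 i0 i3 i2)); (1, g (Tc3 i1 i2 i3)); (1, g (Tc3 i1 i3 i2));
  (1, g (fun x => pr TT i0 i1 x * pr TT i2 i3 x)); (1, g (fun x => pr TT i0 i2 x * pr TT i1 i3 x));
  (1, g (fun x => pr TT i0 i3 x * pr TT i1 i2 x));
  (-1, g (Tc4 i0 i1 i2 i3)); (-1, g (Tc4 i0 i1 i3 i2)); (-1, g (Tc4 i0 i2 i1 i3));
  (-1, g (Tc4 i0 i2 i3 i1)); (-1, g (Tc4 i0 i3 i1 i2)); (-1, g (Tc4 i0 i3 i2 i1))].
have bg F : bm F -> bm (g F) by move=> bF; exact: bmM.
have bs : all_bm s.
  split; first exact/bg/bm_cst.
  do 6 (split; first exact/bg/bTp).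
  do 8 (split; first exact/bg/bt3).
  do 3 (split; first by apply: bg; apply: bmM; exact: bTp).
  by do 6 (split; first exact/bg/bm_tc4).
have -> : (fun x => h01 x * h23 x * rho4 x) = lin s.
  apply/funext => x; rewrite /lin /s /= /g /rho4 /corr4 !(cyc2_trunc2 K) /tc3 /tc4 /pr /=; ring.
have z0 F : bm F -> indep i0 F -> tot N (g F) = 0 by exact: tot_iso0.
have z1 F : bm F -> indep i1 F -> tot N (g F) = 0 by exact: tot_iso1.
have z2 F : bm F -> indep i2 F -> tot N (g F) = 0 by exact: tot_iso2.
have z3 F : bm F -> indep i3 F -> tot N (g F) = 0 by exact: tot_iso3.
have zT a b : tot N (g (pr TT a b)) = 0.
  have [/andP[? ?]|n0] := boolP ((i0 != a) && (i0 != b)); first by apply: z0; [exact: bTp | exact: indep_pr].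
  have [/andP[? ?]|n1] := boolP ((i1 != a) && (i1 != b)); first by apply: z1; [exact: bTp | exact: indep_pr].
  have [/andP[? ?]|n2] := boolP ((i2 != a) && (i2 != b)); first by apply: z2; [exact: bTp | exact: indep_pr].
  exfalso; move: n0 n1 n2; rewrite !negb_and !negbK.
  by case: a => [[|[|[|[|//]]]] ?]; case: b => [[|[|[|[|//]]]] ?].
have zC a b c : tot N (g (Tc3 a b c)) = 0.
  have zz i : i != a -> i != b -> i != c -> indep i (Tc3 a b c) by exact: indep_tc3.
  have [/and3P[? ? ?]|n0] := boolP [&& i0 != a, i0 != b & i0 != c]; first by apply: z0; [exact: bt3 | exact: zz].
  have [/and3P[? ? ?]|n1] := boolP [&& i1 != a, i1 != b & i1 != c]; first by apply: z1; [exact: bt3 | exact: zz].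
  have [/and3P[? ? ?]|n2] := boolP [&& i2 != a, i2 != b & i2 != c]; first by apply: z2; [exact: bt3 | exact: zz].
  apply: z3; [exact: bt3 |].
  have [/and3P[? ? ?]|n3] := boolP [&& i3 != a, i3 != b & i3 != c]; first exact: zz.
  exfalso; move: n0 n1 n2 n3 {zz}; rewrite !negb_and !negbK.
  by case: a => [[|[|[|[|//]]]] ?]; case: b => [[|[|[|[|//]]]] ?]; case: c => [[|[|[|[|//]]]] ?].
have zP : tot N (g (fun x => pr TT i0 i1 x * pr TT i2 i3 x)) = tot N (fun x => h01 x * pr TT i0 i1 x) ^+ 2.
  have f2 i : i \in [:: i2; i3] -> indep i (fun x => h01 x * pr TT i0 i1 x).
    by rewrite !inE => /orP[] /eqP ->; apply: indepM; exact: indep_pr.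
  have f3 i : i \in [:: i0; i1] -> indep i (fun x => h23 x * pr TT i2 i3 x).
    by rewrite !inE => /orP[] /eqP ->; apply: indepM; exact: indep_pr.
  have -> : g (fun x => pr TT i0 i1 x * pr TT i2 i3 x) =
      fun x => (h01 x * pr TT i0 i1 x) * (h23 x * pr TT i2 i3 x).
    by apply/funext => x; rewrite /g; ring.
  have b1 : bm (fun x => h01 x * pr TT i0 i1 x) by exact: bmM.
  have b2 : bm (fun x => h23 x * pr TT i2 i3 x) by exact: bmM.
  rewrite (tot_prod b1 b2); [|exact: f2|exact: f2|exact: f3|exact: f3].
  rewrite expr2; congr (_ * _).
  (* Exchanging 0 with 2 and then 1 with 3 carries the first pair to the second, so both factors are
     equal. *)
  have bs1 := @bm_swap R 4 i0 i2 _ b1.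
  rewrite -(tot_swap N0 b1 bs1).
  have b3 : bm (fun x => pr h i2 i1 x * pr TT i2 i1 x) by apply: bmM => //; exact: bm_pr.
  have -> : (fun x => h01 (swap i0 i2 x) * pr TT i0 i1 (swap i0 i2 x)) =
      (fun x => pr h i2 i1 x * pr TT i2 i1 x).
    by apply/funext => x; rewrite /h01 /pr !tnth_swap /=.
  rewrite -(tot_swap N0 b3 (@bm_swap R 4 i1 i3 _ b3)).
  by congr (tot N _); apply/funext => x; rewrite /h23 /pr !tnth_swap /=.
have z1' : tot N (g (fun=> 1)) = 0 by apply: z0; [exact: bm_cst | exact: indep_cst].
have [_ ->] := tot_lin bs.
rewrite /s /= z1' !zT !zC zP /rem4 -/(g _).
move: (tot N (g (Tc4 i0 i1 i2 i3))) (tot N (g (Tc4 i0 i1 i3 i2))) (tot N (g (Tc4 i0 i2 i1 i3)))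
 (tot N (g (Tc4 i0 i2 i3 i1))) (tot N (g (Tc4 i0 i3 i1 i2))) (tot N (g (Tc4 i0 i3 i2 i1))).
rewrite /g => *; ring.
Qed.

(** Here [x_0] lies in both factors [h], so only the indices 1 and 2 need be covered: their
    transposition survives besides the 3-cycles. *)
Lemma tot_rho3 : tot N (fun x => h01 x * h02 x * rho3 x) =
  tot N (fun x => h01 x * h02 x * Tc3 i0 i1 i2 x) + tot N (fun x => h01 x * h02 x * Tc3 i0 i2 i1 x)
  - tot N (tri i0 i1 i2).
Proof.
pose g (F : V -> R) x := h01 x * h02 x * F x.
pose s : seq (R * (V -> R)) := [:: (1, g (fun=> 1));
  (-1, g (pr TT i0 i1)); (-1, g (pr TT i0 i2)); (-1, g (pr TT i1 i2));
  (1, g (Tc3 i0 i1 i2)); (1, g (Tc3 i0 i2 i1))].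
have bg F : bm F -> bm (g F) by move=> bF; exact: bmM.
have bs : all_bm s.
  split; first exact/bg/bm_cst.
  do 3 (split; first exact/bg/bTp).
  by do 2 (split; first exact/bg/bt3).
have -> : (fun x => h01 x * h02 x * rho3 x) = lin s.
  apply/funext => x; rewrite /lin /s /= /g /rho3 /corr3 !(cyc2_trunc2 K) /tc3 /pr /=; ring.
have z1 F : bm F -> indep i1 F -> tot N (g F) = 0.
  move=> bF iF; have := @tot_isolated i1 i0 (fun x => h02 x * F x) isT (bmM b02 bF).
  move=> <-; last by apply: indepM => //; exact: indep_pr.
  by congr (tot N _); apply/funext => x; rewrite mulrA /g /h01 (hC H i0).
have z2 F : bm F -> indep i2 F -> tot N (g F) = 0.
  move=> bF iF; have := @tot_isolated i2 i0 (fun x => h01 x * F x) isT (bmM b01 bF).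
  move=> <-; last by apply: indepM => //; exact: indep_pr.
  by congr (tot N _); apply/funext => x; rewrite /g mulrA (hC H i2) [_ * h01 x]mulrC.
have e1 : tot N (g (fun=> 1)) = 0 by apply: z1; [exact: bm_cst | exact: indep_cst].
have e2 : tot N (g (pr TT i0 i1)) = 0 by apply: z2; [exact: bTp | exact: indep_pr].
have e3 : tot N (g (pr TT i0 i2)) = 0 by apply: z1; [exact: bTp | exact: indep_pr].
have e4 : tot N (g (pr TT i1 i2)) = tot N (tri i0 i1 i2).
  by congr (tot N _); apply/funext => x; rewrite /g /tri mulrA.
have [_ ->] := tot_lin bs.
rewrite /s /= e1 e2 e3 e4 /g; ring.
Qed.

Lemma tot_rho2 (f : V -> R) : bm f -> tot N (fun x => f x * rho2 x) =
  tot N f - tot N (fun x => f x * pr TT i0 i1 x).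
Proof.
move=> bf; have b2 : bm (fun x => f x * pr TT i0 i1 x) by exact: bmM.
rewrite -(totB N0 bf b2); congr (tot N _); apply/funext => x.
by rewrite /rho2 /corr2 (cyc2_trunc2 K) /pr mulrBr mulr1.
Qed.

(** The second moment sorted by the coincidences between two ordered pairs, none, one (4 ways) or
    two (2 ways), minus the squared expectation; [Ex_psum_variance] identifies it with the
    variance. *)
Definition pair_variance := N ^+ 4 * tot N (fun x => h01 x * h23 x * rho4 x)
  + 4 * (N ^+ 3 * tot N (fun x => h01 x * h02 x * rho3 x))
  + 2 * (N ^+ 2 * tot N (fun x => h01 x ^+ 2 * rho2 x))
  - (N ^+ 2 * tot N (fun x => h01 x * rho2 x)) ^+ 2.

(** The instances of [eterm] for the two ways of joining the pairs {0, 1} and {2, 3} by two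
    transpositions; relabelling brings the lower terms to common totals. *)
Let eterm' c d : c = i2 /\ d = i3 \/ c = i3 /\ d = i2 ->
  `|N ^+ 2 * tot N (fun x => h01 x ^+ 2) - 2 * (N ^+ 3 * tot N (tri i0 i1 i2))
    + N ^+ 4 * tot N (fun x => h01 x * h23 x * (pr TT i0 c x * pr TT i1 d x))|
  <= 9 * k ^+ 2 * L ^+ 3 * N.
Proof.
move=> cd.
have u4 : uniq [:: i1; c; i0; d] by case: cd => -[-> ->].
have := eterm K H u4.
have -> : tot N (fun x => pr h i1 c x * pr h c i1 x) = tot N (fun x => h01 x ^+ 2).
  rewrite -(@tot_h2 c); last by case: cd => -[-> _].
  by congr (tot N _); apply/funext => x; rewrite (hC H c) expr2.
have -> : tot N (fun x => pr h i1 c x * (pr h c d x * pr TT d i1 x)) = tot N (tri i0 i1 i2).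
  have <- : tot N (tri c i1 d) = tot N (tri i0 i1 i2) by apply: tot_tri; case: cd => -[-> ->].
  by congr (tot N _); apply/funext => x; rewrite /tri (hC H c i1) (prTC i1 d).
have -> : tot N (fun x => pr h i1 i0 x * pr TT i0 c x * pr h c i1 x) = tot N (tri i0 i1 i2).
  have <- : tot N (tri i1 i0 c) = tot N (tri i0 i1 i2) by apply: tot_tri; case: cd => -[-> _].
  by congr (tot N _); apply/funext => x; rewrite /tri (hC H c i1); ring.
have -> : tot N (fun x => pr h i1 i0 x * pr TT i0 c x * (pr h c d x * pr TT d i1 x)) =
    tot N (fun x => h01 x * h23 x * (pr TT i0 c x * pr TT i1 d x)).
  congr (tot N _); apply/funext => x; rewrite (prTC d) /h01 (hC H i0) /h23.
  have -> : pr h i2 i3 x = pr h c d x by case: cd => -[-> ->] //; exact: hC H _ _ _.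
  ring.
by congr (`|_| <= _); ring.
Qed.

Lemma tot_h2T : `|N ^+ 2 * tot N (fun x => h01 x ^+ 2 * pr TT i0 i1 x)| <= 2 * k ^+ 2 * L ^+ 3 * N.
Proof.
have bd : bm (dc i0 i1 : V -> R) by exact: bm_dc.
have Tb u : `|TT u| <= 2 * k ^+ 2 * decay u.
  have d1 := decay_le1 u; have S1 := sk_S K u.
  have S2 : `|S u| <= k by exact: le_trans S1 (le_decay_k K u).
  rewrite (le_trans (ler_normB _ _))// (_ : 2 * k ^+ 2 * decay u = k * decay u * k + k * decay u * k); last by ring.
  apply: lerD; first by rewrite expr2; apply: norm_prM.
  by apply: norm_prM; [exact: sk_D K _ | exact: sk_I K _].
have step : `|tot N (fun x => h01 x ^+ 2 * pr TT i0 i1 x)| <= L ^+ 2 * (2 * k ^+ 2) * (L / N).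
  apply: (@le_trans _ _ (tot N (fun x => L ^+ 2 * (2 * k ^+ 2) * dc i0 i1 x))).
    apply: (norm_tot N0).
    - by apply: bmM; [exact: bmX | exact: bTp].
    - exact: bmZ.
    - move=> x _; rewrite -mulrA; apply: norm_prM; last exact: Tb.
      by rewrite normrX lerXn2r ?nnegrE// ?(pp_h H).
  rewrite (totZ N0 _ bd) ler_wpM2l ?mulr_ge0 ?exprn_ge0//.
  exact: (tot_dc H).
rewrite normrM ger0_norm ?exprn_ge0 ?(ltW N0)//.
have N2 : 0 <= N ^+ 2 by rewrite exprn_ge0 ?(ltW N0).
apply: le_trans (ler_wpM2l N2 step) _.
by rewrite le_eqVlt; apply/orP; left; apply/eqP; field; rewrite lt0r_neq0.
Qed.

(** In four of the six cycles 01 and 23 are opposite edges, in the other two they are the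
    diagonals. *)
Lemma norm_rem4 : `|N ^+ 4 * rem4| <= 96 * k ^+ 4 * L ^+ 5 * N.
Proof.
pose t a b c d := N ^+ 4 * tot N (fun x => h01 x * h23 x * Tc4 a b c d x).
have c1 : `|t i0 i1 i2 i3| <= 16 * k ^+ 4 * L ^+ 5 * N by exact: (cyc4_adj K H).
have c2 : `|t i0 i1 i3 i2| <= 16 * k ^+ 4 * L ^+ 5 * N.
  have := @cyc4_adj _ _ _ _ _ _ _ _ _ _ K H i0 i1 i3 i2 isT; congr (`|_ * tot N _| <= _).
  by apply/funext => x; rewrite (hC H i3).
have c3 : `|t i0 i2 i1 i3| <= 16 * k ^+ 4 * L ^+ 5 * N by exact: (cyc4_opp K H).
have c4 : `|t i0 i2 i3 i1| <= 16 * k ^+ 4 * L ^+ 5 * N.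
  have := @cyc4_adj2 _ _ _ _ _ _ _ _ _ _ K H i0 i2 i3 i1 isT; congr (`|_ * tot N _| <= _).
  by apply/funext => x; rewrite (hC H i1) [pr h i2 i3 x * _]mulrC.
have c5 : `|t i0 i3 i1 i2| <= 16 * k ^+ 4 * L ^+ 5 * N.
  have := @cyc4_opp _ _ _ _ _ _ _ _ _ _ K H i0 i3 i1 i2 isT; congr (`|_ * tot N _| <= _).
  by apply/funext => x; rewrite (hC H i3).
have c6 : `|t i0 i3 i2 i1| <= 16 * k ^+ 4 * L ^+ 5 * N.
  have := @cyc4_adj2 _ _ _ _ _ _ _ _ _ _ K H i0 i3 i2 i1 isT; congr (`|_ * tot N _| <= _).
  by apply/funext => x; rewrite (hC H i1) (hC H i3) [pr h i2 i3 x * _]mulrC.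
have -> : N ^+ 4 * rem4 = t i0 i1 i2 i3 + t i0 i1 i3 i2 + t i0 i2 i1 i3 + t i0 i2 i3 i1 + t i0 i3 i1 i2 + t i0 i3 i2 i1.
  by rewrite /rem4 /t; ring.
have -> : 96 * k ^+ 4 * L ^+ 5 * N = 6 * (16 * k ^+ 4 * L ^+ 5 * N) by ring.
move: (16 * k ^+ 4 * L ^+ 5 * N) c1 c2 c3 c4 c5 c6 => B.
rewrite !ler_norml => /andP[? ?] /andP[? ?] /andP[? ?] /andP[? ?] /andP[? ?] /andP[? ?].
by apply/andP; split; lra.
Qed.

Lemma variance_bound : `|pair_variance| <= 200 * k ^+ 4 * L ^+ 5 * N.
Proof.
have bh2 : bm (fun x => h01 x ^+ 2) by exact: bmX.
have e1 := @eterm' i2 i3 (or_introl (conj erefl erefl)); have e2 := @eterm' i3 i2 (or_intror (conj erefl erefl)).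
have e3 := tot_h2T; have e4 := norm_rem4.
have hb x : `|h01 x * h02 x| <= L ^+ 2 by exact: (hh_bound H).
have e5 := @cyc3_bound _ _ _ _ _ _ _ _ _ _ K H _ i0 i1 i2 isT isT isT bhh' hb.
have e6 := @cyc3_bound _ _ _ _ _ _ _ _ _ _ K H _ i0 i2 i1 isT isT isT bhh' hb.
rewrite /pair_variance tot_rho4 tot_rho3 (tot_rho2 bh2) (tot_rho2 b01).
have -> : tot N h01 = 0.
  have := @tot_isolated i0 i1 (fun=> 1) isT (bm_cst _ 1) (@indep_cst R i0 1).
  by move=> <-; congr (tot N _); apply/funext => x; rewrite mulr1.
set a2 := tot N (fun x => h01 x ^+ 2) in e1 e2 *.
set a2T := tot N (fun x => h01 x ^+ 2 * pr TT i0 i1 x) in e3 *.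
set a1T := tot N (fun x => h01 x * pr TT i0 i1 x).
set a3 := tot N (tri i0 i1 i2) in e1 e2 *.
set p1 := tot N (fun x => h01 x * h23 x * (pr TT i0 i2 x * pr TT i1 i3 x)) in e1 *.
set p2 := tot N (fun x => h01 x * h23 x * (pr TT i0 i3 x * pr TT i1 i2 x)) in e2 *.
set c1 := tot N (fun x => h01 x * h02 x * Tc3 i0 i1 i2 x) in e5 *.
set c2 := tot N (fun x => h01 x * h02 x * Tc3 i0 i2 i1 x) in e6 *.
have k1 := sk_k K; have L1 := pp_L H.
have powk m n : (m <= n)%N -> k ^+ m <= k ^+ n by move=> mn; exact: ler_weXn2l.
have powL m n : (m <= n)%N -> L ^+ m <= L ^+ n by move=> mn; exact: ler_weXn2l.
have kL m n : (m <= 4)%N -> (n <= 5)%N -> k ^+ m * L ^+ n * N <= k ^+ 4 * L ^+ 5 * N.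
  by move=> m4 n5; rewrite ler_wpM2r ?(ltW N0)// ler_pM ?exprn_ge0 ?powk ?powL.
have q1 := kL 2%N 3%N isT isT; have q2 := kL 3%N 4%N isT isT.
have q0 : 0 <= k ^+ 4 * L ^+ 5 * N by rewrite !mulr_ge0 ?exprn_ge0 ?(ltW N0).
(* The square of [a1T] cancels, and [a2], [a3], [p1], [p2] regroup into the two instances of
   [eterm']. The constants add up to 9 + 9 + 96 + 24 + 24 + 4, below 200. *)
have -> : N ^+ 4 * (a1T ^+ 2 + p1 + p2 - rem4) + 4 * (N ^+ 3 * (c1 + c2 - a3)) +
    2 * (N ^+ 2 * (a2 - a2T)) - (N ^+ 2 * (0 - a1T)) ^+ 2 =
  (N ^+ 2 * a2 - 2 * (N ^+ 3 * a3) + N ^+ 4 * p1) + (N ^+ 2 * a2 - 2 * (N ^+ 3 * a3) + N ^+ 4 * p2)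
  - N ^+ 4 * rem4 + 4 * (N ^+ 3 * c1) + 4 * (N ^+ 3 * c2) - 2 * (N ^+ 2 * a2T) by ring.
have r1 : 9 * k ^+ 2 * L ^+ 3 * N = 9 * (k ^+ 2 * L ^+ 3 * N) by ring.
have r2 : 2 * k ^+ 2 * L ^+ 3 * N = 2 * (k ^+ 2 * L ^+ 3 * N) by ring.
have r3 : 6 * k ^+ 3 * L ^+ 4 * N = 6 * (k ^+ 3 * L ^+ 4 * N) by ring.
have r4 : 96 * k ^+ 4 * L ^+ 5 * N = 96 * (k ^+ 4 * L ^+ 5 * N) by ring.
have -> : 200 * k ^+ 4 * L ^+ 5 * N = 200 * (k ^+ 4 * L ^+ 5 * N) by ring.
move: e1 e2 e3 e4 e5 e6; rewrite {}r1 {}r2 {}r3 {}r4; move: q0 q1 q2 {kL}.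
move: (k ^+ 4 * L ^+ 5 * N) (k ^+ 3 * L ^+ 4 * N) (k ^+ 2 * L ^+ 3 * N) => B1 B2 B3 q0 q1 q2.
move: (N ^+ 2 * a2 - 2 * (N ^+ 3 * a3) + N ^+ 4 * p1) (N ^+ 2 * a2 - 2 * (N ^+ 3 * a3) + N ^+ 4 * p2)
  (N ^+ 4 * rem4) (N ^+ 3 * c1) (N ^+ 3 * c2) (N ^+ 2 * a2T) => x1 x2 x3 x4 x5 x6.
rewrite !ler_norml => /andP[? ?] /andP[? ?] /andP[? ?] /andP[? ?] /andP[? ?] /andP[? ?].
by apply/andP; split; lra.
Qed.

End variance.

(** * The smoothed logarithmic potential *)

Section potential.
Context {R : realType} (N w : R).
Hypothesis N0 : 0 < N.
Hypothesis wN : w * N = pi *+ 2.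
Implicit Types (q u t y e M : R).

Lemma w_gt0 : 0 < w.
Proof. by rewrite -(pmulr_lgt0 _ N0) wN mulrn_wgt0// pi_gt0. Qed.

Lemma w_half : w * (N / 2) = pi.
Proof. by rewrite mulrA wN -[pi *+ 2]mulr_natr mulfK. Qed.

(** The squared modulus of 1 - q z for z = exp (i w u), so that [logpot] is ln |1 - q z|. *)
Definition psq q u := 1 - 2 * q * cos (w * u) + q ^+ 2.
Definition logpot q u := 2^-1 * ln (psq q u).
Definition dlogpot q u := 2^-1 * ((psq q u)^-1 * (2 * q * (sin (w * u) * w))).

Lemma psq_ge q u : 0 <= q -> (1 - q) ^+ 2 <= psq q u.
Proof.
move=> q0; have := cos_le1 (w * u); rewrite -subr_ge0 => c1.
by rewrite /psq -subr_ge0 (_ : _ - _ = 2 * q * (1 - cos (w * u))) ?mulr_ge0//; ring.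
Qed.

Lemma psq_le q u : 0 <= q -> psq q u <= (1 + q) ^+ 2.
Proof.
move=> q0; have := cos_geN1 (w * u); rewrite -subr_ge0 => c1.
by rewrite /psq -subr_ge0 (_ : _ - _ = 2 * q * (cos (w * u) - -1)) ?mulr_ge0//; ring.
Qed.

Lemma psq_gt0 q u : 0 <= q < 1 -> 0 < psq q u.
Proof.
by move=> /andP[q0 q1]; rewrite (lt_le_trans _ (psq_ge u q0))// exprn_gt0// subr_gt0.
Qed.

Lemma dv_logpot q u : 0 <= q < 1 -> dv (logpot q) u (dlogpot q u).
Proof.
move=> q01; have dP : dv (psq q) u (2 * q * (sin (w * u) * w)).
  apply: dv_eq.
    apply: (dvD (dvD (dv_cst 1 u) (dvN (dvM (dv_cst (2 * q) u) _))) (dv_cst (q ^+ 2) u)).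
    exact: dv_cos (dvM (dv_cst w u) (dv_id u)).
  by rewrite /=; ring.
have dL : dv (fun v => ln (psq q v)) u ((psq q u)^-1 * (2 * q * (sin (w * u) * w))).
  by apply: dv_ln => //; exact: psq_gt0.
by apply: dv_eq; [apply: dvM dL; exact: dv_cst | rewrite mul0r add0r].
Qed.

Lemma continuous_trig (f : R -> R) : continuous f -> continuous (fun u => f (w * u)).
Proof.
move=> cf u; apply: (@continuous_comp _ _ _ (fun u => w * u) f); last exact: cf.
by apply: cvgM; [exact: cvg_cst | exact: cvg_id].
Qed.

Lemma continuous_dlogpot q : 0 <= q < 1 -> continuous (dlogpot q).
Proof.
move=> q01 u; apply: cvgM; first exact: cvg_cst.
have cc : {for u, continuous (fun u => cos (w * u))} by apply: (continuous_trig (@continuous_cos R)).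
have cs : {for u, continuous (fun u => sin (w * u))} by apply: (continuous_trig (@continuous_sin R)).
apply: cvgM.
  apply: cvgV; first by rewrite lt0r_neq0// psq_gt0.
  apply: cvgD; last exact: cvg_cst.
  by apply: cvgB; [exact: cvg_cst | apply: cvgM => //; exact: cvg_cst].
by apply: cvgM; [exact: cvg_cst | apply: cvgM => //; exact: cvg_cst].
Qed.

Lemma bm_dlogpot q : 0 <= q < 1 -> bm (dlogpot q).
Proof.
move=> q01; split; first by apply: continuous_measurable_fun; exact: continuous_dlogpot.
have /andP[q0 q1] := q01.
exists (2^-1 * (((1 - q) ^+ 2)^-1 * (2 * q * (1 * w)))) => u.
have q2 : 0 <= 2 * q by rewrite mulr_ge0.
have h2 : 0 <= 2^-1 :> R by rewrite invr_ge0.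
rewrite /dlogpot normrM (ger0_norm h2) ler_wpM2l// normrM gtr0_norm ?invr_gt0 ?psq_gt0//.
apply: ler_pM.
- by rewrite invr_ge0 ltW// psq_gt0.
- exact: normr_ge0.
- by rewrite lef_pV2 ?psq_ge// posrE ?psq_gt0// exprn_gt0// subr_gt0.
- rewrite normrM (ger0_norm q2) ler_wpM2l// normrM (gtr0_norm w_gt0) ler_wpM2r ?(ltW w_gt0)//.
  by rewrite ler_norml sin_geN1 sin_le1.
Qed.

Lemma logpotN q u : logpot q (- u) = logpot q u.
Proof. by rewrite /logpot /psq mulrN cosN. Qed.

Lemma logpot_per q u : logpot q (u + N) = logpot q u.
Proof. by rewrite /logpot /psq mulrDr wN cosD2pi. Qed.

Lemma logpot_bound q u M : 0 <= q < 1 -> ln 2 <= M -> - ln (1 - q) <= M -> `|logpot q u| <= M.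
Proof.
move=> q01 M2 Mq; have /andP[q0 q1] := q01.
have d0 : 0 < 1 - q by rewrite subr_gt0.
have p0 := psq_gt0 u q01.
have h1 : ln ((1 - q) ^+ 2) <= ln (psq q u) by rewrite ler_ln ?posrE ?exprn_gt0// psq_ge.
have h2 : ln (psq q u) <= ln (2 ^+ 2).
  rewrite ler_ln ?posrE ?exprn_gt0//; apply: le_trans (psq_le u q0) _.
  by rewrite lerXn2r ?nnegrE ?addr_ge0//; lra.
rewrite lnXn// mulr2n in h1; rewrite lnXn// mulr2n in h2.
by rewrite /logpot ler_norml; apply/andP; split; lra.
Qed.

Definition Lpot q := primitive (logpot q).

Lemma continuous_logpot q : 0 <= q < 1 -> continuous (logpot q).
Proof. by move=> q01 u; exact: dv_cts (dv_logpot u q01). Qed.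

Lemma dv_Lpot q u : 0 <= q < 1 -> dv (Lpot q) u (logpot q u).
Proof. by move=> q01; apply: dv_primitive; exact: continuous_logpot. Qed.

Lemma dv_translate (f : R -> R) (a u l : R) : dv f (u + a) l -> dv (fun u => f (u + a)) u l.
Proof.
move=> df; apply: dv_eq; first by apply: (@dv_comp _ f (fun u => u + a)); [exact: df | repeat dv_step].
by rewrite addr0 mulr1.
Qed.

Lemma Lpot_shift q u : 0 <= q < 1 -> Lpot q (u + N) = Lpot q N + Lpot q u.
Proof.
move=> q01; apply: (@dv_eq_cst _ (fun u => Lpot q (u + N)) (fun u => Lpot q N + Lpot q u) (logpot q) u 0).
- by move=> v; apply: dv_translate; rewrite -[X in dv _ _ X]logpot_per; exact: dv_Lpot.
- by move=> v; apply: dv_eq; [apply: dvD (dv_Lpot v q01); exact: dv_cst | rewrite add0r].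
- by rewrite add0r [Lpot q 0]primitive0 addr0.
Qed.

(** It is the factorisation (1 - q z) (1 + q z) = 1 - q ^ 2 z ^ 2, half a period changing the sign
    of z. *)
Lemma logpot_double q u : 0 <= q < 1 -> logpot q u + logpot q (u + N / 2) = logpot (q ^+ 2) (2 * u).
Proof.
move=> q01; rewrite /logpot -mulrDr -lnM ?posrE ?psq_gt0//; congr (_ * ln _).
have -> : psq q (u + N / 2) = 1 + 2 * q * cos (w * u) + q ^+ 2.
  rewrite /psq mulrDr w_half cosDpi; ring.
have -> : psq (q ^+ 2) (2 * u) = 1 - 2 * q ^+ 2 * (2 * cos (w * u) ^+ 2 - 1) + q ^+ 4.
  rewrite /psq (_ : w * (2 * u) = w * u + w * u); last by ring.
  rewrite cosD -!expr2 (_ : sin (w * u) ^+ 2 = 1 - cos (w * u) ^+ 2); first by ring.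
  by have := cos2Dsin2 (w * u); lra.
rewrite /psq; ring.
Qed.

Lemma sqr_itv01 q : 0 <= q < 1 -> 0 <= q ^+ 2 < 1.
Proof. by move=> /andP[q0 q1]; rewrite exprn_ge0// exprn_ilt1. Qed.

(* Averaging [ln |1 - q z|] over the two square roots of [z] gives half of [ln |1 - q^2 z|]. *)
Lemma Lpot_double q : 0 <= q < 1 -> 2 * Lpot q N = Lpot (q ^+ 2) N.
Proof.
move=> q01; have q2 := sqr_itv01 q01.
have E := @dv_eq_cst _ (fun u => Lpot q u + Lpot q (u + N / 2))
  (fun u => Lpot q (N / 2) + 2^-1 * Lpot (q ^+ 2) (2 * u)) (fun u => logpot (q ^+ 2) (2 * u)) N 0.
have {}E : Lpot q N + Lpot q (N + N / 2) = Lpot q (N / 2) + 2^-1 * Lpot (q ^+ 2) (2 * N).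
  apply: E.
  - move=> u; apply: dv_eq; last exact: logpot_double.
    by apply: dvD; [exact: dv_Lpot | apply: dv_translate; exact: dv_Lpot].
  - move=> u; apply: dv_eq.
      apply: dvD; first exact: dv_cst.
      apply: dvM; first exact: dv_cst.
      by apply: (@dv_comp _ (Lpot (q ^+ 2)) (fun u => 2 * u)); [exact: dv_Lpot | repeat dv_step].
    by rewrite /=; field.
  - by rewrite mulr0 !add0r [Lpot q 0]primitive0 [Lpot _ 0]primitive0 mulr0 add0r addr0.
move: E; rewrite addrC [N + _]addrC Lpot_shift// (_ : 2 * N = N + N) ?Lpot_shift//; last by ring.
by move=> E; lra.
Qed.

Lemma Lpot_bound q M : 0 <= q < 1 -> ln 2 <= M -> - ln (1 - q) <= M -> `|Lpot q N| <= M * N.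
Proof.
move=> q01 M2 Mq; rewrite /Lpot /primitive (ltW N0).
have b : bm (logpot q).
  split; first by apply: continuous_measurable_fun; exact: continuous_logpot.
  by exists M => u; exact: logpot_bound.
have := @norm_mean_le _ _ N0 _ M b (fun u => logpot_bound u q01 M2 Mq).
by rewrite /mean normrM gtr0_norm ?invr_gt0// ler_pdivrMl// mulrC.
Qed.

(** By iterating [Lpot_double], 2 ^ n |Lpot q N| is the absolute value at the parameter q ^ (2 ^ n),
    which stays below M N for every n. This replaces the Fourier expansion of ln |1 - q z|. *)
Lemma Lpot0 q : 0 <= q < 1 -> Lpot q N = 0.
Proof.
move=> q01; pose M := Num.max (ln 2) (- ln (1 - q)).
have h n p : 0 <= p -> p <= q -> 2 ^+ n * `|Lpot p N| <= M * N.
  elim: n p => [|n IH] p p0 pq; have p01 : 0 <= p < 1 by rewrite p0 (le_lt_trans pq)//; case/andP: q01.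
    rewrite expr0 mul1r; apply: Lpot_bound => //; first by rewrite le_max lexx.
    rewrite le_max; apply/orP; right; rewrite lerN2 ler_ln ?posrE ?subr_gt0; last 2 first.
    - by case/andP: q01.
    - by case/andP: p01.
    by rewrite lerB.
  rewrite exprSr -mulrA -[X in _ * (X * _)]ger0_norm// -normrM Lpot_double//.
  apply: IH; first by rewrite exprn_ge0.
  rewrite (le_trans _ pq)// expr2 ler_piMr// ltW//; by case/andP: p01.
apply/eqP; rewrite -normr_le0 leNgt; apply/negP => J0.
have := h (Num.bound (M * N / `|Lpot q N|)) q; rewrite lexx => /(_ _ isT).
case/andP: (q01) => q0 _ => /(_ q0); apply/negP; rewrite -ltNge.
have M0 : 0 <= M * N / `|Lpot q N|.
  by rewrite !mulr_ge0 ?invr_ge0 ?(ltW N0)// le_max ln_ge0// ler1n.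
have := archi_boundP M0; rewrite ltr_pdivrMr// => /lt_trans; apply; rewrite ltr_pM2r//.
by rewrite -natrX ltr_nat ltn_expl.
Qed.

Lemma mean_logpot q y : 0 <= q < 1 -> mean N (fun t => logpot q (t - y)) = 0.
Proof.
move=> q01; rewrite /mean (@dv_ftc _ _ (fun t => Lpot q (t - y)) _ _ (ltW N0)).
- by rewrite sub0r [N - y]addrC Lpot_shift// Lpot0// add0r subrr mulr0.
- by move=> t; apply: dv_translate; exact: dv_Lpot.
- by apply: (@continuous_shift _ (logpot q)); exact: continuous_logpot.
Qed.

Section variation.
Variables (q M : R).
Hypothesis q01 : 0 <= q < 1.
Hypothesis hM : forall u, `|logpot q u| <= M.

Let A u := `|dlogpot q u|.
Let cA : continuous A.
Proof. by move=> u; apply: cvg_norm; exact: continuous_dlogpot. Qed.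
Let F := primitive A.
Let dF u : dv F u (A u). Proof. exact: dv_primitive. Qed.

(** Where the derivative has constant sign, the integral of its absolute value is an increment of
    the potential, however steep the latter is. This keeps the bound logarithmic in 1 - q. *)
Lemma variation_piece (a b : R) : a <= b ->
  (forall u, a <= u <= b -> 0 <= dlogpot q u) \/ (forall u, a <= u <= b -> dlogpot q u <= 0) ->
  F b - F a <= 2 * M.
Proof.
move=> ab sg; rewrite -(dv_ftc ab dF cA).
have ba : `|logpot q b - logpot q a| <= 2 * M.
  by rewrite (le_trans (ler_normB _ _))// mulr2n mulrDl !mul1r lerD.
have dl u := dv_logpot u q01; have cl := continuous_dlogpot q01.
case: sg => sg.
- have -> : \int[lebesgue_measure]_(x in `[a, b]) A x = \int[lebesgue_measure]_(x in `[a, b]) dlogpot q x.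
    by apply: eq_Rintegral => u; rewrite inE /= in_itv /= => /sg h; rewrite /A ger0_norm.
  by rewrite (dv_ftc ab dl cl) (le_trans (ler_norm _)).
- have -> : \int[lebesgue_measure]_(x in `[a, b]) A x = \int[lebesgue_measure]_(x in `[a, b]) (- dlogpot q x).
    by apply: eq_Rintegral => u; rewrite inE /= in_itv /= => /sg h; rewrite /A ler0_norm.
  rewrite (@dv_ftc _ _ (fun u => - logpot q u) _ _ ab).
  + by rewrite opprK addrC -opprB (le_trans (ler_norm _))// normrN.
  + by move=> u; apply: dvN.
  + by move=> u; apply: cvgN; exact: cl.
Qed.

Let dlogpot_sg u : exists2 c, 0 <= c & dlogpot q u = c * sin (w * u).
Proof.
have /andP[q0 _] := q01.
exists (2^-1 * ((psq q u)^-1 * (2 * q * w))); last by rewrite /dlogpot; ring.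
by rewrite !mulr_ge0 ?invr_ge0 ?(ltW (psq_gt0 _ q01)) ?(ltW w_gt0).
Qed.

(** The derivative has the sign of sin (w u), constant on half periods. The translate of [0, N] by -
    y lies in [- N, N], which consists of four of them. *)
Lemma logpot_variation y : 0 <= y <= N ->
  N * mean N (fun t => `|dlogpot q (t - y)|) <= 8 * M.
Proof.
move=> /andP[y0 yN]; rewrite /mean mulVKf ?lt0r_neq0//.
rewrite (@dv_ftc _ _ (fun t => F (t - y)) _ _ (ltW N0)); last 2 first.
- by move=> t; apply: dv_translate; exact: dF.
- exact: (continuous_shift cA).
have Fle (a b : R) : a <= b -> F a <= F b.
  by move=> ab; apply: (dv_ge0_le ab (f' := A)) => // u _; exact: normr_ge0.
have h1 := Fle (N - y) N; have h2 := Fle (- N) (0 - y).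
have wle u v : u <= v -> w * u <= w * v by move=> uv; rewrite ler_wpM2l// ltW// w_gt0.
have sin1 u : 0 <= u <= N / 2 -> 0 <= sin (w * u).
  by move=> /andP[/wle a /wle b]; apply: sin_ge0_pi; rewrite -w_half b -(mulr0 w) a.
have sin2 u : N / 2 <= u <= N -> sin (w * u) <= 0.
  move=> /andP[a b]; rewrite -[u](subrK (N / 2)) mulrDr w_half sinDpi oppr_le0.
  by apply: sin1; apply/andP; split; lra.
have p1 : F (N / 2) - F 0 <= 2 * M.
  apply: variation_piece; first by rewrite divr_ge0// ltW.
  by left => u /sin1; have [c c0 ->] := dlogpot_sg u; exact: mulr_ge0.
have p2 : F N - F (N / 2) <= 2 * M.
  apply: variation_piece; first by rewrite ler_pdivrMr// ler_peMr ?(ltW N0)// ler1n.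
  by right => u /sin2; have [c c0 ->] := dlogpot_sg u; exact: mulr_ge0_le0.
have p3 : F 0 - F (- (N / 2)) <= 2 * M.
  apply: variation_piece; first by rewrite oppr_le0 divr_ge0// ltW.
  right => u /andP[a b]; have [c c0 ->] := dlogpot_sg u.
  rewrite -[u]opprK mulrN sinN mulrN oppr_le0 mulr_ge0// sin1//.
  by apply/andP; split; lra.
have p4 : F (- (N / 2)) - F (- N) <= 2 * M.
  apply: variation_piece; first by have := N0; lra.
  left => u /andP[a b]; have [c c0 ->] := dlogpot_sg u.
  rewrite -[u]opprK mulrN sinN mulr_ge0// oppr_ge0 sin2//.
  by apply/andP; split; lra.
have {}h1 : F (N - y) <= F N by apply: h1; lra.
have {}h2 : F (- N) <= F (0 - y) by apply: h2; lra.
lra.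
Qed.

End variation.

Lemma pair_potential_logpot q M L : 0 <= q < 1 -> ln 2 <= M -> - ln (1 - q) <= M ->
  1 <= L -> 8 * M <= L -> 2 * ln (1 + 2 * N) <= L ->
  pair_potential N (logpot q) (dlogpot q) L.
Proof.
move=> q01 M2 Mq L1 ML NL.
have hM u : `|logpot q u| <= M by exact: logpot_bound.
have M0 : 0 <= M by exact: le_trans (normr_ge0 _) (hM 0).
split=> //.
- by move=> u; exact: dv_logpot.
- exact: continuous_dlogpot.
- exact: bm_dlogpot.
- exact: logpotN.
- exact: logpot_per.
- by move=> u; rewrite (le_trans (hM u))//; lra.
- by move=> y yN; exact: le_trans (logpot_variation q01 hM yN) ML.
- move=> y yN; rewrite /mean mulVKf ?lt0r_neq0//.
  exact: le_trans (decay_integral yN) NL.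
- by move=> y yN; exact: mean_logpot.
Qed.

End potential.

(** * Comparison of the logarithm with its smoothed form *)

Section singularity.
Context {R : realType} (N w : R).
Hypothesis N0 : 0 < N.
Hypothesis wN : w * N = pi *+ 2.
Implicit Types (q u t y e : R).

Let a := w / 2.
Let a0 : 0 < a. Proof. by rewrite divr_gt0// (w_gt0 N0 wN). Qed.
Let aN : a * N = pi.
Proof. by rewrite /a mulrAC -mulrA (w_half wN). Qed.

Definition sn u := sin (w / 2 * u).
Let cn u := cos (a * u).
(** The function (sn ^ 2 + e) ^ (-1/4), a bounded smooth approximation of |sn| ^ (-1/2) from
    below. *)
Definition psi e u := (Num.sqrt (Num.sqrt (sn u ^+ 2 + e)))^-1.

Let dsn u : dv sn u (cn u * a).
Proof. by apply: dv_eq; [apply: dv_sin (dvM (dv_cst a u) (dv_id u)) | rewrite /= mul0r add0r mulr1]. Qed.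

Let dcn u : dv cn u (- sn u * a).
Proof. by apply: dv_eq; [apply: dv_cos (dvM (dv_cst a u) (dv_id u)) | rewrite /= mul0r add0r mulr1]. Qed.

Section smoothed.
Variable e : R.
Hypothesis e0 : 0 < e.

Let A u := sn u ^+ 2 + e.
Let A0 u : 0 < A u. Proof. by rewrite ltr_wpDl// sqr_ge0. Qed.
Let r u := Num.sqrt (Num.sqrt (A u)).
Let r0 u : 0 < r u. Proof. by rewrite !sqrtr_gt0. Qed.
Let r4 u : r u ^+ 4 = A u.
Proof. by rewrite (exprM _ 2 2) sqr_sqrtr ?sqrtr_ge0// sqr_sqrtr// ltW. Qed.

Let dpsi u : dv (psi e) u (- (sn u * cn u * a) / (2 * r u ^+ 5)).
Proof.
have dA : dv A u (2 * (sn u * cn u * a)).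
  by apply: dv_eq; [exact: dvD (dvM (dsn u) (dsn u)) (dv_cst e u) | rewrite addr0; ring].
have B0 : 0 < Num.sqrt (A u) by rewrite sqrtr_gt0.
have dr := @dv_sqrt _ (fun u => Num.sqrt (A u)) u _ B0 (@dv_sqrt _ A u _ (A0 u) dA).
apply: dv_eq; first exact: (@dvV _ r u _ (lt0r_neq0 (r0 u)) dr).
rewrite -/(r u); have -> : Num.sqrt (A u) = r u ^+ 2 by rewrite sqr_sqrtr// sqrtr_ge0.
by move: (r u) (r0 u) => v v0; field; rewrite ?lt0r_neq0.
Qed.

Let G u := 2 * (sn u * (cn u * psi e u)).
Let dG u := 2 * (cn u * a * (cn u * psi e u) +
  sn u * (- sn u * a * psi e u + cn u * (- (sn u * cn u * a) / (2 * r u ^+ 5)))).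

Let GE u : dv G u (dG u).
Proof.
apply: dv_eq; first by apply: dvM (dvM (dsn u) (dvM (dcn u) (dpsi u))); exact: dv_cst.
by rewrite mul0r add0r.
Qed.

Let cdG : continuous dG.
Proof.
have cs : continuous sn by move=> u; exact: dv_cts (dsn u).
have cc : continuous cn by move=> u; exact: dv_cts (dcn u).
have cp : continuous (psi e) by move=> u; exact: dv_cts (dpsi u).
have cr : continuous r.
  move=> u; have -> : r = fun u => (psi e u)^-1 by apply/funext => v; rewrite /psi invrK.
  by apply: cvgV; [rewrite /psi invr_eq0 lt0r_neq0//; exact: r0 | exact: cp].
move=> u; apply: cvgM; first exact: cvg_cst.
apply: cvgD.
  by apply: cvgM; [apply: cvgM; [exact: cc | exact: cvg_cst] | apply: cvgM; [exact: cc | exact: cp]].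
apply: cvgM; first exact: cs.
apply: cvgD.
  apply: cvgM; last exact: cp.
  by apply: cvgM; [apply: cvgN; exact: cs | exact: cvg_cst].
apply: cvgM; first exact: cc.
apply: cvgM.
  by apply: cvgN; apply: cvgM; [apply: cvgM; [exact: cs | exact: cc] | exact: cvg_cst].
apply: cvgV; first by rewrite mulf_neq0// expf_neq0// lt0r_neq0.
apply: cvgM; first exact: cvg_cst.
by apply: (@continuous_comp _ _ _ r (fun v => v ^+ 5)); [exact: cr | exact: exprn_continuous].
Qed.

Lemma bm_psi : bm (psi e).
Proof.
split; first by apply: continuous_measurable_fun => u; exact: dv_cts (dpsi u).
exists (Num.sqrt (Num.sqrt e))^-1 => u; rewrite ger0_norm ?invr_ge0 ?sqrtr_ge0//.
rewrite lef_pV2 ?posrE ?sqrtr_gt0//; last exact: A0.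
by apply: ler_wsqrtr; apply: ler_wsqrtr; rewrite lerDr sqr_ge0.
Qed.

(* [G = 2 sin cos psi] is periodic and [G' >= a (1 - 3 sin^2) psi], which controls [psi] near
   the zeros of [sin]. *)
Let psi_le u : psi e u <= a^-1 * dG u + 3.
Proof.
have s2c2 : cn u ^+ 2 = 1 - sn u ^+ 2 by have := cos2Dsin2 (a * u); rewrite -/(cn u) -/(sn u); lra.
have s1 : sn u ^+ 2 <= 1 by have := sqr_ge0 (cn u); rewrite s2c2; lra.
have s0 := sqr_ge0 (sn u); have rp := r0 u.
have rs : sn u ^+ 2 <= r u ^+ 4 by rewrite r4 lerDl ltW.
(* If r < sn ^ 2 <= 1, then r ^ 4 <= r < sn ^ 2, against the preceding line. *)
have sr : sn u ^+ 2 <= r u.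
  rewrite leNgt; apply/negP => rlt.
  have h : r u ^+ 4 < sn u ^+ 2.
    apply: (le_lt_trans _ rlt); rewrite exprSr ler_piMl ?(ltW rp)// exprn_ile1 ?(ltW rp)//.
    exact: le_trans (ltW rlt) s1.
  by rewrite ltNge rs in h.
have -> : a^-1 * dG u = (r u)^-1 * (2 * (cn u ^+ 2 - sn u ^+ 2) - cn u ^+ 2 * (sn u ^+ 2 / r u ^+ 4)).
  rewrite /dG /psi -/(A u) -/(r u); move: (r u) (r0 u) a a0 => v v0 b b0.
  by field; rewrite ?lt0r_neq0.
have q1 : sn u ^+ 2 / r u ^+ 4 <= 1 by rewrite ler_pdivrMr ?mul1r// exprn_gt0.
have q2 : (r u)^-1 * sn u ^+ 2 <= 1 by rewrite mulrC ler_pdivrMr ?mul1r.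
have q3 : cn u ^+ 2 * (sn u ^+ 2 / r u ^+ 4) <= cn u ^+ 2 by rewrite ler_piMr ?sqr_ge0.
rewrite /psi -/(A u) -/(r u).
have ri : 0 <= (r u)^-1 by rewrite invr_ge0 ltW.
have q4 : 0 <= (r u)^-1 * (cn u ^+ 2 - cn u ^+ 2 * (sn u ^+ 2 / r u ^+ 4)) by rewrite mulr_ge0// subr_ge0.
rewrite (_ : (r u)^-1 * _ = (r u)^-1 * (cn u ^+ 2 - cn u ^+ 2 * (sn u ^+ 2 / r u ^+ 4)) +
   ((r u)^-1 * cn u ^+ 2 - 2 * ((r u)^-1 * sn u ^+ 2))); last by ring.
have q5 : (r u)^-1 * cn u ^+ 2 = (r u)^-1 - (r u)^-1 * sn u ^+ 2 by rewrite s2c2 mulrBr mulr1.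
rewrite q5; lra.
Qed.

(** Integrating [psi_le] over a period: the derivative of the periodic [G] contributes nothing, and
    3 N remains, uniformly in [e]. *)
Lemma mean_psi y : N * mean N (fun t => psi e (t - y)) <= 3 * N.
Proof.
rewrite /mean mulVKf ?lt0r_neq0//.
have cpsi : continuous (psi e) by move=> u; exact: dv_cts (dpsi u).
pose f t := a^-1 * dG (t - y) + 3.
have cf : continuous f.
  move=> t; apply: cvgD; last exact: cvg_cst.
  by apply: cvgM; [exact: cvg_cst | exact: (continuous_shift cdG)].
have dF t : dv (fun t => a^-1 * G (t - y) + 3 * t) t (f t).
  apply: dv_eq.
    apply: dvD (dvM (dv_cst a^-1 t) _) (dvM (dv_cst 3 t) (dv_id t)).
    by apply: dv_translate; exact: GE.
  by rewrite /f /= !mul0r !add0r mulr1.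
apply: (@le_trans _ _ (\int[lebesgue_measure]_(t in `[0, N]) f t)).
  apply: le_Rintegral => //.
  - by apply: (@continuous_itv_integrable _ (fun t => psi e (t - y))); exact: (continuous_shift cpsi).
  - exact: continuous_itv_integrable.
rewrite (dv_ftc (ltW N0) dF cf).
have snp u : sn (u + N) = - sn u by rewrite /sn mulrDr -/a aN sinDpi.
have -> : G (N - y) = G (0 - y).
  rewrite sub0r addrC /G /psi !snp /cn mulrDr aN cosDpi sqrrN; ring.
by rewrite mulr0 addr0 addrC addKr.
Qed.

End smoothed.

Lemma psi_ge0 e u : 0 <= psi e u. Proof. by rewrite invr_ge0 sqrtr_ge0. Qed.

Let cvg_root u : Num.sqrt (Num.sqrt (sn u ^+ 2 + n.+1%:R^-1)) @[n --> \oo] --> Num.sqrt `|sn u|.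
Proof.
rewrite -[`|_|]sqrtr_sqr.
apply: (cvg_comp (fun n => Num.sqrt (sn u ^+ 2 + n.+1%:R^-1)) Num.sqrt); last exact: sqrt_continuous.
apply: (cvg_comp (fun n => sn u ^+ 2 + n.+1%:R^-1) Num.sqrt); last exact: sqrt_continuous.
have : (sn u ^+ 2 + n.+1%:R^-1) @[n --> \oo] --> sn u ^+ 2 + 0.
  by apply: cvgD; [exact: cvg_cst | exact: cvg_harmonic].
by rewrite addr0.
Qed.

Lemma cvg_psi u : sn u != 0 -> psi n.+1%:R^-1 u @[n --> \oo] --> (Num.sqrt `|sn u|)^-1.
Proof.
move=> s0; apply: cvgV; last exact: cvg_root.
by rewrite sqrtr_eq0 -ltNge normr_gt0.
Qed.

(** Distinct points of [0, N] with vanishing sine are the two ends, where the logarithm is replaced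
    by the conventional value at 0. The divergence makes the eventual bound infinite there, so that
    this case needs no estimate. *)
Lemma cvg_psi_y u : sn u = 0 -> psi n.+1%:R^-1 u @[n --> \oo] --> +oo.
Proof.
move=> s0; apply/gtr0_cvgV0.
  by apply: nearW => n; rewrite /psi invr_gt0 !sqrtr_gt0 ltr_wpDl// sqr_ge0.
have := @cvg_root u; rewrite s0 normr0 sqrtr0.
apply: cvg_trans; apply: near_eq_cvg; apply: nearW => n.
by rewrite /= /psi invrK s0.
Qed.

(** Since [psq] is |2 sn| ^ 2 times 1 - dl + y ^ 8 for the [y] introduced below, the difference of
    the logarithms is - ln (1 - dl + y ^ 8) / 2, which lies between - 4 y and dl. *)
Lemma remainder_sq (dl u : R) : sn u != 0 -> 0 < dl <= 2^-1 ->
  (ln `|2 * sn u| - logpot w (1 - dl) u) ^+ 2 <=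
  2 * dl ^+ 2 + 32 * Num.sqrt dl * (Num.sqrt `|sn u|)^-1.
Proof.
move=> s0 /andP[d0 d2].
have q01 : 0 <= 1 - dl < 1 by apply/andP; split; lra.
have q0 : 0 < 1 - dl by lra.
have n0 : 0 < `|sn u| by rewrite normr_gt0.
have P0 := psq_gt0 w u q01.
(* The roots are taken so that the squared bound involves y ^ 2 = z, a multiple of |sn| ^ (-1/2),
   which is integrable over a period. *)
pose z := Num.sqrt (dl / (2 * `|sn u|)).
have z0 : 0 <= z by exact: sqrtr_ge0.
have z2 : z ^+ 2 = dl / (2 * `|sn u|) by rewrite sqr_sqrtr// divr_ge0 ?mulr_ge0// ltW.
pose y := Num.sqrt z.
have y0 : 0 <= y by exact: sqrtr_ge0.
have y2 : y ^+ 2 = z by rewrite sqr_sqrtr.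
have y8 : y ^+ 8 = dl ^+ 2 / (4 * sn u ^+ 2).
  rewrite (exprM _ 2 4) y2 (exprM _ 2 2) z2 -[sn u ^+ 2]real_normK ?num_real//.
  by field; rewrite lt0r_neq0.
have PE : psq w (1 - dl) u = `|2 * sn u| ^+ 2 * (1 - dl + y ^+ 8).
  rewrite y8 real_normK ?num_real// /psq.
  have -> : cos (w * u) = 1 - 2 * sn u ^+ 2.
    have -> : w * u = w / 2 * u + w / 2 * u by field.
    by rewrite cosD /sn; have := cos2Dsin2 (w / 2 * u); rewrite !expr2; lra.
  by field.
have g0 : 0 < `|2 * sn u| by rewrite normr_gt0 mulf_neq0.
have t0 : 0 < 1 - dl + y ^+ 8 by rewrite ltr_wpDr// exprn_ge0.
have -> : ln `|2 * sn u| - logpot w (1 - dl) u = - (2^-1 * ln (1 - dl + y ^+ 8)).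
  rewrite /logpot PE lnM ?posrE ?exprn_gt0// lnXn// -mulr_natr; lra.
rewrite sqrrN.
have up : 2^-1 * ln (1 - dl + y ^+ 8) <= 4 * y.
  have h1 : 1 - dl + y ^+ 8 <= (1 + y) ^+ 8.
    have : 1 + y ^+ 8 <= (1 + y) ^+ 8.
      rewrite -subr_ge0 (_ : _ - _ = 8 * y + 28 * y ^+ 2 + 56 * y ^+ 3 + 70 * y ^+ 4
        + 56 * y ^+ 5 + 28 * y ^+ 6 + 8 * y ^+ 7); last by ring.
      by rewrite !addr_ge0// mulr_ge0// exprn_ge0.
    lra.
  have h2 : ln (1 - dl + y ^+ 8) <= ln ((1 + y) ^+ 8).
    by rewrite ler_ln ?posrE ?exprn_gt0// ltr_wpDr.
  have h3 : ln (1 + y) <= y by apply: le_ln1Dx; lra.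
  rewrite lnXn in h2; last by rewrite ltr_wpDr.
  rewrite -mulr_natr in h2; lra.
(* The logarithm of 1 - dl is estimated through the inverse 1 + dl / (1 - dl); this is where dl <= 1
   / 2 enters. *)
have lo : - dl <= 2^-1 * ln (1 - dl + y ^+ 8).
  have h1 : ln (1 - dl) <= ln (1 - dl + y ^+ 8) by rewrite ler_ln ?posrE// lerDl exprn_ge0.
  have h2 : ln (1 - dl)^-1 <= 2 * dl.
    have -> : (1 - dl)^-1 = 1 + dl / (1 - dl) by field; rewrite lt0r_neq0.
    have h : dl / (1 - dl) <= 2 * dl by rewrite ler_pdivrMr//; nra.
    apply: le_trans h; apply: le_ln1Dx.
    by rewrite (lt_le_trans (ltrN10 _))// divr_ge0// ltW.
  rewrite lnV ?posrE// in h2; lra.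
have r2 : (2^-1 * ln (1 - dl + y ^+ 8)) ^+ 2 <= 2 * dl ^+ 2 + 32 * z.
  rewrite -y2; move: (2^-1 * _) up lo => v up lo.
  have v2 : v ^+ 2 <= (dl + 4 * y) ^+ 2.
    rewrite -[v ^+ 2]real_normK ?num_real// lerXn2r ?nnegrE ?addr_ge0 ?mulr_ge0 ?(ltW d0)//.
    by rewrite ler_norml; apply/andP; split; lra.
  by apply: le_trans v2 _; have := sqr_ge0 (dl - 4 * y); rewrite !expr2; lra.
apply: le_trans r2 _; rewrite lerD2l -mulrA ler_wpM2l//.
rewrite -sqrtrV ?(ltW n0)// -sqrtrM ?(ltW d0)// ler_sqrt; last by rewrite mulr_ge0 ?invr_ge0 ?ltW.
rewrite ler_wpM2l ?(ltW d0)// lef_pV2 ?posrE ?mulr_gt0//; lra.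
Qed.

End singularity.

(** * Sums over distinct points *)

Section tuple_sums.
Context {R : realType} (p : seq R).
Implicit Types (x y z t c : R) (f g : R -> R -> R) (k : nat).

(** Recursion on the length, as in [integral_Rn]. Repeated entries are allowed here and excluded in
    [usum]. *)
Fixpoint ksum k : (k.-tuple R -> R) -> R :=
  match k with
  | 0 => fun F => F [tuple]
  | k'.+1 => fun F => \sum_(x <- p) ksum (fun u : k'.-tuple R => F [tuple of x :: u])
  end.

Lemma eq_ksum k (F G : k.-tuple R -> R) : F =1 G -> ksum F = ksum G.
Proof. by move=> FG; congr ksum; apply/funext. Qed.

Lemma ksumD k (F G : k.-tuple R -> R) : ksum (fun u => F u + G u) = ksum F + ksum G.
Proof.
elim: k F G => [//|k IH] F G /=; rewrite -big_split /=.
by apply: eq_bigr => x _; exact: IH.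
Qed.

Lemma ksumZ k c (F : k.-tuple R -> R) : ksum (fun u => c * F u) = c * ksum F.
Proof.
elim: k F => [//|k IH] F /=; rewrite mulr_sumr.
by apply: eq_bigr => x _; exact: IH.
Qed.

Lemma ksum_ge0 k (F : k.-tuple R -> R) : (forall u, 0 <= F u) -> 0 <= ksum F.
Proof.
elim: k F => [|k IH] F F0 /=; first exact: F0.
by apply: sumr_ge0 => x _; exact: IH.
Qed.

Definition usum k (F : k.-tuple R -> R) := ksum (fun u => (uniq u)%:R * F u).

Lemma usumD k (F G : k.-tuple R -> R) : usum (fun u => F u + G u) = usum F + usum G.
Proof. by rewrite /usum -ksumD; apply: eq_ksum => u; rewrite mulrDr. Qed.

Lemma usumZ k c (F : k.-tuple R -> R) : usum (fun u => c * F u) = c * usum F.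
Proof. by rewrite /usum -ksumZ; apply: eq_ksum => u; rewrite mulrCA. Qed.

Definition pairsum f := \sum_(x <- p) \sum_(y <- p) (x != y)%:R * f x y.

Lemma pairsumE f : pairsum f = usum (fun u : 2.-tuple R => f u`_0 u`_1).
Proof.
by rewrite /usum /=; apply: eq_bigr => x _; apply: eq_bigr => y _; rewrite /= inE andbT.
Qed.

Lemma pairsumD f g : pairsum (fun x y => f x y + g x y) = pairsum f + pairsum g.
Proof. by rewrite !pairsumE -usumD. Qed.

Lemma pairsumZ c f : pairsum (fun x y => c * f x y) = c * pairsum f.
Proof. by rewrite !pairsumE -usumZ. Qed.

Lemma pairsum_ge0 f : (forall x y, 0 <= f x y) -> 0 <= pairsum f.
Proof. by move=> f0; apply: sumr_ge0 => x _; apply: sumr_ge0 => y _; rewrite mulr_ge0. Qed.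

Lemma le_pairsum f g : {in p &, forall x y, x != y -> f x y <= g x y} -> pairsum f <= pairsum g.
Proof.
move=> fg; rewrite /pairsum big_seq [leRHS]big_seq; apply: ler_sum => x xp.
rewrite big_seq [leRHS]big_seq; apply: ler_sum => y yp.
by case: eqVneq => [_|xy]; rewrite ?mul0r// !mul1r fg.
Qed.

(** The sum of (f x y - f z t) ^ 2 over all couples of pairs is nonnegative. *)
Lemma pairsum_cauchy f : pairsum f ^+ 2 <= pairsum (fun _ _ => 1) * pairsum (fun x y => f x y ^+ 2).
Proof.
have : 0 <= pairsum (fun x y => pairsum (fun z t => (f x y - f z t) ^+ 2)).
  by apply: pairsum_ge0 => x y; apply: pairsum_ge0 => z t; exact: sqr_ge0.
set n := pairsum (fun _ _ => 1); set s := pairsum f; set q := pairsum (fun x y => f x y ^+ 2).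
have E x y : pairsum (fun z t => (f x y - f z t) ^+ 2) =
    (f x y ^+ 2 * n + (- 2 * s) * f x y) + q * 1.
  rewrite (_ : _ + _ = f x y ^+ 2 * n + (- 2 * f x y) * s + q); last by ring.
  rewrite -!pairsumZ -!pairsumD; congr pairsum; apply/funext => z; apply/funext => t; ring.
rewrite (_ : (fun x y => _) = (fun x y => (f x y ^+ 2 * n + (- 2 * s) * f x y) + q * 1)); last first.
  by apply/funext => x; apply/funext => y; exact: E.
rewrite !pairsumD !pairsumZ -/n.
have -> : pairsum (fun x y => f x y ^+ 2 * n) = n * q.
  by rewrite -pairsumZ; congr pairsum; apply/funext => z; apply/funext => t; rewrite mulrC.
rewrite -/s; nra.
Qed.

Hypothesis up : uniq p.

Lemma sum_collapse x (F : R -> R) : x \in p -> \sum_(z <- p) (z == x)%:R * F z = F x.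
Proof.
move=> xp; rewrite (bigD1_seq x)//= eqxx mul1r big1 ?addr0// => z /negbTE ->.
by rewrite mul0r.
Qed.

Lemma pairsumM f g : (forall x y, f x y = f y x) -> (forall x y, g x y = g y x) ->
  pairsum f * pairsum g = usum (fun u : 4.-tuple R => f u`_0 u`_1 * g u`_2 u`_3)
   + 4 * usum (fun u : 3.-tuple R => f u`_0 u`_1 * g u`_0 u`_2)
   + 2 * usum (fun u : 2.-tuple R => f u`_0 u`_1 * g u`_0 u`_1).
Proof.
move=> fC gC.
pose d x y : R := (x != y)%:R.
have dC x y : d x y = d y x by rewrite /d eq_sym.
pose e x y : R := (x == y)%:R.
pose B := \sum_(x <- p) \sum_(y <- p) d x y * (f x y * g x y).
pose A := \sum_(x <- p) \sum_(y <- p) \sum_(t <- p) d x y * d x t * (f x y * g x t).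
pose S4 (F : R -> R -> R -> R -> R) :=
  \sum_(x <- p) \sum_(y <- p) \sum_(z <- p) \sum_(t <- p) F x y z t.
have eS4 F G : (forall x y z t, F x y z t = G x y z t) -> S4 F = S4 G.
  by move=> FG; do 4 (apply: eq_bigr => ? _); exact: FG.
have S4D F G : S4 (fun x y z t => F x y z t + G x y z t) = S4 F + S4 G.
  rewrite /S4 -big_split; apply: eq_bigr => x _; rewrite -big_split; apply: eq_bigr => y _.
  by rewrite -big_split; apply: eq_bigr => z _; rewrite -big_split.
have S4N F : S4 (fun x y z t => - F x y z t) = - S4 F.
  rewrite /S4 -sumrN; apply: eq_bigr => x _; rewrite -sumrN; apply: eq_bigr => y _.
  by rewrite -sumrN; apply: eq_bigr => z _; rewrite -sumrN.
have S4zt F : S4 F = S4 (fun x y t z => F x y z t).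
  by apply: eq_bigr => x _; apply: eq_bigr => y _; rewrite exchange_big.
have S4xy F : S4 F = S4 (fun y x z t => F x y z t) by rewrite /S4 exchange_big.
pose W x y z t := d x y * d z t * (f x y * g z t).
have E0 : pairsum f * pairsum g = S4 W.
  rewrite /S4 mulr_suml; apply: eq_bigr => x _; rewrite mulr_suml; apply: eq_bigr => y _.
  rewrite mulr_sumr; apply: eq_bigr => z _; rewrite mulr_sumr; apply: eq_bigr => t _.
  by rewrite /W /d; ring.
have E4 : usum (fun u : 4.-tuple R => f u`_0 u`_1 * g u`_2 u`_3) =
    S4 (fun x y z t => (uniq [:: x; y; z; t])%:R * (f x y * g z t)) by [].
(* Inclusion and exclusion over the coincidences z = x, z = y, t = x, t = y: as x != y and z != t,
   no three hold together, and the only compatible couples are the two that are subtracted. *)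
have dec x y z t : W x y z t = (uniq [:: x; y; z; t])%:R * (f x y * g z t) +
    (e z x * W x y z t + e z y * W x y z t + e t x * W x y z t + e t y * W x y z t) -
    (e z x * (e t y * W x y z t) + e z y * (e t x * W x y z t)).
  rewrite /W /d /e /= !inE !negb_or.
  have [->|xy] := eqVneq x y; first by rewrite !mul0r !mulr0; ring.
  have [->|zt] := eqVneq z t; first by rewrite /= !andbF !mul0r !mulr0 !mul0r !mulr0; ring.
  rewrite [x == z]eq_sym [x == t]eq_sym [y == z]eq_sym [y == t]eq_sym.
  have h1 : ~~ ((z == x) && (z == y)) by apply: contra xy => /andP[/eqP <- /eqP <-].
  have h2 : ~~ ((t == x) && (t == y)) by apply: contra xy => /andP[/eqP <- /eqP <-].
  have h3 : ~~ ((z == x) && (t == x)) by apply: contra zt => /andP[/eqP -> /eqP ->].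
  have h4 : ~~ ((z == y) && (t == y)) by apply: contra zt => /andP[/eqP -> /eqP ->].
  move: h1 h2 h3 h4; case: (z == x); case: (z == y); case: (t == x); case: (t == y) => //= _ _ _ _; ring.
have cA : S4 (fun x y z t => e z x * W x y z t) = A.
  rewrite /S4 /A big_seq [RHS]big_seq; apply: eq_bigr => x xp; apply: eq_bigr => y _.
  rewrite -(sum_collapse (fun z => \sum_(t <- p) W x y z t) xp).
  by apply: eq_bigr => z _; rewrite mulr_sumr.
have cA2 : S4 (fun x y z t => e z y * W x y z t) = A.
  rewrite -cA S4xy; apply: eS4 => x y z t.
  by rewrite /W fC dC.
have cA3 : S4 (fun x y z t => e t x * W x y z t) = A.
  by rewrite -cA S4zt; apply: eS4 => x y z t; rewrite /W gC [d t z]dC.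
have cA4 : S4 (fun x y z t => e t y * W x y z t) = A.
  by rewrite -cA2 S4zt; apply: eS4 => x y z t; rewrite /W gC [d t z]dC.
have cB : S4 (fun x y z t => e z x * (e t y * W x y z t)) = B.
  rewrite /S4 /B big_seq [RHS]big_seq; apply: eq_bigr => x xp.
  rewrite big_seq [RHS]big_seq; apply: eq_bigr => y yp.
  transitivity (\sum_(z <- p) e z x * (\sum_(t <- p) e t y * W x y z t)).
    by apply: eq_bigr => z _; rewrite mulr_sumr.
  rewrite (sum_collapse (fun z => \sum_(t <- p) e t y * W x y z t) xp).
  rewrite (sum_collapse (fun t => W x y x t) yp) /W.
  by rewrite -/(d x y) /d; case: eqVneq => _; rewrite ?mul0r// !mul1r.
have cB2 : S4 (fun x y z t => e z y * (e t x * W x y z t)) = B.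
  rewrite -cB S4zt; apply: eS4 => x y z t.
  by rewrite /W gC [d t z]dC mulrCA.
(* Each single coincidence gives [A], which still contains the double one; hence 4 A - 2 B leaves 2
   B besides the sum over triples. *)
have A3 : A = usum (fun u : 3.-tuple R => f u`_0 u`_1 * g u`_0 u`_2) + B.
  have -> : usum (fun u : 3.-tuple R => f u`_0 u`_1 * g u`_0 u`_2) =
     \sum_(x <- p) \sum_(y <- p) \sum_(t <- p) (uniq [:: x; y; t])%:R * (f x y * g x t) by [].
  rewrite /A /B -big_split; apply: eq_bigr => x _ /=; rewrite -big_split.
  rewrite big_seq [RHS]big_seq; apply: eq_bigr => y yp /=.
  have -> : d x y * (f x y * g x y) =
      \sum_(t <- p) (t == y)%:R * (d x y * d x t * (f x y * g x t)).
    rewrite (sum_collapse (fun t => d x y * d x t * (f x y * g x t)) yp).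
    by rewrite /d; case: eqVneq => _; rewrite ?mul0r// !mul1r.
  rewrite -big_split; apply: eq_bigr => t _ /=.
  rewrite /d !inE !negb_or andbT [t == y]eq_sym.
  by case: (x == y); case: (x == t); case: (y == t) => /=; ring.
have B2 : B = usum (fun u : 2.-tuple R => f u`_0 u`_1 * g u`_0 u`_1).
  rewrite -(pairsumE (fun x y => f x y * g x y)) //.
rewrite E0 (eS4 _ _ dec) S4D S4D S4N !S4D cA cA2 cA3 cA4 cB cB2 -E4 -B2 A3; ring.
Qed.

End tuple_sums.

Section tuple_esums.
Context {R : realType}.
Variable p : seq R.
Hypothesis up : uniq p.

Lemma esum_supported (H : R -> R) : (forall x, 0 <= H x) -> (forall x, x \notin p -> H x = 0) ->
  (\esum_(x in [set: R]) (H x)%:E = (\sum_(x <- p) H x)%:E)%E.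
Proof.
move=> H0 Hp; transitivity (\esum_(x in [set` p]) (H x)%:E)%E.
  rewrite [RHS]esum_mkcond; apply: eq_esum => x _.
  by rewrite mem_setE; case: ifPn => // /Hp ->.
rewrite esum_fset.
- by rewrite -fsbig_seq// sumEFin.
- exact: finite_seq.
- by move=> x _; rewrite lee_fin.
Qed.

(** It links the summation over all tuples in [correlation_function] with a finite sum, by splitting
    off the first entry. *)
Lemma esum_ksum k (G : k.-tuple R -> R) : (forall u, 0 <= G u) ->
  (forall u : k.-tuple R, ~~ all (fun x => x \in p) u -> G u = 0) ->
  (\esum_(u in [set: k.-tuple R]) (G u)%:E = (ksum p G)%:E)%E.
Proof.
elim: k G => [|k IH] G G0 Gp.
  have -> : [set: 0.-tuple R] = [set [tuple]].
    by apply/seteqP; split => // u _ /=; rewrite tuple0.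
  by rewrite esum_set1 ?lee_fin.
pose e (z : R * k.-tuple R) : k.+1.-tuple R := [tuple of z.1 :: z.2].
have be : set_bij [set: R * k.-tuple R] [set: k.+1.-tuple R] e.
  split=> //.
  - move=> [x u] [y v] _ _ /= /(congr1 val) /= [-> uv].
    by congr (_, _); apply: val_inj.
  - move=> u _; exists (thead u, [tuple of behead u]) => //.
    by rewrite /e /= [RHS]tuple_eta.
rewrite (@reindex_esum R (R * k.-tuple R)%type (k.+1.-tuple R) setT setT e _ be).
transitivity (\esum_(x in [set: R]) \esum_(u in [set: k.-tuple R]) (G (e (x, u)))%:E)%E.
  rewrite (@esum_esum _ _ _ setT (fun=> setT) (fun x u => (G (e (x, u)))%:E)); last first.
    by move=> *; rewrite lee_fin.
  have -> : [set: R] `*`` (fun=> [set: k.-tuple R]) = setT by apply/seteqP; split.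
  by apply: eq_esum => -[].
transitivity (\esum_(x in [set: R]) (ksum p (fun u : k.-tuple R => G [tuple of x :: u]))%:E)%E.
  apply: eq_esum => x _; apply: IH => [u|u up']; first exact: G0.
  by apply: Gp; rewrite /= negb_and up' orbT.
rewrite esum_supported//.
- by move=> x; exact: ksum_ge0.
- move=> x xp; rewrite (_ : (fun u : k.-tuple R => _) = fun=> 0 * 0).
    by rewrite ksumZ mul0r.
  by apply/funext => u; rewrite mul0r; apply: Gp; rewrite /= (negbTE xp).
Qed.

End tuple_esums.

(** It expresses order statistics by counting variables, whose measurability is given. *)
Lemma sorted_nth_gt (R : realType) (p : seq R) (y : R) i : sorted <=%R p -> (i < size p)%N ->
  (y < nth 0 p i) = (count (fun x : R => x <= y)%R p <= i)%N.
Proof.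
move=> sp ip; have E : count (fun x => x <= y) p = find (fun x => y < x) p.
  elim: p {ip} sp => //= x p IH xp; case: (leP x y) => xy /=.
    by rewrite add1n IH//; exact: path_sorted xp.
  rewrite add0n; apply/eqP; rewrite -leqn0 leqNgt -has_count -all_predC.
  apply/allP => z zp /=; rewrite -ltNge (lt_le_trans xy)//.
  by have /allP := order_path_min le_trans xp; apply.
rewrite E; apply/idP/idP => [h|h].
  by rewrite leqNgt; apply/negP => /(before_find 0) /=; rewrite h.
have hs : has (fun x => y < x) p by rewrite has_find (leq_ltn_trans h).
apply: lt_le_trans (nth_find 0 hs) _.
by apply: (sorted_leq_nth le_trans (@lexx _ _) 0 sp) => //; rewrite inE -?has_find.
Qed.

(** * Measurability of sums over the points in [0, N] *)

Section points.
Context d (T : measurableType d) {R : realType} (X : T -> set R) (N : R).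
Hypothesis rX : random_configuration X.
Implicit Types (w : T) (x y : R) (B : set R).

(** Sorted, so that the i-th point is an order statistic and thereby measurable. *)
Definition pts w : seq R := sort <=%R (finmap.enum_fset (fset_set (X w `&` `[0, N]))).

Lemma uniq_pts w : uniq (pts w).
Proof. by rewrite sort_uniq finmap.fset_uniq. Qed.

Lemma mem_pts w x : (x \in pts w) = `[< X w x /\ 0 <= x <= N >].
Proof.
rewrite mem_sort in_fset_set; last exact: rX.1.
apply/idP/idP => [|/asboolP[Xx xN]].
  by move=> /set_mem[Xx]; rewrite /= in_itv /= => xN; apply/asboolP.
by apply/mem_set; split=> //=; rewrite in_itv.
Qed.

Lemma counting_pts B w :
  counting (X w `&` (B `&` `[0, N])) = (count (fun x => x \in B) (pts w))%:R%:E :> \bar R.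
Proof.
have fin : finite_set (X w `&` (B `&` `[0, N])).
  by apply: sub_finite_set (rX.1 w 0 N) => x [? []].
rewrite /counting asboolT//; congr (_%:R%:E); rewrite -size_filter.
apply: perm_size; apply: uniq_perm; [exact: finmap.fset_uniq | by rewrite filter_uniq// uniq_pts |].
move=> x; rewrite in_fset_set// mem_filter mem_pts; apply/idP/idP.
  move=> /set_mem[Xx [Bx]]; rewrite /= in_itv /= => xN; rewrite mem_set//=.
  exact/asboolP.
move=> /andP[/set_mem Bx /asboolP[Xx xN]]; apply/mem_set; split => //; split => //.
Qed.

Lemma measurable_count B : measurable B ->
  measurable_fun setT (fun w => (count (fun x => x \in B) (pts w))%:R : R).
Proof.
move=> mB; apply/measurable_EFinP.
have -> : EFin \o (fun w => (count (fun x => x \in B) (pts w))%:R : R) =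
   (fun w => counting (X w `&` (B `&` `[0, N])) : \bar R).
  by apply/funext => w; rewrite counting_pts.
by apply: rX.2; exact: measurableI.
Qed.

Lemma measurable_nat_le (c : T -> nat) i : measurable_fun setT (fun w => (c w)%:R : R) ->
  measurable [set w | (c w <= i)%N].
Proof.
move=> mc; have := mc measurableT _ (measurable_itv `]-oo, i%:R : R]); rewrite setTI.
congr measurable; apply/seteqP; split => w /=; rewrite in_itv /= ler_nat//.
Qed.

Lemma measurable_size : measurable_fun setT (fun w => (size (pts w))%:R : R).
Proof.
have := measurable_count measurableT; congr measurable_fun; apply/funext => w.
by congr (_%:R); rewrite -[RHS]count_predT; apply: eq_count => x; rewrite in_setT.
Qed.

Lemma measurable_nth_pts i : measurable_fun setT (fun w => nth 0 (pts w) i).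
Proof.
apply: (measurability _ (RGenOInfty.measurableE R)) => _ [_ [y ->] <-]; rewrite setTI.
have m1 := measurable_nat_le i measurable_size.
have m2 : measurable [set w | (count (fun x : R => x <= y)%R (pts w) <= i)%N].
  have := measurable_nat_le i (measurable_count (measurable_itv `]-oo, y])).
  congr measurable; apply/funext => w /=; congr (is_true (_ <= _)%N).
  by apply: eq_count => x; rewrite mem_setE.
(* For [i] beyond the number of points the default value 0 exceeds [y] exactly when y < 0. *)
have -> : (fun w => nth 0 (pts w) i) @^-1` `]y, +oo[ =
   ([set w | (size (pts w) <= i)%N] `&` [set _ | y < 0]) `|`
   (~` [set w | (size (pts w) <= i)%N] `&` [set w | (count (fun x : R => x <= y)%R (pts w) <= i)%N]).
  apply/seteqP; split => w /=; rewrite in_itv /= andbT.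
    case: (leqP (size (pts w)) i) => si yi; [left | right].
      by rewrite nth_default in yi.
    by split; [apply/negP | rewrite -sorted_nth_gt// sort_le_sorted].
  case=> [[si y0]|[/negP]]; first by rewrite nth_default.
  by rewrite -ltnNge => si; rewrite -sorted_nth_gt// sort_le_sorted.
apply: measurableU; apply: measurableI => //; last exact: measurableC.
have [y0|y0] := boolP (y < 0); first by rewrite (_ : [set _ | _] = setT)//; apply/seteqP; split.
by rewrite (_ : [set _ | _] = set0)//; apply/seteqP; split.
Qed.

Let measurable_ksum_mkseq d' (T' : measurableType d') k (F : T' * k.-tuple R -> R) (v : T' -> T) m :
  measurable_fun setT F -> measurable_fun setT v ->
  measurable_fun setT (fun z => ksum (mkseq (nth 0 (pts (v z))) m) (fun u : k.-tuple R => F (z, u))).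
Proof.
move=> + mv; elim: k F => [|k IH] F mF /=.
  by apply: (measurableT_comp mF); exact: measurable_pair2.
rewrite (_ : (fun z => _) = (fun z => \sum_(i <- iota 0 m)
    ksum (mkseq (nth 0 (pts (v z))) m) (fun u : k.-tuple R => F (z, [tuple of nth 0 (pts (v z)) i :: u])))); last first.
  by apply/funext => z; rewrite /mkseq big_map.
apply: measurable_sum => i.
apply: (IH (fun zu : T' * k.-tuple R => F (zu.1, [tuple of nth 0 (pts (v zu.1)) i :: zu.2]))) => //.
apply: (measurableT_comp mF (g := fun zu : T' * k.-tuple R =>
  (zu.1, [tuple of nth 0 (pts (v zu.1)) i :: zu.2]))).
apply/measurable_fun_pairP; split => /=; first exact: measurable_fst.
apply: measurable_cons; last exact: measurable_snd.
apply: (measurableT_comp (measurable_nth_pts i)); apply: (measurableT_comp mv).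
exact: measurable_fst.
Qed.

(** The number of terms is random; on the event of exactly m points the sum runs over the first m of
    them, each measurable. *)
Lemma measurable_ksum k (F : T * k.-tuple R -> R) : measurable_fun setT F ->
  measurable_fun setT (fun w => ksum (pts w) (fun u : k.-tuple R => F (w, u))).
Proof.
move=> mF; pose g m w := ksum (mkseq (nth 0 (pts w)) m) (fun u : k.-tuple R => F (w, u)).
have mg m : measurable_fun setT (g m).
  exact: (measurable_ksum_mkseq m mF (@measurable_id _ T setT)).
move=> _ Y mY; rewrite setTI.
have -> : (fun w => ksum (pts w) (fun u : k.-tuple R => F (w, u))) @^-1` Y =
    \bigcup_m (([set w | (size (pts w) <= m)%N] `\` [set w | (size (pts w) < m)%N]) `&` g m @^-1` Y).
  have gE w : g (size (pts w)) w = ksum (pts w) (fun u : k.-tuple R => F (w, u)).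
    by rewrite /g mkseq_nth.
  apply/seteqP; split => w.
    move=> Yw; exists (size (pts w)) => //; split; last by rewrite /preimage /= gE.
    by split => //=; rewrite ltnn.
  move=> [m _ [[/= sm /negP]]]; rewrite -leqNgt => ms.
  by rewrite /preimage /= -gE (_ : size (pts w) = m)//; apply/eqP; rewrite eqn_leq sm ms.
apply: bigcupT_measurable => m; apply: measurableI.
  apply: measurableD; first exact: measurable_nat_le measurable_size.
  case: m => [|m]; first by rewrite (_ : [set _ | _] = set0)//; apply/seteqP; split.
  exact: measurable_nat_le measurable_size.
by have := mg m measurableT Y mY; rewrite setTI.
Qed.

Lemma measurable_nth_tuple k i : measurable_fun setT (fun u : k.-tuple R => u`_i).
Proof.
have [ik|ki] := ltnP i k.
  have := @measurable_tnth _ R k (Ordinal ik); congr measurable_fun.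
  by apply/funext => u; rewrite (tnth_nth 0).
by rewrite (_ : (fun u => _) = cst 0)//; apply/funext => u; rewrite nth_default// size_tuple.
Qed.

Lemma measurable_uniq k : measurable_fun setT (fun u : k.-tuple R => (uniq u)%:R : R).
Proof.
have E (u : k.-tuple R) : (uniq u)%:R =
    \prod_(i < k) \prod_(j < k) (1 - (i != j)%:R * (tnth u i == tnth u j)%:R) :> R.
  have [/uniqP uq|nu] := boolP (uniq u).
    rewrite big1// => i _; rewrite big1// => j _.
    have [_|ij] := eqVneq i j; first by rewrite mul0r subr0.
    rewrite mul1r (_ : _ == _ = false) ?subr0//; apply/eqP => E.
    move/eqP: ij; apply; apply: val_inj; apply: (uq 0).
    - by rewrite inE size_tuple ltn_ord.
    - by rewrite inE size_tuple ltn_ord.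
    - by rewrite -!tnth_nth.
  have /uniqPn : ~~ uniq u by [].
  move=> /(_ 0)[i [j [ij js E]]]; rewrite size_tuple in js.
  have ik := ltn_trans ij js.
  rewrite (bigD1 (Ordinal ik))//= (bigD1 (Ordinal js))//= -val_eqE /= neq_ltn ij mul1r.
  by rewrite !(tnth_nth 0) /= E eqxx subrr !mul0r.
rewrite (_ : (fun u => _) = fun u : k.-tuple R =>
  \prod_(i < k) \prod_(j < k) (1 - (i != j)%:R * (tnth u i == tnth u j)%:R)); last exact/funext.
apply: measurable_prod => i _; apply: measurable_prod => j _.
apply: measurable_funB; first exact: measurable_cst.
apply: measurable_funM; first exact: measurable_cst.
apply: (measurableT_comp (f := fun b : bool => b%:R : R)) => //.
by apply: measurable_fun_eqr; exact: measurable_tnth.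
Qed.

Lemma measurable_usum k (F : k.-tuple R -> R) : measurable_fun setT F ->
  measurable_fun setT (fun w => usum (pts w) F).
Proof.
move=> mF; apply: (@measurable_ksum k (fun z => (uniq z.2)%:R * F z.2)).
apply: measurable_funM; last exact: (measurableT_comp mF measurable_snd).
exact: (measurableT_comp (@measurable_uniq k) measurable_snd).
Qed.

End points.

(** * Expectations of sums over distinct points *)

Section iterated_means.
Context {R : realType} (N : R).
Hypothesis N0 : 0 < N.
Implicit Types (x y c : R) (k : nat).
Notation mu := (@lebesgue_measure R).

(** The average in the nested form of [integral_Rn]. The lemmas [kmean_tot2] to [kmean_tot4] pass to
    [tot] in four variables, the missing ones being averaged trivially. *)
Fixpoint kmean k : (k.-tuple R -> R) -> R :=
  match k with
  | 0 => fun f => f [tuple]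
  | k'.+1 => fun f => mean N (fun x => kmean (fun u : k'.-tuple R => f [tuple of x :: u]))
  end.

Lemma measurable_consR d (V : measurableType d) k : measurable_fun setT
  (fun z : (V * R) * k.-tuple R => (z.1.1, [tuple of z.1.2 :: z.2]) : V * k.+1.-tuple R).
Proof.
apply/measurable_fun_pairP; split => /=.
  exact: (measurableT_comp measurable_fst measurable_fst).
apply: measurable_cons; last exact: measurable_snd.
exact: (measurableT_comp measurable_snd measurable_fst).
Qed.

Lemma bm_kmean d (V : measurableType d) k (f : V * k.-tuple R -> R) : bm f ->
  bm (fun z => kmean (fun u : k.-tuple R => f (z, u))).
Proof.
elim: k d V f => [|k IH] d V f bf /=.
  by apply: (bm_comp bf (g := fun z => (z, [tuple]))); exact: measurable_pair2.
apply: (bm_mean N0 (f := fun z : V * R => kmean (fun u : k.-tuple R => f (z.1, [tuple of z.2 :: u])))).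
apply: (IH _ (V * R)%type (fun z => f (z.1.1, [tuple of z.1.2 :: z.2]))).
exact: (bm_comp bf (@measurable_consR _ V k)).
Qed.

Lemma bm_cons k (f : k.+1.-tuple R -> R) : bm f ->
  bm (fun z : R * k.-tuple R => f [tuple of z.1 :: z.2]).
Proof.
move=> bf; apply: (bm_comp bf (g := fun z : R * k.-tuple R => [tuple of z.1 :: z.2])).
by apply: measurable_cons; [exact: measurable_fst | exact: measurable_snd].
Qed.

Lemma bm_consx k (f : k.+1.-tuple R -> R) x : bm f -> bm (fun u : k.-tuple R => f [tuple of x :: u]).
Proof.
by move=> /bm_cons bf; apply: (bm_comp bf (g := fun u => (x, u))); exact: measurable_pair1.
Qed.

Lemma bm_kmean_cons k (f : k.+1.-tuple R -> R) : bm f ->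
  bm (fun x => kmean (fun u : k.-tuple R => f [tuple of x :: u])).
Proof. by move=> bf; exact: (bm_kmean (bm_cons bf)). Qed.

Lemma kmeanZ k c (f : k.-tuple R -> R) : bm f -> kmean (fun u => c * f u) = c * kmean f.
Proof.
elim: k f => [//|k IH] f bf /=; rewrite -(meanZ N0 c (bm_kmean_cons bf)).
by congr (mean N _); apply/funext => x; apply: IH; exact: bm_consx.
Qed.

Lemma kmeanD k (f g : k.-tuple R -> R) : bm f -> bm g ->
  kmean (fun u => f u + g u) = kmean f + kmean g.
Proof.
elim: k f g => [//|k IH] f g bf bg /=; rewrite -(meanD N0 (bm_kmean_cons bf) (bm_kmean_cons bg)).
by congr (mean N _); apply/funext => x; apply: IH; exact: bm_consx.
Qed.

Definition inbox k (u : k.-tuple R) := all (fun x => 0 <= x <= N) u.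

Lemma integral_box (f : R -> R) : bm f ->
  (\int[mu]_x (f x * (0 <= x <= N)%R%:R)%:E = (N * mean N f)%:E)%E.
Proof.
move=> bf; rewrite /mean mulVKf ?gt_eqF// /Rintegral fineK; last first.
  by apply: integrable_fin_num => //; exact: bm_integrable.
rewrite [RHS]integral_mkcond; apply: eq_integral => t _; rewrite patchE mem_setE in_itv /=.
by case: ifP => _; rewrite ?mulr1 ?mulr0.
Qed.

Lemma integral_Rn_box k (f : k.-tuple R -> R) : bm f ->
  integral_Rn (fun u => (f u * (inbox u)%:R)%:E) = (N ^+ k * kmean f)%:E.
Proof.
elim: k f => [|k IH] f bf /=; first by rewrite expr0 mul1r mulr1.
have bk := bm_kmean_cons bf.
rewrite exprS -mulrA -(meanZ N0 (N ^+ k) bk) -integral_box; last exact: bmM (bm_cst _ _) bk.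
suff step (x : R) : integral_Rn (fun u : k.-tuple R => (f [tuple of x :: u] * (inbox [tuple of x :: u])%:R)%:E) =
    (N ^+ k * kmean (fun u : k.-tuple R => f [tuple of x :: u]) * (0 <= x <= N)%R%:R)%:E.
  by apply: eq_integral => x _; exact: step.
have bx := bm_consx x bf.
have := IH (fun u => (0 <= x <= N)%R%:R * f [tuple of x :: u]) (bmM (bm_cst _ _) bx).
rewrite (kmeanZ _ bx) => E.
transitivity (N ^+ k * ((0 <= x <= N)%R%:R * kmean (fun u : k.-tuple R => f [tuple of x :: u])))%:E.
  rewrite -E; congr integral_Rn; apply/funext => u; congr (_%:E).
  by rewrite {1}/inbox /= -/(inbox u); case: (_ && (x <= N)); rewrite /= ?mul1r ?mul0r ?mulr0.
by congr (_%:E); ring.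
Qed.

Lemma kmean_tot2 (f : 2.-tuple R -> R) :
  kmean f = tot N (fun x : 4.-tuple R => f [tuple tnth x i0; tnth x i1]).
Proof.
rewrite /tot enum_I4 /=; apply: (f_equal (mean N)); apply/funext => x; apply: (f_equal (mean N)); apply/funext => y.
rewrite /avg; transitivity (mean N (fun=> mean N (fun=> f [tuple of x :: [tuple of y :: [tuple]]]))).
  by rewrite !(mean_cst N0).
apply: (f_equal (mean N)); apply/funext => z; apply: (f_equal (mean N)); apply/funext => t; congr f.
by apply: val_inj; rewrite /= !tnth_upd.
Qed.

Lemma kmean_tot3 (f : 3.-tuple R -> R) :
  kmean f = tot N (fun x : 4.-tuple R => f [tuple tnth x i0; tnth x i1; tnth x i2]).
Proof.
rewrite /tot enum_I4 /=; apply: (f_equal (mean N)); apply/funext => x; apply: (f_equal (mean N)); apply/funext => y.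
apply: (f_equal (mean N)); apply/funext => z.
rewrite /avg; transitivity (mean N (fun=> f [tuple of x :: [tuple of y :: [tuple of z :: [tuple]]]])).
  by rewrite (mean_cst N0).
apply: (f_equal (mean N)); apply/funext => t; congr f.
by apply: val_inj; rewrite /= !tnth_upd.
Qed.

Lemma kmean_tot4 (f : 4.-tuple R -> R) :
  kmean f = tot N (fun x : 4.-tuple R => f [tuple tnth x i0; tnth x i1; tnth x i2; tnth x i3]).
Proof.
rewrite /tot enum_I4 /=; apply: (f_equal (mean N)); apply/funext => x; apply: (f_equal (mean N)); apply/funext => y.
apply: (f_equal (mean N)); apply/funext => z; apply: (f_equal (mean N)); apply/funext => t; congr f.
by apply: val_inj; rewrite /= !tnth_upd.
Qed.

End iterated_means.

(** * From correlation functions to expectations *)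

Section expectations.
Context d (T : measurableType d) {R : realType} (P : probability T R) (X : T -> set R) (N : R).
Hypothesis N0 : 0 < N.
Hypothesis rX : random_configuration X.
Notation pt := (pts X N).

Lemma eq_ksum_in (p : seq R) k (F G : k.-tuple R -> R) :
  (forall u : k.-tuple R, all (fun x => x \in p) u -> F u = G u) -> ksum p F = ksum p G.
Proof.
elim: k F G => [|k IH] F G FG /=; first exact: FG.
rewrite big_seq [RHS]big_seq; apply: eq_bigr => x xp; apply: IH => u up.
by apply: FG; rewrite /= xp.
Qed.

(** The correlation function is tested on [f] cut off to the box; for a given configuration the sum
    is then the finite [usum]. *)
Lemma expect_usum_ge0 k (f rho : k.-tuple R -> R) : bm f -> (forall u, 0 <= f u) -> bm rho ->
  correlation_function P X rho ->
  (\int[P]_w (usum (pt w) f)%:E = (N ^+ k * kmean N (fun u => f u * rho u))%:E)%E.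
Proof.
move=> bf f0 br cX.
pose F (u : k.-tuple R) : \bar R := (f u * (inbox N u)%:R)%:E.
have mbox : measurable_fun setT (fun u : k.-tuple R => (inbox N u)%:R : R).
  have E (u : k.-tuple R) : (inbox N u)%:R = \prod_(i < k) \1_`[0, N] (tnth u i) :> R.
    have [/all_tnthP h|h] := boolP (inbox N u).
      by rewrite big1// => i _; rewrite indicE mem_setE in_itv /= h.
    have /allPn[x /tnthP[i ->] xN] : ~~ all (fun x => 0 <= x <= N) u by [].
    by rewrite (bigD1 i)//= indicE mem_setE in_itv /= (negbTE xN) mul0r.
  rewrite (_ : (fun u => _) = fun u : k.-tuple R => \prod_(i < k) \1_`[0, N] (tnth u i)); last exact/funext.
  apply: measurable_prod => i _; apply: measurableT_comp (measurable_tnth i).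
  exact: measurable_indic.
have mF : measurable_fun setT F by apply/measurable_EFinP; apply: measurable_funM => //; case: bf.
have F0 u : (0 <= F u)%E by rewrite lee_fin mulr_ge0.
transitivity (integral_Rn (fun u : k.-tuple R => F u * (rho u)%:E)%E); last first.
  rewrite -(integral_Rn_box N0 (bmM bf br)); congr integral_Rn; apply/funext => u.
  by rewrite /F -EFinM mulrAC.
rewrite -(cX F mF F0); apply: eq_integral => w _.
have up := uniq_pts X N w.
rewrite esum_mkcond.
pose G (u : k.-tuple R) := (all (fun x => x \in pt w) u)%:R * ((uniq u)%:R * f u).
transitivity (\esum_(u in [set: k.-tuple R]) (G u)%:E)%E.
  rewrite (esum_ksum up) => [|u|u /negbTE]; last 2 first.
  - by rewrite !mulr_ge0.
  - by rewrite /G => ->; rewrite mul0r.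
  by congr (_%:E); apply: eq_ksum_in => u uu; rewrite /G uu mul1r.
apply: eq_esum => u _; rewrite /G /F.
case: ifPn => [/set_mem /= [-> Xu]|nu].
  rewrite mul1r mulrC; congr ((_ * _%:R)%:E); rewrite /inbox.
  have E : {in tval u, (fun x => x \in pt w) =1 (fun x => 0 <= x <= N)}.
    by move=> x /tnthP[i ->]; rewrite (mem_pts N rX); apply/asboolP/idP => [[]|].
  by rewrite (eq_in_all E).
case: (boolP (uniq u)) => uu; last by rewrite mul0r mulr0.
case: (boolP (all _ u)) => au; last by rewrite mul0r.
case/negP: nu; apply/mem_set; split => // i.
by have := all_tnthP au i; rewrite (mem_pts N rX) => /asboolP[].
Qed.

(** The test functions of [correlation_function] are nonnegative, so a signed [f] is shifted by its
    bound and the sum of the constant subtracted. *)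
Lemma expect_usum k (f rho : k.-tuple R -> R) : bm f -> bm rho -> correlation_function P X rho ->
  P.-integrable setT (EFin \o (fun w => usum (pt w) f)) /\
  (\int[P]_w (usum (pt w) f)%:E = (N ^+ k * kmean N (fun u => f u * rho u))%:E)%E.
Proof.
move=> bf br cX; have [mf [C fC]] := bf.
have int (g : k.-tuple R -> R) : bm g -> (forall u, 0 <= g u) -> P.-integrable setT (EFin \o (fun w => usum (pt w) g)).
  move=> bg g0; apply/integrableP; split.
    by apply/measurable_EFinP; apply: (measurable_usum N rX); case: bg.
  have ug w : 0 <= usum (pt w) g.
    by apply: ksum_ge0 => u; rewrite mulr_ge0.
  have -> : (\int[P]_w `|(EFin \o (fun w => usum (pt w) g)) w| = \int[P]_w (usum (pt w) g)%:E)%E.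
    by apply: eq_integral => w _ /=; rewrite ger0_norm.
  by rewrite (expect_usum_ge0 bg g0 br cX) ltry.
pose g u := f u + C.
have bc : bm (fun _ : k.-tuple R => C) by exact: bm_cst.
have C0 : 0 <= C by apply: le_trans (fC [tuple 0 | _ < k]); exact: normr_ge0.
have bg : bm g by exact: bmD.
have g0 u : 0 <= g u by have := fC u; rewrite ler_norml => /andP[h _]; rewrite /g; lra.
have ig := int _ bg g0; have ic := int _ bc (fun=> C0).
have E w : usum (pt w) f = usum (pt w) g - usum (pt w) (fun _ : k.-tuple R => C).
  by rewrite -[X in _ - X]mul1r -[_ - _]addr0 /g usumD; ring.
have E2 : EFin \o (fun w => usum (pt w) f) =
    (fun w => (EFin \o (fun w => usum (pt w) g)) w - (EFin \o (fun w => usum (pt w) (fun _ : k.-tuple R => C))) w)%E.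
  by apply/funext => w; rewrite /comp E EFinB.
split; first by rewrite E2; exact: integrableB.
transitivity (\int[P]_w ((EFin \o (fun w => usum (pt w) g)) w - (EFin \o (fun w => usum (pt w) (fun _ : k.-tuple R => C))) w))%E.
  by apply: eq_integral => w _; exact: (congr1 (fun F : T -> \bar R => F w) E2).
rewrite integralB// (expect_usum_ge0 bg g0 br cX) (expect_usum_ge0 bc (fun=> C0) br cX) -EFinB.
congr (_%:E); rewrite -mulrBr; congr (_ * _).
have -> : (fun u => g u * rho u) = (fun u => f u * rho u + C * rho u).
  by apply/funext => u; rewrite /g mulrDl.
by rewrite (kmeanD N0 (bmM bf br) (bmM bc br)) addrK.
Qed.

End expectations.

(** * Expectations and variances *)

Section moments.
Context d (T : measurableType d) {R : realType} (P : probability T R).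
Implicit Types (Y Z : T -> R) (c m : R).

Definition Ex Y m := P.-integrable setT (EFin \o Y) /\ (\int[P]_w (Y w)%:E = m%:E)%E.

Lemma ExD Y Z m c : Ex Y m -> Ex Z c -> Ex (fun w => Y w + Z w) (m + c).
Proof.
move=> [iY EY] [iZ EZ]; split; first exact: (integrableD _ iY iZ).
by rewrite EFinD -EY -EZ -(integralD _ iY iZ)//; apply: eq_integral.
Qed.

Lemma ExZ a Y m : Ex Y m -> Ex (fun w => a * Y w) (a * m).
Proof.
move=> [iY EY]; split; first exact: (integrableZl _ a iY).
by rewrite EFinM -EY -(integralZl _ iY a)//; apply: eq_integral.
Qed.

Lemma Ex_cst c : Ex (fun=> c) c.
Proof.
split; first exact: finite_measure_integrable_cst.
by rewrite integral_cst// [X in (_ * X)%E](_ : _ = 1%E) ?mule1//; exact: probability_setT.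
Qed.

Lemma Ex_eq Y Z m c : Y =1 Z -> m = c -> Ex Y m -> Ex Z c.
Proof. by move=> YZ <-; congr Ex; apply/funext. Qed.

(** The second moment about any point dominates the variance; its finiteness also provides the
    square integrability. *)
Lemma variance_le Y b c : measurable_fun setT Y ->
  (\int[P]_w ((Y w - b) ^+ 2)%:E <= c%:E)%E -> ('V_P[Y] <= c%:E)%E.
Proof.
move=> mY Yc; pose Z w := Y w - b.
have mZ : measurable_fun setT Z by apply: measurable_funB.
have lZ : Z \in Lfun P 2%:E.
  rewrite inE; apply/andP; split; rewrite inE//= /finite_norm unlock poweR_lty//.
  apply: le_lt_trans (ltry c); apply: le_trans Yc.
  by rewrite le_eqVlt; apply/orP; left; apply/eqP; apply: eq_integral => w _; rewrite /= powR_mulrn// real_normK ?num_real.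
have -> : 'V_P[Y] = 'V_P[Z].
  have -> : Y = (Z \+ cst b)%R by apply/funext => w; rewrite /Z /= subrK.
  exact: varianceD_cst_r.
rewrite varianceE//.
have h1 : ('E_P[Z ^+ 2] <= c%:E)%E.
  by rewrite unlock; apply: le_trans Yc; rewrite le_eqVlt; apply/orP; left; apply/eqP; apply: eq_integral.
apply: le_trans h1; rewrite -[leRHS]sube0 leeB// expe2.
have : ('E_P[Z])%E \is a fin_num.
  by apply: expectation_fin_num; apply: Lfun_subset12 => //; rewrite fin_num_measure.
by move=> /fineK <-; rewrite -EFinM lee_fin -expr2 sqr_ge0.
Qed.

End moments.

(** * Moments of pair statistics *)

Section correlations.
Context {R : realType} (S D I Q : R -> R) (k : R).
Hypothesis K : sine_kernel S D I Q k.

Section coordinates.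
Context d (V : measurableType d) (x y z t : V -> R).
Hypotheses (mx : measurable_fun setT x) (my : measurable_fun setT y).
Hypotheses (mz : measurable_fun setT z) (mt : measurable_fun setT t).

Let bdiff (f : R -> R) (u v : V -> R) : bm f -> measurable_fun setT u -> measurable_fun setT v ->
  bm (fun w => f (u w - v w)).
Proof. by move=> bf mu mv; apply: (bm_comp bf (g := fun w => u w - v w)); exact: measurable_funB. Qed.

Let bS u v := @bdiff S u v (bm_S K).
Let bD u v := @bdiff D u v (bm_D K).
Let bI u v := @bdiff I u v (bm_I K).

Lemma bm_cyc2 (u v : V -> R) : measurable_fun setT u -> measurable_fun setT v ->
  bm (fun w => cyc2 S D I (u w) (v w)).
Proof.
move=> mu mv; have -> : (fun w => cyc2 S D I (u w) (v w)) = fun w => 2^-1 * (2 * S (u w - v w) * S (v w - u w) +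
  D (u w - v w) * I (v w - u w) + I (u w - v w) * D (v w - u w)).
  by apply/funext => w; rewrite cyc2E.
apply: bmM; first exact: bm_cst.
apply: bmD; [apply: bmD |]; apply: bmM; first [exact: bS | exact: bD | exact: bI | idtac].
by apply: bmM; [exact: bm_cst | exact: bS].
Qed.

Lemma bm_cyc3 (u v s : V -> R) : measurable_fun setT u -> measurable_fun setT v -> measurable_fun setT s ->
  bm (fun w => cyc3 S D I (u w) (v w) (s w)).
Proof.
move=> mu mv ms; rewrite (_ : (fun w => _) = fun w =>
  S (u w - v w) * (S (v w - s w) * S (s w - u w)) + 2^-1 * (
  D (u w - v w) * (S (s w - u w) * I (v w - s w)) + D (u w - v w) * (S (v w - s w) * I (s w - u w)) +
  D (v w - s w) * (S (s w - u w) * I (u w - v w)) + D (v w - s w) * (S (u w - v w) * I (s w - u w)) +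
  D (s w - u w) * (S (v w - s w) * I (u w - v w)) + D (s w - u w) * (S (u w - v w) * I (v w - s w)))); last first.
  by apply/funext => w; rewrite cyc3E.
apply: bmD; last (apply: bmM; first exact: bm_cst); repeat apply: bmD;
  apply: bmM; first [exact: bS | exact: bD | idtac]; apply: bmM; first [exact: bS | exact: bD | exact: bI].
Qed.

Lemma bm_cyc4 (u v s r : V -> R) : measurable_fun setT u -> measurable_fun setT v ->
  measurable_fun setT s -> measurable_fun setT r ->
  bm (fun w => cyc4 S D I (u w) (v w) (s w) (r w)).
Proof.
move=> mu mv ms mr.
pose f (p q : V -> R) (g : R -> R) w := g (p w - q w).
have bfS p q : measurable_fun setT p -> measurable_fun setT q -> bm (f p q S) by exact: bS.
have bfD p q : measurable_fun setT p -> measurable_fun setT q -> bm (f p q D) by exact: bD.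
have bfI p q : measurable_fun setT p -> measurable_fun setT q -> bm (f p q I) by exact: bI.
rewrite (_ : (fun w => _) = fun w =>
  mix4 (f u v S w) (f v s S w) (f s r S w) (f r u S w) (f u v D w) (f v s D w) (f s r D w) (f r u D w)
   (f u v I w) (f v s I w) (f s r I w) (f r u I w) +
  2^-1 * (f u v D w * (f v s I w * (f s r D w * f r u I w)) +
    f v s D w * (f s r I w * (f r u D w * f u v I w)))); last first.
  by apply/funext => w; rewrite cyc4E.
have m4 (a b c e : V -> R) : bm a -> bm b -> bm c -> bm e -> bm (fun w => a w * (b w * (c w * e w))).
  by move=> ba bb bc be; do 3 apply: bmM => //.
have h1 := bfS _ _ mu mv; have h2 := bfS _ _ mv ms; have h3 := bfS _ _ ms mr; have h4 := bfS _ _ mr mu.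
have g1 := bfD _ _ mu mv; have g2 := bfD _ _ mv ms; have g3 := bfD _ _ ms mr; have g4 := bfD _ _ mr mu.
have j1 := bfI _ _ mu mv; have j2 := bfI _ _ mv ms; have j3 := bfI _ _ ms mr; have j4 := bfI _ _ mr mu.
apply: bmD; last by apply: bmM; [exact: bm_cst | apply: bmD; exact: m4].
apply: bmD; first exact: m4.
apply: bmM; first exact: bm_cst.
by do 11 (apply: bmD; last exact: m4); exact: m4.
Qed.

Lemma bm_corr2 : bm (fun w => corr2 S D I (x w) (y w)).
Proof. by apply: bmB; [exact: bm_cst | exact: bm_cyc2]. Qed.

Lemma bm_corr3 : bm (fun w => corr3 S D I (x w) (y w) (z w)).
Proof.
do 2 (apply: bmD; last exact: bm_cyc3); do 3 (apply: bmB; last exact: bm_cyc2).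
exact: bm_cst.
Qed.

Lemma bm_corr4 : bm (fun w => corr4 S D I (x w) (y w) (z w) (t w)).
Proof.
do 6 (apply: bmB; last exact: bm_cyc4).
do 3 (apply: bmD; last by apply: bmM; exact: bm_cyc2).
do 8 (apply: bmD; last exact: bm_cyc3); do 6 (apply: bmB; last exact: bm_cyc2).
exact: bm_cst.
Qed.

End coordinates.

Context d (T : measurableType d) (P : probability T R) (X : T -> set R) (N : R).
Hypothesis N0 : 0 < N.
Hypothesis rX : random_configuration X.
Notation pt := (pts X N).
Notation c2 := (fun u : 2.-tuple R => corr2 S D I u`_0 u`_1).
Notation c3 := (fun u : 3.-tuple R => corr3 S D I u`_0 u`_1 u`_2).
Notation c4 := (fun u : 4.-tuple R => corr4 S D I u`_0 u`_1 u`_2 u`_3).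
Hypothesis cX2 : correlation_function P X c2.
Hypothesis cX3 : correlation_function P X c3.
Hypothesis cX4 : correlation_function P X c4.

Let mn n i : measurable_fun setT (fun u : n.-tuple R => u`_i) := @measurable_nth_tuple R n i.
Let b2 : bm c2 := bm_corr2 (@mn 2 0) (@mn 2 1).
Let b3 : bm c3 := bm_corr3 (@mn 3 0) (@mn 3 1) (@mn 3 2).
Let b4 : bm c4 := bm_corr4 (@mn 4 0) (@mn 4 1) (@mn 4 2) (@mn 4 3).

Let bd n i j (f : R -> R) : bm f -> bm (fun u : n.-tuple R => f (u`_i - u`_j)).
Proof.
move=> bf; apply: (bm_comp bf (g := fun u : n.-tuple R => u`_i - u`_j)).
by apply: measurable_funB; exact: mn.
Qed.

(** The sum L f of the overview. *)
Definition pair_stat (f : R -> R) w := pairsum (pt w) (fun x y => f (x - y)).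

Lemma Ex_psum (f : R -> R) : bm f ->
  Ex P (pair_stat f) (N ^+ 2 * tot N (fun x => pr f i0 i1 x * rho2 S D I x)).
Proof.
move=> bf; have [iu Eu] := expect_usum N0 rX (bd 2 0 1 bf) b2 cX2.
apply: Ex_eq (conj iu Eu).
  by move=> w; rewrite /pair_stat (pairsumE _ (fun x y => f (x - y))).
by rewrite kmean_tot2.
Qed.

Lemma Ex_psumM (f g : R -> R) : bm f -> bm g -> (forall u, f (- u) = f u) -> (forall u, g (- u) = g u) ->
  Ex P (fun w => pair_stat f w * pair_stat g w)
   (N ^+ 4 * tot N (fun x => pr f i0 i1 x * pr g i2 i3 x * rho4 S D I x) +
    4 * (N ^+ 3 * tot N (fun x => pr f i0 i1 x * pr g i0 i2 x * rho3 S D I x)) +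
    2 * (N ^+ 2 * tot N (fun x => pr f i0 i1 x * pr g i0 i1 x * rho2 S D I x))).
Proof.
move=> bf bg fN gN.
have [iu4 Eu4] := expect_usum N0 rX (bmM (bd 4 0 1 bf) (bd 4 2 3 bg)) b4 cX4.
have [iu3 Eu3] := expect_usum N0 rX (bmM (bd 3 0 1 bf) (bd 3 0 2 bg)) b3 cX3.
have [iu2 Eu2] := expect_usum N0 rX (bmM (bd 2 0 1 bf) (bd 2 0 1 bg)) b2 cX2.
apply: Ex_eq (ExD (ExD (conj iu4 Eu4) (ExZ 4 (conj iu3 Eu3))) (ExZ 2 (conj iu2 Eu2))).
  move=> w; rewrite /pair_stat (pairsumM (uniq_pts X N w)) //.
  - by move=> x y; rewrite -opprB fN.
  - by move=> x y; rewrite -opprB gN.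
congr (_ * _ + 4 * (_ * _) + 2 * (_ * _)); [exact: kmean_tot4 | exact: kmean_tot3 | exact: kmean_tot2].
Qed.

Lemma Ex_psum_variance h dh L : pair_potential N h dh L ->
  exists m, Ex P (fun w => (pair_stat h w - m) ^+ 2) (pair_variance S D I N h).
Proof.
move=> H; have bh := bm_h H.
exists (N ^+ 2 * tot N (fun x => pr h i0 i1 x * rho2 S D I x)).
set m := N ^+ 2 * _.
have E1 := Ex_psum bh; have E2 := Ex_psumM bh bh (pp_hN H) (pp_hN H).
apply: Ex_eq (ExD (ExD E2 (ExZ (- 2 * m) E1)) (Ex_cst P (m ^+ 2))).
  by move=> w; ring.
rewrite /pair_variance -/m.
have -> : (fun x => pr h i0 i1 x * pr h i0 i1 x * rho2 S D I x) = (fun x => pr h i0 i1 x ^+ 2 * rho2 S D I x).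
  by apply/funext => x; rewrite expr2.
by ring.
Qed.

(** The expectation of the Cauchy-Schwarz product for the remainder. The correlation functions are
    merely bounded by [C]; 7 = 1 + 4 + 2 counts the coincidences, all powers of [N] being replaced
    by the fourth. *)
Lemma Ex_psum_count (C : R) (f : R -> R) (c : R) : 1 <= N -> bm f -> (forall u, 0 <= f u) -> (forall u, f (- u) = f u) ->
  (forall y, mean N (fun t => f (t - y)) <= c) ->
  (forall x : 4.-tuple R, [/\ `|rho2 S D I x| <= C, `|rho3 S D I x| <= C & `|rho4 S D I x| <= C]) ->
  exists2 m, Ex P (fun w => pair_stat f w * pair_stat (fun=> 1) w) m & m <= 7 * C * N ^+ 4 * c.
Proof.
move=> N1 bf f0 fN fc rC.
have bo : bm (fun _ : R => 1 : R) by exact: bm_cst.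
have E := Ex_psumM bf bo fN (fun=> erefl); eexists; first exact: E.
have bp : bm (pr f i0 i1) by exact: bm_pr.
have p0 x : 0 <= pr f i0 i1 x by exact: f0.
have C0 : 0 <= C by have [/(le_trans (normr_ge0 _))] := rC [tuple 0 | _ < 4].
have tc : tot N (pr f i0 i1) <= c.
  rewrite -(tot_avg N0 i0 bp) -(tot_cst 4 N0 c); apply: (le_tot N0); [exact: bm_avg | exact: bm_cst |].
  by move=> x cx; rewrite avg_pr.
have tb (rho : 4.-tuple R -> R) (g : 4.-tuple R -> R) : bm rho -> (forall x, `|rho x| <= C) -> (forall x, g x = 1) ->
    tot N (fun x => pr f i0 i1 x * g x * rho x) <= C * c.
  move=> br rC' g1; apply: le_trans (ler_wpM2l C0 tc); rewrite -(totZ N0 _ bp).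
  have -> : (fun x => pr f i0 i1 x * g x * rho x) = (fun x => pr f i0 i1 x * rho x).
    by apply/funext => x; rewrite g1 mulr1.
  apply: (le_tot N0); [exact: bmM | exact: bmZ |].
  by move=> x _; rewrite mulrC ler_wpM2r// (le_trans (ler_norm _)).
have mt i : measurable_fun setT (fun x : 4.-tuple R => tnth x i) by exact: measurable_tnth.
have t4 := tb (rho4 S D I) (pr (fun=> 1) i2 i3) (bm_corr4 (mt i0) (mt i1) (mt i2) (mt i3)) (fun x => let: And3 _ _ h := rC x in h) (fun=> erefl).
have t3 := tb (rho3 S D I) (pr (fun=> 1) i0 i2) (bm_corr3 (mt i0) (mt i1) (mt i2)) (fun x => let: And3 _ h _ := rC x in h) (fun=> erefl).
have t2 := tb (rho2 S D I) (pr (fun=> 1) i0 i1) (bm_corr2 (mt i0) (mt i1)) (fun x => let: And3 h _ _ := rC x in h) (fun=> erefl).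
have c0 : 0 <= c by apply: le_trans tc; apply: (tot_ge0 N0).
have Cc : 0 <= C * c by exact: mulr_ge0.
have N3 : N ^+ 3 <= N ^+ 4 by rewrite ler_weXn2l.
have N2 : N ^+ 2 <= N ^+ 4 by rewrite ler_weXn2l.
have P4 : 0 <= N ^+ 4 by rewrite exprn_ge0// ltW.
have P3 : 0 <= N ^+ 3 by rewrite exprn_ge0// ltW.
have P2 : 0 <= N ^+ 2 by rewrite exprn_ge0// ltW.
have q4 := ler_wpM2l P4 t4.
have q3 := le_trans (ler_wpM2l P3 t3) (ler_wpM2r Cc N3).
have q2 := le_trans (ler_wpM2l P2 t2) (ler_wpM2r Cc N2).
rewrite (_ : 7 * C * N ^+ 4 * c = 7 * (N ^+ 4 * (C * c))); last by ring.
move: q2 q3 q4; move: (N ^+ 4 * (C * c)) => B; lra.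
Qed.

End correlations.

(** * Variance of the energy *)

Section energy.
Context {R : realType} (S D I Q : R -> R) (k : R).
Hypothesis K : sine_kernel S D I Q k.
Context d (T : measurableType d) (P : probability T R) (X : T -> set R) (N : R).
Hypothesis N2 : 2 <= N.
Hypothesis rX : random_configuration X.
Hypothesis cX2 : correlation_function P X (fun u : 2.-tuple R => corr2 S D I u`_0 u`_1).
Hypothesis cX3 : correlation_function P X (fun u : 3.-tuple R => corr3 S D I u`_0 u`_1 u`_2).
Hypothesis cX4 : correlation_function P X (fun u : 4.-tuple R => corr4 S D I u`_0 u`_1 u`_2 u`_3).
Implicit Types (w : T) (x y u : R).
Notation pt := (pts X N).
Notation psum := (pair_stat X N).

Let N0 : 0 < N. Proof. by apply: lt_le_trans N2. Qed.
Let N1 : 1 <= N. Proof. by apply: le_trans N2; rewrite ler1n. Qed.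
Let om : R := pi *+ 2 / N.
Let omN : om * N = pi *+ 2. Proof. by rewrite divfK// lt0r_neq0. Qed.

Definition logsin u := ln `|2 * sn om u|.

Lemma energyE w : renormalized_energy N (X w) = - (N^-1 * psum logsin w) + ln N.
Proof.
rewrite /renormalized_energy; congr (- (_ * _) + _).
pose r := [seq z <- [seq (x, y) | x <- pt w, y <- pt w] | z.1 != z.2].
have ur : uniq r.
  rewrite filter_uniq// allpairs_uniq ?uniq_pts// => -[x y] [x' y'] _ _ /= [-> ->]//.
have -> : [set p : R * R | [/\ X w p.1, X w p.2, 0 <= p.1 <= N, 0 <= p.2 <= N & p.1 != p.2]] = [set` r].
  apply/seteqP; split => [[x y] /= [Xx Xy xN yN xy]|[x y] /=].
    rewrite mem_filter /= xy; apply/allpairsP; exists (x, y); rewrite /= !(mem_pts N rX).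
    by split => //; apply/asboolP.
  rewrite mem_filter /= => /andP[xy /allpairsP[[x' y'] /= [xp yp [ex ey]]]].
  by move: xp yp; rewrite -ex -ey !(mem_pts N rX) => /asboolP[Xx xN] /asboolP[Xy yN]; split.
rewrite -fsbig_seq// big_filter big_mkcond big_allpairs /pair_stat /pairsum.
apply: eq_bigr => x _; apply: eq_bigr => y _ /=; case: ifP => _; rewrite ?mul1r ?mul0r//.
rewrite /logsin /sn (_ : om / 2 * (x - y) = pi * (x - y) / N)//.
by rewrite /om -mulr_natr; move: (@pi R) => p; field; rewrite lt0r_neq0.
Qed.

Lemma measurable_logsin : measurable_fun setT logsin.
Proof.
have m2 : measurable_fun setT (fun u => 2 * sn om u).
  apply: measurable_funM; first exact: measurable_cst.
  by apply: continuous_measurable_fun; have := @continuous_trig R (om / 2) _ (@continuous_sin R).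
by apply: (measurableT_comp (@measurable_ln R)); exact: measurableT_comp m2.
Qed.

Lemma measurable_psum (f : R -> R) : measurable_fun setT f -> measurable_fun setT (psum f).
Proof.
move=> mf; rewrite (_ : psum f = fun w => usum (pt w) (fun u : 2.-tuple R => f (u`_0 - u`_1))); last first.
  by apply/funext => w; rewrite /pair_stat (pairsumE _ (fun x y => f (x - y))).
apply: (measurable_usum N rX); apply: (measurableT_comp mf).
by apply: measurable_funB; exact: measurable_nth_tuple.
Qed.

Section remainder.
Variable dl : R.
Hypothesis d0 : 0 < dl <= 2^-1.

Let h := logpot om (1 - dl).
Let q01 : 0 <= 1 - dl < 1. Proof. by case/andP: d0 => ? ?; apply/andP; split; lra. Qed.
Let r u := logsin u - h u.
(** A bounded version of the estimate in [remainder_sq], since expectations of sums are available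
    for bounded functions; the limit in n is taken by Fatou's lemma. *)
Let phi n u := 2 * dl ^+ 2 + 32 * Num.sqrt dl * psi om n.+1%:R^-1 u.
Let c0 : 0 < 32 * Num.sqrt dl. Proof. by rewrite mulr_gt0// sqrtr_gt0; case/andP: d0. Qed.
Let phi_ge0 n u : 0 <= phi n u.
Proof. by apply: addr_ge0; [rewrite mulr_ge0 ?sqr_ge0 | rewrite mulr_ge0 ?psi_ge0// ltW]. Qed.

Let cvg_seq_sum (E : Type) (s : seq E) (f : E -> nat -> R) (l : E -> R) :
  (forall i, f i n @[n --> \oo] --> l i) -> \sum_(i <- s) f i n @[n --> \oo] --> \sum_(i <- s) l i.
Proof.
move=> fl; elim: s => [|i s IH].
  by rewrite big_nil (_ : (fun _ => _) = fun=> 0); [exact: cvg_cst | apply/funext => n; rewrite big_nil].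
rewrite big_cons (_ : (fun _ => _) = fun n => f i n + \sum_(j <- s) f j n).
  by apply: cvgD; [exact: fl | exact: IH].
by apply/funext => n; rewrite big_cons.
Qed.

(** If two distinct points have vanishing sine, the right-hand side is infinite; otherwise every
    term converges and [remainder_sq] applies to each pair. *)
Lemma remainder_liminf w : ((psum (fun=> 1) w * psum (fun u => r u ^+ 2) w)%:E <=
  limn_einf (fun n => (psum (phi n) w * psum (fun=> 1) w)%:E))%E.
Proof.
set n1 := psum (fun=> 1) w.
have n10 : 0 <= n1 by apply: pairsum_ge0.
have [sing|reg] := pselect (exists x y, [/\ x \in pt w, y \in pt w, x != y & sn om (x - y) = 0]).
  have [x [y [xp yp xy s0]]] := sing.
  have term (f : R -> R -> R) : (forall u v, 0 <= f u v) -> f x y <= pairsum (pt w) f.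
    move=> f0; rewrite /pairsum (bigD1_seq x)//= ?uniq_pts// (bigD1_seq y)//= ?uniq_pts//.
    rewrite xy mul1r -addrA lerDl addr_ge0//; first by apply: sumr_ge0 => v _; rewrite mulr_ge0.
    by apply: sumr_ge0 => v _; apply: sumr_ge0 => v' _; rewrite mulr_ge0.
  have n11 : 1 <= n1 by apply: (term (fun _ _ => 1)).
  have lim : (psum (phi n) w * n1)%:E @[n --> \oo] --> +oo%E.
    apply/cvgeryP; apply/cvgryPge => A.
    have := cvg_psi_y s0 => /cvgryPge /(_ (A / (32 * Num.sqrt dl))).
    apply: filterS => n An.
    have h1 : A <= 32 * Num.sqrt dl * psi om n.+1%:R^-1 (x - y).
      by rewrite mulrC -ler_pdivrMr.
    have h2 : phi n (x - y) <= psum (phi n) w by exact: (term (fun x y => phi n (x - y)) (fun _ _ => phi_ge0 n _)).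
    have h3 : psum (phi n) w <= psum (phi n) w * n1.
      by rewrite ler_peMr// (le_trans _ h2).
    apply: le_trans h3; apply: le_trans h2; apply: le_trans h1 _.
    by rewrite lerDr mulr_ge0// sqr_ge0.
  by rewrite (cvg_limn_einf_sup lim).1 leey.
have nz x y : x \in pt w -> y \in pt w -> x != y -> sn om (x - y) != 0.
  by move=> xp yp xy; apply/eqP => s0; apply: reg; exists x, y.
pose phioo u := 2 * dl ^+ 2 + 32 * Num.sqrt dl * (Num.sqrt `|sn om u|)^-1.
have lim : (psum (phi n) w * n1)%:E @[n --> \oo] --> (psum phioo w * n1)%:E.
  apply: cvg_EFin; first exact: nearW.
  apply: cvgM; last exact: cvg_cst.
  rewrite /pair_stat /pairsum big_seq.
  rewrite (_ : (fun n => _) = fun n => \sum_(x <- pt w | x \in pt w) \sum_(y <- pt w | y \in pt w) (x != y)%:R * phi n (x - y)); last first.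
    by apply/funext => n; rewrite big_seq; apply: eq_bigr => x _; rewrite big_seq.
  have seqE (F : R -> R) : \sum_(x <- pt w | x \in pt w) F x = \sum_(x <- pt w) (x \in pt w)%:R * F x.
    by rewrite big_mkcond; apply: eq_bigr => x _; case: ifP => _; rewrite ?mul1r ?mul0r.
  rewrite seqE (_ : (fun n => _) = fun n => \sum_(x <- pt w) (x \in pt w)%:R * \sum_(y <- pt w) (y \in pt w)%:R * ((x != y)%:R * phi n (x - y))); last first.
    by apply/funext => n; rewrite seqE; apply: eq_bigr => x _; rewrite seqE.
  apply: cvg_seq_sum => x; have [xp|xp] := boolP (x \in pt w); last first.
    rewrite mul0r (_ : (fun n => _) = fun=> 0); first exact: cvg_cst.
    by apply/funext => n; rewrite mul0r.
  apply: cvgM; first exact: cvg_cst.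
  rewrite (_ : \sum_(y <- pt w) _ = \sum_(y <- pt w) (y \in pt w)%:R * ((x != y)%:R * phioo (x - y))); last first.
    by rewrite big_seq seqE; apply: eq_bigr.
  apply: cvg_seq_sum => y; have [yp|yp] := boolP (y \in pt w); last first.
    rewrite mul0r (_ : (fun n => _) = fun=> 0); first exact: cvg_cst.
    by apply/funext => n; rewrite mul0r.
  apply: cvgM; first exact: cvg_cst.
  have [xy|xy] := eqVneq x y.
    rewrite mul0r (_ : (fun n => _) = fun=> 0); first exact: cvg_cst.
    by apply/funext => n; rewrite mul0r.
  apply: cvgM; first exact: cvg_cst.
  apply: cvgD; first exact: cvg_cst.
  by apply: cvgM; [exact: cvg_cst | apply: cvg_psi; exact: nz].
rewrite (cvg_limn_einf_sup lim).1 lee_fin mulrC ler_wpM2r//.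
apply: le_pairsum => x y xp yp xy.
exact: (remainder_sq (nz _ _ xp yp xy) d0).
Qed.

(** The energy is centred at the value given by the expected smoothed sum, and the factors 2 come
    from (a + b) ^ 2 <= 2 a ^ 2 + 2 b ^ 2. *)
Lemma energy_variance_le (L C V : R) : pair_potential N h (dlogpot om (1 - dl)) L ->
  pair_variance S D I N h <= V ->
  (forall x : 4.-tuple R, [/\ `|rho2 S D I x| <= C, `|rho3 S D I x| <= C & `|rho4 S D I x| <= C]) ->
  ('V_P[(fun w => renormalized_energy N (X w))] <=
    (N ^- 2 * (2 * V + 2 * (7 * C * N ^+ 4 * (2 * dl ^+ 2 + 96 * Num.sqrt dl))))%:E)%E.
Proof.
move=> H HV rC.
have [m [iA EA]] := Ex_psum_variance K N0 rX cX2 cX3 cX4 H.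
have bphi n : bm (phi n).
  apply: bmD; first exact: bm_cst.
  by apply: bmM; [exact: bm_cst | apply: bm_psi; rewrite invr_gt0].
have phiN n u : phi n (- u) = phi n u by rewrite /phi /psi /sn mulrN sinN sqrrN.
set c := 2 * dl ^+ 2 + 96 * Num.sqrt dl.
have phic n y : mean N (fun t => phi n (t - y)) <= c.
  have bp : bm (psi om n.+1%:R^-1) by apply: bm_psi; rewrite invr_gt0.
  have bps := bm_shift y bp.
  rewrite /phi (meanD N0 (bm_cst _ _) (bmM (bm_cst _ (32 * Num.sqrt dl)) bps)) (mean_cst N0) (meanZ N0 _ bps) /c lerD2l.
  have n0 : 0 < n.+1%:R^-1 :> R by rewrite invr_gt0.
  have := mean_psi N0 omN n0 y; rewrite mulrC ler_pM2r// => m3.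
  by have := ler_wpM2l (ltW c0) m3; lra.
have Zb n : exists2 z, Ex P (fun w => psum (phi n) w * psum (fun=> 1) w) z & z <= 7 * C * N ^+ 4 * c.
  exact: (Ex_psum_count K N0 rX cX2 cX3 cX4 N1 (bphi n) (phi_ge0 n) (phiN n) (phic n) rC).
apply: (@variance_le _ _ _ P _ (- (N^-1 * m) + ln N)).
  rewrite (_ : (fun w => _) = fun w => - (N^-1 * psum logsin w) + ln N); last first.
    by apply/funext => w; exact: energyE.
  apply: measurable_funD; last exact: measurable_cst.
  apply: measurableT_comp => //; apply: measurable_funM; first exact: measurable_cst.
  exact: measurable_psum measurable_logsin.
have NN : 0 <= N ^- 2 by rewrite invr_ge0 exprn_ge0// ltW.
pose A w := 2 * N ^- 2 * (psum h w - m) ^+ 2.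
pose Z n w := psum (phi n) w * psum (fun=> 1) w.
pose B w : \bar R := limn_einf (fun n => (Z n w)%:E).
have Z0 n w : 0 <= Z n w by rewrite mulr_ge0//; apply: pairsum_ge0.
have B0 w : (0 <= B w)%E.
  rewrite /B limn_einf_lim; apply: lime_ge; first exact: is_cvg_einfs.
  by apply: nearW => n; apply: le_ereal_inf_tmp => _ [j _ <-]; rewrite lee_fin.
have mZ n : measurable_fun setT (fun w => (Z n w)%:E).
  by have [z [/measurable_int iz _] _] := Zb n.
have mB : measurable_fun setT B.
  have -> : B = fun w => (- limn_esup (fun n => - (Z n w)%:E))%E.
    by apply/funext => w; rewrite -limn_einfN; congr limn_einf; apply/funext => n; rewrite /comp oppeK.
  apply: measurableT_comp => //; apply: measurable_fun_limn_esup => n.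
  by apply: measurableT_comp.
have mA : measurable_fun setT (EFin \o A).
  have /measurable_int/measurable_EFinP mA' := iA.
  by apply/measurable_EFinP; apply: measurable_funM => //; exact: measurable_cst.
have c2 : 0 <= 2 * N ^- 2 by rewrite mulr_ge0.
have A0 w : 0 <= A w by apply: mulr_ge0 => //; exact: sqr_ge0.
(* Fatou's lemma, the bound on the expectations being uniform in n. *)
have IB : (\int[P]_w B w <= (7 * C * N ^+ 4 * c)%:E)%E.
  apply: le_trans (fatou _ _ _ _) _ => //; first by move=> n w _; rewrite lee_fin.
  rewrite limn_einf_lim; apply: lime_le; first exact: is_cvg_einfs.
  apply: nearW => n; have [z [_ Ez] zc] := Zb n.
  apply: (@le_trans _ _ z%:E); last by rewrite lee_fin.
  by apply: ereal_inf_lbound; exists n => //=; rewrite Ez.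
have IA : (\int[P]_w (A w)%:E = (2 * N ^- 2 * pair_variance S D I N h)%:E)%E.
  by have [_ ->] := ExZ (2 * N ^- 2) (conj iA EA).
apply: (@le_trans _ _ (\int[P]_w ((A w)%:E + (2 * N ^- 2)%:E * B w)))%E.
  apply: ge0_le_integral => //.
  - by move=> w _; rewrite lee_fin sqr_ge0.
  - apply/measurable_EFinP; apply: measurable_funX; apply: measurable_funB; last exact: measurable_cst.
    rewrite (_ : (fun w => _) = fun w => - (N^-1 * psum logsin w) + ln N); last first.
      by apply/funext => w; exact: energyE.
    apply: measurable_funD; last exact: measurable_cst.
    apply: measurableT_comp => //; apply: measurable_funM; first exact: measurable_cst.
    exact: measurable_psum measurable_logsin.
  - by apply: emeasurable_funD => //; exact: measurable_funeM.
  - move=> w _; rewrite energyE.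
    have E : - (N^-1 * psum logsin w) + ln N - (- (N^-1 * m) + ln N) = - N^-1 * (psum logsin w - m) by ring.
    rewrite E exprMn sqrrN exprVn.
    have sE : psum logsin w = psum h w + psum r w.
      rewrite /pair_stat -pairsumD; congr pairsum; apply/funext => x; apply/funext => y.
      by rewrite /r; ring.
    have cs : psum r w ^+ 2 <= psum (fun=> 1) w * psum (fun u => r u ^+ 2) w by exact: pairsum_cauchy.
    have rl := remainder_liminf w.
    apply: (@le_trans _ _ ((A w)%:E + (2 * N ^- 2)%:E * (psum r w ^+ 2)%:E)%E); last first.
      rewrite leeD2lE// lee_wpmul2l ?lee_fin//.
      by apply: le_trans rl; rewrite lee_fin.
    rewrite -EFinM -EFinD lee_fin /A sE.
    rewrite -!mulrA [2 * (_ * _)]mulrCA [2 * (_ * psum r w ^+ 2)]mulrCA -mulrDr ler_wpM2l//.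
    by have := sqr_ge0 (psum h w - m - psum r w); rewrite !expr2; lra.
rewrite ge0_integralD//; last 3 first.
- by move=> w _; rewrite lee_fin.
- by move=> w _; rewrite mule_ge0.
- exact: measurable_funeM.
rewrite ge0_integralZl_EFin//.
rewrite IA; apply: (@le_trans _ _ ((2 * N ^- 2 * pair_variance S D I N h)%:E + (2 * N ^- 2)%:E * (7 * C * N ^+ 4 * c)%:E)%E).
  by rewrite leeD2lE// lee_wpmul2l ?lee_fin.
rewrite -EFinM -EFinD lee_fin -/c.
rewrite (_ : N ^- 2 * _ = 2 * N ^- 2 * V + 2 * N ^- 2 * (7 * C * N ^+ 4 * c)); last by ring.
by rewrite lerD2r ler_wpM2l.
Qed.

End remainder.

End energy.

(** * Rate of convergence *)

Section rate.
Context {R : realType}.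
Implicit Types (N : R).

(** From exp (-1/2) >= 1/2. It makes 100 ln N at least 1 for N >= 2, as [pair_potential] demands. *)
Lemma ln2_ge : 2^-1 <= ln 2 :> R.
Proof.
rewrite -ler_expR lnK ?posrE//; have := expR_ge1Dx (- 2^-1 : R); rewrite expRN => h.
have e0 := expR_gt0 (2^-1 : R).
rewrite -[X in X <= _]invrK -[leRHS]invrK lef_pV2 ?posrE ?invr_gt0//.
by apply: le_trans h; lra.
Qed.

(** The exponent 1 / 10 makes the fifth power of ln N at most a multiple of sqrt N. *)
Lemma ln_le_root N : 1 <= N -> exists2 s, 0 <= s & s ^+ 10 = N /\ ln N <= 10 * s.
Proof.
move=> N1; have N0 : 0 < N by exact: lt_le_trans N1.
exists (N `^ (10%:R^-1)); first exact: powR_ge0.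
split; first by rewrite -powR_mulrn ?powR_ge0// -powRrM mulVf ?pnatr_eq0// powRr1// ltW.
have := ln_sublinear (powR_gt0 10%:R^-1 N0); rewrite ln_powR => /ltW h.
have := ler_wpM2l (ler0n R 10) h; rewrite mulrA divff ?pnatr_eq0// mul1r.
by rewrite (_ : 10%:R = 10 :> R).
Qed.

Lemma inv_sqrt_cvg0 (c : R) : (c * (Num.sqrt N)^-1)%:E @[N --> +oo] --> 0%:E.
Proof.
apply: cvg_EFin; first exact: nearW.
rewrite -[X in _ --> X](mulr0 c); apply: cvgM; first exact: cvg_cst.
apply/gtr0_cvgV0.
  by near=> N; rewrite sqrtr_gt0; near: N; exact: nbhs_pinfty_gt.
apply/cvgryPge => A; near=> N.
have AN : A ^+ 2 <= N by near: N; apply: nbhs_pinfty_ge; exact: num_real.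
rewrite (le_trans (ler_norm A))// -sqrtr_sqr ler_sqrt// (le_trans _ AN)// sqr_ge0.
Unshelve. all: by end_near. Qed.

End rate.

Section energy_rate.
Context {R : realType} (S D I Q : R -> R) (k : R).
Hypothesis K : sine_kernel S D I Q k.
Context d (T : measurableType d) (P : probability T R) (X : T -> set R).
Hypothesis rX : random_configuration X.
Hypothesis cX2 : correlation_function P X (fun u : 2.-tuple R => corr2 S D I u`_0 u`_1).
Hypothesis cX3 : correlation_function P X (fun u : 3.-tuple R => corr3 S D I u`_0 u`_1 u`_2).
Hypothesis cX4 : correlation_function P X (fun u : 4.-tuple R => corr4 S D I u`_0 u`_1 u`_2 u`_3).

(** The smooth part contributes N ^ -2 times N ln ^ 5 N, at most a multiple of N ^ (-1/2), and the
    remainder contributes N ^ -3, up to constants. *)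
Lemma energy_variance_rate : exists c : R, forall N, 2 <= N ->
  ('V_P[(fun w => renormalized_energy N (X w))] <= (c * (Num.sqrt N)^-1)%:E)%E.
Proof.
have mt i : measurable_fun setT (fun x : 4.-tuple R => tnth x i) by exact: measurable_tnth.
have [_ [C2 h2]] := bm_corr2 K (mt i0) (mt i1).
have [_ [C3 h3]] := bm_corr3 K (mt i0) (mt i1) (mt i2).
have [_ [C4 h4]] := bm_corr4 K (mt i0) (mt i1) (mt i2) (mt i3).
pose C := C2 + C3 + C4.
have p2 : 0 <= C2 by exact: le_trans (normr_ge0 _) (h2 [tuple 0 | _ < 4]).
have p3 : 0 <= C3 by exact: le_trans (normr_ge0 _) (h3 [tuple 0 | _ < 4]).
have p4 : 0 <= C4 by exact: le_trans (normr_ge0 _) (h4 [tuple 0 | _ < 4]).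
have rC x : [/\ `|rho2 S D I x| <= C, `|rho3 S D I x| <= C & `|rho4 S D I x| <= C].
  split; [apply: le_trans (h2 x) _ | apply: le_trans (h3 x) _ | apply: le_trans (h4 x) _];
    rewrite /C; lra.
have C0 : 0 <= C by rewrite /C !addr_ge0.
have k0 : 0 <= k ^+ 4 by rewrite exprn_ge0// (le_trans ler01 (sk_k K)).
(* The constant is hidden behind an equation so that its numeral is not expanded. *)
have [c5 c5E] : exists c : R, c = (100 * 10) ^+ 5 by eexists.
exists (400 * k ^+ 4 * c5 + 14 * 98 * C) => N N2.
have N0 : 0 < N by exact: lt_le_trans N2.
have N1 : 1 <= N by apply: le_trans N2; rewrite ler1n.
have [s s0 [s10 lnN]] := ln_le_root N1.
pose l := ln N; rewrite -/l in lnN.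
have l2 : 2^-1 <= l.
  by apply: le_trans ln2_ge _; rewrite ler_ln ?posrE.
have ln2l : ln 2 <= l by rewrite ler_ln ?posrE.
pose dl := N ^- 10.
have dl0 : 0 < dl by rewrite invr_gt0 exprn_gt0.
have Nle n : N <= N ^+ n.+1 by rewrite exprS ler_peMr ?exprn_ege1// ltW.
have dl2 : dl <= 2^-1 by rewrite lef_pV2 ?posrE ?exprn_gt0// (le_trans N2).
have d0 : 0 < dl <= 2^-1 by rewrite dl0.
have q01 : 0 <= 1 - dl < 1 by apply/andP; split; lra.
have omN : (pi *+ 2 / N) * N = pi *+ 2 by rewrite divfK// lt0r_neq0.
(* M = 10 ln N because - ln (1 - q) = 10 ln N. Then 8 M = 80 ln N, and 100 ln N also exceeds 1 and
   the logarithm coming from [decay_integral]. *)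
have H : pair_potential N (logpot (pi *+ 2 / N) (1 - dl)) (dlogpot (pi *+ 2 / N) (1 - dl)) (100 * l).
  apply: (pair_potential_logpot N0 omN q01 (M := 10 * l)).
  - by apply: le_trans ln2l _; lra.
  - rewrite subKr /dl lnV ?posrE ?exprn_gt0// opprK lnXn// -mulr_natr -/l; lra.
  - lra.
  - lra.
  - have : ln (1 + 2 * N) <= ln (N ^+ 3).
      rewrite ler_ln ?posrE ?exprn_gt0//; last by rewrite ltr_wpDr// mulr_ge0// ltW.
      rewrite !exprS expr0 mulr1; nra.
    by rewrite lnXn// -mulr_natr -/l; lra.
have HV : pair_variance S D I N (logpot (pi *+ 2 / N) (1 - dl)) <= 200 * k ^+ 4 * (100 * l) ^+ 5 * N.
  exact: le_trans (ler_norm _) (variance_bound K H).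
apply: le_trans (energy_variance_le K N2 rX cX2 cX3 cX4 d0 H HV rC) _; rewrite lee_fin.
have sqN : s ^+ 5 = Num.sqrt N by rewrite -s10 (exprM _ 5 2) sqrtr_sqr ger0_norm// exprn_ge0.
pose t := Num.sqrt N.
have t0 : 0 < t by rewrite sqrtr_gt0.
have tt : t ^+ 2 = N by rewrite sqr_sqrtr// ltW.
have t1 : 1 <= t by rewrite -sqrtr1 ler_sqrt// ltW.
have L5 : (100 * l) ^+ 5 <= c5 * t.
  have e1 : 100 * l <= 100 * (10 * s) by rewrite ler_wpM2l.
  have e2 : 0 <= 100 * l by rewrite mulr_ge0// (le_trans _ l2)// invr_ge0.
  have e3 : 0 <= 100 * (10 * s) by rewrite !mulr_ge0.
  by rewrite /t -sqN c5E -exprMn -mulrA lerXn2r.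
have dsq : Num.sqrt dl = N ^- 5 by rewrite /dl (exprM _ 5 2) -exprVn sqrtr_sqr ger0_norm// invr_ge0 exprn_ge0// ltW.
have z1 : N ^- 2 * (2 * (200 * k ^+ 4 * (100 * l) ^+ 5 * N)) <= 400 * k ^+ 4 * c5 * t^-1.
  have -> : N ^- 2 * (2 * (200 * k ^+ 4 * (100 * l) ^+ 5 * N)) = 400 * k ^+ 4 * N^-1 * (100 * l) ^+ 5.
    by move: (k ^+ 4) ((100 * l) ^+ 5) => k4 L5'; field; rewrite lt0r_neq0.
  have -> : 400 * k ^+ 4 * c5 * t^-1 = 400 * k ^+ 4 * N^-1 * (c5 * t).
    by rewrite -tt; move: (k ^+ 4) => k4; field; rewrite lt0r_neq0.
  have N0' : 0 <= N^-1 by rewrite invr_ge0 ltW.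
  exact: (ler_wpM2l (mulr_ge0 (mulr_ge0 (ler0n R 400) k0) N0') L5).
have z2 : N ^- 2 * (2 * (7 * C * N ^+ 4 * (2 * dl ^+ 2 + 96 * Num.sqrt dl))) <= 14 * 98 * C * t^-1.
  rewrite dsq; have h : 2 * dl ^+ 2 + 96 * N ^- 5 <= 98 * N ^- 5.
    have : dl ^+ 2 <= N ^- 5.
      rewrite /dl -exprVn -exprM -exprVn ler_wiXn2l ?invr_ge0 ?invf_le1// ltW//.
    by lra.
  have P0 : 0 <= N ^- 2 * (2 * (7 * C * N ^+ 4)) by rewrite !mulr_ge0 ?invr_ge0 ?exprn_ge0 ?(ltW N0).
  have E : N ^- 2 * (2 * (7 * C * N ^+ 4)) * (98 * N ^- 5) = 14 * 98 * C * N ^- 3.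
    by field; rewrite lt0r_neq0.
  have := ler_wpM2l P0 h; rewrite E => h'.
  rewrite (_ : N ^- 2 * _ = N ^- 2 * (2 * (7 * C * N ^+ 4)) * (2 * dl ^+ 2 + 96 * N ^- 5)); last by ring.
  apply: (le_trans h').
  have c0 : 0 <= 14 * 98 * C := mulr_ge0 (mulr_ge0 (ler0n R 14) (ler0n R 98)) C0.
  apply: (ler_wpM2l c0); rewrite lef_pV2 ?posrE ?exprn_gt0//.
  by apply: le_trans (Nle 2%N); rewrite -tt expr2 ler_peMl// ltW.
by rewrite [leLHS]mulrDr [leRHS]mulrDl; exact: lerD z1 z2.
Qed.

End energy_rate.

Theorem theorem4 (R : realType) (d : measure_display) (T : measurableType d)
    (P : probability T R) (beta : nat) (X : T -> set R)
    (hbeta : beta \in [:: 1; 2; 4]%N)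
    (hX : sine_process P beta X) :
  ('V_P[(fun w => renormalized_energy N (X w))] @[N --> +oo%R] --> 0)%E.
Proof.
have [rX _ _ cX] := hX.
have [S [D [I [Q [k [K c2 c3 c4]]]]]] := sine_correlation_kernel (R := R) hbeta.
have tE n (u : n.-tuple R) (v : n.-tuple R) : (forall i, (i < n)%N -> u`_i = v`_i) -> u = v.
  by move=> uv; apply: eq_from_tnth => i; rewrite !(tnth_nth 0) uv.
have cX2 : correlation_function P X (fun u : 2.-tuple R => corr2 S D I u`_0 u`_1).
  have := cX 2%N; congr correlation_function; apply/funext => u; rewrite -c2; congr sine_correlation.
  by apply: tE => -[|[|]].
have cX3 : correlation_function P X (fun u : 3.-tuple R => corr3 S D I u`_0 u`_1 u`_2).
  have := cX 3%N; congr correlation_function; apply/funext => u; rewrite -c3; congr sine_correlation.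
  by apply: tE => -[|[|[|]]].
have cX4 : correlation_function P X (fun u : 4.-tuple R => corr4 S D I u`_0 u`_1 u`_2 u`_3).
  have := cX 4%N; congr correlation_function; apply/funext => u; rewrite -c4; congr sine_correlation.
  by apply: tE => -[|[|[|[|]]]].
have [c hc] := energy_variance_rate K rX cX2 cX3 cX4.
apply: (@squeeze_cvge _ _ _ _ (fun=> 0%E) _ (fun N => (c * (Num.sqrt N)^-1)%:E)).
- near=> N; rewrite variance_ge0 /=; apply: hc; near: N; apply: nbhs_pinfty_ge; exact: num_real.
- exact: cvg_cst.
- exact: inv_sqrt_cvg0.
Unshelve. all: by end_near. Qed.
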